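(* Let $a>0$ and choose a sign $\pm$. A function $f$ belongs to $A^2(\mathbf R^{m+1}_{\pm,\mp a},\mathbf C^{(m)})$ if and only if $$f(x)=\frac{1}{(2\pi)^m}\int_{\mathbf R^m}e^{\pm}(x,\underline\xi)\,g(\underline\xi)\,d\underline\xi,\qquad x\in\mathbf R^{m+1}_{\pm,\mp a},$$ where $g=\mathcal F(f)\in L^2(\mathbf R^m,\mathbf C^{(m)})$ (the Fourier transform of the restriction of $f$ to $\mathbf R^m=\{x_0=0\}$) satisfies $$\frac{1}{(2\pi)^m}\int_{\mathbf R^m}e^{2a|\underline\xi|}\,\frac{|\chi_\pm(\underline\xi)g(\underline\xi)|^2}{2|\underline\xi|}\,d\underline\xi<\infty .$$
   Context: $\mathbf C^{(m)}$ is the complex Clifford algebra generated by $\mathbf e_1,\dots,\mathbf e_m$ with $\mathbf e_j\mathbf e_k+\mathbf e_k\mathbf e_j=-2\delta_{jk}$, unit $\mathbf e_0=1$, norm $|\sum_T x_T\mathbf e_T|=(\sum_T|x_T|^2)^{1/2}$. Points of $\mathbf R^{m+1}$ are $x=x_0+\underline x$, $\underline x=\sum_{j=1}^m x_j\mathbf e_j$. $F$ is left-monogenic on an open set if $\sum_{k=0}^m\mathbf e_k\partial F/\partial x_k=0$ there. Fourier transform: $\mathcal F(f)(\underline\xi)=\int_{\mathbf R^m}e^{-i\langle\underline x,\underline\xi\rangle}f(\underline x)d\underline x$ (componentwise, extended to $L^2$). For $\underline\xi\ne0$: $\chi_\pm(\underline\xi)=\frac12(1\pm i\underline\xi/|\underline\xi|)$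 and $e^\pm(x,\underline\xi)=e^{i\langle\underline x,\underline\xi\rangle}e^{\mp x_0|\underline\xi|}\chi_\pm(\underline\xi)$. $\mathbf R^{m+1}_{+,-a}=\{x:x_0>-a\}$, $\mathbf R^{m+1}_{-,a}=\{x:x_0<a\}$. $A^2(\mathbf R^{m+1}_{+,-a},\mathbf C^{(m)})$ is the space of left-monogenic $f$ on $\mathbf R^{m+1}_{+,-a}$ with $\int_{-a}^\infty\int_{\mathbf R^m}|f(x_0+\underline x)|^2d\underline x\,dx_0<\infty$, and $A^2(\mathbf R^{m+1}_{-,a},\mathbf C^{(m)})$ the space of left-monogenic $f$ on $\mathbf R^{m+1}_{-,a}$ with $\int_{-\infty}^a\int_{\mathbf R^m}|f(x_0+\underline x)|^2d\underline x\,dx_0<\infty$. *)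

(* Defs.v *)
From HB Require Import structures.
From mathcomp Require Import all_boot all_order all_algebra.
From mathcomp Require Import all_classical all_reals all_analysis.
Set Implicit Arguments. Unset Strict Implicit. Unset Printing Implicit Defensive.
Import Order.TTheory GRing.Theory Num.Theory.
Import numFieldNormedType.Exports.
Local Open Scope classical_set_scope.
Local Open Scope ring_scope.

Section Clifford.
Variable R : realType.

Definition cplx := (R * R)%type.
Definition cadd (u v : cplx) : cplx := (u.1 + v.1, u.2 + v.2).
Definition cmul (u v : cplx) : cplx := (u.1 * v.1 - u.2 * v.2, u.1 * v.2 + u.2 * v.1).
Definition czero : cplx := (0, 0).

(** The complex Clifford algebra C^(m): x = sum_T x_T e_T, T ranging over
    subsets of {1..m} (encoded as subsets of 'I_m), x_T complex. *)
Definition Cl (m : nat) := {set 'I_m} -> cplx.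

(** Sign in e_A e_B = clsign A B e_(A Δ B), for e_T = e_t1 ... e_tk (t1<...<tk)
    and e_j e_k + e_k e_j = -2 delta_jk. *)
Definition clsign m (A B : {set 'I_m}) : R :=
  (-1) ^+ (#|[set p : 'I_m * 'I_m | (p.1 \in A) && (p.2 \in B) && (p.2 < p.1)%N]%SET|
           + #|A :&: B|)%N.

Definition clmul m (u v : Cl m) : Cl m := fun T =>
  \big[cadd/czero]_(A : {set 'I_m}) \big[cadd/czero]_(B : {set 'I_m})
     (if (A :|: B) :\: (A :&: B) == T
      then cmul (clsign A B, 0) (cmul (u A) (v B)) else czero).

Definition cladd m (u v : Cl m) : Cl m := fun T => cadd (u T) (v T).
Definition clcscale m (c : cplx) (u : Cl m) : Cl m := fun T => cmul c (u T).
Definition clscale m (r : R) (u : Cl m) : Cl m := fun T => ((u T).1 * r, (u T).2 * r).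
Definition clzero m : Cl m := fun _ => czero.

Definition clnorm m (u : Cl m) : R :=
  Num.sqrt (\sum_(T : {set 'I_m}) ((u T).1 ^+ 2 + (u T).2 ^+ 2)).

(** Euclidean inner product and norm on R^m (NB: the library norm on 'rV is the sup norm). *)
Definition dotp m (x y : 'rV[R]_m) : R := \sum_(j < m) x 0 j * y 0 j.
Definition enorm m (x : 'rV[R]_m) : R := Num.sqrt (dotp x x).

(** the Clifford vector underline(xi) = sum_j xi_j e_j *)
Definition clvec m (xi : 'rV[R]_m) : Cl m := fun T =>
  if [pick j | T == [set j]%SET] is Some j then (xi 0 j, 0) else czero.

(** unit e_0 = 1 and e_1, ..., e_m, indexed by k : 'I_(1+m) *)
Definition clbasis m (k : 'I_(1 + m)) : Cl m := fun T =>
  if T == [set j : 'I_m | (j : nat).+1 == (k : nat)]%SET then (1, 0) else czero.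

Definition sgn (s : bool) : R := if s then 1 else -1.

(** chi_pm(xi) = 1/2 (1 pm i xi/|xi|) *)
Definition chi m (s : bool) (xi : 'rV[R]_m) : Cl m := fun T =>
  if #|T| == 0%N then (2^-1, 0)
  else ((clvec xi T).2 * (sgn s / (2 * enorm xi)) * (-1),
        (clvec xi T).1 * (sgn s / (2 * enorm xi))).

Definition pt m (x0 : R) (xv : 'rV[R]_m) : 'rV[R]_(1 + m) := row_mx (\row_(_ < 1) x0) xv.
Definition x0_of m (x : 'rV[R]_(1 + m)) : R := lsubmx x 0 0.
Definition xv_of m (x : 'rV[R]_(1 + m)) : 'rV[R]_m := rsubmx x.

Definition eps m (s : bool) (x : 'rV[R]_(1 + m)) (xi : 'rV[R]_m) : Cl m :=
  clcscale (expR (- sgn s * x0_of x * enorm xi) * cos (dotp (xv_of x) xi),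
            expR (- sgn s * x0_of x * enorm xi) * sin (dotp (xv_of x) xi))
           (chi s xi).

Fixpoint iint (m : nat) : ('rV[R]_m -> \bar R) -> \bar R :=
  match m return ('rV[R]_m -> \bar R) -> \bar R with
  | 0 => fun F => F 0
  | m'.+1 => fun F =>
      (\int[lebesgue_measure]_t iint (fun y : 'rV[R]_m' => F (row_mx (\row_(_ < 1) t) y)))%E
  end.

Fixpoint Rint (m : nat) : ('rV[R]_m -> R) -> R :=
  match m return ('rV[R]_m -> R) -> R with
  | 0 => fun F => F 0
  | m'.+1 => fun F =>
      Rintegral lebesgue_measure setT
        (fun t => Rint (fun y : 'rV[R]_m' => F (row_mx (\row_(_ < 1) t) y)))
  end.

Definition clint m (F : 'rV[R]_m -> Cl m) : Cl m := fun T =>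
  (Rint (fun xi => (F xi T).1), Rint (fun xi => (F xi T).2)).

Definition borel_fun n (h : 'rV[R]_n -> R) : Prop :=
  forall V : set R, open V ->
    <<s [set U : set 'rV[R]_n | open U] >> (h @^-1` V).

Definition l2sq m (h : 'rV[R]_m -> Cl m) : \bar R :=
  iint (fun x => ((clnorm (h x)) ^+ 2)%:E).

Definition L2 m (h : 'rV[R]_m -> Cl m) : Prop :=
  (forall T, borel_fun (fun x => (h x T).1) /\ borel_fun (fun x => (h x T).2))
  /\ (l2sq h < +oo)%E.

(** Fourier transform of h restricted to the ball |x| <= r (absolutely convergent):
    int_{|x|<=r} e^{-i<x,xi>} h(x) dx *)
Definition fourier_trunc m (r : R) (h : 'rV[R]_m -> Cl m) (xi : 'rV[R]_m) : Cl m :=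
  clint (fun x => if enorm x <= r
                  then clcscale (cos (dotp x xi), - sin (dotp x xi)) (h x)
                  else @clzero m).

(** g = F(h) for h in L^2: the L^2 Fourier transform (Plancherel extension),
    i.e. the L^2-limit of the Fourier transforms of the truncations h 1_{|x|<=n}. *)
Definition is_L2_fourier m (h g : 'rV[R]_m -> Cl m) : Prop :=
  L2 h /\ L2 g /\
  (fun n : nat => l2sq (fun xi => cladd (g xi) (clscale (-1) (fourier_trunc n%:R h xi))))
     @ \oo --> (0 : \bar R).

Definition comp m (F : 'rV[R]_(1 + m) -> Cl m) (T : {set 'I_m}) (im : bool) :
  'rV[R]_(1 + m) -> R := fun x => if im then (F x T).2 else (F x T).1.

Definition dir m (k : 'I_(1 + m)) : 'rV[R]_(1 + m) := delta_mx 0 k.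

Definition partial m (k : 'I_(1 + m)) (F : 'rV[R]_(1 + m) -> Cl m)
  (x : 'rV[R]_(1 + m)) : Cl m := fun T =>
  ('D_(dir k) (comp F T false) x, 'D_(dir k) (comp F T true) x).

Definition left_monogenic m (O : set 'rV[R]_(1 + m)) (F : 'rV[R]_(1 + m) -> Cl m) : Prop :=
  open O /\
  (forall T im x, O x -> differentiable (comp F T im) x) /\
  (forall T im (k : 'I_(1 + m)) x, O x ->
      (fun y => 'D_(dir k) (comp F T im) y) @ x --> 'D_(dir k) (comp F T im) x) /\
  (forall x, O x ->
      \big[@cladd m/@clzero m]_(k < 1 + m) clmul (clbasis k) (partial k F x) = @clzero m).

(** the half space R^{m+1}_{+,-a} = {x0 > -a} (s = true) or R^{m+1}_{-,a} = {x0 < a} (s = false) *)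
Definition halfspace m (s : bool) (a : R) : set 'rV[R]_(1 + m) :=
  [set x | - a < sgn s * x0_of x].

Definition A2 m (s : bool) (a : R) (f : 'rV[R]_(1 + m) -> Cl m) : Prop :=
  left_monogenic (@halfspace m s a) f /\
  (\int[lebesgue_measure]_(t in [set t : R | (- a < sgn s * t)%R])
      iint (fun xv => ((clnorm (f (pt t xv))) ^+ 2)%:E) < +oo)%E.

End Clifford.

(* Main.v *)
Require Import Defs.
From HB Require Import structures.
From mathcomp Require Import all_boot all_order all_algebra.
From mathcomp Require Import all_classical all_reals all_analysis.
From mathcomp Require Import measurable_realfun.
From mathcomp Require Import zify ring lra.
Set Implicit Arguments. Unset Strict Implicit. Unset Printing Implicit Defensive.
Import Order.TTheory GRing.Theory Num.Theory.
Import numFieldNormedType.Exports.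
Local Open Scope classical_set_scope.
Local Open Scope ring_scope.

(** On every slice [x0 = t] a monogenic [f] has a Fourier transform [F_t], and
    the equation [D f = 0] becomes the ODE [d/dt F_t = - i xi F_t]. The operator
    [i xi] has eigenvalues [|xi|] and [-|xi|], with spectral projections [chi_+]
    and [chi_-], so [exp (t |xi|) chi_+ F_t] and [exp (- t |xi|) chi_- F_t] do not
    depend on [t]. To derive this without decay of [f] at infinity, [f] is
    multiplied by cutoffs [eta (x / N)], whose gradients are of order [1 / N], and
    [N] is sent to infinity. On the half space with sign [+-], finiteness of the
    energy over the unbounded half line kills the growing component [chi_-+ F_t];
    the remaining one is the density [al], [f] is recovered from [al] by Fourier
    inversion on almost every slice and by continuity on all of them, and
    Plancherel together with Tonelli in [x0] turns the energy into the weighted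
    integral of [|al|^2]. Conversely, differentiation under the integral sign
    shows that such integrals are monogenic. In dimension [m = 0] the origin is
    not negligible, and both sides say that [f] vanishes. *)

(** Finite energy makes almost every slice square integrable, but not a prescribed one, and an L2
    transform [F_t] is only defined up to null sets, so the ODE cannot be stated pointwise in [t]
    and [xi]. It is derived exactly for cut off slices, integrated between two times, and its error
    is bounded by Cauchy-Schwarz in [t] and Plancherel in [xi]: on a ball of frequencies the squared
    error is a constant times the energy over [N^2]. The weight [exp (2 a |xi|) / (2 |xi|)] is the
    integral of [exp (- 2 |t| |xi|)]-type factors over the half line, with [t] measured from
    [x0 = 0]. The slice [x0 = 0], where [g] lives, is reached last: [2 a |xi| <= exp (2 a |xi|)]
    shows that it is square integrable, and this is where [a > 0] enters. All Fourier analysis rests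
    on Gaussians: damping by a Gaussian justifies Fubini and becomes convolution with an approximate
    identity. Every use of Plancherel is an upper bound, so the inequality is enough in both
    directions. Complex numbers are pairs of reals, and a shift of the phase of a cosine by [pi / 2]
    plays the role of [i]. *)

Definition rV_open (R : realType) n : set (set 'rV[R]_n) := open.

(** This is the sigma-algebra that occurs in [borel_fun], so measurability of real functions on row
    vectors is the Borel condition of the theorem. *)
HB.instance Definition _ (R : realType) (n : nat) :=
  @isMeasurable.Build (sigma_display (@rV_open R n)) 'rV[R]_n
  <<s (@rV_open R n) >> (@sigma_algebra0 _ setT (@rV_open R n))
  (@sigma_algebraC _ _) (@sigma_algebra_bigcup _ setT (@rV_open R n)).

(** * Lebesgue measure on row vectors *)

Section borel.
Context {R : realType}.

Lemma open_measurable_rV n (U : set 'rV[R]_n) : open U -> measurable U.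
Proof. by move=> oU; apply: sub_sigma_algebra. Qed.

Lemma measurable_fun_openP n (h : 'rV[R]_n -> R) :
  (forall V, open V -> measurable (h @^-1` V)) -> measurable_fun setT h.
Proof.
move=> bh; apply: (measurability _ (RGenOpens.measurableE R)).
by move=> _ [_ [a [b ->] <-]]; rewrite setTI; apply: bh; exact: interval_open.
Qed.

Lemma borel_funP n (h : 'rV[R]_n -> R) : borel_fun h <-> measurable_fun setT h.
Proof.
split=> [bh|mh V oV]; first exact: measurable_fun_openP.
by have := mh measurableT V (open_measurable oV); rewrite setTI.
Qed.

Lemma continuous_measurable_rV n (h : 'rV[R]_n -> R) :
  continuous h -> measurable_fun setT h.
Proof.
move=> /continuousP ch; apply: measurable_fun_openP => V oV.
by apply: open_measurable_rV; exact: ch.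
Qed.

Lemma measurable_fun_rV d (T : measurableType d) n (h : T -> 'rV[R]_n) :
  (forall U, open U -> measurable (h @^-1` U)) -> measurable_fun setT h.
Proof.
move=> bh; apply: (@measurability _ _ _ _ _ _ (@open 'rV[R]_n)) => //.
by move=> _ [U oU <-]; rewrite setTI; exact: bh.
Qed.

(** Second countability. Rational centres and radii make the index set countable, so preimages of
    open sets become countable unions of preimages of balls; sup norm balls are boxes, which reduces
    measurability to coordinates. *)
Lemma open_rV_bigcup n (U : set 'rV[R]_n) : open U ->
  U = \bigcup_(p in [set p : 'rV[rat]_n * nat |
        ball (map_mx ratr p.1 : 'rV[R]_n) (p.2.+1%:R^-1) `<=` U])
       ball (map_mx ratr p.1 : 'rV[R]_n) (p.2.+1%:R^-1).
Proof.
move=> oU; rewrite eqEsubset; split=> [x Ux|x [p /= pU] /pU//].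
have /nbhs_ballP[e /= e0 xeU] : nbhs x U by exact: open_nbhs_nbhs.
have e20 : 0 < e / 2 by rewrite divr_gt0.
have [k _ ke] : \forall k \near \oo, (k.+1%:R^-1 : R) < e / 2.
  exact: (near_infty_natSinv_lt (PosNum e20)).
have {}ke := ke k (leqnn k).
have r0 : 0 < k.+1%:R^-1 :> R by rewrite invr_gt0.
have q_ i : {q : rat | x 0 i - k.+1%:R^-1 < ratr q < x 0 i + k.+1%:R^-1}.
  apply: cid; move: (k.+1%:R^-1) r0 => r r0; have : x 0 i - r < x 0 i + r by lra.
  by move=> /rat_in_itvoo[q]; rewrite in_itv/= => ?; exists q.
pose q : 'rV[rat]_n := \row_i sval (q_ i).
have bxq : ball (map_mx ratr q : 'rV[R]_n) (k.+1%:R^-1) x.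
  split=> // i j; rewrite !mxE ord1 /ball/=.
  by case: (q_ j) => /= r; rewrite ltr_distl; move: (k.+1%:R^-1) => ?; lra.
exists (q, k) => //= y qy; apply: xeU.
have xq : ball x (e / 2) (map_mx ratr q : 'rV[R]_n).
  by apply: ball_sym; apply: le_ball bxq; exact: ltW.
have {}qy : ball (map_mx ratr q : 'rV[R]_n) (e / 2) y by apply: le_ball qy; exact: ltW.
by rewrite [e]splitr; exact: ball_triangle xq qy.
Qed.

Lemma measurable_fun_rV_coord d (T : measurableType d) n (h : T -> 'rV[R]_n) :
  (forall i, measurable_fun setT (fun t => h t 0 i)) -> measurable_fun setT h.
Proof.
move=> mh; apply: measurable_fun_rV => U oU.
rewrite (open_rV_bigcup oU) preimage_bigcup bigcup_mkcond.
apply: countable_bigcupT_measurable => // -[q k]; case: ifPn => // _ /=.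
have -> : h @^-1` ball (map_mx ratr q : 'rV[R]_n) (k.+1%:R^-1) =
  \bigcap_(i in [set: 'I_n]) ((fun t => h t 0 i) @^-1` ball (ratr (q 0 i) : R) (k.+1%:R^-1)).
  apply/seteqP; split => [t [_ ht] i /= _|t ht].
    by have := ht 0 i; rewrite mxE.
  split=> [|i j]; first by rewrite invr_gt0.
  by rewrite mxE ord1; exact: ht.
apply: fin_bigcap_measurable => // i _.
have := mh i measurableT _ (open_measurable (@ball_open _ _ (ratr (q 0 i) : R) (k.+1%:R^-1 : R))).
by rewrite setTI.
Qed.

Lemma measurable_coord n i : measurable_fun setT (fun x : 'rV[R]_n => x 0 i).
Proof. by apply: continuous_measurable_rV; exact: coord_continuous. Qed.

Lemma pt00 n t (y : 'rV[R]_n) : pt t y 0 0 = t.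
Proof. by rewrite /pt (_ : 0 = lshift n (0 : 'I_1)) ?row_mxEl ?mxE//; exact: val_inj. Qed.

Lemma ptS n t (y : 'rV[R]_n) j : pt t y 0 (lift ord0 j) = y 0 j.
Proof. by rewrite /pt (_ : lift _ _ = rshift 1 j) ?row_mxEr//; exact: val_inj. Qed.

Lemma x0_ofE n (x : 'rV[R]_n.+1) : x0_of x = x 0 0.
Proof. by rewrite /x0_of mxE; congr (x _ _); exact: val_inj. Qed.

Lemma xv_ofE n (x : 'rV[R]_n.+1) j : xv_of x 0 j = x 0 (lift ord0 j).
Proof. by rewrite /xv_of mxE; congr (x _ _); exact: val_inj. Qed.

Lemma x0_of_pt n t (y : 'rV[R]_n) : x0_of (pt t y) = t.
Proof. by rewrite x0_ofE pt00. Qed.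

Lemma xv_of_pt n t (y : 'rV[R]_n) : xv_of (pt t y) = y.
Proof. by rewrite /xv_of/pt row_mxKr. Qed.

Lemma pt_of n (x : 'rV[R]_n.+1) : pt (x0_of x) (xv_of x) = x.
Proof.
by apply/rowP => j; case: (unliftP ord0 j) => [k|] ->;
  rewrite ?ptS ?pt00 ?xv_ofE ?x0_ofE.
Qed.

Definition consr n (p : R * 'rV[R]_n) : 'rV[R]_n.+1 := pt p.1 p.2.
Definition uncons n (x : 'rV[R]_n.+1) : R * 'rV[R]_n := (x0_of x, @xv_of R n x).

Lemma unconsK n : cancel (@uncons n) (@consr n).
Proof. by move=> x; exact: pt_of. Qed.

Lemma consrK n : cancel (@consr n) (@uncons n).
Proof. by move=> [t y]; rewrite /uncons /consr/= x0_of_pt xv_of_pt. Qed.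

Lemma measurable_fun_pt d (T : measurableType d) n (u : T -> R) (v : T -> 'rV[R]_n) :
  measurable_fun setT u -> measurable_fun setT v ->
  measurable_fun setT (fun x => pt (u x) (v x) : 'rV[R]_n.+1).
Proof.
move=> mu mv; apply: measurable_fun_rV_coord => j; case: (unliftP ord0 j) => [k|] ->.
  under eq_fun do rewrite ptS.
  exact: measurableT_comp (measurable_coord k) mv.
by under eq_fun do rewrite pt00.
Qed.

Lemma measurable_consr n : measurable_fun setT (@consr n).
Proof. exact: (measurable_fun_pt measurable_fst measurable_snd). Qed.

Lemma measurable_uncons n : measurable_fun setT (@uncons n).
Proof.
apply: measurable_fun_pair.
  by rewrite (funext (@x0_ofE n)); exact: measurable_coord.
apply: measurable_fun_rV_coord => j.
under eq_fun do rewrite xv_ofE; exact: measurable_coord.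
Qed.

Lemma measurable_pt n t : measurable_fun setT (@pt R n t).
Proof.
exact: measurable_fun_pt.
Qed.

End borel.

Section lebesgue_step.
Context {R : realType} (n : nat) (nu : {sigma_finite_measure set 'rV[R]_n -> \bar R}).
Local Open Scope ereal_scope.

Definition lstep : set 'rV[R]_n.+1 -> \bar R :=
  pushforward (lebesgue_measure \x nu) (@consr R n).

Let lstep0 : lstep set0 = 0.
Proof. by rewrite /lstep /pushforward preimage_set0 measure0. Qed.

Let lstep_ge0 A : 0 <= lstep A.
Proof. by rewrite /lstep /pushforward; exact: measure_ge0. Qed.

Let lstep_sigma_additive : semi_sigma_additive lstep.
Proof.
exact: (@measure_semi_sigma_additive _ _ _
  (measure_function_pushforward__canonical__measure_function_Measure
     (lebesgue_measure \x nu) (@measurable_consr R n))).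
Qed.

HB.instance Definition _ := isMeasure.Build _ _ _ lstep
  lstep0 lstep_ge0 lstep_sigma_additive.

Let lstep_sigma_finite : sigma_finite setT lstep.
Proof.
have /sigma_finiteP[F [FT ndF Foo]] := sigma_finiteT (@lebesgue_measure R).
have /sigma_finiteP[G [GT ndG Goo]] := sigma_finiteT nu.
exists (fun k => @uncons R n @^-1` (F k `*` G k)).
  apply/esym; rewrite -subTset => x _.
  have [i _ Fi] : (\bigcup_i F i) (x0_of x) by rewrite -FT.
  have [j _ Gj] : (\bigcup_i G i) (@xv_of R n x) by rewrite -GT.
  exists (maxn i j) => //; split => /=.
    by move: Fi; apply/subsetPset/ndF/leq_maxl.
  by move: Gj; apply/subsetPset/ndG/leq_maxr.
move=> k; have [mF lF] := Foo k; have [mG lG] := Goo k.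
have mFG : measurable (F k `*` G k) by exact: measurableX.
split; first by have := measurable_uncons measurableT mFG; rewrite setTI.
rewrite /lstep /pushforward -comp_preimage (_ : _ \o _ = id) ?preimage_id; last first.
  by apply/funext => x /=; rewrite consrK.
by rewrite product_measure1E// lte_mul_pinfty// ge0_fin_numE.
Qed.

HB.instance Definition _ := Measure_isSigmaFinite.Build _ _ _ lstep lstep_sigma_finite.

End lebesgue_step.

(* Lebesgue measure on [R^n], built by the same recursion as [iint]. *)
Fixpoint mun {R : realType} (n : nat) : {sigma_finite_measure set 'rV[R]_n -> \bar R} :=
  match n with
  | 0 => [the {sigma_finite_measure set _ -> \bar R} of (\d_ (0 : 'rV[R]_0))]
  | k.+1 => [the {sigma_finite_measure set _ -> \bar R} of lstep (mun k)]
  end.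

Section mun_theory.
Context {R : realType}.
Local Notation leb := (@lebesgue_measure R).
Local Open Scope ereal_scope.

Lemma ge0_integral_munS n (F : 'rV[R]_n.+1 -> \bar R) :
  measurable_fun setT F -> (forall x, 0 <= F x) ->
  \int[mun n.+1]_x F x = \int[leb]_t \int[mun n]_y F (pt t y).
Proof.
move=> mF F0.
pose mm : {measure set (measurableTypeR R * 'rV[R]_n)%type -> \bar R} := (leb \x mun n)%E.
have := @ge0_integral_pushforward _ _ (measurableTypeR R * 'rV[R]_n)%type _ R _ (@measurable_consr R n)
  mm setT F measurableT mF (fun x _ => F0 x).
rewrite preimage_setT fubini_tonelli1; first by move=> ->.
- by apply: measurableT_comp => //; exact: measurable_consr.
- by move=> x /=; exact: F0.
Qed.

Lemma integral_mun0 (F : 'rV[R]_0 -> \bar R) :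
  measurable_fun setT F -> \int[mun 0]_x F x = F 0%R.
Proof. by move=> mF; rewrite integral_dirac//= diracT mul1e. Qed.

Lemma iintE n (F : 'rV[R]_n -> \bar R) :
  measurable_fun setT F -> (forall x, 0 <= F x) ->
  iint F = \int[mun n]_x F x.
Proof.
elim: n F => [|n IH] F mF F0; first by rewrite integral_mun0.
rewrite [LHS]/= ge0_integral_munS//; apply: eq_integral => t _; apply: IH => //.
by apply: measurableT_comp => //; exact: measurable_pt.
Qed.

(** No integrability is assumed: Tonelli treats the positive and the negative part, and the integral
    is by definition the difference of the two. *)
Lemma measurable_integral_param d (X : measurableType d) d' (Y : measurableType d')
    (nu : {sigma_finite_measure set Y -> \bar R}) (f : X * Y -> \bar R) :
  measurable_fun setT f -> measurable_fun setT (fun x => \int[nu]_y f (x, y)).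
Proof.
move=> mf.
have -> : (fun x => \int[nu]_y f (x, y)) =
    (fun x => \int[nu]_y f^\+ (x, y)) \- (fun x => \int[nu]_y f^\- (x, y)).
  apply/funext => x; rewrite [LHS]integralE; congr (_ - _).
    by under eq_integral do rewrite funepos_comp/=.
  by under eq_integral do rewrite funeneg_comp/=.
apply: emeasurable_funB.
  by apply: (@measurable_fun_fubini_tonelli_F _ _ _ _ _ nu f^\+) => //; exact: measurable_funepos.
by apply: (@measurable_fun_fubini_tonelli_F _ _ _ _ _ nu f^\-) => //; exact: measurable_funeneg.
Qed.

Lemma measurable_Rint d (X : measurableType d) n (F : X * 'rV[R]_n -> R) :
  measurable_fun setT F -> measurable_fun setT (fun x => Defs.Rint (fun y => F (x, y))).
Proof.
elim: n d X F => [|n IH] d X F mF /=.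
  apply: measurableT_comp => //; exact: measurable_fun_pair.
rewrite /Rintegral; apply: measurableT_comp => //.
apply: (@measurable_integral_param d X _ (measurableTypeR R) leb (fun p =>
  (Defs.Rint (fun y : 'rV[R]_n => F (p.1, pt p.2 y)))%:E)).
apply/measurable_EFinP.
apply: (IH _ (X * measurableTypeR R)%type (fun q => F (q.1.1, pt q.1.2 q.2))).
apply: measurableT_comp => //; apply: measurable_fun_pair => /=.
  exact: measurableT_comp measurable_fst measurable_fst.
apply: measurable_fun_pt; last exact: measurable_snd.
exact: measurableT_comp measurable_snd measurable_fst.
Qed.

Lemma integrable_consr n (F : 'rV[R]_n.+1 -> \bar R) :
  (mun n.+1).-integrable setT F <-> (leb \x mun n).-integrable setT (F \o @consr R n).
Proof.
split=> [/integrableP[mF lF]|iF]; last first.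
  have mF : measurable_fun setT F.
    rewrite (_ : F = (F \o @consr R n) \o @uncons R n); last first.
      by apply/funext => x /=; rewrite unconsK.
    by apply: measurableT_comp; [exact: measurable_int iF|exact: measurable_uncons].
  pose mm : {measure set (measurableTypeR R * 'rV[R]_n)%type -> \bar R} := (leb \x mun n)%E.
  by apply: (@integrable_pushforward _ _ (measurableTypeR R * 'rV[R]_n)%type _ R _
    (@measurable_consr R n) mm setT F mF).
apply/integrableP; split.
  by apply: measurableT_comp => //; exact: measurable_consr.
rewrite fubini_tonelli1//=; last first.
  by do 2!apply: measurableT_comp => //; exact: measurable_consr.
by move: lF; rewrite ge0_integral_munS//; exact: measurableT_comp.
Qed.

Lemma integral_munS n (F : 'rV[R]_n.+1 -> \bar R) :
  (mun n.+1).-integrable setT F ->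
  \int[mun n.+1]_x F x = \int[leb]_t \int[mun n]_y F (pt t y).
Proof.
move=> iF; have iF' := (integrable_consr F).1 iF.
pose mm : {measure set (measurableTypeR R * 'rV[R]_n)%type -> \bar R} := (leb \x mun n)%E.
have := @integral_pushforward _ _ (measurableTypeR R * 'rV[R]_n)%type _ R _ (@measurable_consr R n)
  mm setT F (measurable_int _ iF).
rewrite preimage_setT -(integral12_prod_meas1 iF') => -> //.
Qed.

(** Links the iterated real integral of the statement to measure theory. Integrability of [F] makes
    almost every section integrable, where the induction applies; on the exceptional sections the
    inner [Rint] is a default value, invisible to the outer integral. *)
Lemma RintE n (F : 'rV[R]_n -> R) : (mun n).-integrable setT (EFin \o F) ->
  Defs.Rint F = (\int[mun n]_x F x)%R.
Proof.
elim: n F => [|n IH] F iF.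
  by rewrite /Rintegral integral_mun0//; exact: measurable_int iF.
rewrite [LHS]/= /Rintegral integral_munS//; congr fine.
have iF' := (integrable_consr _).1 iF.
have mF : measurable_fun setT F by apply/measurable_EFinP; exact: measurable_int iF.
apply: ae_eq_integral => //.
- apply/measurable_EFinP; apply: (@measurable_Rint _ (measurableTypeR R) n (F \o @consr R n)).
  by apply: measurableT_comp => //; exact: measurable_consr.
- apply: (@measurable_integral_param _ (measurableTypeR R) _ _ (mun n) ((EFin \o F) \o @consr R n)).
  by apply: measurableT_comp; [exact: measurable_int iF|exact: measurable_consr].
have := ae_integrable1 iF'; apply: filterS => t it _.
by rewrite IH// /Rintegral fineK//; apply: integrable_fin_num.
Qed.

End mun_theory.

(** * Integrable real functions and Fubini *)

Notation L1 mu f := (mu.-integrable setT (fun x => (f x)%:E)).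

Section real_integrals.
Context d (T : measurableType d) (R : realType) (mu : {measure set T -> \bar R}).
Implicit Types f g h : T -> R.

Lemma L1_measurable f : L1 mu f -> measurable_fun setT f.
Proof. by move=> /measurable_int/measurable_EFinP. Qed.

Lemma L1_le f g : measurable_fun setT f -> (forall x, `|f x| <= g x) ->
  L1 mu g -> L1 mu f.
Proof.
move=> mf fg; apply: le_integrable => //; first exact/measurable_EFinP.
by move=> x _ /=; rewrite lee_fin (le_trans (fg x))// ler_norm.
Qed.

Lemma L1P f : measurable_fun setT f ->
  (\int[mu]_x (`|f x|)%:E < +oo)%E -> L1 mu f.
Proof. by move=> mf lf; apply/integrableP; split => //; exact/measurable_EFinP. Qed.

Lemma L1_abs f : L1 mu f -> L1 mu (fun x => `|f x|).
Proof.
move=> lf; have mf := L1_measurable lf.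
apply: le_integrable lf => //; first by apply/measurable_EFinP; exact: measurableT_comp.
by move=> x _ /=; rewrite normr_id.
Qed.

Lemma L1_lty f : L1 mu f -> (\int[mu]_x (`|f x|)%:E < +oo)%E.
Proof. by move=> /integrableP[]. Qed.

Lemma L1D f g : L1 mu f -> L1 mu g -> L1 mu (fun x => f x + g x).
Proof.
by move=> lf lg; apply: eq_integrable (integrableD measurableT lf lg).
Qed.

Lemma L1Z k f : L1 mu f -> L1 mu (fun x => k * f x).
Proof.
by move=> lf; apply: eq_integrable (integrableZl measurableT k lf).
Qed.

Lemma L1N f : L1 mu f -> L1 mu (fun x => - f x).
Proof.
by move=> /(L1Z (-1)); under eq_fun do rewrite mulN1r.
Qed.

Lemma L1B f g : L1 mu f -> L1 mu g -> L1 mu (fun x => f x - g x).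
Proof. by move=> lf /L1N; exact: L1D. Qed.

Lemma L1_cst0 : L1 mu (fun=> 0 : R).
Proof. exact: integrable0. Qed.

Lemma L1_sum I (r : seq I) (P : pred I) (F : I -> T -> R) :
  (forall i, P i -> L1 mu (F i)) -> L1 mu (fun x => \sum_(i <- r | P i) F i x).
Proof.
move=> lF; elim: r => [|i r IH].
  by under eq_fun do rewrite big_nil; exact: L1_cst0.
under eq_fun do rewrite big_cons.
by case Pi : (P i) => //; apply: L1D => //; exact: lF.
Qed.

Lemma L1_bM h f (M : R) : measurable_fun setT h -> (forall x, `|h x| <= M) ->
  L1 mu f -> L1 mu (fun x => h x * f x).
Proof.
move=> mh hM lf; apply: (@L1_le _ (fun x => M * `|f x|)).
- by apply: measurable_funM => //; exact: L1_measurable.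
- by move=> x; rewrite normrM ler_wpM2r.
- by apply: L1Z; exact: L1_abs.
Qed.

Lemma EFin_Rintegral f : L1 mu f -> ((\int[mu]_x f x)%:E = \int[mu]_x (f x)%:E)%E.
Proof. by move=> lf; rewrite /Rintegral fineK//; exact: integrable_fin_num. Qed.

Lemma RintD f g : L1 mu f -> L1 mu g ->
  \int[mu]_x (f x + g x) = \int[mu]_x f x + \int[mu]_x g x.
Proof. by move=> lf lg; rewrite RintegralD. Qed.

Lemma RintZ k f : L1 mu f -> \int[mu]_x (k * f x) = k * \int[mu]_x f x.
Proof. by move=> lf; rewrite RintegralZl. Qed.

Lemma RintN f : L1 mu f -> \int[mu]_x (- f x) = - \int[mu]_x f x.
Proof.
by move=> lf; rewrite -mulN1r -RintZ//; apply: eq_Rintegral => x _; rewrite mulN1r.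
Qed.

Lemma RintB f g : L1 mu f -> L1 mu g ->
  \int[mu]_x (f x - g x) = \int[mu]_x f x - \int[mu]_x g x.
Proof. by move=> lf lg; rewrite RintegralB. Qed.

Lemma Rint_sum I (r : seq I) (P : pred I) (F : I -> T -> R) :
  (forall i, P i -> L1 mu (F i)) ->
  \int[mu]_x (\sum_(i <- r | P i) F i x) = \sum_(i <- r | P i) \int[mu]_x F i x.
Proof.
move=> lF; elim: r => [|i r IH].
  rewrite big_nil; under eq_Rintegral do rewrite big_nil.
  by rewrite Rintegral_cst ?mul0r.
rewrite big_cons; under eq_Rintegral do rewrite big_cons.
by case Pi : (P i) => //; rewrite RintD ?IH//; [exact: lF|exact: L1_sum].
Qed.

Lemma le_Rint f g : L1 mu f -> L1 mu g -> (forall x, f x <= g x) ->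
  \int[mu]_x f x <= \int[mu]_x g x.
Proof. by move=> lf lg fg; apply: le_Rintegral. Qed.

Lemma Rint_abs f : L1 mu f -> `|\int[mu]_x f x| <= \int[mu]_x `|f x|.
Proof. by move=> lf; apply: le_normr_Rintegral. Qed.

Lemma Rint_abs_le f g : L1 mu f -> L1 mu g -> (forall x, `|f x| <= g x) ->
  `|\int[mu]_x f x| <= \int[mu]_x g x.
Proof.
move=> lf lg fg; apply: le_trans (Rint_abs lf) _.
by apply: le_Rint => //; exact: L1_abs.
Qed.

Lemma ae_Rint f g : measurable_fun setT f -> measurable_fun setT g ->
  {ae mu, forall x, f x = g x} -> \int[mu]_x f x = \int[mu]_x g x.
Proof.
move=> mf mg fg; rewrite /Rintegral; congr fine.
apply: ae_eq_integral => //; [exact/measurable_EFinP|exact/measurable_EFinP|].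
by apply: filterS fg => x fgx _; rewrite fgx.
Qed.

Lemma ae_L1 f g : measurable_fun setT g ->
  {ae mu, forall x, f x = g x} -> L1 mu f -> L1 mu g.
Proof.
move=> mg fg lf; apply: L1P => //.
rewrite -(@ae_eq_integral _ _ _ mu setT _ (fun x => (`|f x|)%:E))//.
- exact: L1_lty.
- apply/measurable_EFinP/measurableT_comp => //; exact: L1_measurable.
- by apply/measurable_EFinP; exact: measurableT_comp.
- by apply: filterS fg => x fgx _; rewrite fgx.
Qed.

Lemma Rint_dominated (F : nat -> T -> R) f g : (forall n, measurable_fun setT (F n)) ->
  measurable_fun setT f -> L1 mu g -> (forall n x, `|F n x| <= g x) ->
  (forall x, F ^~ x @ \oo --> f x) ->
  L1 mu f /\ (fun n => \int[mu]_x F n x) @ \oo --> \int[mu]_x f x.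
Proof.
move=> mF mf lg Fg Ff.
have lF n : L1 mu (F n) by apply: L1_le (Fg n) lg.
have [||||lf _ cf] := @dominated_convergence _ _ R mu setT measurableT
  (fun n x => (F n x)%:E) (fun x => (f x)%:E) (fun x => (g x)%:E) _ _ _ lg.
- by move=> n; exact/measurable_EFinP.
- exact/measurable_EFinP.
- by apply: aeW => x _; apply: cvg_EFin (Ff x); exact: nearW.
- by apply: aeW => x n _ /=; rewrite lee_fin.
split => //; apply: fine_cvg; rewrite /Rintegral fineK//.
exact: integrable_fin_num.
Qed.

Lemma L1_sqM f g : measurable_fun setT f -> measurable_fun setT g ->
  L1 mu (fun x => f x ^+ 2) -> L1 mu (fun x => g x ^+ 2) ->
  L1 mu (fun x => f x * g x).
Proof.
move=> mf mg lf lg; apply: (@L1_le _ (fun x => f x ^+ 2 + g x ^+ 2)).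
- exact: measurable_funM.
- move=> x; rewrite normrM -(real_normK (num_real (f x))) -(real_normK (num_real (g x))).
  by move: `|f x| `|g x| (normr_ge0 (f x)) (normr_ge0 (g x)) => a b; nra.
- exact: L1D.
Qed.

End real_integrals.

Section real_fubini.
Context d1 d2 (X : measurableType d1) (Y : measurableType d2) (R : realType).
Variables (m1 : {sigma_finite_measure set X -> \bar R})
  (m2 : {sigma_finite_measure set Y -> \bar R}).

Lemma L1_fubini (F : X * Y -> R) (u : X -> R) (v : Y -> R) :
  measurable_fun setT F -> L1 m1 u -> L1 m2 v ->
  (forall x y, `|F (x, y)| <= u x * v y) ->
  L1 (m1 \x m2)%E F.
Proof.
move=> mF lu lv Fuv; apply/integrable12ltyP; first exact/measurable_EFinP.
apply: (@le_lt_trans _ _ (\int[m1]_x (`|u x|%:E * \int[m2]_y `|v y|%:E))%E).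
  apply: ge0_le_integral => //.
  - by move=> x _; apply: integral_ge0.
  - apply: (@measurable_fun_fubini_tonelli_F _ _ _ _ _ m2 (fun p => (`|F p|)%:E)) => //.
    by apply/measurable_EFinP; exact: measurableT_comp.
  - apply: emeasurable_funM => //; apply/measurable_EFinP/measurableT_comp => //.
    exact: L1_measurable lu.
  - move=> x _; rewrite -ge0_integralZl//; last first.
      by apply/measurable_EFinP/measurableT_comp => //; exact: L1_measurable lv.
    apply: ge0_le_integral => //.
    + apply/measurable_EFinP/measurableT_comp => //.
      by apply: measurableT_comp => //; exact: measurable_fun_pair.
    + apply: measurable_funeM.
      by apply/measurable_EFinP/measurableT_comp => //; exact: L1_measurable lv.
    + by move=> y _ /=; rewrite lee_fin (le_trans (Fuv x y))// -normrM ler_norm.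
have lv' := L1_lty lv; have lu' := L1_lty lu.
rewrite ge0_integralZr//.
- by apply: lte_mul_pinfty => //; [exact: integral_ge0|rewrite ge0_fin_numE// integral_ge0].
- by apply/measurable_EFinP/measurableT_comp => //; exact: L1_measurable lu.
- exact: integral_ge0.
Qed.

Variables (F : X * Y -> R) (u : X -> R) (v : Y -> R).
Hypotheses (mF : measurable_fun setT F) (lu : L1 m1 u) (lv : L1 m2 v)
  (Fuv : forall x y, `|F (x, y)| <= u x * v y).

Lemma L1_section1 x : L1 m2 (fun y => F (x, y)).
Proof.
apply: (@L1_le _ _ _ _ _ (fun y => u x * v y)) => //; last exact: L1Z.
by apply: measurableT_comp => //; exact: measurable_fun_pair.
Qed.

Lemma L1_section2 y : L1 m1 (fun x => F (x, y)).
Proof.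
apply: (@L1_le _ _ _ _ _ (fun x => v y * u x)); last exact: L1Z.
  by apply: measurableT_comp => //; exact: measurable_fun_pair.
by move=> x; rewrite mulrC.
Qed.

(** Domination by a product [u x * v y] makes every section integrable, not only almost every one,
    so the real iterated integrals are exchanged without exceptional sets. *)
Lemma Rint_fubini :
  \int[m1]_x \int[m2]_y F (x, y) = \int[m2]_y \int[m1]_x F (x, y).
Proof.
have := Fubini (L1_fubini mF lu lv Fuv).
move=> E; rewrite /Rintegral; congr fine.
transitivity (\int[m1]_x \int[m2]_y (F (x, y))%:E)%E.
  by apply: eq_integral => x _; rewrite -/(Rintegral _ _ _) EFin_Rintegral//; exact: L1_section1.
rewrite E; apply: eq_integral => y _.
by rewrite -/(Rintegral _ _ _) EFin_Rintegral//; exact: L1_section2.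
Qed.

End real_fubini.

Section line.
Context {R : realType}.
Local Notation leb := (@lebesgue_measure R).

Lemma Rint_FTC (G g : R -> R) (a b : R) : a <= b ->
  (forall x, a <= x <= b -> is_derive x 1 G (g x)) -> {within `[a, b], continuous g} ->
  \int[leb]_(x in `[a, b]) g x = G b - G a.
Proof.
rewrite le_eqVlt => /orP[/eqP<- _ _|ab dG cg].
  by rewrite subrr set_itv1 Rintegral_set1.
have dG' x : a <= x <= b -> derivable G x 1 by move=> /dG[].
rewrite /Rintegral (@continuous_FTC2 _ g G a b)//.
- split.
  + by move=> x; rewrite in_itv/= => /andP[ax xb]; apply: dG'; rewrite !ltW.
  + apply: cvg_at_right_filter; apply: differentiable_continuous.
    by apply/derivable1_diffP; apply: dG'; rewrite lexx ltW.
  + apply: cvg_at_left_filter; apply: differentiable_continuous.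
    by apply/derivable1_diffP; apply: dG'; rewrite lexx ltW.
- move=> x; rewrite in_itv/= => /andP[ax xb].
  by rewrite derive1E; have /dG[_ ->] : a <= x <= b by rewrite !ltW.
Qed.

Lemma cvg_Rint_itv (g : R -> R) : L1 leb g ->
  (fun n : nat => \int[leb]_(x in `[- n%:R, n%:R]) g x) @ \oo --> \int[leb]_x g x.
Proof.
move=> lg; have mg := L1_measurable lg.
rewrite (_ : (fun n : nat => _) = (fun n : nat => \int[leb]_x (\1_(`[- n%:R, n%:R]%classic : set R) x * g x))); last first.
  apply/funext => n; rewrite Rintegral_mkcond; apply: eq_Rintegral => x _.
  by rewrite patchE indicE; case: ifPn => _; rewrite ?mul1r ?mul0r.
have [] := @Rint_dominated _ _ R leb
  (fun n x => \1_(`[- n%:R, n%:R]%classic : set R) x * g x) g (fun x => `|g x|) => //.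
- by move=> n; apply: measurable_funM => //; exact: measurable_indic.
- exact: L1_abs.
- move=> n x; rewrite normrM ler_piMl// indicE; case: (_ \in _) => /=; rewrite ?normr1 ?normr0//.
- move=> x; apply: cvg_near_cst; near=> n; rewrite indicE mem_set ?mul1r//=.
  rewrite in_itv/= -ler_norml; near: n; exact: nbhs_infty_ger.
Unshelve. all: by end_near. Qed.

Lemma Rint_derive0 (G g : R -> R) : (forall x : R, is_derive x (1 : R) G (g x)) ->
  continuous g -> L1 leb g ->
  (fun n : nat => G n%:R) @ \oo --> (0 : R) -> (fun n : nat => G (- n%:R)) @ \oo --> (0 : R) ->
  \int[leb]_x g x = 0.
Proof.
move=> dG cg lg G1 G2; have := cvg_Rint_itv lg.
rewrite (_ : (fun n : nat => _) = (fun n : nat => G n%:R - G (- n%:R))); last first.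
  apply/funext => n; apply: Rint_FTC => //; first by rewrite -subr_ge0 opprK addr_ge0.
  exact: continuous_subspaceT.
have : (fun n : nat => G n%:R - G (- n%:R)) @ \oo --> (0 - 0 : R) by exact: cvgB.
by rewrite subr0 => h1 h2; apply: cvg_unique h2 h1.
Qed.

End line.

(** * The Gaussian and its Fourier transform *)

Section gaussian.
Context {R : realType}.
Local Notation leb := (@lebesgue_measure R).

(** Damping factor in the frequency variable, scaled so that its Fourier transform is [2 * pi] times
    the centred normal density of standard deviation [e]: as [e] tends to 0 the damping disappears
    while the density concentrates. *)
Definition gauss_w (e x : R) := expR (- (e ^+ 2 / 2) * x ^+ 2).

Lemma gauss_w_ge0 e x : 0 <= gauss_w e x. Proof. exact: expR_ge0. Qed.

Lemma continuous_gauss_w e : continuous (gauss_w e).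
Proof.
move=> x; apply: differentiable_continuous; apply/derivable1_diffP.
by rewrite /gauss_w; apply: ex_derive.
Qed.

Lemma measurable_gauss_w e : measurable_fun setT (gauss_w e).
Proof. by apply: continuous_measurable_fun; exact: continuous_gauss_w. Qed.

Section fixed.
Variable e : R.
Hypothesis e0 : 0 < e.

Lemma gauss_wE x : gauss_w e x = (normal_peak e^-1)^-1 * normal_pdf 0 e^-1 x.
Proof.
have eV0 : e^-1 != 0 by rewrite invr_neq0 ?gt_eqF.
rewrite normal_pdfE// mulrA mulVf ?mul1r; last by rewrite gt_eqF// normal_peak_gt0.
rewrite /normal_fun /gauss_w subr0 -mulr_natr; congr expR.
by field; rewrite gt_eqF.
Qed.

Lemma L1_gauss_w : L1 leb (gauss_w e).
Proof.
rewrite (funext gauss_wE); apply: L1Z; exact: integrable_normal_pdf.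
Qed.

Lemma Rint_gauss_w : \int[leb]_x gauss_w e x = (normal_peak e^-1)^-1.
Proof.
rewrite (funext gauss_wE) RintZ; last exact: integrable_normal_pdf.
by rewrite /Rintegral integral_normal_pdf/= mulr1.
Qed.

(** Halving the parameter pays for the factor [|x|]: the spare exponent is [c = 3 e^2 / 8], and
    [exp (c x^2) >= 1 + c x^2]. The bound dominates the derivative of the Gaussian integral with
    respect to the frequency. *)
Lemma xgauss_w_le x : `|x| * gauss_w e x <= (1 + 8 / (3 * e ^+ 2)) * gauss_w (e / 2) x.
Proof.
pose c := 3 * e ^+ 2 / 8.
have c0 : 0 < c by rewrite /c divr_gt0// mulr_gt0// exprn_gt0.
have -> : gauss_w e x = expR (- (c * x ^+ 2)) * gauss_w (e / 2) x.
  by rewrite /gauss_w -expRD; congr expR; rewrite /c; field.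
rewrite mulrA ler_wpM2r ?gauss_w_ge0// expRN ler_pdivrMr ?expR_gt0//.
have -> : 8 / (3 * e ^+ 2) = c^-1.
  by rewrite /c; field; rewrite gt_eqF.
apply: (@le_trans _ _ ((1 + c^-1) * (1 + c * x ^+ 2))).
  have -> : (1 + c^-1) * (1 + c * x ^+ 2) = 1 + c * x ^+ 2 + c^-1 + x ^+ 2.
    by field; rewrite gt_eqF.
  have : 0 <= c * x ^+ 2 by rewrite mulr_ge0 ?sqr_ge0 ?ltW.
  have : 0 < c^-1 by rewrite invr_gt0.
  rewrite -(real_normK (num_real x)); move: `|x| (normr_ge0 x) => y.
  by nra.
rewrite ler_wpM2l//; first by rewrite addr_ge0// invr_ge0 ltW.
exact: expR_ge1Dx.
Qed.

End fixed.

Lemma cvg_gauss_w (e : R) : 0 < e -> (fun n : nat => gauss_w e n%:R) @ \oo --> (0 : R).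
Proof.
move=> e0; have c0 : 0 < e ^+ 2 / 2 by rewrite divr_gt0 ?exprn_gt0.
have h : (fun x : R => (e ^+ 2 / 2) * x ^+ 2) @ +oo%R --> +oo%R.
  by apply: (gt0_cvgMry c0); exact: cvgr_expr2.
have := cvg_comp _ _ (cvg_comp _ _ (@cvgr_idn R) h) (@cvgr_expR R).
by apply: cvg_trans; apply: near_eq_cvg; apply: nearW => n /=; rewrite /gauss_w mulNr.
Qed.

Lemma cvg0_bM (u v : R^nat) : (forall n, `|v n| <= 1) -> u @ \oo --> (0 : R) ->
  (fun n => u n * v n) @ \oo --> (0 : R).
Proof.
move=> v1 u0; apply: norm_cvg0.
apply: (@squeeze_cvgr _ _ _ _ (cst 0) (fun n => `|u n|)).
- by apply: nearW => n; rewrite normr_ge0/= normrM ler_piMr.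
- exact: cvg_cst.
- exact/norm_cvg0P.
Qed.

Lemma L1_xgauss_w e : 0 < e -> L1 leb (fun x => `|x| * gauss_w e x).
Proof.
move=> e0; apply: (@L1_le _ _ R leb _ (fun x => (1 + 8 / (3 * e ^+ 2)) * gauss_w (e / 2) x)).
- by apply: measurable_funM => //; exact: measurable_gauss_w.
- by move=> x; rewrite normrM normr_id [`|gauss_w _ _|]ger0_norm ?gauss_w_ge0// xgauss_w_le.
- by apply: L1Z; apply: L1_gauss_w; rewrite divr_gt0.
Qed.

Lemma continuous_cos_affine (x t : R) : continuous (fun y : R => cos (x * y + t)).
Proof.
move=> y; apply: differentiable_continuous; apply/derivable1_diffP.
by apply: ex_derive.
Qed.

Lemma measurable_cos_affine (x t : R) : measurable_fun setT (fun y : R => cos (x * y + t)).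
Proof. by apply: continuous_measurable_fun; exact: continuous_cos_affine. Qed.

Lemma normr_cos_le1 (x : R) : `|cos x| <= 1.
Proof. by rewrite ler_norml cos_geN1 cos_le1. Qed.

Lemma normr_sin_le1 (x : R) : `|sin x| <= 1.
Proof. by rewrite ler_norml sin_geN1 sin_le1. Qed.

Section fourier.
Variables (e t : R).
Hypothesis e0 : 0 < e.

Let F x := \int[leb]_y (gauss_w e y * cos (x * y + t)).
Let D x := \int[leb]_y (- (y * gauss_w e y * sin (x * y + t))).

Let lF x : L1 leb (fun y => gauss_w e y * cos (x * y + t)).
Proof.
under eq_fun do rewrite mulrC.
apply: (@L1_bM _ _ R leb _ _ 1); last exact: L1_gauss_w.
  exact: measurable_cos_affine.
by move=> y; exact: normr_cos_le1.
Qed.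

Let dcos (x y : R) : is_derive x (1 : R) (fun z : R => gauss_w e y * cos (z * y + t))
  (- (y * gauss_w e y * sin (x * y + t))).
Proof.
by apply: is_derive_eq; rewrite /GRing.scale/= ; ring.
Qed.

Let lD x : L1 leb (fun y => y * gauss_w e y * sin (x * y + t)).
Proof.
apply: (L1_le _ _ (L1_xgauss_w e0)).
  apply: continuous_measurable_fun => y; apply: differentiable_continuous.
  by apply/derivable1_diffP; rewrite /gauss_w; apply: ex_derive.
move=> y; rewrite !normrM [`|gauss_w _ _|]ger0_norm ?gauss_w_ge0//.
by rewrite ler_piMr ?normr_sin_le1// mulr_ge0// gauss_w_ge0.
Qed.

Let dF x : is_derive x (1 : R) F (D x).
Proof.
pose f x y := gauss_w e y * cos (x * y + t).
have xI : x \in `]x - 1, x + 1[ by rewrite in_itv/=; apply/andP; split; lra.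
have E : forall x y, partial1of2 f x y = - (y * gauss_w e y * sin (x * y + t)).
  by move=> z y; rewrite partial1of2E; have [_ ->] := dcos z y.
have h1 z : `]x - 1, x + 1[%classic z -> leb.-integrable setT (EFin \o f z).
  by move=> _; exact: lF.
have h2 z y : `]x - 1, x + 1[%classic z -> setT y -> derivable (f ^~ y) z 1.
  by move=> _ _; have [] := dcos z y.
have h3 z y : `]x - 1, x + 1[%classic z -> setT y -> `|partial1of2 f z y| <= `|y| * gauss_w e y.
  move=> _ _; rewrite E normrN !normrM [`|gauss_w _ _|]ger0_norm ?gauss_w_ge0//.
  by rewrite ler_piMr ?normr_sin_le1// mulr_ge0// gauss_w_ge0.
have h0 y : 0 <= `|y| * gauss_w e y by rewrite mulr_ge0// gauss_w_ge0.
have := @derivable_under_integral R _ _ leb f setT measurableT x _ _ xI h1 h2 _ h0 (L1_xgauss_w e0) h3.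
have := @differentiation_under_integral R _ _ leb f setT measurableT x _ _ xI h1 h2 _ h0 (L1_xgauss_w e0) h3.
rewrite derive1E => FE dF; apply: DeriveDef => //; rewrite FE.
by apply: eq_Rintegral => y _; rewrite E.
Qed.

Let parts x : D x = - (x / e ^+ 2) * F x.
Proof.
(* [g] is the derivative in [y] of [gauss_w e y * sin (x * y + t)], which vanishes at both ends of
   the line. *)
pose g y := e ^+ 2 * (- (y * gauss_w e y * sin (x * y + t))) + x * (gauss_w e y * cos (x * y + t)).
have lg1 : L1 leb (fun y => - (y * gauss_w e y * sin (x * y + t))) by exact: L1N.
have : \int[leb]_y g y = 0.
  apply: (@Rint_derive0 _ (fun y => gauss_w e y * sin (x * y + t))).
  - by move=> y; rewrite /g/gauss_w; apply: is_derive_eq; rewrite /GRing.scale/=; field.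
  - move=> y; apply: differentiable_continuous; apply/derivable1_diffP.
    by rewrite /g /gauss_w; apply: ex_derive.
  - by apply: L1D; apply: L1Z.
  - by apply: cvg0_bM => [n|]; [exact: normr_sin_le1|exact: cvg_gauss_w].
  - apply: cvg0_bM => [n|]; first exact: normr_sin_le1.
    rewrite (_ : (fun n : nat => _) = (fun n : nat => gauss_w e n%:R)); first exact: cvg_gauss_w.
    by apply/funext => n; rewrite /gauss_w sqrrN.
rewrite /g RintD; [|exact: L1Z|exact: L1Z].
rewrite !RintZ// -/(D x) -/(F x) => /eqP; rewrite addr_eq0 => /eqP h.
by apply: (@mulfI _ (e ^+ 2)); [rewrite gt_eqF// exprn_gt0|rewrite h; field; rewrite gt_eqF].
Qed.

(** Differential equation method: differentiation under the integral and integration by parts give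
    [F' = - (x / e^2) F], so [F x * exp (x^2 / (2 e^2))] is constant. The phase [t] covers the
    cosine and the sine transform together. *)
Lemma fourier_gauss x :
  \int[leb]_y (gauss_w e y * cos (x * y + t)) = 2 * pi * normal_pdf 0 e x * cos t.
Proof.
pose H z := F z * expR (z ^+ 2 / (2 * e ^+ 2)).
have dH z : is_derive z (1 : R) H 0.
  have dE : is_derive z (1 : R) (fun y : R => expR (y ^+ 2 / (2 * e ^+ 2)))
      (z / e ^+ 2 * expR (z ^+ 2 / (2 * e ^+ 2))).
    by apply: is_derive_eq; rewrite /GRing.scale/= -exprVn; field; rewrite gt_eqF.
  have := is_deriveM (dF z) dE; congr (is_derive _ _ _ _).
  by rewrite parts /GRing.scale/=; ring.
have := is_derive_0_is_cst x 0 dH.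
have -> : H 0 = (normal_peak e^-1)^-1 * cos t.
  rewrite /H expr0n/= mul0r expR0 mulr1 /F -Rint_gauss_w// mulrC -RintZ; last exact: L1_gauss_w.
  by apply: eq_Rintegral => y _; rewrite mul0r add0r mulrC.
rewrite -/(F x) /H => HE.
have -> : F x = F x * expR (x ^+ 2 / (2 * e ^+ 2)) * expR (- (x ^+ 2 / (2 * e ^+ 2))).
  by rewrite -mulrA -expRD subrr expR0 mulr1.
rewrite HE normal_pdfE ?gt_eqF// /normal_fun subr0 mulNr.
have -> : (e ^+ 2 *+ 2) = 2 * e ^+ 2 by rewrite mulr_natl.
(* The two normalisations are related by [sqrt (2 pi / e^2) * sqrt (2 pi e^2) = 2 pi]. *)
suff -> : (normal_peak e^-1)^-1 = 2 * pi * normal_peak e by ring.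
have B0 : 0 < e ^+ 2 * pi *+ 2 by rewrite mulrn_wgt0// mulr_gt0 ?pi_gt0 ?exprn_gt0.
rewrite /normal_peak invrK; apply: (@mulIf _ (Num.sqrt (e ^+ 2 * pi *+ 2))).
  by rewrite gt_eqF// sqrtr_gt0.
rewrite divfK ?gt_eqF ?sqrtr_gt0// -sqrtrM; last first.
  by rewrite mulrn_wge0// mulr_ge0 ?sqr_ge0 ?pi_ge0.
have E p : e^-1 ^+ 2 * p *+ 2 * (e ^+ 2 * p *+ 2) = (2 * p) ^+ 2.
  by field; rewrite gt_eqF.
rewrite E sqrtr_sqr.
by rewrite ger0_norm// mulr_ge0 ?pi_ge0.
Qed.

End fourier.
End gaussian.

(** * Inner products, product integrals and Gaussians on row vectors *)

Section rV_tools.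
Context {R : realType}.
Local Notation leb := (@lebesgue_measure R).

Lemma dotp_pt n s t (x y : 'rV[R]_n) : dotp (pt s x) (pt t y) = s * t + dotp x y.
Proof.
rewrite /dotp big_ord_recl !pt00; congr (_ + _).
by apply: eq_bigr => j _; rewrite !ptS.
Qed.

Lemma dotp_ptl n (x : 'rV[R]_n.+1) t (y : 'rV[R]_n) :
  dotp x (pt t y) = x0_of x * t + dotp (@xv_of R n x) y.
Proof. by rewrite -{1}(pt_of x) dotp_pt. Qed.

Lemma dotpC n (x y : 'rV[R]_n) : dotp x y = dotp y x.
Proof. by apply: eq_bigr => j _; rewrite mulrC. Qed.

Lemma dotpDl n (x y z : 'rV[R]_n) : dotp (x + y) z = dotp x z + dotp y z.
Proof. by rewrite /dotp -big_split; apply: eq_bigr => j _; rewrite mxE mulrDl. Qed.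

Lemma dotpNl n (x z : 'rV[R]_n) : dotp (- x) z = - dotp x z.
Proof. by rewrite /dotp -sumrN; apply: eq_bigr => j _; rewrite mxE mulNr. Qed.

Lemma dotpBl n (x y z : 'rV[R]_n) : dotp (x - y) z = dotp x z - dotp y z.
Proof. by rewrite dotpDl dotpNl. Qed.

Lemma dotpxx_ge0 n (x : 'rV[R]_n) : 0 <= dotp x x.
Proof. by apply: sumr_ge0 => j _; rewrite -expr2 sqr_ge0. Qed.

Lemma enorm_ge0 n (x : 'rV[R]_n) : 0 <= enorm x. Proof. exact: sqrtr_ge0. Qed.

Lemma sqr_enorm n (x : 'rV[R]_n) : enorm x ^+ 2 = dotp x x.
Proof. by rewrite sqr_sqrtr// dotpxx_ge0. Qed.

Lemma enorm_eq0 n (x : 'rV[R]_n) : (enorm x == 0) = (x == 0).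
Proof.
rewrite sqrtr_eq0 le_eqVlt ltNge dotpxx_ge0 orbF; apply/eqP/eqP => [|->]; last first.
  by rewrite /dotp big1// => j _; rewrite mxE mul0r.
move=> /eqP; rewrite psumr_eq0 => [/allP h|j _]; last by rewrite -expr2 sqr_ge0.
apply/rowP => j; have /eqP := h j (mem_index_enum _).
by rewrite mxE => /eqP; rewrite mulf_eq0 orbb => /eqP.
Qed.

Lemma coord_le_enorm n (x : 'rV[R]_n) j : `|x 0 j| <= enorm x.
Proof.
rewrite -ler_sqr ?nnegrE ?enorm_ge0// sqr_enorm real_normK ?num_real//.
rewrite /dotp (bigD1 j)//= -expr2 lerDl; apply: sumr_ge0 => i _.
by rewrite -expr2 sqr_ge0.
Qed.

Lemma measurable_fun_dotp d (T : measurableType d) n (u v : T -> 'rV[R]_n) :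
  measurable_fun setT u -> measurable_fun setT v ->
  measurable_fun setT (fun t => dotp (u t) (v t)).
Proof.
move=> mu mv; apply: measurable_sum => j; apply: measurable_funM.
  exact: measurableT_comp (measurable_coord j) mu.
exact: measurableT_comp (measurable_coord j) mv.
Qed.

Lemma measurable_fun_enorm d (T : measurableType d) n (u : T -> 'rV[R]_n) :
  measurable_fun setT u -> measurable_fun setT (fun t => enorm (u t)).
Proof.
move=> mu; rewrite /enorm; apply: measurableT_comp; last exact: measurable_fun_dotp.
by apply: continuous_measurable_fun; exact: sqrt_continuous.
Qed.

Lemma measurable_cos : measurable_fun setT (@cos R).
Proof. by apply: continuous_measurable_fun; exact: continuous_cos. Qed.

Lemma measurable_sin : measurable_fun setT (@sin R).
Proof. by apply: continuous_measurable_fun; exact: continuous_sin. Qed.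

Lemma L1_prod n (u : 'I_n -> R -> R) : (forall j, L1 leb (u j)) ->
  L1 (mun n) (fun x => \prod_(j < n) u j (x 0 j)) /\
  \int[mun n]_x (\prod_(j < n) u j (x 0 j)) = \prod_(j < n) \int[leb]_t u j t.
Proof.
elim: n u => [|n IH] u lu.
  have mF : measurable_fun setT (fun x : 'rV[R]_0 => (\prod_(j < 0) u j (x 0 j))).
    by apply: measurable_prod => -[].
  split; last by rewrite /Rintegral integral_mun0 ?big_ord0//; exact/measurable_EFinP.
  apply: L1P => //; rewrite integral_mun0 ?big_ord0 ?ltry//.
  by apply/measurable_EFinP; exact: measurableT_comp.
have [lU EU] := IH (fun j => u (lift ord0 j)) (fun j => lu _).
set U := (fun x : 'rV[R]_n => \prod_(j < n) u (lift ord0 j) (x 0 j)) in lU EU.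
have E t (y : 'rV[R]_n) : \prod_(j < n.+1) u j (pt t y 0 j) = u ord0 t * U y.
  by rewrite big_ord_recl pt00; congr (_ * _); apply: eq_bigr => j _; rewrite ptS.
have mG : measurable_fun setT (fun p : measurableTypeR R * 'rV[R]_n => u ord0 p.1 * U p.2).
  apply: measurable_funM.
    by apply: measurableT_comp => //; exact: L1_measurable (lu ord0).
  by apply: (measurableT_comp (L1_measurable lU)).
have lG : L1 (leb \x mun n)%E (fun p : measurableTypeR R * 'rV[R]_n => u ord0 p.1 * U p.2).
  apply: (@L1_fubini _ _ _ _ R leb (mun n) _ (fun t => `|u ord0 t|) (fun y => `|U y|)) => //.
  - exact: L1_abs.
  - exact: L1_abs.
  - by move=> x y; rewrite normrM.
have lF : L1 (mun n.+1) (fun x => \prod_(j < n.+1) u j (x 0 j)).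
  apply/integrable_consr; apply: eq_integrable lG => // -[t y] _ /=.
  by rewrite /consr/= E.
split=> //; rewrite big_ord_recl -EU /Rintegral integral_munS// mulrC.
transitivity (fine (\int[leb]_t ((u ord0 t)%:E * (\int[mun n]_y U y)%:E))%E).
  congr fine; apply: eq_integral => t _.
  rewrite EFin_Rintegral// -integralZl//; apply: eq_integral => y _.
  by rewrite E EFinM.
by rewrite integralZr//= fineM//=; [rewrite mulrC|exact: integrable_fin_num].
Qed.

End rV_tools.

Section gaussian_rV.
Context {R : realType}.
Local Notation leb := (@lebesgue_measure R).
Implicit Types e : R.

Lemma Rint_munS n (F : 'rV[R]_n.+1 -> R) : L1 (mun n.+1) F ->
  (forall t, L1 (mun n) (fun y => F (pt t y))) ->
  \int[mun n.+1]_x F x = \int[leb]_t \int[mun n]_y F (pt t y).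
Proof.
move=> lF lFt; rewrite {1 2}/Rintegral integral_munS//; congr fine.
by apply: eq_integral => t _; rewrite EFin_Rintegral.
Qed.

(** [gW] damps in frequency and [gK] is the matching approximate identity in space; both are
    products over the coordinates, so that their integrals factorise. *)
Definition gW n e (x : 'rV[R]_n) := \prod_(j < n) gauss_w e (x 0 j).
Definition gK n e (x : 'rV[R]_n) := \prod_(j < n) normal_pdf 0 e (x 0 j).

Lemma gW_ge0 n e (x : 'rV[R]_n) : 0 <= gW e x.
Proof. by apply: prodr_ge0 => j _; exact: gauss_w_ge0. Qed.

Lemma gauss_w_le1 e x : gauss_w e x <= 1.
Proof.
rewrite /gauss_w -[leRHS]expR0 ler_expR mulNr oppr_le0 mulr_ge0 ?sqr_ge0//.
by rewrite divr_ge0 ?sqr_ge0.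
Qed.

Lemma gW_le1 n e (x : 'rV[R]_n) : gW e x <= 1.
Proof.
rewrite -(@big1_eq _ 1 *%R 'I_n (index_enum _) xpredT) /gW; apply: ler_prod => j _.
by rewrite gauss_w_ge0 gauss_w_le1.
Qed.

Lemma measurable_gW n e : measurable_fun setT (@gW n e).
Proof.
apply: measurable_prod => j _; apply: measurableT_comp; last exact: measurable_coord.
exact: measurable_gauss_w.
Qed.

Lemma gK_ge0 n e (x : 'rV[R]_n) : 0 <= gK e x.
Proof. by apply: prodr_ge0 => j _; exact: normal_pdf_ge0. Qed.

Lemma gK_le n e (x : 'rV[R]_n) : 0 < e -> gK e x <= normal_peak e ^+ n.
Proof.
move=> e0; rewrite -[X in _ ^+ X]card_ord -prodr_const; apply: ler_prod => j _.
by rewrite normal_pdf_ge0 normal_pdf_ub// gt_eqF.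
Qed.

Lemma L1_gW n e : 0 < e -> L1 (mun n) (@gW n e).
Proof. by move=> e0; have [] := @L1_prod R n (fun=> gauss_w e) (fun=> L1_gauss_w e0). Qed.

Lemma gK_sub n e (x y : 'rV[R]_n) : 0 < e ->
  gK e (x - y) = \prod_(j < n) normal_pdf (x 0 j) e (y 0 j).
Proof.
move=> e0; apply: eq_bigr => j _; rewrite !mxE !normal_pdfE ?gt_eqF//.
by rewrite /normal_fun subr0 -sqrrN opprB.
Qed.

Lemma gKN n e (x : 'rV[R]_n) : 0 < e -> gK e (- x) = gK e x.
Proof.
move=> e0; apply: eq_bigr => j _; rewrite !mxE !normal_pdfE ?gt_eqF//.
by rewrite /normal_fun !subr0 sqrrN.
Qed.

Lemma L1_gK_sub n e (x : 'rV[R]_n) : 0 < e ->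
  L1 (mun n) (fun y => gK e (x - y)) /\ \int[mun n]_y gK e (x - y) = 1.
Proof.
move=> e0; rewrite (funext (fun y => gK_sub x y e0)).
have [? ->] := @L1_prod R n (fun j => normal_pdf (x 0 j) e) (fun=> integrable_normal_pdf _ _).
by split=> //; rewrite big1// => j _; rewrite /Rintegral integral_normal_pdf.
Qed.

(** The free phase carries the induction: the first term of the inner product is absorbed into [t],
    so the cosine of a sum is never expanded. *)
Lemma fourier_gW n e (x : 'rV[R]_n) t : 0 < e ->
  \int[mun n]_y (gW e y * cos (dotp x y + t)) = (2 * pi) ^+ n * gK e x * cos t.
Proof.
move=> e0; elim: n x t => [|n IH] x t.
  rewrite /Rintegral integral_mun0.
    by rewrite /gW /gK /dotp !big_ord0 add0r expr0 !mul1r.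
  apply/measurable_EFinP; apply: measurable_funM; first exact: measurable_gW.
  apply: (measurableT_comp measurable_cos); apply: measurable_funD => //.
  exact: measurable_fun_dotp.
have lG k (z : 'rV[R]_k) s : L1 (mun k) (fun y => gW e y * cos (dotp z y + s)).
  under eq_fun do rewrite mulrC.
  apply: (@L1_bM _ _ R _ _ _ 1); last exact: L1_gW.
    apply: (measurableT_comp measurable_cos); apply: measurable_funD => //.
    exact: measurable_fun_dotp.
  by move=> y; exact: normr_cos_le1.
have E s (y : 'rV[R]_n) : gW e (pt s y) * cos (dotp x (pt s y) + t) =
    gauss_w e s * (gW e y * cos (dotp (@xv_of R n x) y + (x0_of x * s + t))).
  rewrite dotp_ptl /gW big_ord_recl pt00 -!mulrA; congr (_ * (_ * cos _)); last by ring.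
  by apply: eq_bigr => j _; rewrite ptS.
rewrite Rint_munS//; last first.
  by move=> s; under eq_fun do rewrite E; exact: L1Z.
transitivity (\int[leb]_s ((2 * pi) ^+ n * gK e (@xv_of R n x) * (gauss_w e s * cos (x0_of x * s + t)))).
  apply: eq_Rintegral => s _; under eq_Rintegral do rewrite E.
  by rewrite RintZ// IH; ring.
rewrite RintZ; last first.
  under eq_fun do rewrite mulrC.
  apply: (@L1_bM _ _ R _ _ _ 1); last exact: L1_gauss_w.
    exact: measurable_cos_affine.
  by move=> y; exact: normr_cos_le1.
rewrite fourier_gauss// /gK big_ord_recl -x0_ofE exprS.
rewrite (eq_bigr (fun j => normal_pdf 0 e (x 0 (lift ord0 j)))); last first.
  by move=> j _; rewrite xv_ofE.
ring.
Qed.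

End gaussian_rV.

(** * The Fourier transform on L2 *)

Section fourier_transform.
Context {R : realType} (n : nat).
Local Notation mu := (@mun R n).
Implicit Types (u v : 'rV[R]_n -> R).

(* Real part of the Fourier transform of [u1 + i u2]; the imaginary part is
   [ftc u2 (fun x => - u1 x)], the real part of the transform of [-i (u1 + i u2)]. *)
Definition ftc u1 u2 (xi : 'rV[R]_n) : R :=
  \int[mu]_x (u1 x * cos (dotp x xi) + u2 x * sin (dotp x xi)).

Lemma measurable_Rintegral_param d (X : measurableType d) d' (Y : measurableType d')
    (nu : {sigma_finite_measure set Y -> \bar R}) (f : X * Y -> R) :
  measurable_fun setT f -> measurable_fun setT (fun x => \int[nu]_y f (x, y)).
Proof.
move=> mf; rewrite /Rintegral; apply: measurableT_comp => //.
apply: (@measurable_integral_param R _ _ _ _ _ (fun p => (f p)%:E)).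
exact/measurable_EFinP.
Qed.

Lemma measurable_ftc_fun d (X : measurableType d) (u1 u2 : X -> R) (p q : X -> 'rV[R]_n) :
  measurable_fun setT u1 -> measurable_fun setT u2 ->
  measurable_fun setT p -> measurable_fun setT q ->
  measurable_fun setT (fun z => u1 z * cos (dotp (p z) (q z)) + u2 z * sin (dotp (p z) (q z))).
Proof.
move=> m1 m2 mp mq; have md := measurable_fun_dotp mp mq.
apply: measurable_funD; apply: measurable_funM => //.
  exact: measurableT_comp measurable_cos md.
exact: measurableT_comp measurable_sin md.
Qed.

Lemma ftc_fun_le (a b t : R) : `|a * cos t + b * sin t| <= `|a| + `|b|.
Proof.
apply: le_trans (ler_normD _ _) _; rewrite !normrM.
by apply: lerD; rewrite ler_piMr// (normr_cos_le1, normr_sin_le1).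
Qed.

Lemma measurable_ftc u1 u2 : measurable_fun setT u1 -> measurable_fun setT u2 ->
  measurable_fun setT (ftc u1 u2).
Proof.
move=> m1 m2; apply: (@measurable_Rintegral_param _ _ _ _ mu (fun p : 'rV[R]_n * 'rV[R]_n =>
  u1 p.2 * cos (dotp p.2 p.1) + u2 p.2 * sin (dotp p.2 p.1))).
by apply: measurable_ftc_fun => //; exact: measurableT_comp.
Qed.

Lemma L1_ftc u1 u2 xi : L1 mu u1 -> L1 mu u2 ->
  L1 mu (fun x => u1 x * cos (dotp x xi) + u2 x * sin (dotp x xi)).
Proof.
move=> l1 l2; apply: (@L1_le _ _ R _ _ (fun x => `|u1 x| + `|u2 x|)).
- by apply: measurable_ftc_fun => //; [exact: L1_measurable l1|exact: L1_measurable l2].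
- by move=> x; exact: ftc_fun_le.
- by apply: L1D; exact: L1_abs.
Qed.

Lemma ftc_le u1 u2 xi : L1 mu u1 -> L1 mu u2 ->
  `|ftc u1 u2 xi| <= \int[mu]_x (`|u1 x| + `|u2 x|).
Proof.
move=> l1 l2; apply: Rint_abs_le; first exact: L1_ftc.
  by apply: L1D; exact: L1_abs.
by move=> x; exact: ftc_fun_le.
Qed.

Lemma L1_gK_conv (e : R) u (x : 'rV[R]_n) : 0 < e -> L1 mu u ->
  L1 mu (fun y => u y * gK e (x - y)).
Proof.
move=> e0 lu; under eq_fun do rewrite mulrC.
apply: (@L1_bM _ _ R mu _ _ (normal_peak e ^+ n)) => //.
  exact: L1_measurable (L1_gK_sub x e0).1.
by move=> y; rewrite ger0_norm ?gK_ge0// gK_le.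
Qed.

(** Gaussian damped Fourier inversion, real part. After Fubini the inner integral is the transform
    of [gW]; the part with [u2] carries the phase [pi / 2] and drops out because
    [cos (pi / 2) = 0]. *)
Lemma smoothing e (x : 'rV[R]_n) u1 u2 : 0 < e -> L1 mu u1 -> L1 mu u2 ->
  \int[mu]_xi (gW e xi * (cos (dotp x xi) * ftc u1 u2 xi
     - sin (dotp x xi) * ftc u2 (fun y => - u1 y) xi)) =
  (2 * pi) ^+ n * \int[mu]_y (u1 y * gK e (x - y)).
Proof.
move=> e0 l1 l2.
have m1 := L1_measurable l1; have m2 := L1_measurable l2.
have l12 : L1 mu (fun y => `|u1 y| + `|u2 y|) by apply: L1D; exact: L1_abs.
pose F (p : 'rV[R]_n * 'rV[R]_n) := gW e p.1 *
  (u1 p.2 * cos (dotp (x - p.2) p.1 + 0) + u2 p.2 * cos (dotp (x - p.2) p.1 + pi / 2)).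
have cosE z : cos (z + pi / 2) = - sin z :> R.
  by rewrite cosD cos_pihalf sin_pihalf mulr0 sub0r mulr1.
have mF : measurable_fun setT F.
  apply: measurable_funM.
    by apply: measurableT_comp; [exact: measurable_gW|exact: measurable_fst].
  have md : measurable_fun setT (fun p : 'rV[R]_n * 'rV[R]_n => dotp (x - p.2) p.1).
    under eq_fun do rewrite dotpBl.
    by apply: measurable_funB; apply: measurable_fun_dotp.
  apply: measurable_funD; apply: measurable_funM.
  - by apply: measurableT_comp => //; exact: measurable_snd.
  - by apply: (measurableT_comp measurable_cos); exact: measurable_funD.
  - by apply: measurableT_comp => //; exact: measurable_snd.
  - by apply: (measurableT_comp measurable_cos); exact: measurable_funD.
have bF xi y : `|F (xi, y)| <= gW e xi * (`|u1 y| + `|u2 y|).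
  rewrite /F/= normrM (ger0_norm (gW_ge0 _ _)) ler_wpM2l ?gW_ge0//.
  by rewrite addr0 cosE mulrN -mulNr (le_trans (ftc_fun_le _ _ _))// normrN.
transitivity (\int[mu]_xi \int[mu]_y F (xi, y)).
  apply: eq_Rintegral => xi _.
  have la := L1_ftc xi l1 l2; have lb := L1_ftc xi l2 (L1N l1).
  rewrite /ftc -!RintZ// -RintB; [|exact: L1Z|exact: L1Z].
  rewrite -RintZ; last by apply: L1B; exact: L1Z.
  by apply: eq_Rintegral => y _; rewrite /F/= addr0 cosE dotpBl cosB sinB; ring.
rewrite (@Rint_fubini _ _ _ _ R mu mu F (gW e) (fun y => `|u1 y| + `|u2 y|))//; last exact: L1_gW.
rewrite -RintZ; last exact: L1_gK_conv.
apply: eq_Rintegral => y _; rewrite /F/=.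
have lc z s : L1 mu (fun xi => gW e xi * cos (dotp z xi + s)).
  under eq_fun do rewrite mulrC.
  apply: (@L1_bM _ _ R _ _ _ 1); last exact: L1_gW.
    apply: (measurableT_comp measurable_cos); apply: measurable_funD => //.
    exact: measurable_fun_dotp.
  by move=> y0; exact: normr_cos_le1.
transitivity (\int[mu]_xi (u1 y * (gW e xi * cos (dotp (x - y) xi + 0)) +
    u2 y * (gW e xi * cos (dotp (x - y) xi + pi / 2)))).
  by apply: eq_Rintegral => xi _; ring.
rewrite RintD; [|exact: L1Z|exact: L1Z].
by rewrite !RintZ// !fourier_gW// cos0 cos_pihalf; ring.
Qed.

Lemma measurable_gK_diff (e : R) :
  measurable_fun setT (fun p : 'rV[R]_n * 'rV[R]_n => gK e (p.1 - p.2)).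
Proof.
rewrite (_ : (fun p : 'rV[R]_n * 'rV[R]_n => gK e (p.1 - p.2)) =
    fun p => \prod_(j < n) normal_pdf 0 e (p.1 0 j - p.2 0 j)); last first.
  by apply/funext => p; apply: eq_bigr => j _; rewrite !mxE.
apply: measurable_prod => j _; apply: measurableT_comp; first exact: measurable_normal_pdf.
by apply: measurable_funB; [exact: (measurableT_comp (measurable_coord j) measurable_fst)
  |exact: (measurableT_comp (measurable_coord j) measurable_snd)].
Qed.

Lemma L1_conv_quad (e : R) u : 0 < e -> L1 mu u ->
  L1 mu (fun x => u x * \int[mu]_y (u y * gK e (x - y))).
Proof.
move=> e0 lu; have mu1 := L1_measurable lu.
have mc : measurable_fun setT (fun x : 'rV[R]_n => \int[mu]_y (u y * gK e (x - y))).
  apply: (@measurable_Rintegral_param _ _ _ _ mu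
    (fun p : 'rV[R]_n * 'rV[R]_n => u p.2 * gK e (p.1 - p.2))).
  apply: measurable_funM; first exact: (measurableT_comp mu1 measurable_snd).
  exact: measurable_gK_diff.
under eq_fun do rewrite mulrC.
apply: (@L1_bM _ _ R mu _ _ (\int[mu]_y (normal_peak e ^+ n * `|u y|))) => //.
move=> x; apply: Rint_abs_le; first exact: L1_gK_conv.
  by apply: L1Z; exact: L1_abs.
by move=> y; rewrite normrM mulrC ler_wpM2r// ger0_norm ?gK_ge0//; exact: gK_le.
Qed.

(** Schur test: [u x * u y <= (u x ^ 2 + u y ^ 2) / 2], and the kernel, being even, has mass 1 in
    each variable. The right side may be infinite, hence the extended reals. *)
Lemma conv_quad_le (e : R) u : 0 < e -> L1 mu u ->
  ((\int[mu]_x (u x * \int[mu]_y (u y * gK e (x - y))))%:E <= \int[mu]_x (u x ^+ 2)%:E)%E.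
Proof.
move=> e0 lu; have mu1 := L1_measurable lu.
pose K (p : 'rV[R]_n * 'rV[R]_n) := gK e (p.1 - p.2).
have mK : measurable_fun setT K by exact: measurable_gK_diff.
have lc (x : 'rV[R]_n) : L1 mu (fun y => u y * gK e (x - y)) by exact: L1_gK_conv.
have luc := L1_conv_quad e0 lu.
have mF : measurable_fun setT (fun p : 'rV[R]_n * 'rV[R]_n => (2^-1 * u p.1 ^+ 2 * K p)%:E).
  apply/measurable_EFinP; apply: measurable_funM => //; apply: measurable_funM => //.
  by apply: measurable_funX; exact: (measurableT_comp mu1 measurable_fst).
have mG : measurable_fun setT (fun p : 'rV[R]_n * 'rV[R]_n => (2^-1 * u p.2 ^+ 2 * K p)%:E).
  apply/measurable_EFinP; apply: measurable_funM => //; apply: measurable_funM => //.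
  by apply: measurable_funX; exact: (measurableT_comp mu1 measurable_snd).
have F0 (a : R) p : (0%:E <= (2^-1 * a ^+ 2 * K p)%:E)%E.
  by rewrite lee_fin; apply: mulr_ge0; [rewrite mulr_ge0 ?sqr_ge0|exact: gK_ge0].
have K1 (x : 'rV[R]_n) : (\int[mu]_y (gK e (x - y))%:E = 1)%E.
  by have [l E] := L1_gK_sub x e0; rewrite -EFin_Rintegral// E.
have u20 : forall x, (0 <= (2^-1 * u x ^+ 2)%:E)%E by move=> x; rewrite lee_fin mulr_ge0 ?sqr_ge0.
have mu2 : measurable_fun setT (fun x => (2^-1 * u x ^+ 2)%:E).
  by apply/measurable_EFinP; apply: measurable_funM => //; exact: measurable_funX.
have mKs (x : 'rV[R]_n) : measurable_fun setT (fun y : 'rV[R]_n => (gK e (x - y))%:E).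
  by apply/measurable_EFinP; exact: L1_measurable (L1_gK_sub x e0).1.
have mp (x : 'rV[R]_n) : measurable_fun setT (fun y : 'rV[R]_n => (x, y)).
  exact: measurable_fun_pair.
have mFs (x : 'rV[R]_n) : measurable_fun setT (fun y => (2^-1 * u x ^+ 2 * K (x, y))%:E).
  exact: measurableT_comp mF (mp x).
have mGs (x : 'rV[R]_n) : measurable_fun setT (fun y => (2^-1 * u y ^+ 2 * K (x, y))%:E).
  exact: measurableT_comp mG (mp x).
apply: (@le_trans _ _ (\int[mu]_x (\int[mu]_y (2^-1 * u x ^+ 2 * K (x, y))%:E +
    \int[mu]_y (2^-1 * u y ^+ 2 * K (x, y))%:E))%E); last first.
  rewrite ge0_integralD//; last 4 first.
  - by move=> x _; exact: integral_ge0.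
  - exact: (@measurable_fun_fubini_tonelli_F _ _ _ _ _ mu _ mF).
  - by move=> x _; exact: integral_ge0.
  - exact: (@measurable_fun_fubini_tonelli_F _ _ _ _ _ mu _ mG).
  rewrite [X in (_ + X <= _)%E](@fubini_tonelli _ _ _ _ _ mu mu _ mG)//.
  have E1 : (\int[mu]_x \int[mu]_y (2^-1 * u x ^+ 2 * K (x, y))%:E = \int[mu]_x (2^-1 * u x ^+ 2)%:E)%E.
    apply: eq_integral => x _; under eq_integral do rewrite EFinM.
    rewrite ge0_integralZl//; first by rewrite K1 mule1.
      exact: mKs.
    by move=> y _; rewrite lee_fin gK_ge0.
  have E2 : (\int[mu]_y \int[mu]_x (2^-1 * u y ^+ 2 * K (x, y))%:E = \int[mu]_x (2^-1 * u x ^+ 2)%:E)%E.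
    apply: eq_integral => x _.
    under eq_integral => y _ do rewrite EFinM /K/= -(gKN _ e0) opprB.
    rewrite ge0_integralZl//; first by rewrite K1 mule1.
    by move=> y _; rewrite lee_fin gK_ge0.
  apply: (@le_trans _ _ (\int[mu]_x (2^-1 * u x ^+ 2)%:E + \int[mu]_x (2^-1 * u x ^+ 2)%:E)%E).
    by apply: leeD; [rewrite [leLHS]E1|rewrite [leLHS]E2].
  rewrite -ge0_integralD//.
  rewrite (@eq_integral _ _ R mu setT (fun x => (u x ^+ 2)%:E))// => x _.
  by rewrite -EFinD; congr EFin; lra.
apply: (@le_trans _ _ (\int[mu]_x (`|u x * \int[mu]_y (u y * gK e (x - y))|)%:E)%E).
  by rewrite -EFin_Rintegral ?lee_fin; [exact: le_trans (ler_norm _) (Rint_abs luc)|exact: L1_abs].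
apply: ge0_le_integral => //.
- by apply/measurable_EFinP; apply: measurableT_comp => //; exact: L1_measurable luc.
- by apply: emeasurable_funD;
   [exact: (@measurable_fun_fubini_tonelli_F _ _ _ _ _ mu _ mF)
   |exact: (@measurable_fun_fubini_tonelli_F _ _ _ _ _ mu _ mG)].
- move=> x _; rewrite -ge0_integralD//.
  rewrite -RintZ//; have lxy := L1Z (u x) (lc x).
  apply: (@le_trans _ _ (\int[mu]_y (`|u x * (u y * gK e (x - y))|)%:E)%E).
    by rewrite -EFin_Rintegral ?lee_fin; [exact: Rint_abs|exact: L1_abs].
  apply: ge0_le_integral => //.
  + by apply/measurable_EFinP; apply: measurableT_comp => //; exact: L1_measurable lxy.
  + exact: emeasurable_funD.
  + move=> y _; rewrite -EFinD lee_fin mulrA normrM [`|gK _ _|]ger0_norm ?gK_ge0//.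
    rewrite -mulrDl ler_wpM2r ?gK_ge0// normrM.
    rewrite -(real_normK (num_real (u x))) -(real_normK (num_real (u y))).
    have := sqr_ge0 (`|u x| - `|u y|); rewrite sqrrB; lra.
Qed.

End fourier_transform.

(** * The Plancherel inequality *)

Section fatou_bound.
Context d (T : measurableType d) (R : realType) (mu : {measure set T -> \bar R}).

Lemma fatou_bound (F : nat -> T -> R) (f : T -> R) (C : \bar R) :
  (forall k, measurable_fun setT (F k)) -> (forall k x, 0 <= F k x) ->
  (forall x, F ^~ x @ \oo --> f x) ->
  (\forall k \near \oo, \int[mu]_x (F k x)%:E <= C)%E ->
  (\int[mu]_x (f x)%:E <= C)%E.
Proof.
move=> mF F0 Ff FC.
have := @fatou _ _ R mu setT measurableT (fun k x => (F k x)%:E)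
  (fun k => (measurable_EFinP _ _).2 (mF k)) (fun k x _ => F0 k x).
under eq_integral => x _.
  have c : (fun k => (F k x)%:E) @ \oo --> (f x)%:E by apply: cvg_EFin (Ff x); exact: nearW.
  rewrite (cvg_limn_einf_sup c).1; over.
move=> /le_trans; apply; rewrite limn_einf_lim.
apply: lime_le; first exact: is_cvg_einfs.
apply: filterS FC => k; apply: le_trans.
by apply: ereal_inf_lbound; exists k => //=.
Qed.

End fatou_bound.

Section plancherel.
Context {R : realType} (n : nat).
Local Notation mu := (@mun R n).
Implicit Types (u v : 'rV[R]_n -> R).

Lemma ftcN u1 u2 xi : L1 mu u1 -> L1 mu u2 ->
  ftc (fun x => - u1 x) (fun x => - u2 x) xi = - ftc u1 u2 xi.
Proof.
move=> l1 l2; rewrite /ftc -RintN; last exact: L1_ftc.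
by apply: eq_Rintegral => x _; rewrite !mulNr opprD.
Qed.

Lemma cvg_prod_seq I (r : seq I) (a : I -> nat -> R) (l : I -> R) :
  (forall i, a i @ \oo --> l i) ->
  (fun k => \prod_(i <- r) a i k) @ \oo --> \prod_(i <- r) l i.
Proof.
move=> al; elim: r => [|i r IH].
  by rewrite big_nil; under eq_fun do rewrite big_nil; exact: cvg_cst.
by rewrite big_cons; under eq_fun do rewrite big_cons; exact: cvgM.
Qed.

Lemma cvg_gW (x : 'rV[R]_n) : (fun k : nat => gW k.+1%:R^-1 x) @ \oo --> (1 : R).
Proof.
have h t : (fun k : nat => gauss_w k.+1%:R^-1 t) @ \oo --> (1 : R).
  rewrite -[X in _ --> X]expR0; apply: (cvg_comp _ expR); last exact: continuous_expR.
  rewrite (_ : 0 = - (0 * 0 / 2) * t ^+ 2); last by rewrite !mul0r oppr0 mul0r.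
  apply: cvgMl; apply: cvgN; apply: cvgMl; rewrite /=.
  under eq_fun do rewrite expr2.
  by apply: cvgM; exact: cvg_harmonic.
rewrite /gW -[X in _ --> X](@big1_eq _ 1 *%R 'I_n (index_enum _) xpredT).
by apply: (cvg_prod_seq (a := fun j k => gauss_w k.+1%:R^-1 (x 0 j))) => j; exact: h.
Qed.

(** One factor of the squared transform is written out as an integral. Exchanging the integrals and
    applying [smoothing] leaves the quadratic form of the Gaussian kernel, which the Schur test
    bounds. For integrable [u1], [u2] the transform is merely bounded, and the weight supplies the
    integrability that Fubini requires. *)
Lemma plancherel_gW (e : R) u1 u2 : 0 < e -> L1 mu u1 -> L1 mu u2 ->
  (\int[mu]_xi (gW e xi * (ftc u1 u2 xi ^+ 2 + ftc u2 (fun x => - u1 x) xi ^+ 2))%:E <=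
   ((2 * pi) ^+ n)%:E * \int[mu]_x (u1 x ^+ 2 + u2 x ^+ 2)%:E)%E.
Proof.
move=> e0 l1 l2; have m1 := L1_measurable l1; have m2 := L1_measurable l2.
set P := ftc u1 u2; set Q := ftc u2 _.
have mP : measurable_fun setT P by exact: measurable_ftc.
have mQ : measurable_fun setT Q by apply: measurable_ftc => //; exact: measurableT_comp.
have l12 : L1 mu (fun y => `|u1 y| + `|u2 y|) by apply: L1D; exact: L1_abs.
pose M := \int[mu]_x (`|u1 x| + `|u2 x|).
have M0 : 0 <= M by apply: Rintegral_ge0 => x _; exact: addr_ge0.
have bP xi : `|P xi| <= M by exact: ftc_le.
have bQ xi : `|Q xi| <= M.
  apply: le_trans (ftc_le _ l2 (L1N l1)) _; rewrite /M.
  by under eq_Rintegral do rewrite normrN addrC.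
pose F (p : 'rV[R]_n * 'rV[R]_n) := gW e p.1 *
  (P p.1 * (u1 p.2 * cos (dotp p.2 p.1) + u2 p.2 * sin (dotp p.2 p.1)) +
   Q p.1 * (u2 p.2 * cos (dotp p.2 p.1) + - u1 p.2 * sin (dotp p.2 p.1))).
have mF : measurable_fun setT F.
  apply: measurable_funM; first exact: measurableT_comp (measurable_gW e) measurable_fst.
  have m1' := measurableT_comp m1 (@measurable_snd _ _ 'rV[R]_n 'rV[R]_n).
  have m2' := measurableT_comp m2 (@measurable_snd _ _ 'rV[R]_n 'rV[R]_n).
  apply: measurable_funD; apply: measurable_funM.
  - exact: measurableT_comp mP measurable_fst.
  - exact: measurable_ftc_fun.
  - exact: measurableT_comp mQ measurable_fst.
  - apply: measurable_ftc_fun => //; exact: measurableT_comp m1'.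
have bF xi y : `|F (xi, y)| <= gW e xi * (2 * M * (`|u1 y| + `|u2 y|)).
  rewrite /F/= normrM (ger0_norm (gW_ge0 _ _)) ler_wpM2l ?gW_ge0//.
  apply: le_trans (ler_normD _ _) _; rewrite !normrM.
  have -> : 2 * M * (`|u1 y| + `|u2 y|) = M * (`|u1 y| + `|u2 y|) + M * (`|u2 y| + `|u1 y|) by ring.
  apply: lerD; apply: ler_pM => //; first exact: ftc_fun_le.
  by rewrite -(normrN (u1 y)); exact: ftc_fun_le.
have lW : L1 mu (fun xi => gW e xi * (P xi ^+ 2 + Q xi ^+ 2)).
  under eq_fun do rewrite mulrC.
  apply: (@L1_bM _ _ R mu _ _ (M ^+ 2 + M ^+ 2)); last exact: L1_gW.
    by apply: measurable_funD; exact: measurable_funX.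
  move=> xi; rewrite ger0_norm ?addr_ge0 ?sqr_ge0//.
  by apply: lerD; rewrite -(real_normK (num_real (_ xi))) lerXn2r ?nnegrE//.
have lWM (c s : 'rV[R]_n -> R) : measurable_fun setT c -> measurable_fun setT s ->
    (forall x, `|c x| <= 1) -> (forall x, `|s x| <= 1) ->
    L1 mu (fun xi => gW e xi * (c xi * P xi - s xi * Q xi)).
  move=> mc ms c1 s1; under eq_fun do rewrite mulrC.
  apply: (@L1_bM _ _ R mu _ _ (M + M)); last exact: L1_gW.
    by apply: measurable_funB; exact: measurable_funM.
  move=> xi; apply: le_trans (ler_normB _ _) _; rewrite !normrM.
  by apply: lerD; rewrite -[leRHS]mul1r ler_pM.
have E : \int[mu]_xi (gW e xi * (P xi ^+ 2 + Q xi ^+ 2)) =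
  (2 * pi) ^+ n * \int[mu]_x (u1 x * \int[mu]_y (u1 y * gK e (x - y)) +
                              u2 x * \int[mu]_y (u2 y * gK e (x - y))).
  transitivity (\int[mu]_xi \int[mu]_y F (xi, y)).
    apply: eq_Rintegral => xi _.
    have la := L1_ftc xi l1 l2; have lb := L1_ftc xi l2 (L1N l1).
    rewrite /F/= RintZ; last by apply: L1D; exact: L1Z.
    rewrite RintD; [|exact: L1Z|exact: L1Z].
    by rewrite !RintZ.
  rewrite (Rint_fubini mF (L1_gW _ e0) (L1Z (2 * M) l12) bF).
  have mcos (x : 'rV[R]_n) : measurable_fun setT (fun xi => cos (dotp x xi)).
    by apply: measurableT_comp; [exact: measurable_cos|exact: measurable_fun_dotp].
  have msin (x : 'rV[R]_n) : measurable_fun setT (fun xi => sin (dotp x xi)).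
    by apply: measurableT_comp; [exact: measurable_sin|exact: measurable_fun_dotp].
  have lc1 : L1 mu (fun x => u1 x * \int[mu]_y (u1 y * gK e (x - y)) +
                              u2 x * \int[mu]_y (u2 y * gK e (x - y))).
    by apply: L1D; exact: L1_conv_quad.
  rewrite -RintZ//; apply: eq_Rintegral => x _.
  transitivity (\int[mu]_xi (u1 x * (gW e xi * (cos (dotp x xi) * P xi - sin (dotp x xi) * Q xi)) +
     u2 x * (gW e xi * (sin (dotp x xi) * P xi - - cos (dotp x xi) * Q xi)))).
    by apply: eq_Rintegral => xi _; rewrite /F/=; ring.
  have la : L1 mu (fun xi => gW e xi * (cos (dotp x xi) * P xi - sin (dotp x xi) * Q xi)).
    apply: lWM => // xi; [exact: normr_cos_le1|exact: normr_sin_le1].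
  have lb : L1 mu (fun xi => gW e xi * (sin (dotp x xi) * P xi - - cos (dotp x xi) * Q xi)).
    apply: lWM => //; first exact: measurableT_comp (mcos x).
      by move=> xi; exact: normr_sin_le1.
    by move=> xi; rewrite normrN; exact: normr_cos_le1.
  rewrite RintD; [|exact: L1Z|exact: L1Z].
  have E2 : \int[mu]_xi (gW e xi * (sin (dotp x xi) * P xi - - cos (dotp x xi) * Q xi)) =
      (2 * pi) ^+ n * \int[mu]_y (u2 y * gK e (x - y)).
    rewrite -(smoothing x e0 l2 (L1N l1)).
    by apply: eq_Rintegral => xi _; rewrite ftcN// -/P -/Q; ring.
  by rewrite !RintZ// smoothing// E2; ring.
rewrite -EFin_Rintegral// E EFinM; apply: lee_wpmul2l.
  by rewrite lee_fin exprn_ge0// mulr_ge0 ?pi_ge0.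
rewrite RintD; [|exact: L1_conv_quad|exact: L1_conv_quad].
under [leRHS]eq_integral do rewrite EFinD.
rewrite ge0_integralD//.
- by rewrite EFinD; apply: leeD; exact: conv_quad_le.
- by move=> x _; rewrite lee_fin sqr_ge0.
- by apply/measurable_EFinP; exact: measurable_funX.
- by move=> x _; rewrite lee_fin sqr_ge0.
- by apply/measurable_EFinP; exact: measurable_funX.
Qed.

(** The damping is removed by Fatou along [e = 1 / (k + 1)]. *)
Lemma plancherel_le u1 u2 : L1 mu u1 -> L1 mu u2 ->
  (\int[mu]_xi (ftc u1 u2 xi ^+ 2 + ftc u2 (fun x => - u1 x) xi ^+ 2)%:E <=
   ((2 * pi) ^+ n)%:E * \int[mu]_x (u1 x ^+ 2 + u2 x ^+ 2)%:E)%E.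
Proof.
move=> l1 l2; have m1 := L1_measurable l1; have m2 := L1_measurable l2.
have mP : measurable_fun setT (fun xi => ftc u1 u2 xi ^+ 2 + ftc u2 (fun x => - u1 x) xi ^+ 2).
  apply: measurable_funD; apply: measurable_funX; apply: measurable_ftc => //.
  exact: measurableT_comp.
apply: (@fatou_bound _ _ R mu (fun k xi => gW k.+1%:R^-1 xi *
  (ftc u1 u2 xi ^+ 2 + ftc u2 (fun x => - u1 x) xi ^+ 2))).
- by move=> k; apply: measurable_funM => //; exact: measurable_gW.
- by move=> k xi; rewrite mulr_ge0 ?gW_ge0// addr_ge0 ?sqr_ge0.
- by move=> xi; rewrite -[X in _ --> X]mul1r; apply: cvgMl; exact: cvg_gW.
- by apply: nearW => k; apply: plancherel_gW => //; rewrite invr_gt0.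
Qed.

End plancherel.

(** * Completeness, cutoffs and the L2 transform *)

Section L2_completeness.
Context d (T : measurableType d) (R : realType) (mu : {measure set T -> \bar R}).

(** Riesz-Fischer with a rate. Along a subsequence the consecutive squared distances are at most
    [4^-k]; weighted by [2^k] they remain summable, so the weighted sum is finite almost everywhere
    and forces pointwise convergence. The rate passes to the limit by Fatou. *)
Lemma L2_complete (v : nat -> T -> R) (eps : nat -> R) :
  (forall k, measurable_fun setT (v k)) -> eps @ \oo --> (0 : R) ->
  (forall K k, (K <= k)%N -> \int[mu]_x ((v k x - v K x) ^+ 2)%:E <= (eps K)%:E)%E ->
  exists w : T -> R, measurable_fun setT w /\
    forall K, (\int[mu]_x ((w x - v K x) ^+ 2)%:E <= (eps K)%:E)%E.
Proof.
move=> mv eps0 vC.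
have /choice[N HN] : forall k : nat, exists N, forall i, (N <= i)%N -> eps i <= 4^-1 ^+ k.
  move=> k; have p0 : 0 < 4^-1 ^+ k :> R by rewrite exprn_gt0// invr_gt0.
  have [N _ HN] := cvgr0_norm_le _ eps0 _ p0.
  by exists N => i Ni; apply: le_trans (ler_norm _) (HN i Ni).
(* The partial sums make [nk] nondecreasing and at least [N k]; the summand [k] makes it tend to
   infinity. *)
pose nk k := (\sum_(i < k.+1) N i + k)%N.
have nkS k : (nk k <= nk k.+1)%N by rewrite /nk [X in (_ <= X + _)%N]big_ord_recr/=; lia.
have nkN k : (N k <= nk k)%N by rewrite /nk big_ord_recr/=; lia.
have nkk k : (k <= nk k)%N by rewrite /nk leq_addl.
pose D k x := 2 ^+ k * (v (nk k.+1) x - v (nk k) x) ^+ 2.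
have D0 k x : (0 <= (D k x)%:E)%E by rewrite lee_fin mulr_ge0 ?sqr_ge0 ?exprn_ge0.
have mD k : measurable_fun setT (fun x => (D k x)%:E).
  apply/measurable_EFinP; apply: measurable_funM => //.
  by apply: measurable_funX; exact: measurable_funB.
pose S x := (\sum_(k <oo) (D k x)%:E)%E.
have mS : measurable_fun setT S by apply: ge0_emeasurable_sum.
have S0 x : (0 <= S x)%E by exact: nneseries_ge0.
have iS : (\int[mu]_x S x < +oo)%E.
  rewrite integral_nneseries//.
  apply: (@le_lt_trans _ _ (\sum_(k <oo) (2 / (2 ^ (k + 1))%:R)%:E)%E).
    apply: lee_nneseries => [k *|k *]; first by apply: integral_ge0 => x _; exact: D0.
    under eq_integral do rewrite EFinM.
    rewrite ge0_integralZl//; last 2 first.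
    - by apply/measurable_EFinP; apply: measurable_funX; exact: measurable_funB.
    - by move=> x _; rewrite lee_fin sqr_ge0.
    apply: (@le_trans _ _ ((2 ^+ k)%:E * (4^-1 ^+ k)%:E)%E).
      apply: lee_wpmul2l; first by rewrite lee_fin exprn_ge0.
      by apply: le_trans (vC _ _ (nkS k)) _; rewrite lee_fin HN.
    rewrite -EFinM lee_fin -exprMn addn1 natrX exprS invfM mulrA divff// mul1r -exprVn.
    by rewrite (_ : 2 * 4^-1 = 2^-1 :> R)//; field.
  by rewrite (cvg_lim _ (@cvg_geometric_eseries_half R 2 0))// ltry.
pose G := [set x | S x \is a fin_num].
have mG : measurable G by rewrite -[G]setTI; exact: emeasurable_fin_num.
have aeG : {ae mu, forall x, G x}.
  have iS' : mu.-integrable setT S.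
    by apply/integrableP; split => //; under eq_integral do rewrite gee0_abs//.
  by apply: filterS (integrable_ae measurableT iS') => x; exact.
(* Setting the functions to 0 off [G] makes them converge at every point, so that the limit is
   measurable. *)
pose w k x := \1_G x * v (nk k) x.
have mw k : measurable_fun setT (w k) by apply: measurable_funM => //; exact: measurable_indic.
have cw x : cvgn (w ^~ x).
  have [Gx|nGx] := pselect (G x); last first.
    rewrite (_ : w ^~ x = cst 0); first exact: is_cvg_cst.
    by apply/funext => k; rewrite /w indicE memNset// mul0r.
  pose u k := v (nk k) x.
  rewrite (_ : w ^~ x = fun k => u 0%N + series (telescope u) k); last first.
    by apply/funext => k; rewrite -eq_sum_telescope /w indicE mem_set// mul1r.
  apply: is_cvgD; first exact: is_cvg_cst.
  apply: normed_cvg; apply: nondecreasing_is_cvgn.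
    by apply: nondecreasing_series => k _ _; exact: normr_ge0.
  exists (2 + fine (S x)) => _ [k _ <-]; rewrite /series/=.
  (* Termwise [|t| <= 2^-i + 2^i t^2], so finiteness of [S x] gives absolute convergence of the
     telescoping series. *)
  apply: (@le_trans _ _ (\sum_(0 <= i < k) (2^-1 ^+ i + D i x))).
    apply: ler_sum => i _; rewrite /telescope /D /u/=; set t := v _ x - v _ x.
    have p0 : 0 < 2 ^+ i :> R by rewrite exprn_gt0.
    rewrite -(real_normK (num_real t)) exprVn.
    rewrite -(ler_pM2l p0) mulrDr divff ?gt_eqF// mulrA -expr2 -exprMn.
    have : 0 <= 2 ^+ i * `|t| by rewrite mulr_ge0// ltW.
    by move: (2 ^+ i * `|t|) => a a0; nra.
  rewrite big_split; apply: lerD.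
    have -> : \sum_(0 <= i < k) 2^-1 ^+ i = 2 - 2 * 2^-1 ^+ k :> R.
      elim: k => [|k IH]; first by rewrite big_geq// expr0; lra.
      by rewrite big_nat_recr//= IH exprS; lra.
    by rewrite gerBl mulr_ge0// exprn_ge0// invr_ge0.
  rewrite -lee_fin fineK// -sumEFin; apply: nneseries_lim_ge => i _ _; exact: D0.
pose W x := lim (w ^~ x @ \oo).
have mW : measurable_fun setT W.
  by apply: (@measurable_fun_cvg _ _ _ _ w) => // x _; exact: cw.
exists W; split => // K.
apply: (@fatou_bound _ _ R mu (fun k x => (w k x - v K x) ^+ 2)).
- by move=> k; apply: measurable_funX; exact: measurable_funB.
- by move=> k x; rewrite sqr_ge0.
- move=> x; apply: (@cvg_comp _ _ _ _ (fun y : R => y ^+ 2)); last exact: exprn_continuous.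
  by apply: cvgB; [exact: cw|exact: cvg_cst].
- near=> k.
  rewrite (@ae_eq_integral _ _ _ mu setT (fun x => ((v (nk k) x - v K x) ^+ 2)%:E))//.
  + apply: vC; apply: leq_trans (nkk k).
    by near: k; exact: nbhs_infty_ge.
  + by apply/measurable_EFinP; apply: measurable_funX; exact: measurable_funB.
  + by apply/measurable_EFinP; apply: measurable_funX; exact: measurable_funB.
  + by apply: filterS aeG => x Gx _; rewrite /w indicE mem_set// mul1r.
Unshelve. all: by end_near. Qed.

End L2_completeness.

Section cube.
Context {R : realType} (n : nat).
Local Notation mu := (@mun R n).
Local Notation leb := (@lebesgue_measure R).

Definition cube (r : R) (x : 'rV[R]_n) : R := \prod_(j < n) \1_(`[- r, r]%classic : set R) (x 0 j).

Lemma L1_cube r : L1 mu (cube r).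
Proof.
have [] // := @L1_prod R n (fun=> \1_(`[- r, r]%classic : set R)) => j.
exact: integrable_indic_itv.
Qed.

Lemma cube_ge0 r x : 0 <= cube r x.
Proof. by apply: prodr_ge0 => j _; rewrite indicE. Qed.

Lemma cubeE r (x : 'rV[R]_n) : (forall j, `|x 0 j| <= r) -> cube r x = 1.
Proof.
move=> xr; rewrite /cube big1// => j _.
by rewrite indicE mem_set//= in_itv/= -ler_norml xr.
Qed.

Lemma L1_cube_le (f : 'rV[R]_n -> R) (r M : R) : measurable_fun setT f ->
  (forall x : 'rV[R]_n, (forall j, `|x 0 j| <= r) -> `|f x| <= M) ->
  (forall x : 'rV[R]_n, (exists j, r < `|x 0 j|) -> f x = 0) -> L1 mu f.
Proof.
move=> mf fM f0; apply: (@L1_le _ _ R mu _ (fun x => `|M| * cube r x)) => //; last first.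
  by apply: L1Z; exact: L1_cube.
move=> x; have [xr|/existsNP[j /negP]] := pselect (forall j, `|x 0 j| <= r).
  by rewrite cubeE// mulr1 (le_trans (fM x xr))// ler_norm.
by rewrite -ltNge => xj; rewrite f0 ?normr0 ?mulr_ge0 ?cube_ge0//; exists j.
Qed.

End cube.

Section truncation.
Context {R : realType} (n : nat).
Local Notation mu := (@mun R n).
Implicit Types (u v : 'rV[R]_n -> R).

Definition sq2 u v := fun x => u x ^+ 2 + v x ^+ 2.

Definition trunc (r : R) u x := if enorm x <= r then u x else 0.

Lemma measurable_le_enorm (r : R) : measurable [set x : 'rV[R]_n | enorm x <= r].
Proof.
rewrite (_ : [set x | _] = setT `&` (@enorm R n) @^-1` `]-oo, r]%classic); last first.
  by rewrite setTI; apply/seteqP; split => x /=; rewrite in_itv.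
have me : measurable_fun setT (@enorm R n) by exact: measurable_fun_enorm.
exact: me.
Qed.

Lemma truncE r u x : trunc r u x = \1_[set x : 'rV[R]_n | enorm x <= r] x * u x.
Proof.
by rewrite /trunc indicE; case: ifPn => h; [rewrite mem_set ?mul1r|rewrite memNset ?mul0r//; exact/negP].
Qed.

Lemma measurable_trunc r u : measurable_fun setT u -> measurable_fun setT (trunc r u).
Proof.
move=> mu1; rewrite (funext (truncE r u)); apply: measurable_funM => //.
by apply: measurable_indic; exact: measurable_le_enorm.
Qed.

(* [|t| <= 1 + t^2] makes an L^2 function cut off to a cube integrable. *)
Lemma L1_sq_cube u v r : measurable_fun setT u -> measurable_fun setT v ->
  L1 mu (fun x => u x ^+ 2) -> (forall x, `|v x| <= `|u x|) ->
  (forall x : 'rV[R]_n, (exists j, r < `|x 0 j|) -> v x = 0) -> L1 mu v.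
Proof.
move=> mu1 mv lu vu v0; apply: (@L1_le _ _ R mu _ (fun x => cube r x + u x ^+ 2)) => //; last first.
  by apply: L1D => //; exact: L1_cube.
move=> x; have [xr|/existsNP[j /negP]] := pselect (forall j, `|x 0 j| <= r).
  rewrite cubeE// (le_trans (vu x))// -(real_normK (num_real (u x))).
  by move: `|u x| (normr_ge0 (u x)) => a; nra.
rewrite -ltNge => xj; rewrite v0 ?normr0 ?addr_ge0 ?cube_ge0 ?sqr_ge0//; by exists j.
Qed.

Lemma trunc_le r u x : `|trunc r u x| <= `|u x|.
Proof. by rewrite /trunc; case: ifP => //; rewrite normr0. Qed.

Lemma L1_trunc r u : measurable_fun setT u -> L1 mu (fun x => u x ^+ 2) -> L1 mu (trunc r u).
Proof.
move=> mu1 lu; apply: (@L1_sq_cube u _ r) => //; first exact: measurable_trunc.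
  by move=> x; exact: trunc_le.
move=> x [j xj]; rewrite /trunc ifN// -ltNge (lt_le_trans xj)//; exact: coord_le_enorm.
Qed.

Lemma ftcB u1 u2 v1 v2 xi : L1 mu u1 -> L1 mu u2 -> L1 mu v1 -> L1 mu v2 ->
  ftc u1 u2 xi - ftc v1 v2 xi = ftc (fun x => u1 x - v1 x) (fun x => u2 x - v2 x) xi.
Proof.
move=> l1 l2 k1 k2; rewrite /ftc -RintB; [|exact: L1_ftc|exact: L1_ftc].
by apply: eq_Rintegral => x _; ring.
Qed.

Lemma plancherel_diff u1 u2 v1 v2 : L1 mu u1 -> L1 mu u2 -> L1 mu v1 -> L1 mu v2 ->
  (\int[mu]_xi (sq2 (fun xi => ftc u1 u2 xi - ftc v1 v2 xi)
     (fun xi => ftc u2 (fun x => - u1 x) xi - ftc v2 (fun x => - v1 x) xi) xi)%:E <=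
   ((2 * pi) ^+ n)%:E * \int[mu]_x (sq2 (fun x => u1 x - v1 x) (fun x => u2 x - v2 x) x)%:E)%E.
Proof.
move=> l1 l2 k1 k2.
have := plancherel_le (L1B l1 k1) (L1B l2 k2); apply: le_trans.
rewrite le_eqVlt; apply/orP; left; apply/eqP; apply: eq_integral => xi _.
rewrite /sq2 ftcB// ftcB//; [|exact: L1N|exact: L1N].
congr ((_ + _ ^+ 2)%:E); congr (ftc _ _ _).
by apply/funext => x; rewrite opprB opprK addrC.
Qed.

(** The condition [is_L2_fourier] for a single complex coefficient: [p1 + i p2] is the L2 limit of
    the transforms of the truncations of [u1 + i u2] to balls. *)
Definition is_ft (u1 u2 p1 p2 : 'rV[R]_n -> R) :=
  [/\ measurable_fun setT u1 /\ measurable_fun setT u2,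
      measurable_fun setT p1 /\ measurable_fun setT p2,
      L1 mu (fun x => u1 x ^+ 2) /\ L1 mu (fun x => u2 x ^+ 2),
      L1 mu (fun x => p1 x ^+ 2) /\ L1 mu (fun x => p2 x ^+ 2) &
      (fun k : nat => \int[mu]_xi (sq2
         (fun xi => p1 xi - ftc (trunc k%:R u1) (trunc k%:R u2) xi)
         (fun xi => p2 xi - ftc (trunc k%:R u2) (fun x => - trunc k%:R u1 x) xi) xi)%:E)%E
         @ \oo --> (0 : \bar R)].

Lemma measurable_sq2 u v : measurable_fun setT u -> measurable_fun setT v ->
  measurable_fun setT (sq2 u v).
Proof. by move=> *; apply: measurable_funD; exact: measurable_funX. Qed.

Lemma sq2_ge0 u v x : 0 <= sq2 u v x.
Proof. by rewrite addr_ge0 ?sqr_ge0. Qed.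

Definition wcutoff (th : nat -> 'rV[R]_n -> R) :=
  [/\ forall k, measurable_fun setT (th k), forall k x, `|th k x| <= 1 &
      forall x, th ^~ x @ \oo --> (1 : R)].

Definition cutoff (th : nat -> 'rV[R]_n -> R) :=
  wcutoff th /\
  forall k, exists r, forall x : 'rV[R]_n, (exists j, r < `|x 0 j|) -> th k x = 0.

Lemma L1_cutoff th k u : cutoff th -> measurable_fun setT u -> L1 mu (fun x => u x ^+ 2) ->
  L1 mu (fun x => th k x * u x).
Proof.
move=> [[mth th1 _] th0] mu1 lu; have [r thr] := th0 k.
apply: (@L1_sq_cube u _ r) => //; first exact: measurable_funM.
- by move=> x; rewrite normrM ler_piMl.
- by move=> x /thr ->; rewrite mul0r.
Qed.

Lemma cutoff_trunc : cutoff (fun k => \1_[set x : 'rV[R]_n | enorm x <= k%:R]).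
Proof.
split; first split.
- by move=> k; apply: measurable_indic; exact: measurable_le_enorm.
- by move=> k x; rewrite indicE; case: (_ \in _); rewrite ?normr1 ?normr0.
- move=> x; apply: cvg_near_cst; near=> k; rewrite indicE mem_set//=.
  by near: k; exact: nbhs_infty_ger.
- move=> k; exists k%:R => x [j xj]; rewrite indicE memNset//= => xk.
  by have := lt_le_trans xj (le_trans (coord_le_enorm x j) xk); rewrite ltxx.
Unshelve. all: by end_near. Qed.

Lemma cutoff_diff_le th th' u1 u2 k x : wcutoff th -> wcutoff th' ->
  sq2 (fun x => th k x * u1 x - th' k x * u1 x) (fun x => th k x * u2 x - th' k x * u2 x) x
  <= 4 * (u1 x ^+ 2 + u2 x ^+ 2).
Proof.
move=> [_ t1 _] [_ t1' _]; rewrite /sq2 -!mulrBl !exprMn mulrDr.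
have h : (th k x - th' k x) ^+ 2 <= 4.
  rewrite -(real_normK (num_real _)) (_ : 4 = 2 ^+ 2); last by rewrite expr2; lra.
  rewrite lerXn2r ?nnegrE// (le_trans (ler_normB _ _))//.
  by rewrite (_ : 2 = 1 + 1)// lerD.
by apply: lerD; rewrite ler_wpM2r ?sqr_ge0.
Qed.

Lemma L1_cutoff_diff th th' u1 u2 k : wcutoff th -> wcutoff th' ->
  measurable_fun setT u1 -> measurable_fun setT u2 ->
  L1 mu (fun x => u1 x ^+ 2) -> L1 mu (fun x => u2 x ^+ 2) ->
  L1 mu (sq2 (fun x => th k x * u1 x - th' k x * u1 x) (fun x => th k x * u2 x - th' k x * u2 x)).
Proof.
move=> ct ct' m1 m2 l1 l2.
apply: (@L1_le _ _ R mu _ (fun x => 4 * (u1 x ^+ 2 + u2 x ^+ 2))).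
- by case: ct ct' => mt _ _ [mt' _ _]; apply: measurable_sq2; apply: measurable_funB; exact: measurable_funM.
- by move=> x; rewrite ger0_norm ?sq2_ge0//; exact: cutoff_diff_le.
- by apply: L1Z; exact: L1D.
Qed.

Lemma cutoff_diff th th' u1 u2 : wcutoff th -> wcutoff th' ->
  measurable_fun setT u1 -> measurable_fun setT u2 ->
  L1 mu (fun x => u1 x ^+ 2) -> L1 mu (fun x => u2 x ^+ 2) ->
  (fun k => \int[mu]_x (sq2 (fun x => th k x * u1 x - th' k x * u1 x)
    (fun x => th k x * u2 x - th' k x * u2 x) x)) @ \oo --> (0 : R).
Proof.
move=> ct ct' m1 m2 l1 l2.
have [] := @Rint_dominated _ _ R mu (fun k => sq2 (fun x => th k x * u1 x - th' k x * u1 x)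
    (fun x => th k x * u2 x - th' k x * u2 x)) (fun=> 0)
    (fun x => 4 * (u1 x ^+ 2 + u2 x ^+ 2)).
- by move=> k; apply: L1_measurable (L1_cutoff_diff k ct ct' m1 m2 l1 l2).
- exact: measurable_cst.
- by apply: L1Z; exact: L1D.
- by move=> k x; rewrite ger0_norm ?sq2_ge0//; exact: cutoff_diff_le.
- move=> x; case: ct ct' => _ _ tc [_ _ tc'].
  have h0 : (fun k => th k x - th' k x) @ \oo --> (1 - 1 : R) by exact: cvgB.
  have h2 : (fun k => (th k x - th' k x) * (th k x - th' k x) * (u1 x ^+ 2 + u2 x ^+ 2)) @ \oo -->
      ((1 - 1) * (1 - 1) * (u1 x ^+ 2 + u2 x ^+ 2) : R) by apply: cvgMl; exact: cvgM.
  rewrite subrr !mul0r in h2.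
  by apply: cvg_trans h2; apply: near_eq_cvg; apply: nearW => k /=; rewrite /sq2; ring.
by rewrite Rintegral_cst// mul0r.
Qed.

(** The factors 2 come from [(p + q)^2 <= 2 p^2 + 2 q^2]; working with squares avoids roots and
    allows infinite integrals. *)
Lemma int_sq2_tri (a1 a2 b1 b2 c1 c2 : 'rV[R]_n -> R) :
  measurable_fun setT a1 -> measurable_fun setT a2 -> measurable_fun setT b1 ->
  measurable_fun setT b2 -> measurable_fun setT c1 -> measurable_fun setT c2 ->
  (\int[mu]_x (sq2 (fun x => a1 x - c1 x)%R (fun x => a2 x - c2 x)%R x)%:E <=
   2%:E * \int[mu]_x (sq2 (fun x => a1 x - b1 x)%R (fun x => a2 x - b2 x)%R x)%:E +
   2%:E * \int[mu]_x (sq2 (fun x => b1 x - c1 x)%R (fun x => b2 x - c2 x)%R x)%:E)%E.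
Proof.
move=> ma1 ma2 mb1 mb2 mc1 mc2.
have ms (f1 f2 g1 g2 : 'rV[R]_n -> R) : measurable_fun setT f1 -> measurable_fun setT f2 ->
    measurable_fun setT g1 -> measurable_fun setT g2 ->
    measurable_fun setT (fun x : 'rV[R]_n => (sq2 (fun x => f1 x - g1 x) (fun x => f2 x - g2 x) x)%:E).
  by move=> *; apply/measurable_EFinP; apply: measurable_sq2; exact: measurable_funB.
have s0 f1 f2 (x : 'rV[R]_n) : (0 <= (sq2 f1 f2 x)%:E)%E by rewrite lee_fin sq2_ge0.
rewrite -!ge0_integralZl//; [|exact: ms|exact: ms].
rewrite -ge0_integralD//.
- apply: ge0_le_integral => //; first exact: ms.
    by apply: emeasurable_funD; apply: measurable_funeM; exact: ms.
  move=> x _; rewrite -!EFinM -EFinD lee_fin /sq2.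
  have := sqr_ge0 ((a1 x - b1 x) - (b1 x - c1 x)); have := sqr_ge0 ((a2 x - b2 x) - (b2 x - c2 x)).
  by move: (a1 x) (a2 x) (b1 x) (b2 x) (c1 x) (c2 x) => *; nra.
- by move=> x _; rewrite mule_ge0.
- by apply: measurable_funeM; exact: ms.
- by move=> x _; rewrite mule_ge0.
- by apply: measurable_funeM; exact: ms.
Qed.

Lemma measurable_ftc_N u1 u2 : measurable_fun setT u1 -> measurable_fun setT u2 ->
  measurable_fun setT (ftc u2 (fun x => - u1 x)).
Proof. by move=> *; apply: measurable_ftc => //; exact: measurableT_comp. Qed.

Lemma squeeze_e0 (a b : nat -> \bar R) : (forall k, 0 <= a k <= b k)%E ->
  b @ \oo --> (0 : \bar R) -> a @ \oo --> (0 : \bar R).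
Proof.
move=> ab b0; apply: (@squeeze_cvge _ _ _ _ (cst 0%E) a b) => //.
  by apply: nearW => k; exact: ab.
exact: cvg_cst.
Qed.

(** The transform is defined by sharp truncation to balls, while integration by parts needs
    differentiable cutoffs. By Plancherel the two families of transforms differ by the L2 distance
    of the cut off functions, which tends to 0 by dominated convergence. *)
Lemma ft_cutoff th u1 u2 p1 p2 : is_ft u1 u2 p1 p2 -> cutoff th ->
  (fun k : nat => \int[mu]_xi (sq2
     (fun xi => p1 xi - ftc (fun x => th k x * u1 x) (fun x => th k x * u2 x) xi)
     (fun xi => p2 xi - ftc (fun x => th k x * u2 x) (fun x => - (th k x * u1 x)) xi) xi)%:E)%E
     @ \oo --> (0 : \bar R).
Proof.
move=> [[m1 m2] [mp1 mp2] [l1 l2] _ cp] cth.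
have mth k : measurable_fun setT (th k) by case: cth => -[].
pose A k := (\int[mu]_xi (sq2
         (fun xi => p1 xi - ftc (trunc k%:R u1) (trunc k%:R u2) xi)
         (fun xi => p2 xi - ftc (trunc k%:R u2) (fun x => - trunc k%:R u1 x) xi) xi)%:E)%E.
pose B k := ((2 * pi) ^+ n * \int[mu]_x (sq2
  (fun x => \1_[set x : 'rV[R]_n | enorm x <= k%:R] x * u1 x - th k x * u1 x)
  (fun x => \1_[set x : 'rV[R]_n | enorm x <= k%:R] x * u2 x - th k x * u2 x) x))%R.
apply: (@squeeze_e0 _ (fun k => 2%:E * A k + 2%:E * (B k)%:E)%E); last first.
  rewrite (_ : 0%E = 2%:E * 0 + 2%:E * 0%:E)%E; last by rewrite !mule0 adde0.
  apply: cvgeD => //; apply: cvgeZl => //.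
  apply: cvg_EFin; first exact: nearW.
  rewrite -[X in _ --> X](mulr0 ((2 * pi) ^+ n)); apply: cvgMr.
  by apply: cutoff_diff => //; [exact: cutoff_trunc.1|exact: cth.1].
move=> k; apply/andP; split.
  by apply: integral_ge0 => x _; rewrite lee_fin sq2_ge0.
have mt1 := measurable_trunc k%:R m1; have mt2 := measurable_trunc k%:R m2.
have lt1 := L1_trunc k%:R m1 l1; have lt2 := L1_trunc k%:R m2 l2.
have mh1 : measurable_fun setT (fun x => th k x * u1 x) by exact: measurable_funM.
have mh2 : measurable_fun setT (fun x => th k x * u2 x) by exact: measurable_funM.
have lh1 := L1_cutoff k cth m1 l1; have lh2 := L1_cutoff k cth m2 l2.
apply: le_trans (int_sq2_tri mp1 mp2 (measurable_ftc mt1 mt2) (measurable_ftc_N mt1 mt2)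
  (measurable_ftc mh1 mh2) (measurable_ftc_N mh1 mh2)) _.
apply: leeD => //; apply: lee_wpmul2l => //.
apply: le_trans (plancherel_diff lt1 lt2 lh1 lh2) _; rewrite EFinM.
apply: lee_wpmul2l; first by rewrite lee_fin exprn_ge0// mulr_ge0 ?pi_ge0.
rewrite EFin_Rintegral; last first.
  exact: (L1_cutoff_diff k cutoff_trunc.1 cth.1 m1 m2 l1 l2).
rewrite le_eqVlt; apply/orP; left; apply/eqP; apply: eq_integral => x _.
by rewrite /sq2 !truncE.
Qed.

Lemma L1_ftc_sq u1 u2 : L1 mu u1 -> L1 mu u2 ->
  L1 mu (fun x => u1 x ^+ 2) -> L1 mu (fun x => u2 x ^+ 2) ->
  L1 mu (fun xi => ftc u1 u2 xi ^+ 2).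
Proof.
move=> l1 l2 k1 k2; have m1 := L1_measurable l1; have m2 := L1_measurable l2.
have mf := measurable_ftc m1 m2.
apply: L1P; first exact: measurable_funX.
apply: (@le_lt_trans _ _ (\int[mu]_xi (ftc u1 u2 xi ^+ 2 + ftc u2 (fun x => - u1 x) xi ^+ 2)%:E)%E).
  apply: ge0_le_integral => //.
  - by apply/measurable_EFinP; apply: measurableT_comp => //; exact: measurable_funX.
  - apply/measurable_EFinP; apply: measurable_funD; first exact: measurable_funX.
    by apply: measurable_funX; exact: measurable_ftc_N.
  - by move=> x _; rewrite lee_fin ger0_norm ?sqr_ge0// lerDl sqr_ge0.
apply: le_lt_trans (plancherel_le l1 l2) _.
have lk := L1D k1 k2; rewrite -EFin_Rintegral// -EFinM ltry//.
Qed.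

Lemma L1_sq_near u v : measurable_fun setT u -> L1 mu (fun x => v x ^+ 2) ->
  measurable_fun setT v ->
  (\int[mu]_x ((u x - v x) ^+ 2)%:E < +oo)%E -> L1 mu (fun x => u x ^+ 2).
Proof.
move=> m1 lv mv luv.
have luv' : L1 mu (fun x => (u x - v x) ^+ 2).
  apply: L1P; first by apply: measurable_funX; exact: measurable_funB.
  by under eq_integral do rewrite ger0_norm ?sqr_ge0//.
apply: (@L1_le _ _ R mu _ (fun x => 2 * (u x - v x) ^+ 2 + 2 * v x ^+ 2)).
- exact: measurable_funX.
- move=> x; rewrite ger0_norm ?sqr_ge0//; have := sqr_ge0 (u x - v x - v x).
  by move: (u x) (v x) => *; nra.
- by apply: L1D; exact: L1Z.
Qed.

Lemma wcutoff1 : wcutoff (fun _ _ => 1).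
Proof.
split=> [k|k x|x]; [exact: measurable_cst|by rewrite normr1|exact: cvg_cst].
Qed.

(** For [K <= k] two truncations differ by at most the tail of [u1 + i u2] beyond radius [K].
    Plancherel therefore makes their transforms Cauchy at the rate [eps K], and completeness
    provides the limit. *)
Lemma ft_exists u1 u2 : measurable_fun setT u1 -> measurable_fun setT u2 ->
  L1 mu (fun x => u1 x ^+ 2) -> L1 mu (fun x => u2 x ^+ 2) ->
  exists p1 p2, is_ft u1 u2 p1 p2.
Proof.
move=> m1 m2 l1 l2.
have mt1 k := measurable_trunc k%:R m1; have mt2 k := measurable_trunc k%:R m2.
have lt1 k := L1_trunc k%:R m1 l1; have lt2 k := L1_trunc k%:R m2 l2.
pose v1 k := ftc (trunc k%:R u1) (trunc k%:R u2).
pose v2 k := ftc (trunc k%:R u2) (fun x => - trunc k%:R u1 x).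
have mv1 k : measurable_fun setT (v1 k) by exact: measurable_ftc.
have mv2 k : measurable_fun setT (v2 k) by exact: measurable_ftc_N.
pose eps k := ((2 * pi) ^+ n * \int[mu]_x (sq2
  (fun x => 1 * u1 x - \1_[set x : 'rV[R]_n | enorm x <= k%:R] x * u1 x)
  (fun x => 1 * u2 x - \1_[set x : 'rV[R]_n | enorm x <= k%:R] x * u2 x) x)).
have ct := @cutoff_trunc.
have eps0 : eps @ \oo --> (0 : R).
  rewrite -[X in _ --> X](mulr0 ((2 * pi) ^+ n)); apply: cvgMr.
  by apply: (cutoff_diff (th := fun _ _ => 1)) => //; [exact: wcutoff1|exact: ct.1].
have vC K k : (K <= k)%N ->
    (\int[mu]_x (sq2 (fun x => v1 k x - v1 K x) (fun x => v2 k x - v2 K x) x)%:E <= (eps K)%:E)%E.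
  move=> Kk; apply: le_trans (plancherel_diff (lt1 k) (lt2 k) (lt1 K) (lt2 K)) _.
  rewrite EFinM; apply: lee_wpmul2l; first by rewrite lee_fin exprn_ge0// mulr_ge0 ?pi_ge0.
  have lc := L1_cutoff_diff K wcutoff1 ct.1 m1 m2 l1 l2.
  rewrite EFin_Rintegral//; apply: ge0_le_integral => //.
  - by move=> x _; rewrite lee_fin sq2_ge0.
  - by apply/measurable_EFinP; apply: measurable_sq2; exact: measurable_funB.
  - exact: measurable_int lc.
  - move=> x _; rewrite lee_fin /sq2 -!truncE !mul1r /trunc.
    have [xK|xK] := leP (enorm x) K%:R.
      by rewrite (le_trans xK) ?ler_nat// !subrr expr0n.
    by rewrite !subr0; case: ifP => _ //; rewrite expr0n addr0 addr_ge0 ?sqr_ge0.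
have vCi (v w : nat -> 'rV[R]_n -> R) (ww : forall k, measurable_fun setT (w k))
    (vv : forall k, measurable_fun setT (v k)) K k :
    (\int[mu]_x ((v k x - v K x) ^+ 2)%:E <=
     \int[mu]_x (sq2 (fun x => v k x - v K x) (fun x => w k x - w K x) x)%:E)%E.
  apply: ge0_le_integral => //.
  - by move=> x _; rewrite lee_fin sqr_ge0.
  - by apply/measurable_EFinP; apply: measurable_funX; exact: measurable_funB.
  - by apply/measurable_EFinP; apply: measurable_sq2; exact: measurable_funB.
  - by move=> x _; rewrite lee_fin lerDl sqr_ge0.
have [|p1 [mp1 hp1]] := @L2_complete _ _ R mu v1 eps mv1 eps0.
  by move=> K k Kk; apply: le_trans (vC K k Kk); exact: vCi.
have [|p2 [mp2 hp2]] := @L2_complete _ _ R mu v2 eps mv2 eps0.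
  move=> K k Kk; apply: le_trans (vC K k Kk); apply: le_trans (vCi v2 v1 mv1 mv2 _ _) _.
  by under eq_integral do rewrite /sq2 addrC.
have tsq u : L1 mu (fun x => u x ^+ 2) -> measurable_fun setT u ->
    L1 mu (fun x => trunc 0%:R u x ^+ 2).
  move=> lu mu1; apply: (@L1_le _ _ R mu _ (fun x => u x ^+ 2)) => //.
    by apply: measurable_funX; exact: measurable_trunc.
  move=> x; rewrite ger0_norm ?sqr_ge0// -(real_normK (num_real (trunc _ _ _))).
  by rewrite -(real_normK (num_real (u x))) lerXn2r ?nnegrE// trunc_le.
exists p1, p2; split => //.
- split.
    (* Square integrability is inherited from the transform of the truncation at radius 0, whose
       squared distance to the limit is at most [eps 0]. *)
    apply: (@L1_sq_near _ (v1 0%N)) => //.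
      by apply: L1_ftc_sq => //; exact: tsq.
    by apply: le_lt_trans (hp1 0%N) _; rewrite ltry.
  apply: (@L1_sq_near _ (v2 0%N)) => //.
    apply: L1_ftc_sq => //; [exact: L1N|exact: tsq|].
    by under eq_fun do rewrite sqrrN; exact: tsq.
  by apply: le_lt_trans (hp2 0%N) _; rewrite ltry.
- apply: (@squeeze_e0 _ (fun k => (eps k + eps k)%:E)); last first.
    apply: cvg_EFin; first exact: nearW.
    by rewrite -[X in _ --> X](addr0 (0 : R)); apply: cvgD.
  move=> k; rewrite integral_ge0/=; last by move=> x _; rewrite lee_fin sq2_ge0.
  under eq_integral do rewrite EFinD.
  rewrite ge0_integralD//.
  + by rewrite EFinD; apply: leeD; [exact: hp1|exact: hp2].
  + by move=> x _; rewrite lee_fin sqr_ge0.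
  + by apply/measurable_EFinP; apply: measurable_funX; exact: (measurable_funB mp1 (mv1 k)).
  + by move=> x _; rewrite lee_fin sqr_ge0.
  + by apply/measurable_EFinP; apply: measurable_funX; exact: (measurable_funB mp2 (mv2 k)).
Qed.

End truncation.

Lemma ecvg0P (R : realType) (a : nat -> \bar R) : (forall k, 0 <= a k)%E ->
  a @ \oo --> (0 : \bar R) <->
  forall e : R, 0 < e -> \forall k \near \oo, (a k <= e%:E)%E.
Proof.
move=> a0; split=> [/fine_cvgP[af c] e e0|h].
  apply: (filterS2 _ _ af (cvgr0_norm_le _ c _ e0)) => k ak /=.
  by rewrite ger0_norm ?fine_ge0// => h; rewrite -(fineK ak) lee_fin.
have fk : \forall k \near \oo, a k \is a fin_num.
  by apply: filterS (h 1 ltr01) => k ak; rewrite ge0_fin_numE// (le_lt_trans ak)// ltry.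
apply/fine_cvgP; split => //; apply/cvgr0Pnorm_le => e e0.
apply: (filterS2 _ _ fk (h e e0)) => k fak ak.
by rewrite /= ger0_norm ?fine_ge0// -lee_fin fineK.
Qed.

Section L2_to_L1.
Context d (T : measurableType d) (R : realType) (mu : {measure set T -> \bar R}).

(** A substitute for Cauchy-Schwarz: [t <= e + t^2 / e] for any [e > 0]. Once the integral of
    [a k ^ 2] is below [e^2], the weighted integral is at most [e] times the mass of [q] plus 1. *)
Lemma L2_to_L1 (q : T -> R) (a : nat -> T -> R) :
  L1 mu q -> (forall x, 0 <= q x <= 1) -> (forall k, measurable_fun setT (a k)) ->
  (fun k => \int[mu]_x (a k x ^+ 2)%:E)%E @ \oo --> (0 : \bar R) ->
  (fun k => \int[mu]_x (q x * `|a k x|)%:E)%E @ \oo --> (0 : \bar R).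
Proof.
move=> lq q01 ma a0; have mq := L1_measurable lq.
pose M := \int[mu]_x q x.
have M0 : 0 <= M by apply: Rintegral_ge0 => x _; case/andP: (q01 x).
have key (e : R) : 0 < e -> \forall k \near \oo, (\int[mu]_x (q x * `|a k x|)%:E <= (e * (M + 1))%:E)%E.
  move=> e0; have e20 : 0 < e ^+ 2 by rewrite exprn_gt0.
  have h0 k : (0 <= \int[mu]_x (a k x ^+ 2)%:E)%E.
    by apply: integral_ge0 => x _; rewrite lee_fin sqr_ge0.
  apply: filterS ((ecvg0P h0).1 a0 _ e20) => k lk.
  apply: (@le_trans _ _ (\int[mu]_x ((e * q x)%:E + (e^-1)%:E * (a k x ^+ 2)%:E))%E).
    apply: ge0_le_integral => //.
    - by move=> x _; rewrite lee_fin mulr_ge0//; case/andP: (q01 x).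
    - by apply/measurable_EFinP; apply: measurable_funM => //; exact: measurableT_comp.
    - apply: emeasurable_funD; first by apply/measurable_EFinP; exact: measurable_funM.
      by apply: measurable_funeM; apply/measurable_EFinP; exact: measurable_funX.
    - move=> x _; rewrite -EFinM -EFinD lee_fin.
      have /andP[q0 q1] := q01 x.
      have eV : 0 < e^-1 by rewrite invr_gt0.
      rewrite -(real_normK (num_real (a k x))); move: `|a k x| (normr_ge0 (a k x)) => t t0.
      have h : t <= e + e^-1 * t ^+ 2.
        rewrite -(ler_pM2l e0) mulrDr mulrA divff ?gt_eqF// mul1r -expr2; nra.
      apply: le_trans (ler_wpM2l q0 h) _; rewrite mulrDr; apply: lerD; first by rewrite mulrC.
      by rewrite ler_piMl// mulr_ge0 ?sqr_ge0// ltW.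
  rewrite ge0_integralD//.
  - have -> : (\int[mu]_x ((e^-1)%:E * (a k x ^+ 2)%:E) = (e^-1)%:E * \int[mu]_x (a k x ^+ 2)%:E)%E.
      apply: ge0_integralZl => //; last by rewrite lee_fin invr_ge0 ltW.
        by apply/measurable_EFinP; exact: measurable_funX.
      by move=> x _; rewrite lee_fin sqr_ge0.
    rewrite mulrDr mulr1 EFinD; apply: leeD.
      by rewrite -EFin_Rintegral; [rewrite RintZ|exact: L1Z].
    have -> : e%:E = ((e^-1)%:E * (e ^+ 2)%:E)%E by rewrite -EFinM expr2 mulKf ?gt_eqF.
    by apply: lee_wpmul2l; [rewrite lee_fin invr_ge0 ltW|].
  - by move=> x _; case/andP: (q01 x) => ? _; rewrite lee_fin mulr_ge0// ltW.
  - by apply/measurable_EFinP; exact: measurable_funM.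
  - by move=> x _; rewrite -EFinM lee_fin mulr_ge0 ?sqr_ge0// invr_ge0 ltW.
  - by apply: measurable_funeM; apply/measurable_EFinP; exact: measurable_funX.
apply/ecvg0P => [k|e e0].
  by apply: integral_ge0 => x _; rewrite lee_fin mulr_ge0//; case/andP: (q01 x).
have M1 : 0 < M + 1 by rewrite ltr_wpDl.
have := key (e / (M + 1)) (divr_gt0 e0 M1).
by rewrite divfK ?gt_eqF.
Qed.

End L2_to_L1.

(** * Fourier inversion at points of continuity *)

Section inversion.
Context {R : realType} (n : nat).
Local Notation mu := (@mun R n).
Implicit Types (u v p : 'rV[R]_n -> R).

Lemma gK_sq_L1 (e : R) (x : 'rV[R]_n) : 0 < e -> L1 mu (fun y => gK e (x - y) ^+ 2).
Proof.
move=> e0; have [lK _] := L1_gK_sub x e0.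
apply: (@L1_le _ _ R mu _ (fun y => normal_peak e ^+ n * gK e (x - y))).
- by apply: measurable_funX; exact: L1_measurable lK.
- by move=> y; rewrite ger0_norm ?sqr_ge0// expr2 ler_wpM2r ?gK_ge0// gK_le.
- exact: L1Z.
Qed.

Lemma L1_sq_gK (e : R) u (x : 'rV[R]_n) : 0 < e -> measurable_fun setT u ->
  L1 mu (fun y => u y ^+ 2) -> L1 mu (fun y => u y * gK e (x - y)).
Proof.
move=> e0 m1 l1; apply: L1_sqM => //; last exact: gK_sq_L1.
exact: L1_measurable (L1_gK_sub x e0).1.
Qed.

(** Limit of [smoothing] along truncations to balls. On the left the integrable weight [gW] turns L2
    convergence of the transforms into convergence of integrals; on the right [|u1| * gK]
    dominates. *)
Lemma smoothing_L2 (e : R) (x : 'rV[R]_n) u1 u2 p1 p2 : 0 < e -> is_ft u1 u2 p1 p2 ->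
  \int[mu]_xi (gW e xi * (cos (dotp x xi) * p1 xi - sin (dotp x xi) * p2 xi)) =
  (2 * pi) ^+ n * \int[mu]_y (u1 y * gK e (x - y)).
Proof.
move=> e0 [[m1 m2] [mp1 mp2] [l1 l2] [k1 k2] cp].
have mt1 k := measurable_trunc k%:R m1; have mt2 k := measurable_trunc k%:R m2.
have lt1 k := L1_trunc k%:R m1 l1; have lt2 k := L1_trunc k%:R m2 l2.
pose v1 (k : nat) := ftc (trunc k%:R u1) (trunc k%:R u2).
pose v2 (k : nat) := ftc (trunc k%:R u2) (fun x => - trunc k%:R u1 x).
have mv1 k : measurable_fun setT (v1 k) by exact: measurable_ftc.
have mv2 k : measurable_fun setT (v2 k) by exact: measurable_ftc_N.
have mcos : measurable_fun setT (fun xi => cos (dotp x xi)).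
  by apply: measurableT_comp; [exact: measurable_cos|exact: measurable_fun_dotp].
have msin : measurable_fun setT (fun xi => sin (dotp x xi)).
  by apply: measurableT_comp; [exact: measurable_sin|exact: measurable_fun_dotp].
have lW := @L1_gW R n e e0.
have mW := @measurable_gW R n e.
pose A k := \int[mu]_xi (gW e xi * (cos (dotp x xi) * v1 k xi - sin (dotp x xi) * v2 k xi)).
have AE k : A k = (2 * pi) ^+ n * \int[mu]_y (trunc k%:R u1 y * gK e (x - y)) by exact: smoothing.
have cA1 : A @ \oo --> (2 * pi) ^+ n * \int[mu]_y (u1 y * gK e (x - y)).
  rewrite (funext AE); apply: cvgMr.
  have lK := L1_sq_gK x e0 m1 l1.
  have [] // := @Rint_dominated _ _ R mu (fun k y => trunc k%:R u1 y * gK e (x - y))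
    (fun y => u1 y * gK e (x - y)) (fun y => `|u1 y * gK e (x - y)|).
  - by move=> k; apply: measurable_funM => //; exact: L1_measurable (L1_gK_sub x e0).1.
  - exact: L1_measurable lK.
  - exact: L1_abs.
  - by move=> k y; rewrite !normrM ler_wpM2r// trunc_le.
  - move=> y; apply: cvgMl; apply: cvg_near_cst; near=> k; rewrite /trunc ifT//.
    by near: k; exact: nbhs_infty_ger.
have lWp : L1 mu (fun xi => gW e xi * (cos (dotp x xi) * p1 xi - sin (dotp x xi) * p2 xi)).
  apply: L1_sqM => //.
  - by apply: measurable_funB; exact: measurable_funM.
  - apply: (@L1_le _ _ R mu _ (gW e)) => //; first exact: measurable_funX.
    by move=> y; rewrite ger0_norm ?sqr_ge0// expr2 ler_piMl ?gW_ge0// gW_le1.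
  - apply: (@L1_le _ _ R mu _ (fun xi => 2 * p1 xi ^+ 2 + 2 * p2 xi ^+ 2)).
    + by apply: measurable_funX; apply: measurable_funB; exact: measurable_funM.
    + move=> xi; rewrite ger0_norm ?sqr_ge0//; have := cos2Dsin2 (dotp x xi).
      move: (cos _) (sin _) (p1 xi) (p2 xi) => c s a b cs.
      have := sqr_ge0 (c * b + s * a); nra.
    + by apply: L1D; exact: L1Z.
have cA2 : A @ \oo --> \int[mu]_xi (gW e xi * (cos (dotp x xi) * p1 xi - sin (dotp x xi) * p2 xi)).
  have z1 : (fun k => \int[mu]_xi (gW e xi * `|p1 xi - v1 k xi|)%:E)%E @ \oo --> (0 : \bar R).
    apply: L2_to_L1 => //.
    - by move=> xi; rewrite gW_ge0 gW_le1.
    - by move=> k; exact: measurable_funB.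
    apply: squeeze_e0 cp => k; apply/andP; split.
      by apply: integral_ge0 => xi _; rewrite lee_fin sqr_ge0.
    apply: ge0_le_integral => //.
    - by move=> xi _; rewrite lee_fin sqr_ge0.
    - by apply/measurable_EFinP; apply: measurable_funX; exact: measurable_funB.
    - by apply/measurable_EFinP; apply: measurable_sq2; [exact: (measurable_funB mp1 (mv1 k))|exact: (measurable_funB mp2 (mv2 k))].
    - by move=> xi _; rewrite lee_fin /sq2 lerDl sqr_ge0.
  have z2 : (fun k => \int[mu]_xi (gW e xi * `|p2 xi - v2 k xi|)%:E)%E @ \oo --> (0 : \bar R).
    apply: L2_to_L1 => //.
    - by move=> xi; rewrite gW_ge0 gW_le1.
    - by move=> k; exact: measurable_funB.
    apply: squeeze_e0 cp => k; apply/andP; split.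
      by apply: integral_ge0 => xi _; rewrite lee_fin sqr_ge0.
    apply: ge0_le_integral => //.
    - by move=> xi _; rewrite lee_fin sqr_ge0.
    - by apply/measurable_EFinP; apply: measurable_funX; exact: measurable_funB.
    - by apply/measurable_EFinP; apply: measurable_sq2; [exact: (measurable_funB mp1 (mv1 k))|exact: (measurable_funB mp2 (mv2 k))].
    - by move=> xi _; rewrite lee_fin /sq2 lerDr sqr_ge0.
  have lWv k : L1 mu (fun xi => gW e xi * (cos (dotp x xi) * v1 k xi - sin (dotp x xi) * v2 k xi)).
    under eq_fun do rewrite mulrC.
    pose M1 := \int[mu]_x (`|trunc k%:R u1 x| + `|trunc k%:R u2 x|).
    pose M2 := \int[mu]_x (`|trunc k%:R u2 x| + `|- trunc k%:R u1 x|).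
    apply: (@L1_bM _ _ R mu _ _ (M1 + M2)) => //.
      by apply: measurable_funB; exact: measurable_funM.
    move=> xi; apply: le_trans (ler_normB _ _) _; rewrite !normrM; apply: lerD.
      apply: le_trans (ftc_le xi (lt1 k) (lt2 k)).
      by rewrite ler_piMl// normr_cos_le1.
    apply: le_trans (ftc_le xi (lt2 k) (L1N (lt1 k))).
    by rewrite ler_piMl// normr_sin_le1.
  apply/cvgrPdist_le => d d0; have d20 : 0 < d / 2 by rewrite divr_gt0.
  have pos1 k : (0 <= \int[mu]_xi (gW e xi * `|p1 xi - v1 k xi|)%:E)%E.
    by apply: integral_ge0 => xi _; rewrite lee_fin mulr_ge0// gW_ge0.
  have pos2 k : (0 <= \int[mu]_xi (gW e xi * `|p2 xi - v2 k xi|)%:E)%E.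
    by apply: integral_ge0 => xi _; rewrite lee_fin mulr_ge0// gW_ge0.
  apply: (filterS2 _ _ ((ecvg0P pos1).1 z1 _ d20) ((ecvg0P pos2).1 z2 _ d20)) => k h1 h2.
  have mW1 : measurable_fun setT (fun xi => gW e xi * `|p1 xi - v1 k xi|).
    by apply: measurable_funM => //; apply: measurableT_comp => //; exact: measurable_funB.
  have mW2 : measurable_fun setT (fun xi => gW e xi * `|p2 xi - v2 k xi|).
    by apply: measurable_funM => //; apply: measurableT_comp => //; exact: measurable_funB.
  have l1' : L1 mu (fun xi => gW e xi * `|p1 xi - v1 k xi|).
    apply: L1P => //; apply: le_lt_trans (ltry (d / 2)); apply: le_trans h1.
    rewrite le_eqVlt; apply/orP; left; apply/eqP; apply: eq_integral => xi _.
    by rewrite ger0_norm// mulr_ge0// gW_ge0.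
  have l2' : L1 mu (fun xi => gW e xi * `|p2 xi - v2 k xi|).
    apply: L1P => //; apply: le_lt_trans (ltry (d / 2)); apply: le_trans h2.
    rewrite le_eqVlt; apply/orP; left; apply/eqP; apply: eq_integral => xi _.
    by rewrite ger0_norm// mulr_ge0// gW_ge0.
  rewrite -(EFin_Rintegral l1') lee_fin in h1; rewrite -(EFin_Rintegral l2') lee_fin in h2.
  rewrite /A -RintB//; apply: le_trans (Rint_abs_le (L1B lWp (lWv k)) (L1D l1' l2') _) _.
    move=> xi; rewrite -mulrBr normrM ger0_norm ?gW_ge0// -mulrDr ler_wpM2l ?gW_ge0//.
    have -> : cos (dotp x xi) * p1 xi - sin (dotp x xi) * p2 xi -
      (cos (dotp x xi) * v1 k xi - sin (dotp x xi) * v2 k xi) =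
      cos (dotp x xi) * (p1 xi - v1 k xi) - sin (dotp x xi) * (p2 xi - v2 k xi) by ring.
    apply: le_trans (ler_normB _ _) _; rewrite !normrM; apply: lerD.
      by rewrite ler_piMl// normr_cos_le1.
    by rewrite ler_piMl// normr_sin_le1.
  by rewrite (RintD l1' l2'); apply: le_trans (lerD h1 h2) _; rewrite -splitr.
exact: cvg_unique cA2 cA1.
Unshelve. all: by end_near. Qed.

Lemma normal_pdf_scale (k : nat) (t : R) :
  normal_pdf 0 k.+1%:R^-1 t = k.+1%:R * expR (- ((k.+1%:R ^+ 2 - 1) * t ^+ 2 / 2)) * normal_pdf 0 1 t.
Proof.
have K0 : (0 : R) < k.+1%:R by rewrite ltr0n.
rewrite !normal_pdfE ?invr_eq0 ?gt_eqF//; move: k.+1%:R K0 => K K0.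
have -> : normal_peak K^-1 = K * normal_peak 1.
  rewrite /normal_peak expr1n mul1r -mulrnAr sqrtrM ?exprn_ge0 ?invr_ge0 ?ltW//.
  by rewrite sqrtr_sqr ger0_norm ?invr_ge0 ?ltW// invfM invrK.
have -> : normal_fun 0 K^-1 t = expR (- ((K ^+ 2 - 1) * t ^+ 2 / 2)) * normal_fun 0 1 t.
  by rewrite /normal_fun -expRD !subr0; congr expR; field; rewrite gt_eqF.
by ring.
Qed.

(** Away from the origin the concentrated kernel is a small multiple of the fixed kernel [gK 1],
    against which every L2 function is integrable. One coordinate of size [r] is enough, since the
    other exponents only help. *)
Lemma gK_far (k : nat) (z : 'rV[R]_n) (r : R) (j : 'I_n) : 0 <= r -> r <= `|z 0 j| ->
  gK k.+1%:R^-1 z <= k.+1%:R ^+ n * expR (- ((k.+1%:R ^+ 2 - 1) * r ^+ 2 / 2)) * gK 1 z.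
Proof.
move=> r0 rz; have K1 : (1 : R) <= k.+1%:R by rewrite ler1n.
rewrite /gK; under eq_bigr do rewrite normal_pdf_scale.
rewrite !big_split/= ler_wpM2r ?gK_ge0// big_const_ord iter_mulr_1.
rewrite ler_wpM2l ?exprn_ge0// -expR_sum ler_expR (bigD1 j)//=.
have h (t : R) : 0 <= (k.+1%:R ^+ 2 - 1) * t ^+ 2 / 2.
  by rewrite divr_ge0// mulr_ge0 ?sqr_ge0// subr_ge0 exprn_ege1.
apply: (@le_trans _ _ (- ((k.+1%:R ^+ 2 - 1) * z 0 j ^+ 2 / 2))).
  by rewrite gerDl; apply: sumr_le0 => i _; rewrite oppr_le0.
rewrite lerN2 ler_wpM2r// ler_wpM2l ?subr_ge0 ?exprn_ege1//.
by rewrite -(real_normK (num_real (z 0 j))) lerXn2r ?nnegrE.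
Qed.

Lemma cvg_gK_tail (b : R) : 0 < b ->
  (fun k : nat => k.+1%:R ^+ n * expR (- ((k.+1%:R ^+ 2 - 1) * b))) @ \oo --> (0 : R).
Proof.
(* With [K = k + 1 >= 2], [(K b)^(n+1) / (n+1)! <= exp (K b) <= exp ((K^2 - 1) b)]. One power more
   than [K^n] leaves the decay [C / K]. *)
move=> b0; pose C : R := (n.+1)`!%:R / b ^+ n.+1.
have c0 : (fun k : nat => C * k.+1%:R^-1) @ \oo --> (0 : R).
  rewrite -[X in _ --> X](mulr0 C); apply: cvgMr; exact: cvg_harmonic.
apply: (squeeze_cvgr _ (cvg_cst 0) c0).
near=> k; rewrite mulr_ge0 ?expR_ge0 ?exprn_ge0//=.
have k1 : (1 <= k)%N by near: k; exact: nbhs_infty_ge.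
have K0 : (0 : R) < k.+1%:R by rewrite ltr0n.
rewrite expRN ler_pdivrMr ?expR_gt0//.
have : (k.+1%:R * b) ^+ n.+1 / (n.+1)`!%:R <= expR ((k.+1%:R ^+ 2 - 1) * b).
  apply: (@le_trans _ _ (expR (k.+1%:R * b))).
    apply: le_trans (expR_ge1Dxn n (mulr_ge0 (ltW K0) (ltW b0))).
    by rewrite lerDr.
  rewrite ler_expR ler_pM2r//; have : (2 : R) <= k.+1%:R by rewrite ler_nat.
  by move: k.+1%:R => K; nra.
rewrite ler_pdivrMr ?ltr0n ?fact_gt0// exprMn exprS => h.
have bn : 0 < b ^+ n.+1 by exact: exprn_gt0.
rewrite /C -(ler_pM2l K0) -(ler_pM2r bn); apply: le_trans h _.
rewrite le_eqVlt; apply/orP; left; apply/eqP; field.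
by rewrite !gt_eqF.
Unshelve. all: by end_near. Qed.

(** Within distance [r] of [x] continuity controls [u y - u x]; beyond it [gK_far] does. The sum of
    the two bounds is a single integrable majorant valid for every [y]. *)
Lemma cvg_gK_conv u (x : 'rV[R]_n) : measurable_fun setT u -> L1 mu (fun y => u y ^+ 2) ->
  {for x, continuous u} ->
  (fun k : nat => \int[mu]_y (u y * gK k.+1%:R^-1 (x - y))) @ \oo --> u x.
Proof.
move=> mu_ lu cu.
have K0 k : (0 : R) < k.+1%:R^-1 by rewrite invr_gt0.
have lD e : 0 < e -> L1 mu (fun y => (u y - u x) * gK e (x - y)).
  move=> e0; under eq_fun do rewrite mulrBl.
  by apply: L1B; [exact: L1_sq_gK|apply: L1Z; exact: (L1_gK_sub x e0).1].
apply/cvgrPdist_le => d d0; have d20 : 0 < d / 2 by rewrite divr_gt0.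
have [r /= r0 rx] : exists2 r : R, 0 < r & forall y : 'rV[R]_n, (forall j, `|(x - y) 0 j| < r) -> `|u x - u y| <= d / 2.
  move: cu => /cvgrPdist_le /(_ _ d20) /nbhs_ballP[r r0 h]; exists r => // y yr; apply: h.
  by split=> // i j; rewrite (ord1 i) /ball/=; have := yr j; rewrite !mxE.
pose c k := k.+1%:R ^+ n * expR (- ((k.+1%:R ^+ 2 - 1) * (r ^+ 2 / 2))).
pose C := \int[mu]_y (`|(u y - u x) * gK 1 (x - y)|).
have C0 : 0 <= C by apply: Rintegral_ge0.
have cC : (fun k => c k * C) @ \oo --> (0 : R).
  rewrite -[X in _ --> X](mul0r C); apply: cvgMl; apply: cvg_gK_tail.
  by rewrite divr_gt0 ?exprn_gt0.
apply: filterS (cvgr0_norm_le _ cC _ d20) => k hk.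
have -> : u x - \int[mu]_y (u y * gK k.+1%:R^-1 (x - y)) =
   - \int[mu]_y ((u y - u x) * gK k.+1%:R^-1 (x - y)).
  under [in RHS]eq_Rintegral do rewrite mulrBl.
  rewrite RintB; [|exact: L1_sq_gK|by apply: L1Z; exact: (L1_gK_sub x (K0 k)).1].
  rewrite RintZ; last exact: (L1_gK_sub x (K0 k)).1.
  by rewrite (L1_gK_sub x (K0 k)).2 mulr1 opprB.
rewrite normrN.
have lA := L1Z (d / 2) (L1_gK_sub x (K0 k)).1.
have lB := L1Z (c k) (L1_abs (lD 1 ltr01)).
apply: le_trans (Rint_abs_le (lD _ (K0 k)) (L1D lA lB) _) _; last first.
  rewrite RintD// RintZ; last exact: (L1_gK_sub x (K0 k)).1.
  rewrite (L1_gK_sub x (K0 k)).2 mulr1 RintZ; last exact: L1_abs (lD 1 ltr01).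
  by rewrite [leRHS]splitr lerD2l; apply: le_trans hk; exact: ler_norm.
move=> y; rewrite normrM (ger0_norm (gK_ge0 _ _)).
have c0 : 0 <= c k by rewrite mulr_ge0 ?exprn_ge0 ?expR_ge0.
have [/forallP xy|/forallPn[j]] := boolP [forall j, `|(x - y) 0 j| < r].
  rewrite ler_wpDr ?mulr_ge0// ler_wpM2r ?gK_ge0// distrC; exact: rx.
rewrite -leNgt => hj; rewrite ler_wpDl ?(mulr_ge0 (ltW d20) (gK_ge0 _ _))//.
rewrite normrM (ger0_norm (gK_ge0 _ _)) mulrCA ler_wpM2l//.
suff -> : c k = k.+1%:R ^+ n * expR (- ((k.+1%:R ^+ 2 - 1) * r ^+ 2 / 2)) by exact: (gK_far k (ltW r0) hj).
by rewrite /c; congr (_ * expR _); ring.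
Qed.

(** Multiplication by [- i], which turns statements on real parts into statements on imaginary
    parts. *)
Lemma is_ft_rot u1 u2 p1 p2 : is_ft u1 u2 p1 p2 ->
  is_ft u2 (fun x => - u1 x) p2 (fun x => - p1 x).
Proof.
move=> [[m1 m2] [mp1 mp2] [l1 l2] [k1 k2] cp]; split.
- by split => //; exact: measurableT_comp.
- by split => //; exact: measurableT_comp.
- by split => //; under eq_fun do rewrite sqrrN.
- by split => //; under eq_fun do rewrite sqrrN.
apply: cvg_trans cp; apply: near_eq_cvg; apply: nearW => k; apply: eq_integral => xi _.
have -> : trunc k%:R (fun x => - u1 x) = (fun x => - trunc k%:R u1 x).
  by apply/funext => y; rewrite /trunc; case: ifP => // _; rewrite oppr0.
rewrite /sq2 ftcN; [|exact: L1_trunc|exact: L1_trunc].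
by congr EFin; rewrite addrC; congr (_ + _); ring.
Qed.

(** As the damping is removed, the damped integral has two limits: the inverse Fourier integral, by
    domination with the integrable transform, and the value of [u1] at [x], by the approximate
    identity. *)
Lemma ft_inversion u1 u2 p1 p2 (x : 'rV[R]_n) : is_ft u1 u2 p1 p2 -> L1 mu p1 -> L1 mu p2 ->
  {for x, continuous u1} ->
  u1 x = ((2 * pi) ^+ n)^-1 * \int[mu]_xi (cos (dotp x xi) * p1 xi - sin (dotp x xi) * p2 xi).
Proof.
move=> ft lp1 lp2 cu; have [[m1 m2] [mp1 mp2] [l1 l2] _ _] := ft.
have P0 : ((2 * pi) ^+ n : R) != 0 by rewrite expf_neq0// mulf_neq0 ?gt_eqF// pi_gt0.
have mcos : measurable_fun setT (fun xi => cos (dotp x xi)).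
  by apply: measurableT_comp; [exact: measurable_cos|exact: measurable_fun_dotp].
have msin : measurable_fun setT (fun xi => sin (dotp x xi)).
  by apply: measurableT_comp; [exact: measurable_sin|exact: measurable_fun_dotp].
pose F xi := cos (dotp x xi) * p1 xi - sin (dotp x xi) * p2 xi.
have mF : measurable_fun setT F by apply: measurable_funB; exact: measurable_funM.
have [_ c1] : L1 mu F /\ (fun k : nat => \int[mu]_xi (gW k.+1%:R^-1 xi * F xi)) @ \oo -->
    \int[mu]_xi F xi.
  apply: (@Rint_dominated _ _ R mu _ _ (fun xi => `|p1 xi| + `|p2 xi|)) => //.
  - by move=> k; apply: measurable_funM => //; exact: measurable_gW.
  - by apply: L1D; exact: L1_abs.
  - move=> k xi; rewrite normrM (ger0_norm (gW_ge0 _ _)).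
    apply: (@le_trans _ _ `|F xi|); first by rewrite ler_piMl// gW_le1.
    apply: le_trans (ler_normB _ _) _; rewrite !normrM; apply: lerD.
      by rewrite ler_piMl// normr_cos_le1.
    by rewrite ler_piMl// normr_sin_le1.
  - by move=> xi; rewrite -[X in _ --> X]mul1r; apply: cvgMl; exact: cvg_gW.
have c2 : (fun k : nat => \int[mu]_xi (gW k.+1%:R^-1 xi * F xi)) @ \oo --> (2 * pi) ^+ n * u1 x.
  have h : (fun k : nat => (2 * pi) ^+ n * \int[mu]_y (u1 y * gK k.+1%:R^-1 (x - y))) @ \oo
      --> (2 * pi) ^+ n * u1 x by apply: cvgMr; exact: cvg_gK_conv.
  apply: cvg_trans h; apply: near_eq_cvg; apply: nearW => k /=.
  by rewrite -(smoothing_L2 x _ ft)// invr_gt0.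
by rewrite (cvg_unique _ c1 c2)// mulKf.
Qed.

End inversion.

(** * Clifford multiplication on coefficients *)

Section clifford.
Context {R : realType} (m : nat).
Implicit Types (A B T : {set 'I_m}) (j k : 'I_m) (xi : 'rV[R]_m).

Definition cpt (u : Cl R m) T (im : bool) : R := if im then (u T).2 else (u T).1.

(** Symmetric difference with a singleton, in the shape used by [clmul]: left multiplication by
    [e_k] sends [e_(flip k T)] to a multiple of [e_T]. *)
Definition flip k T : {set 'I_m} := (([set k] :|: T) :\: ([set k] :&: T))%SET.

(** The sign in [e_k e_(flip k T) = esgn k T e_T]. *)
Definition esgn k T : R := clsign R [set k]%SET (flip k T).

Lemma in_flip k T j : (j \in flip k T) = (j == k) (+) (j \in T).
Proof. by rewrite !inE; case: (j == k); case: (j \in T). Qed.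

Lemma flipK k T : flip k (flip k T) = T.
Proof. by apply/setP => j; rewrite !in_flip addKb. Qed.

Lemma flipC j k T : flip j (flip k T) = flip k (flip j T).
Proof. by apply/setP => i; rewrite !in_flip addbCA. Qed.

(** Moving [e_k] into place passes the generators of smaller index, on which [T] and [flip k T]
    agree; a further sign from [e_k^2 = -1] occurs when [k] belongs to [flip k T], that is, when it
    is not in [T]. *)
Lemma esgnE k T : esgn k T = (-1) ^+ (\sum_(b < m | (b < k)%N) (b \in T) + (k \notin T))%N.
Proof.
rewrite /esgn /clsign; congr (_ ^+ (_ + _)).
  transitivity #|[set b in T | (b < k)%N]%SET|.
    rewrite -(card_imset _ (_ : injective (fun b : 'I_m => (k, b)))); last by move=> ? ? [].
    apply: eq_card => -[p q]; rewrite !inE/=.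
    apply/andP/imsetP => [[/andP[/eqP-> qT] qk]|[b]].
      exists q => //; move: qT qk; rewrite !inE => qT qk.
      move: qT; rewrite (_ : (q == k) = false) ?qk//=; first by rewrite andbT => ->.
      by apply/negbTE; rewrite -val_eqE/= ltn_eqF.
    rewrite !inE => /andP[bT bk] [-> ->]; rewrite eqxx bT bk/= andbT orbT; split=> //.
    by rewrite andbT; apply/eqP => bk'; rewrite bk' ltnn in bk.
  rewrite -sum1_card -big_mkcondr/=; apply: eq_bigl => b; rewrite inE andbC.
  by [].
have -> : ([set k] :&: flip k T = if k \in T then finset.set0 else [set k])%SET.
  by apply/setP => j; rewrite 2!inE in_flip; case: ifP; rewrite !inE; case: eqVneq => // -> ->.
by case: ifP; rewrite ?cards0 ?cards1.
Qed.

(** The relation [e_k^2 = -1], read on coefficients. *)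
Lemma esgn_flip k T : esgn k (flip k T) = - esgn k T.
Proof.
rewrite !esgnE !exprD -mulrN; congr (_ ^+ _ * _).
  apply: eq_bigr => b bk; rewrite in_flip (_ : (b == k) = false)//.
  by apply/negbTE; rewrite -val_eqE/= ltn_eqF.
by rewrite in_flip eqxx; case: (k \in T); rewrite /= ?expr0 ?expr1 ?opprK.
Qed.

Lemma esgn_sqr k T : esgn k T ^+ 2 = 1.
Proof. by rewrite esgnE -exprM mulnC exprM sqrrN !expr1n. Qed.

Lemma normr_esgn k T : `|esgn k T| = 1.
Proof. by rewrite esgnE normrX normrN1 expr1n. Qed.

Lemma esgn_lt j k T : (j < k)%N -> esgn j (flip k T) = esgn j T /\ esgn k (flip j T) = - esgn k T.
Proof.
move=> jk; have kj : (k == j) = false by apply/negbTE; rewrite -val_eqE/= gtn_eqF.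
have jk' : (j == k) = false by rewrite eq_sym.
split; rewrite !esgnE in_flip.
  rewrite jk' /=; congr (_ ^+ (_ + _)); apply: eq_bigr => b bj; rewrite in_flip (_ : (b == k) = false)//.
  by apply/negbTE; rewrite -val_eqE/= ltn_eqF// (ltn_trans bj).
rewrite kj /= (bigD1 j)//= [in RHS](bigD1 j)//= in_flip eqxx.
have -> : (\sum_(i < m | (i < k)%N && (i != j)) (i \in flip j T) =
          \sum_(i < m | (i < k)%N && (i != j)) (i \in T))%N.
  by apply: eq_bigr => b /andP[_ /negbTE bj]; rewrite in_flip bj.
rewrite !exprD; case: (j \in T); rewrite /= ?expr0 ?expr1; ring.
Qed.

(* The anticommutation e_j e_k = - e_k e_j, read on coefficients. *)
Lemma esgn_anti j k T : j != k -> esgn j T * esgn k (flip j T) = - (esgn k T * esgn j (flip k T)).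
Proof.
rewrite -val_eqE neq_ltn => /orP[] /(esgn_lt T)[-> ->]; ring.
Qed.

(* Multiplication by [i]: [true] indexes the imaginary coefficient. *)
Definition iF (u : {set 'I_m} -> bool -> R) T im : R := if im then u T false else - u T true.

(* Left multiplication by [i xi], read on the real and imaginary coefficients. *)
Definition NF xi (u : {set 'I_m} -> bool -> R) T im : R :=
  \sum_(k < m) xi 0 k * esgn k T * iF u (flip k T) im.

(** Multiplication by [chi], for a sign [s]. At [xi = 0] the convention [0^-1 = 0] makes it half the
    identity, which is not a projection. *)
Definition chiF (s : R) xi (u : {set 'I_m} -> bool -> R) T im : R :=
  2^-1 * u T im + s / (2 * enorm xi) * NF xi u T im.

Lemma iFK u T im : iF (iF u) T im = - u T im.
Proof. by case: im; rewrite /iF// opprK. Qed.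

Lemma NF_iF xi u T im : NF xi (iF u) T im = iF (NF xi u) T im.
Proof.
case: im; rewrite /NF /iF//= -sumrN; apply: eq_bigr => k _; ring.
Qed.

(** The identity [(i xi)^2 = |xi|^2], which gives [i xi] its eigenvalues. *)
Lemma NF_NF xi u T im : NF xi (NF xi u) T im = enorm xi ^+ 2 * u T im.
Proof.
pose F (j k : 'I_m) : R := - (xi 0 j * xi 0 k * (esgn j T * esgn k (flip j T)) * u (flip k (flip j T)) im).
have E : NF xi (NF xi u) T im = \sum_(j < m) \sum_(k < m) F j k.
  apply: eq_bigr => j _; rewrite -NF_iF /NF mulr_sumr; apply: eq_bigr => k _.
  by rewrite iFK /F; ring.
have F0 j k : j != k -> F j k = - F k j.
  by move=> jk; rewrite /F esgn_anti// flipC; ring.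
have Fd j : F j j = xi 0 j ^+ 2 * u T im.
  by rewrite /F esgn_flip flipK mulrN -(expr2 (esgn _ _)) esgn_sqr; ring.
(* The double sum is added to its transpose: the off-diagonal terms cancel by anticommutation and
   the diagonal ones double. *)
have S2 : 2 * (\sum_(j < m) \sum_(k < m) F j k) = 2 * (enorm xi ^+ 2 * u T im).
  rewrite mulr_natl mulr2n {2}exchange_big/= -big_split/=.
  rewrite sqr_enorm /dotp !mulr_suml mulr_sumr; apply: eq_bigr => j _.
  rewrite -big_split/= (bigD1 j)//= big1 ?addr0; last first.
    by move=> k kj; rewrite (F0 k j)// subrr.
  by rewrite !Fd; ring.
by rewrite E; apply: (mulfI _ S2); rewrite pnatr_eq0.
Qed.

Lemma NF_lin xi (a b : R) u v T im :
  NF xi (fun T im => a * u T im + b * v T im) T im = a * NF xi u T im + b * NF xi v T im.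
Proof.
rewrite /NF !mulr_sumr -big_split/=; apply: eq_bigr => k _; case: im; rewrite /iF; ring.
Qed.

Lemma NF_chiF (s : R) xi u T im : xi != 0 -> s ^+ 2 = 1 ->
  NF xi (chiF s xi u) T im = s * enorm xi * chiF s xi u T im.
Proof.
move=> x0 s1; have e0 : enorm xi != 0 by rewrite enorm_eq0.
rewrite /chiF NF_lin NF_NF.
have -> : s * enorm xi * (2^-1 * u T im + s / (2 * enorm xi) * NF xi u T im) =
  s * enorm xi * 2^-1 * u T im + s ^+ 2 * 2^-1 * NF xi u T im by field.
by by rewrite s1; field.
Qed.

Lemma chiF_id (s : R) xi u T im : xi != 0 -> s ^+ 2 = 1 ->
  (forall T im, NF xi u T im = s * enorm xi * u T im) -> chiF s xi u T im = u T im.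
Proof.
move=> x0 s1 h; have e0 : enorm xi != 0 by rewrite enorm_eq0.
rewrite /chiF h.
have -> : s / (2 * enorm xi) * (s * enorm xi * u T im) = s ^+ 2 * 2^-1 * u T im by field.
by rewrite s1; field.
Qed.

Lemma chiF_split (s : R) xi u T im : chiF s xi u T im + chiF (- s) xi u T im = u T im.
Proof. by rewrite /chiF mulNr; move: (s / _) => c; field. Qed.

Lemma chiF_lin (s : R) xi (a b : R) u v T im :
  chiF s xi (fun T im => a * u T im + b * v T im) T im = a * chiF s xi u T im + b * chiF s xi v T im.
Proof. rewrite /chiF NF_lin; ring. Qed.

Lemma NF_le xi u T im : `|NF xi u T im| <= enorm xi * \sum_(k < m) `|iF u (flip k T) im|.
Proof.
rewrite mulr_sumr; apply: le_trans (ler_norm_sum _ _ _) _; apply: ler_sum => k _.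
by rewrite !normrM normr_esgn mulr1 ler_wpM2r// coord_le_enorm.
Qed.

Lemma chiF_le (s : R) xi u T im : `|s| <= 1 ->
  `|chiF s xi u T im| <= `|u T im| + \sum_(k < m) `|iF u (flip k T) im|.
Proof.
move=> s1; apply: le_trans (ler_normD _ _) _; rewrite !normrM; apply: lerD.
  by rewrite ler_piMl// ger0_norm// invf_le1// ler1n.
have [->|x0] := eqVneq (enorm xi) 0; first by rewrite mulr0 invr0 normr0 mulr0 mul0r sumr_ge0.
have e0 : 0 < enorm xi by rewrite lt_def x0 enorm_ge0.
apply: (@le_trans _ _ (1 / (2 * enorm xi) * (enorm xi * \sum_(k < m) `|iF u (flip k T) im|))).
  apply: ler_pM => //; last exact: NF_le.
  have V0 : 0 <= (2 * enorm xi)^-1 by rewrite invr_ge0 mulr_ge0// ltW.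
  by rewrite (ger0_norm V0) ler_wpM2r.
have S0 : 0 <= \sum_(k < m) `|iF u (flip k T) im| by exact: sumr_ge0.
move: (\sum_(k < m) _) S0 => S S0.
have -> : 1 / (2 * enorm xi) * (enorm xi * S) = S / 2 by field.
by rewrite ler_pdivrMr// ler_peMr// ler1n.
Qed.

Lemma big_cadd I (r : seq I) (P : pred I) (F : I -> cplx R) :
  \big[@Defs.cadd R/@Defs.czero R]_(i <- r | P i) F i =
  (\sum_(i <- r | P i) (F i).1, \sum_(i <- r | P i) (F i).2).
Proof. by elim/big_rec3: _ => // i x y z _ ->. Qed.

(** For fixed [A] and [T] exactly one [B] has symmetric difference [T] with [A], namely the
    symmetric difference of [A] and [T]; this collapses the inner sum. *)
Lemma clmulE (u v : Cl R m) T : clmul u v T =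
  (\sum_A clsign R A ((A :|: T) :\: (A :&: T))%SET *
     ((u A).1 * (v ((A :|: T) :\: (A :&: T))%SET).1 - (u A).2 * (v ((A :|: T) :\: (A :&: T))%SET).2),
   \sum_A clsign R A ((A :|: T) :\: (A :&: T))%SET *
     ((u A).1 * (v ((A :|: T) :\: (A :&: T))%SET).2 + (u A).2 * (v ((A :|: T) :\: (A :&: T))%SET).1)).
Proof.
have sd A B : ((A :|: B) :\: (A :&: B) == T)%SET = (B == (A :|: T) :\: (A :&: T))%SET.
  apply/eqP/eqP => [<-|->]; apply/setP => j; rewrite !inE; case: (j \in A) => //=;
    by case: (j \in _).
rewrite /clmul big_cadd; congr (_, _); apply: eq_bigr => A _.
  rewrite big_cadd/= (bigD1 ((A :|: T) :\: (A :&: T))%SET)//= sd eqxx big1 ?addr0.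
    by rewrite /cmul/=; ring.
  by move=> B; rewrite sd => /negbTE ->.
rewrite big_cadd/= (bigD1 ((A :|: T) :\: (A :&: T))%SET)//= sd eqxx big1 ?addr0.
  by rewrite /cmul/=; ring.
by move=> B; rewrite sd => /negbTE ->.
Qed.

Lemma flip0 T : ((finset.set0 :|: T) :\: (finset.set0 :&: T) = T)%SET.
Proof. by rewrite finset.set0U finset.set0I finset.setD0. Qed.

Lemma clsign0 T : clsign R finset.set0 T = 1.
Proof.
rewrite /clsign finset.set0I cards0 addn0 (_ : #|_| = 0%N) ?expr0//.
by apply: eq_card0 => -[p q]; rewrite !inE.
Qed.

Lemma clbasis_mul (u : Cl R m) (k : 'I_(1 + m)) T im :
  cpt (clmul (clbasis R k) u) T im =
  if unlift ord0 k is Some j then esgn j T * cpt u (flip j T) im else cpt u T im.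
Proof.
have mono (S : {set 'I_m}) (w : Cl R m) : (forall A, w A = if A == S then (1, 0) else Defs.czero R) ->
    cpt (clmul w u) T im = clsign R S ((S :|: T) :\: (S :&: T))%SET *
      cpt u ((S :|: T) :\: (S :&: T))%SET im.
  move=> wE; rewrite /cpt clmulE; case: im => /=; rewrite (bigD1 S)//= big1 ?addr0; rewrite ?wE ?eqxx/=; try ring;
    by move=> A /negbTE AS; rewrite wE AS /=; ring.
case: unliftP => [j ->|->].
  rewrite (mono [set j]%SET)// => A; rewrite /clbasis.
  by congr (if _ == _ then _ else _); apply/setP => i; rewrite !inE lift0 eqSS.
by rewrite (mono finset.set0) ?flip0 ?clsign0 ?mul1r.
Qed.

Lemma clvec1 xi j : clvec xi [set j]%SET = (xi 0 j, 0).
Proof.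
rewrite /clvec; case: pickP => [i /eqP/finset.set1_inj -> //|/(_ j)].
by rewrite eqxx.
Qed.

Lemma clvec_card xi A : #|A| != 1%N -> clvec xi A = Defs.czero R.
Proof.
by rewrite /clvec; case: pickP => // i /eqP ->; rewrite cards1.
Qed.

Lemma chi_mul (s : bool) xi (u : Cl R m) T im :
  cpt (clmul (chi s xi) u) T im = chiF (sgn R s) xi (cpt u) T im.
Proof.
pose G (A : {set 'I_m}) : R := clsign R A ((A :|: T) :\: (A :&: T))%SET *
  (if #|A| == 0%N then 2^-1 * cpt u ((A :|: T) :\: (A :&: T))%SET im else
   sgn R s / (2 * enorm xi) * (clvec xi A).1 * iF (cpt u) ((A :|: T) :\: (A :&: T))%SET im).
have c2 A : (clvec xi A).2 = 0 by rewrite /clvec; case: pickP.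
have -> : cpt (clmul (chi s xi) u) T im = \sum_A G A.
  rewrite /cpt clmulE; case: im @G => G /=; apply: eq_bigr => A _; rewrite /G /chi;
  by case: ifP => _ /=; rewrite ?c2 /iF/=; ring.
rewrite (bigD1 finset.set0)//= {1}/G cards0 eqxx clsign0 mul1r flip0; congr (_ + _).
(* Besides the empty set, only singletons carry a nonzero coefficient of [chi]. *)
pose D := [set [set j]%SET | j in 'I_m]%SET.
rewrite (bigID (mem D))/= [X in _ + X]big1 ?addr0; last first.
  move=> A /andP[A0 AD]; rewrite /G cards_eq0 (negbTE A0) clvec_card//=; first by ring.
  by apply: contra AD => /cards1P[j ->]; exact: imset_f.
transitivity (\sum_(A in D) G A).
  apply: eq_bigl => A; case AD: (A \in D); last by rewrite andbF.
  by rewrite andbT; case/imsetP: AD => j _ ->; rewrite -card_gt0 cards1.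
rewrite big_imset; last by move=> i j _ _; exact: finset.set1_inj.
rewrite /NF mulr_sumr; apply: eq_bigr => j _.
by rewrite /G cards1 /= clvec1 /= -/(flip j T) -/(esgn j T); ring.
Qed.

Lemma cpt_clcscale (c : cplx R) (u : Cl R m) T im :
  cpt (clcscale c u) T im = c.1 * cpt u T im + c.2 * iF (cpt u) T im.
Proof. by case: im; rewrite /cpt /clcscale/= /iF; ring. Qed.

Lemma clmul_cscale (c : cplx R) (u v : Cl R m) : clmul (clcscale c u) v = clcscale c (clmul u v).
Proof.
apply/funext => T; rewrite /clcscale !clmulE /cmul/=; congr (_, _);
  by rewrite !mulr_sumr -?sumrB -?big_split/=; apply: eq_bigr => A _; ring.
Qed.

Lemma cpt_inj (u v : Cl R m) : (forall T im, cpt u T im = cpt v T im) -> u = v.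
Proof.
move=> h; apply/funext => T; have := h T false; have := h T true; rewrite /cpt.
by case: (u T) (v T) => a b [c d] /= -> ->.
Qed.

Lemma clnormE (u : Cl R m) : clnorm u ^+ 2 = \sum_T (cpt u T false ^+ 2 + cpt u T true ^+ 2).
Proof. by rewrite sqr_sqrtr// sumr_ge0// => T _; rewrite addr_ge0 ?sqr_ge0. Qed.

Lemma cpt_clscale (c : R) (u : Cl R m) T im : cpt (clscale c u) T im = c * cpt u T im.
Proof. by case: im; rewrite /cpt/= mulrC. Qed.

Lemma cpt_cladd (u v : Cl R m) T im : cpt (cladd u v) T im = cpt u T im + cpt v T im.
Proof. by case: im. Qed.

Lemma cpt_clint (F : 'rV[R]_m -> Cl R m) T im :
  cpt (clint F) T im = Defs.Rint (fun xi => cpt (F xi) T im).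
Proof. by case: im. Qed.

Lemma cpt_big_cladd I (r : seq I) (P : pred I) (F : I -> Cl R m) T im :
  cpt (\big[@cladd R m/@clzero R m]_(i <- r | P i) F i) T im = \sum_(i <- r | P i) cpt (F i) T im.
Proof.
by elim/big_rec2: _ => [|i x y _ <-]; [case: im|rewrite cpt_cladd].
Qed.

Lemma cptE (F : 'rV[R]_(1 + m) -> Cl R m) T im x : Defs.comp F T im x = cpt (F x) T im.
Proof. by []. Qed.

Lemma monogenicP (F : 'rV[R]_(1 + m) -> Cl R m) x :
  \big[@cladd R m/@clzero R m]_(k < 1 + m) clmul (clbasis R k) (partial k F x) = @clzero R m <->
  forall T im, 'D_(@dir R m ord0) (Defs.comp F T im) x +
    \sum_(j < m) esgn j T * 'D_(@dir R m (lift ord0 j)) (Defs.comp F (flip j T) im) x = 0.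
Proof.
have cp (k : 'I_(1 + m)) T im : cpt (partial k F x) T im = 'D_(@dir R m k) (Defs.comp F T im) x by case: im.
have E T im : cpt (\big[@cladd R m/@clzero R m]_(k < 1 + m) clmul (clbasis R k) (partial k F x)) T im =
  'D_(@dir R m ord0) (Defs.comp F T im) x +
    \sum_(j < m) esgn j T * 'D_(@dir R m (lift ord0 j)) (Defs.comp F (flip j T) im) x.
  rewrite cpt_big_cladd (eq_bigr _ (fun (i : 'I_(1 + m)) _ => clbasis_mul _ i T im)) big_ord_recl unlift_none cp.
  by under eq_bigr do rewrite liftK cp.
split=> [h T im|h]; first by rewrite -E h; case: im.
by apply: cpt_inj => T im; rewrite E h; case: im.
Qed.

Lemma sgn_sqr (s : bool) : sgn R s ^+ 2 = 1.
Proof. by case: s; rewrite /sgn ?sqrrN expr1n. Qed.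

Lemma normr_sgn (s : bool) : `|sgn R s| = 1.
Proof. by case: s; rewrite /sgn ?normrN normr1. Qed.

End clifford.

(** * Clifford valued functions and their real coefficients *)

Section conversion.
Context {R : realType} (m : nat).
Local Notation mu := (@mun R m).
Implicit Types (h g : 'rV[R]_m -> Cl R m) (T : {set 'I_m}).

Definition mcpt h := forall T im, measurable_fun setT (fun x => cpt (h x) T im).

Lemma measurable_clnorm h : mcpt h -> measurable_fun setT (fun x => clnorm (h x) ^+ 2).
Proof.
move=> mh; under eq_fun do rewrite clnormE.
apply: measurable_sum => T; apply: measurable_funD; exact: measurable_funX.
Qed.

Lemma l2sqE h : mcpt h -> (l2sq h = \int[mu]_x (clnorm (h x) ^+ 2)%:E)%E.
Proof.
move=> mh; rewrite /l2sq iintE//; last by move=> x; rewrite lee_fin sqr_ge0.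
by apply/measurable_EFinP; exact: measurable_clnorm.
Qed.

Lemma cpt_le_clnorm (u : Cl R m) T im : cpt u T im ^+ 2 <= clnorm u ^+ 2.
Proof.
rewrite clnormE (bigD1 T)//=; apply: ler_wpDr.
  by apply: sumr_ge0 => S _; rewrite addr_ge0 ?sqr_ge0.
by case: im; rewrite ?lerDl ?lerDr sqr_ge0.
Qed.

Lemma L2_mcpt h : L2 h -> mcpt h.
Proof.
move=> [bh _] T [|]; [have := (bh T).2|have := (bh T).1]; rewrite borel_funP; exact.
Qed.

Lemma L2P h : L2 h <-> mcpt h /\ forall T im, L1 mu (fun x => cpt (h x) T im ^+ 2).
Proof.
split=> [l2|[mh lh]].
  have mh := L2_mcpt l2; split=> // T im.
  have lc : L1 mu (fun x => clnorm (h x) ^+ 2).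
    apply: L1P; first exact: measurable_clnorm.
    under eq_integral do rewrite ger0_norm ?sqr_ge0//.
    by rewrite -l2sqE//; case: l2.
  apply: L1_le lc; first exact: measurable_funX.
  by move=> x; rewrite ger0_norm ?sqr_ge0// cpt_le_clnorm.
split; first by move=> T; split; apply/borel_funP; [exact: (mh T false)|exact: (mh T true)].
have lc : L1 mu (fun x => clnorm (h x) ^+ 2).
  under eq_fun do rewrite clnormE.
  by apply: L1_sum => T _; apply: L1D; exact: lh.
rewrite l2sqE//; apply: le_lt_trans (L1_lty lc).
by under [leRHS]eq_integral do rewrite ger0_norm ?sqr_ge0//.
Qed.

Lemma cpt_fourier_trunc h (k : nat) xi T : mcpt h -> (forall im, L1 mu (fun x => cpt (h x) T im ^+ 2)) ->
  cpt (fourier_trunc k%:R h xi) T false =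
    ftc (trunc k%:R (fun x => cpt (h x) T false)) (trunc k%:R (fun x => cpt (h x) T true)) xi /\
  cpt (fourier_trunc k%:R h xi) T true =
    ftc (trunc k%:R (fun x => cpt (h x) T true)) (fun x => - trunc k%:R (fun x => cpt (h x) T false) x) xi.
Proof.
move=> mh lh.
have l1 := L1_trunc k%:R (mh T false) (lh false).
have l2 := L1_trunc k%:R (mh T true) (lh true).
rewrite /fourier_trunc !cpt_clint; split.
  have E : (fun x => cpt (if enorm x <= k%:R then clcscale (cos (dotp x xi), - sin (dotp x xi)) (h x)
      else clzero R (m:=m)) T false) =
    (fun x => trunc k%:R (fun x => cpt (h x) T false) x * cos (dotp x xi) +
              trunc k%:R (fun x => cpt (h x) T true) x * sin (dotp x xi)).
    apply/funext => x; rewrite /trunc; case: ifP => _; rewrite ?cpt_clcscale /cpt/= /iF; ring.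
  by rewrite E RintE//; exact: L1_ftc.
have E : (fun x => cpt (if enorm x <= k%:R then clcscale (cos (dotp x xi), - sin (dotp x xi)) (h x)
      else clzero R (m:=m)) T true) =
    (fun x => trunc k%:R (fun x => cpt (h x) T true) x * cos (dotp x xi) +
              - trunc k%:R (fun x => cpt (h x) T false) x * sin (dotp x xi)).
  apply/funext => x; rewrite /trunc; case: ifP => _; rewrite ?cpt_clcscale /cpt/= /iF; ring.
by rewrite E RintE//; apply: L1_ftc => //; exact: L1N.
Qed.

Lemma is_L2_fourier_cpt h g :
  (forall T, is_ft (fun x => cpt (h x) T false) (fun x => cpt (h x) T true)
                   (fun x => cpt (g x) T false) (fun x => cpt (g x) T true)) ->
  is_L2_fourier h g.
Proof.
move=> ft.
have mh : mcpt h by move=> T [|]; have [[]] := ft T.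
have mg : mcpt g by move=> T [|]; have [_ []] := ft T.
have lh T im : L1 mu (fun x => cpt (h x) T im ^+ 2) by have [_ _ [? ?] _ _] := ft T; case: im.
have lg T im : L1 mu (fun x => cpt (g x) T im ^+ 2) by have [_ _ _ [? ?] _] := ft T; case: im.
split; first exact/L2P; split; first exact/L2P.
pose S (T : {set 'I_m}) (k : nat) := (\int[mu]_xi (sq2
         (fun xi => cpt (g xi) T false - ftc (trunc k%:R (fun x => cpt (h x) T false)) (trunc k%:R (fun x => cpt (h x) T true)) xi)
         (fun xi => cpt (g xi) T true - ftc (trunc k%:R (fun x => cpt (h x) T true)) (fun x => - trunc k%:R (fun x => cpt (h x) T false) x) xi) xi)%:E)%E.
have mS T k : measurable_fun setT (sq2
         (fun xi => cpt (g xi) T false - ftc (trunc k%:R (fun x => cpt (h x) T false)) (trunc k%:R (fun x => cpt (h x) T true)) xi)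
         (fun xi => cpt (g xi) T true - ftc (trunc k%:R (fun x => cpt (h x) T true)) (fun x => - trunc k%:R (fun x => cpt (h x) T false) x) xi)).
  have mt im := measurable_trunc k%:R (mh T im).
  apply: measurable_sq2; apply: measurable_funB; try exact: mg.
    exact: measurable_ftc.
  exact: measurable_ftc_N.
have E k : l2sq (fun xi => cladd (g xi) (clscale (-1) (fourier_trunc k%:R h xi))) = (\sum_T S T k)%E.
  have cE T xi : cpt (cladd (g xi) (clscale (-1) (fourier_trunc k%:R h xi))) T false =
      cpt (g xi) T false - ftc (trunc k%:R (fun x => cpt (h x) T false)) (trunc k%:R (fun x => cpt (h x) T true)) xi
    /\ cpt (cladd (g xi) (clscale (-1) (fourier_trunc k%:R h xi))) T true =
      cpt (g xi) T true - ftc (trunc k%:R (fun x => cpt (h x) T true)) (fun x => - trunc k%:R (fun x => cpt (h x) T false) x) xi.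
    have [e1 e2] := cpt_fourier_trunc k xi mh (lh T).
    by rewrite !cpt_cladd !cpt_clscale !mulN1r e1 e2.
  have mc : mcpt (fun xi => cladd (g xi) (clscale (-1) (fourier_trunc k%:R h xi))).
    move=> T im; have mt b := measurable_trunc k%:R (mh T b).
    case: im.
      under eq_fun => xi do rewrite (cE T xi).2.
      by apply: measurable_funB; [exact: mg|exact: measurable_ftc_N].
    under eq_fun => xi do rewrite (cE T xi).1.
    by apply: measurable_funB; [exact: mg|exact: measurable_ftc].
  rewrite l2sqE// /S -ge0_integral_sum//.
  - apply: eq_integral => xi _; rewrite clnormE -sumEFin; apply: eq_bigr => T _.
    by rewrite (cE T xi).1 (cE T xi).2.
  - by move=> T; apply/measurable_EFinP; exact: mS.
  - by move=> T xi _; rewrite lee_fin sq2_ge0.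
rewrite (funext E).
have cS T : S T @ \oo --> (0 : \bar R) by have [] := ft T.
elim: (index_enum _) => [|T r ih].
  by under eq_fun do rewrite big_nil; exact: cvg_cst.
have h0 : (fun k => S T k + \sum_(j <- r) S j k)%E @ \oo --> (0 + 0 : \bar R)%E.
  by apply: cvgeD => //; exact: cS.
rewrite adde0 in h0; apply: cvg_trans h0; apply: near_eq_cvg; apply: nearW => k /=.
by rewrite big_cons.
Qed.

End conversion.

(** * Quadratic remainders and Taylor bounds *)

Section quadratic_differentiable.
Context {R : realType} (n : nat).

Definition linf (D : 'I_n -> R) (h : 'rV[R]_n) : R := \sum_k D k * h 0 k.

Lemma linf_is_linear (D : 'I_n -> R) : linear (linf D).
Proof.
move=> a u v; rewrite /linf /GRing.scale/= mulr_sumr -big_split/=; apply: eq_bigr => k _.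
by rewrite !mxE; ring.
Qed.

HB.instance Definition _ (D : 'I_n -> R) := GRing.isLinear.Build R 'rV[R]_n R _ (linf D)
  (linf_is_linear D).

Lemma linf_continuous (D : 'I_n -> R) : continuous (linf D).
Proof.
move=> x; rewrite /linf; elim: (index_enum _) => [|k r ih].
  rewrite (_ : (fun h => _) = cst 0); first exact: cst_continuous.
  by apply/funext => h; rewrite big_nil.
rewrite (_ : (fun h => _) = (fun h : 'rV[R]_n => D k * h 0 k) \+ (fun h : 'rV[R]_n => \sum_(j <- r) D j * h 0 j)).
  apply: continuousD ih.
  by apply: continuousM; [exact: cst_continuous|exact: coord_continuous].
by apply/funext => h; rewrite big_cons.
Qed.

Lemma linf_delta (D : 'I_n -> R) k : linf D (delta_mx 0 k) = D k.
Proof.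
rewrite /linf (bigD1 k)//= big1 ?addr0 ?mxE ?eqxx ?mulr1//.
by move=> j jk; rewrite mxE (negbTE jk) andbF mulr0.
Qed.

(** Suited to integrals with a parameter: a quadratic bound on the remainder of the integrand
    integrates directly, and yields the differential and all partial derivatives at once. *)
Lemma differentiable_quad (f : 'rV[R]_n -> R) x (D : 'I_n -> R) (C d : R) : 0 < d ->
  (forall h, `|h| < d -> `|f (h + x) - f x - linf D h| <= C * `|h| ^+ 2) ->
  differentiable f x /\ forall k, 'D_(delta_mx 0 k) f x = D k.
Proof.
move=> d0 H.
have E : f \o shift x = cst (f x) + linf D +o_ (0 : 'rV[R]_n) id.
  apply/eqaddoP => e e0.
  have K : 0 < `|C| + 1 by rewrite ltr_wpDl.
  near=> h; rewrite /= (_ : _ h = f (h + x) - f x - linf D h); last first.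
    by rewrite !fctE opprD addrA.
  have hd : `|h| < d by near: h; exact: (@nbhs0_lt _ 'rV[R]_n).
  have he : `|h| <= e / (`|C| + 1).
    by near: h; apply: (@nbhs0_le _ 'rV[R]_n); rewrite divr_gt0.
  apply: le_trans (H h hd) _; rewrite expr2 mulrA ler_wpM2r//.
  move: he; rewrite ler_pdivlMr// => he.
  apply: le_trans (ler_wpM2r (normr_ge0 h) (ler_norm C)) _.
  by apply: le_trans he; rewrite mulrC ler_wpM2l// lerDl.
have U := diff_unique (@linf_continuous D) E.
have df : differentiable f x.
  by apply/diff_locallyP; rewrite U; split => //; exact: linf_continuous.
by split=> // k; rewrite deriveE// U /= linf_delta.
Unshelve. all: by end_near. Qed.

End quadratic_differentiable.

Section taylor.
Context {R : realType}.

Lemma mvt_bound (f df : R -> R) (M x : R) : (forall y : R, is_derive y (1 : R) f (df y)) ->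
  (forall c, `|c| <= `|x| -> `|df c| <= M) -> `|f x - f 0| <= M * `|x|.
Proof.
move=> d b.
have cf : continuous f.
  by move=> y; apply: differentiable_continuous; apply/derivable1_diffP; exact: ex_derive.
have [x0|x0] := leP 0 x.
  have [c cx ->] := MVT_segment x0 (fun y _ => d y) (continuous_subspaceT cf).
  rewrite subr0 normrM ler_wpM2r// b//; move: cx; rewrite in_itv/= => /andP[c0 cx].
  by rewrite !ger0_norm.
have [c cx] := MVT_segment (ltW x0) (fun y _ => d y) (continuous_subspaceT cf).
rewrite sub0r distrC => ->; rewrite normrM normrN ler_wpM2r// b//.
by move: cx; rewrite in_itv/= => /andP[c0 cx]; rewrite !ler0_norm ?lerN2// ltW.
Qed.

Lemma normr_sin_le (x : R) : `|sin x| <= `|x|.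
Proof.
have := @mvt_bound sin cos 1 x; rewrite sin0 subr0 mul1r; apply => // c _.
exact: normr_cos_le1.
Qed.

Lemma cosB1_le (x : R) : `|cos x - 1| <= x ^+ 2.
Proof.
have := @mvt_bound cos (fun y => - sin y) `|x| x; rewrite cos0 -expr2 real_normK ?num_real//.
by apply=> c cx; rewrite normrN (le_trans (normr_sin_le c)).
Qed.

Lemma sinB_le (x : R) : `|sin x - x| <= x ^+ 2.
Proof.
have := @mvt_bound (fun y => sin y - y) (fun y => cos y - 1) `|x| x.
rewrite sin0 !subr0 -expr2 real_normK ?num_real//; apply => c cx.
have := @mvt_bound cos (fun y => - sin y) 1 c; rewrite cos0 mul1r => h.
by apply: le_trans (h _ _) cx => // y _; rewrite normrN normr_sin_le1.
Qed.

Lemma expRB1_le (x : R) : `|expR x - 1| <= `|x| * expR `|x|.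
Proof.
have := @mvt_bound expR expR (expR `|x|) x; rewrite expR0 mulrC; apply => c cx.
by rewrite ger0_norm ?expR_ge0// ler_expR (le_trans (ler_norm _)).
Qed.

Lemma expRB_le (x : R) : `|expR x - 1 - x| <= x ^+ 2 * expR `|x|.
Proof.
have := @mvt_bound (fun y => expR y - y) (fun y => expR y - 1) (`|x| * expR `|x|) x.
rewrite expR0 subr0 addrAC => h.
rewrite -(real_normK (num_real x)) expr2 mulrAC; apply: h => c cx.
by apply: le_trans (expRB1_le c) _; rewrite ler_pM ?expR_ge0// ler_expR.
Qed.

(** Real part of the second order bound for [exp (z + z') - exp z - z' exp z], with [z = p + i q]
    and [z' = p' + i q']. *)
Lemma expcos_taylor (p q p' q' : R) :
  `|expR (p + p') * cos (q + q') - expR p * cos q - (p' * (expR p * cos q) - q' * (expR p * sin q))|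
  <= 3 * expR (p + `|p'|) * (p' ^+ 2 + q' ^+ 2).
Proof.
have e0 := expR_ge0 p; have E1 : 1 + `|p'| <= expR `|p'| by exact: expR_ge1Dx.
rewrite !expRD.
have -> : expR p * expR p' * cos (q + q') - expR p * cos q - (p' * (expR p * cos q) - q' * (expR p * sin q))
  = expR p * ((expR p' - 1 - p') * cos (q + q') + (1 + p') * (cos (q + q') - cos q + q' * sin q)
     - p' * q' * sin q) by ring.
rewrite normrM (ger0_norm e0) (mulrC 3) -!mulrA ler_wpM2l//.
have A : `|(expR p' - 1 - p') * cos (q + q')| <= expR `|p'| * p' ^+ 2.
  by rewrite normrM mulrC (le_trans (ler_piMl _ (normr_cos_le1 _)))// mulrC expRB_le.
have B : `|cos (q + q') - cos q + q' * sin q| <= 2 * q' ^+ 2.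
  rewrite cosD.
  have -> : cos q * cos q' - sin q * sin q' - cos q + q' * sin q =
    cos q * (cos q' - 1) - sin q * (sin q' - q') by ring.
  apply: le_trans (ler_normB _ _) _; rewrite !normrM mulr2n mulrDl !mul1r; apply: lerD.
    by apply: le_trans (cosB1_le q'); rewrite ler_piMl// normr_cos_le1.
  by apply: le_trans (sinB_le q'); rewrite ler_piMl// normr_sin_le1.
have C : `|(1 + p') * (cos (q + q') - cos q + q' * sin q)| <= expR `|p'| * (2 * q' ^+ 2).
  rewrite normrM ler_pM//; apply: le_trans E1; apply: le_trans (ler_normD _ _) _.
  by rewrite normr1.
have D : `|p' * (q' * sin q)| <= expR `|p'| * (p' ^+ 2 + q' ^+ 2).
  rewrite mulrA normrM (le_trans (ler_piMr _ (normr_sin_le1 _)))// normrM.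
  rewrite -(real_normK (num_real p')) -(real_normK (num_real q')).
  have : 1 <= expR `|p'| by apply: le_trans E1; rewrite lerDl.
  have := normr_ge0 p'; have := normr_ge0 q'.
  move: (`|p'|) (`|q'|) (expR _) => a b E b0 a0 E1'.
  have h : a * b <= a ^+ 2 + b ^+ 2 by nra.
  apply: le_trans h _; rewrite ler_peMl// addr_ge0 ?sqr_ge0//.
apply: le_trans (ler_normB _ _) _; apply: le_trans (lerD (ler_normD _ _) (lexx _)) _.
apply: le_trans (lerD (lerD A C) D) _.
have := expR_ge0 `|p'|; have := sqr_ge0 p'; have := sqr_ge0 q'.
move: (expR _) (p' ^+ 2) (q' ^+ 2) => E a b; nra.
Qed.

End taylor.

(** * Monogenic functions from spectral densities *)

Section synthesis.
Context {R : realType} (m : nat).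
Local Notation mu := (@mun R m).
Implicit Types (A h : 'rV[R]_m -> R) (x : 'rV[R]_(1 + m)).

(** Real part of the scalar factor of [eps], rotated by the phase [t]; shifts of [t] produce its
    imaginary part and its derivatives. *)
Definition kern (s t : R) x (xi : 'rV[R]_m) : R :=
  expR (- s * x0_of x * enorm xi) * cos (dotp (xv_of x) xi + t).

Definition syn (s t : R) A x : R := \int[mu]_xi (kern s t x xi * A xi).

(** Integrability at every exponential rate strictly below [a]. The strict inequality leaves room to
    absorb powers of [|xi|], so the class is stable under the multipliers that differentiation
    produces. *)
Definition expL1 (a : R) A := measurable_fun setT A /\
  forall c, c < a -> L1 mu (fun xi => expR (c * enorm xi) * A xi).

Lemma measurable_expR_enorm (c : R) : measurable_fun setT (fun xi : 'rV[R]_m => expR (c * enorm xi)).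
Proof.
apply: measurableT_comp; first exact: measurable_expR.
by apply: measurable_funM => //; exact: measurable_fun_enorm.
Qed.

Lemma measurable_kern s t x : measurable_fun setT (kern s t x).
Proof.
apply: measurable_funM; first exact: measurable_expR_enorm.
apply: measurableT_comp; first exact: measurable_cos.
by apply: measurable_funD => //; exact: measurable_fun_dotp.
Qed.

Lemma expL1M (a : R) h A : expL1 a A -> measurable_fun setT h ->
  (forall xi, `|h xi| <= enorm xi) -> expL1 a (fun xi => h xi * A xi).
Proof.
move=> [mA lA] mh hb; split=> [|c ca]; first exact: measurable_funM.
(* Half of the gap is spent on one factor, [|xi| <= exp (d |xi|) / d], and the rate [c + d] is still
   below [a]. *)
pose d := (a - c) / 2; have d0 : 0 < d by rewrite divr_gt0// subr_gt0.
apply: (@L1_le _ _ R mu _ (fun xi => d^-1 * `|expR ((c + d) * enorm xi) * A xi|)).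
- by apply: measurable_funM; [exact: measurable_expR_enorm|exact: measurable_funM].
- move=> xi; rewrite !normrM !(ger0_norm (expR_ge0 _)) mulrDl expRD.
  have := expR_ge1Dx (d * enorm xi); have := hb xi; have := enorm_ge0 xi.
  have := normr_ge0 (h xi); have := normr_ge0 (A xi); have := expR_ge0 (c * enorm xi).
  move: (`|h xi|) (`|A xi|) (enorm xi) (expR (c * _)) (expR (d * _)) => H B r E D E0 B0 H0 r0 Hr rD.
  have -> : d^-1 * (E * D * B) = E * ((D / d) * B) by ring.
  apply: ler_wpM2l => //; apply: ler_wpM2r => //; rewrite ler_pdivlMr//.
  apply: (@le_trans _ _ (r * d)); first by rewrite ler_wpM2r// ltW.
  by apply: le_trans rD; rewrite mulrC lerDr.
- apply: L1Z; apply: L1_abs; apply: lA; rewrite /d; lra.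
Qed.

Lemma L1_kern (s t a : R) A x : expL1 a A -> - a < s * x0_of x -> L1 mu (fun xi => kern s t x xi * A xi).
Proof.
move=> [mA lA] xa; have la := lA (- s * x0_of x) _.
apply: (@L1_le _ _ R mu _ (fun xi => `|expR (- s * x0_of x * enorm xi) * A xi|)).
- by apply: measurable_funM => //; exact: measurable_kern.
- by move=> xi; rewrite !normrM -mulrA ler_wpM2l// ler_piMl// normr_cos_le1.
- by apply: L1_abs; apply: la; lra.
Qed.

Lemma x0_ofD x (h : 'rV[R]_(1 + m)) : x0_of (h + x) = x0_of h + x0_of x.
Proof. by rewrite /x0_of !mxE. Qed.

Lemma xv_ofD x (h : 'rV[R]_(1 + m)) : xv_of (h + x) = xv_of h + xv_of x.
Proof. by apply/rowP => j; rewrite /xv_of !mxE. Qed.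

Lemma normr_coord (h : 'rV[R]_(1 + m)) k : `|h 0 k| <= `|h|.
Proof.
rewrite [leRHS]/Num.norm/= mx_normrE.
by apply: le_trans (le_bigmax _ (fun ij => `|h ij.1 ij.2|) (0, k)).
Qed.

Lemma dotp_le (h : 'rV[R]_(1 + m)) (xi : 'rV[R]_m) : `|dotp (xv_of h) xi| <= m%:R * `|h| * enorm xi.
Proof.
apply: le_trans (ler_norm_sum _ _ _) _.
apply: (@le_trans _ _ (\sum_(j < m) `|h| * enorm xi)).
  apply: ler_sum => j _; rewrite normrM; apply: ler_pM => //; last exact: coord_le_enorm.
  by rewrite xv_ofE; exact: normr_coord.
by rewrite sumr_const card_ord -mulrA mulr_natl.
Qed.

(* The partial derivatives of [kern s t], absorbed in the density and the phase. *)
Definition synD (s t : R) A x (k : 'I_(1 + m)) : R :=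
  if unlift ord0 k is Some j then syn s (t + pi / 2) (fun xi => xi 0 j * A xi) x
  else syn s t (fun xi => - s * enorm xi * A xi) x.

Lemma syn_differentiable (s t a : R) A x : `|s| = 1 -> expL1 a A -> - a < s * x0_of x ->
  differentiable (syn s t A) x /\ forall k, 'D_(@dir R m k) (syn s t A) x = synD s t A x k.
Proof.
move=> s1 eA xa; have [mA lA] := eA.
have menorm : measurable_fun setT (@enorm R m) by exact: measurable_fun_enorm.
have eN : expL1 a (fun xi => - s * enorm xi * A xi).
  apply: expL1M => //; first exact: measurable_funM.
  by move=> xi; rewrite normrM normrN s1 mul1r ger0_norm ?enorm_ge0.
have eC j : expL1 a (fun xi => xi 0 j * A xi).
  by apply: expL1M => //; [exact: measurable_coord|move=> xi; exact: coord_le_enorm].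
have e2 : expL1 a (fun xi => enorm xi * (enorm xi * A xi)).
  by apply: expL1M => //; [apply: expL1M => //|] => xi; rewrite ger0_norm ?enorm_ge0.
(* [c] is the exponential rate at [x] and [d] half its distance to [a]: for [|h| < d] all rates stay
   below [c + d < a]. The integral [K] at that rate, with the factor [|xi|^2] of the quadratic
   remainder, bounds them all. *)
pose c := - s * x0_of x; pose d := (a - c) / 2.
have d0 : 0 < d by rewrite divr_gt0// subr_gt0 /c; lra.
pose K := \int[mu]_xi `|expR ((c + d) * enorm xi) * (enorm xi * (enorm xi * A xi))|.
have lK := L1_abs (e2.2 (c + d) _).
have cda : c + d < a by move: d0; rewrite /d; lra.
have {}lK := lK cda.
apply: (@differentiable_quad R (1 + m) _ x (synD s t A x) (3 * (1 + m%:R ^+ 2) * K) d d0) => h hd.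
have xha : - a < s * x0_of (h + x).
  have : `|s * x0_of h| < d.
    by rewrite normrM s1 mul1r; apply: le_lt_trans hd; rewrite x0_ofE; exact: normr_coord.
  rewrite ltr_norml => /andP[h1 _]; rewrite x0_ofD mulrDr.
  by move: h1 xa; rewrite /d /c; lra.
have l1 := L1_kern t eA xha; have l0 := L1_kern t eA xa.
have lN := L1_kern t eN xa.
have lC j := L1_kern (t + pi / 2) (eC j) xa.
have lS : L1 mu (fun xi => \sum_(j < m) h 0 (lift ord0 j) *
    (kern s (t + pi / 2) x xi * (xi 0 j * A xi))).
  by apply: L1_sum => j _; apply: L1Z; exact: lC.
have lL : L1 mu (fun xi => h 0 ord0 * (kern s t x xi * (- s * enorm xi * A xi)) +
   \sum_(j < m) h 0 (lift ord0 j) * (kern s (t + pi / 2) x xi * (xi 0 j * A xi))).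
  by apply: L1D => //; exact: L1Z.
have -> : linf (synD s t A x) h = \int[mu]_xi (h 0 ord0 * (kern s t x xi * (- s * enorm xi * A xi)) +
   \sum_(j < m) h 0 (lift ord0 j) * (kern s (t + pi / 2) x xi * (xi 0 j * A xi))).
  rewrite RintD//; last exact: L1Z.
  rewrite RintZ// Rint_sum; last by move=> j _; apply: L1Z; exact: lC.
  rewrite /linf big_ord_recl /synD unlift_none mulrC; congr (_ + _).
  by apply: eq_bigr => j _; rewrite liftK RintZ// mulrC.
rewrite /syn -RintB// -RintB//; last exact: L1B.
apply: le_trans (Rint_abs_le _ (L1Z (3 * (1 + m%:R ^+ 2) * `|h| ^+ 2) lK) _) _.
- by apply: L1B => //; exact: L1B.
- move=> xi.
  pose p := c * enorm xi; pose q := dotp (xv_of x) xi + t.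
  pose p' := - s * x0_of h * enorm xi; pose q' := dotp (xv_of h) xi.
  have E1 : kern s t (h + x) xi = expR (p + p') * cos (q + q').
    rewrite /kern x0_ofD xv_ofD dotpDl; congr (expR _ * cos _); rewrite /p /p' /q /q' /c; ring.
  have E0 : kern s t x xi = expR p * cos q by [].
  have E2 : kern s (t + pi / 2) x xi = - (expR p * sin q).
    by rewrite /kern addrA cosDpihalf mulrN.
  have E3 : \sum_(j < m) h 0 (lift ord0 j) * (kern s (t + pi / 2) x xi * (xi 0 j * A xi)) =
      - (q' * (expR p * sin q)) * A xi.
    rewrite /q' /dotp mulr_suml -sumrN mulr_suml; apply: eq_bigr => j _.
    by rewrite E2 xv_ofE; ring.
  rewrite E3 E1 E0 [X in `|X|](_ : _ = (expR (p + p') * cos (q + q') - expR p * cos q -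
     (p' * (expR p * cos q) - q' * (expR p * sin q))) * A xi); last first.
    by rewrite /p' x0_ofE; ring.
  rewrite normrM; apply: le_trans (ler_wpM2r (normr_ge0 _) (expcos_taylor p q p' q')) _.
  have r0 := enorm_ge0 xi.
  have p'b : `|p'| <= `|h| * enorm xi.
    rewrite /p' !normrM normrN s1 mul1r (ger0_norm r0) ler_wpM2r// x0_ofE; exact: normr_coord.
  have q'b : `|q'| <= m%:R * (`|h| * enorm xi) by rewrite mulrA; exact: dotp_le.
  have Eb : expR (p + `|p'|) <= expR ((c + d) * enorm xi).
    rewrite ler_expR /p mulrDl lerD2l; apply: le_trans p'b _; rewrite ler_wpM2r// ltW//.
  have P2 : p' ^+ 2 + q' ^+ 2 <= (1 + m%:R ^+ 2) * (`|h| ^+ 2 * enorm xi ^+ 2).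
    rewrite -(real_normK (num_real p')) -(real_normK (num_real q')).
    have -> : (1 + m%:R ^+ 2) * (`|h| ^+ 2 * enorm xi ^+ 2) =
      (`|h| * enorm xi) ^+ 2 + (m%:R * (`|h| * enorm xi)) ^+ 2 by ring.
    by apply: lerD; rewrite lerXn2r// nnegrE ?mulr_ge0.
  have -> : `|expR ((c + d) * enorm xi) * (enorm xi * (enorm xi * A xi))| =
    expR ((c + d) * enorm xi) * (enorm xi * (enorm xi * `|A xi|)).
    by rewrite !normrM !(ger0_norm r0) (ger0_norm (expR_ge0 _)).
  apply: (@le_trans _ _ (3 * expR ((c + d) * enorm xi) * ((1 + m%:R ^+ 2) * (`|h| ^+ 2 * enorm xi ^+ 2)) * `|A xi|)).
    apply: ler_wpM2r => //; apply: ler_pM => //.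
    - by rewrite addr_ge0 ?sqr_ge0.
    - by rewrite ler_wpM2l.
  rewrite le_eqVlt; apply/orP; left; apply/eqP; ring.
rewrite RintZ// -/K; rewrite le_eqVlt; apply/orP; left; apply/eqP; ring.
Qed.

End synthesis.

(** * Exponential weights and integrals over the half line *)

Section exponential_weights.
Context {R : realType}.
Local Notation leb := (@lebesgue_measure R).

(* With the convention 0^-1 = 0, inversion is the pointwise limit of x / (x^2 + 1/(k+1)). *)
Lemma measurable_invr : measurable_fun setT (fun x : R => x^-1).
Proof.
have P (k : nat) (x : R) : 0 < x ^+ 2 + k.+1%:R^-1 by rewrite ltr_wpDl ?sqr_ge0// invr_gt0.
apply: (@measurable_fun_cvg _ _ _ setT (fun (k : nat) (x : R) => x * (x ^+ 2 + k.+1%:R^-1)^-1)).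
- move=> k; apply: continuous_measurable_fun => x; apply: cvgM; first exact: cvg_id.
  apply: cvgV; first by rewrite gt_eqF.
  by apply: cvgD; [exact: exprn_continuous|exact: cvg_cst].
- move=> x _; have [->|x0] := eqVneq x 0.
    by rewrite invr0; under eq_fun do rewrite mul0r; exact: cvg_cst.
  have -> : x^-1 = x * (x ^+ 2 + 0)^-1 by field.
  apply: cvgM; first exact: cvg_cst.
  apply: cvgV; first by rewrite addr0 expf_neq0.
  by apply: cvgD; [exact: cvg_cst|exact: cvg_harmonic].
Qed.

Lemma measurable_sqrtr : measurable_fun setT (@Num.sqrt R).
Proof. by apply: continuous_measurable_fun; exact: sqrt_continuous. Qed.

Lemma L1_oneDsqrV : L1 leb (fun t : R => (oneDsqr t)^-1).
Proof.
have c : continuous (fun t : R => (oneDsqr t)^-1) by exact: continuous_oneDsqrV.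
have p (t : R) : 0 <= (oneDsqr t)^-1 by rewrite invr_ge0.
apply: L1P; first exact: continuous_measurable_fun.
under eq_integral do rewrite ger0_norm//.
rewrite (ge0_symfun_integralT p c); last by move=> t; rewrite /= /oneDsqr sqrrN.
by rewrite -set_itvcy integral0y_oneDsqr -EFinM ltry.
Qed.

Lemma measurable_expR_abs (b : R) : measurable_fun setT (fun t : R => expR (- b * `|t|)).
Proof.
apply: measurableT_comp; first exact: measurable_expR.
by apply: measurable_funM => //; exact: measurableT_comp.
Qed.

(** Comparison with [1 / (1 + t^2)] by means of [exp u >= 1 + u^2 / 2] for [u >= 0]. *)
Lemma L1_expR_abs (b : R) : 0 < b -> L1 leb (fun t : R => expR (- b * `|t|)).
Proof.
move=> b0; apply: (@L1_le _ _ R leb _ (fun t => (1 + 2 / b ^+ 2) * (oneDsqr t)^-1)).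
- exact: measurable_expR_abs.
- move=> t; rewrite ger0_norm ?expR_ge0// mulNr expRN.
  have h : 1 + (b * `|t|) ^+ 2 / 2 <= expR (b * `|t|).
    by have := @expR_ge1Dxn R (b * `|t|) 1; apply; rewrite mulr_ge0// ltW.
  rewrite -[_ * _^-1]/(_ / _) ler_pdivlMr ?oneDsqr_gt0// mulrC ler_pdivrMr ?expR_gt0//.
  apply: le_trans (ler_wpM2l _ h); last by rewrite addr_ge0// divr_ge0// sqr_ge0.
  rewrite /oneDsqr exprMn real_normK ?num_real//.
  have b2 : 0 < b ^+ 2 by rewrite exprn_gt0.
  have t2 := sqr_ge0 t.
  rewrite mulrDl mul1r -addrA lerD2l.
  rewrite (_ : _ / _ * _ = 2 / b ^+ 2 + t ^+ 2); last by field; rewrite gt_eqF.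
  have : 0 <= b ^+ 2 * t ^+ 2 / 2 by rewrite divr_ge0// mulr_ge0// ltW.
  have : 0 <= 2 / b ^+ 2 by rewrite divr_ge0// ltW.
  lra.
- by apply: L1Z; exact: L1_oneDsqrV.
Qed.

Lemma L1_expR_enorm (m : nat) (d : R) : 0 < d ->
  L1 (@mun R m) (fun xi : 'rV[R]_m => expR (- d * enorm xi)).
Proof.
(* The rate is shared among the coordinates, each bounded by the norm; dividing by [m + 1] instead
   of [m] also covers dimension 0. *)
move=> d0; have m0 : (0 : R) < m.+1%:R by rewrite ltr0n.
have b0 : 0 < d / m.+1%:R by rewrite divr_gt0.
have [lp _] := L1_prod (fun _ : 'I_m => L1_expR_abs b0).
apply: (@L1_le _ _ R _ _ (fun x : 'rV[R]_m => \prod_(j < m) expR (- (d / m.+1%:R) * `|x 0 j|))) => //.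
  exact: measurable_expR_enorm.
move=> xi.
rewrite ger0_norm ?expR_ge0// -expR_sum ler_expR -mulr_sumr !mulNr lerN2 mulrAC ler_pdivrMr//.
rewrite -mulrA ler_pM2l//.
apply: (@le_trans _ _ (\sum_(j < m) enorm xi)).
  by apply: ler_sum => j _; exact: coord_le_enorm.
by rewrite sumr_const card_ord -[leLHS]mulr_natr ler_wpM2l ?enorm_ge0// ler_nat.
Qed.

(** Cauchy-Schwarz: [exp (c |xi|) A = F G], where [F^2] is the weighted density and
    [G^2 = 2 |xi| exp (2 (c - a) |xi|)] is integrable for [c < a]. At the origin [F] is 0 by
    [0^-1 = 0], so the factorisation there relies on [A 0 = 0]. *)
Lemma wexpL1 (m : nat) (a : R) (A : 'rV[R]_m -> R) : measurable_fun setT A -> A 0 = 0 ->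
  L1 (mun m) (fun xi => expR (2 * a * enorm xi) * A xi ^+ 2 / (2 * enorm xi)) -> expL1 a A.
Proof.
move=> mA A0 lA; split=> // c ca.
have men : measurable_fun setT (@enorm R m) by exact: measurable_fun_enorm.
have msq : measurable_fun setT (fun xi : 'rV[R]_m => Num.sqrt (2 * enorm xi)).
  by apply: measurableT_comp; [exact: measurable_sqrtr|exact: measurable_funM].
pose F (xi : 'rV[R]_m) := expR (a * enorm xi) * A xi * Num.sqrt ((2 * enorm xi)^-1).
pose G (xi : 'rV[R]_m) := expR ((c - a) * enorm xi) * Num.sqrt (2 * enorm xi).
have mF : measurable_fun setT F.
  apply: measurable_funM; first by apply: measurable_funM => //; exact: measurable_expR_enorm.
  apply: measurableT_comp; first exact: measurable_sqrtr.
  by apply: measurableT_comp; [exact: measurable_invr|exact: measurable_funM].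
have mG : measurable_fun setT G by apply: measurable_funM => //; exact: measurable_expR_enorm.
have r0 (xi : 'rV[R]_m) : 0 <= 2 * enorm xi by rewrite mulr_ge0// enorm_ge0.
have E : (fun xi => (expR (c * enorm xi) * A xi)%:E) = (fun xi => (F xi * G xi)%:E).
  apply/funext => xi; congr EFin; rewrite /F /G.
  have [->|x0] := eqVneq xi 0; first by rewrite A0 !(mulr0, mul0r).
  have s0 : Num.sqrt (2 * enorm xi) != 0.
    by rewrite sqrtr_eq0 -ltNge mulr_gt0// lt_def enorm_ge0 enorm_eq0 x0.
  rewrite sqrtrV//.
  have -> : expR (c * enorm xi) = expR (a * enorm xi) * expR ((c - a) * enorm xi).
    by rewrite -expRD; congr expR; ring.
  by field.
rewrite E; apply: L1_sqM => //.
- have -> : (fun xi => (F xi ^+ 2)%:E) = (fun xi => (expR (2 * a * enorm xi) * A xi ^+ 2 / (2 * enorm xi))%:E); last exact: lA.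
  apply/funext => xi; congr EFin; rewrite /F !exprMn sqr_sqrtr ?invr_ge0// -expRM_natl.
  by congr (expR _ * _ * _); ring.
(* With [r = |xi|], [G^2 = 2 r exp (- 2 d r)], and [d r exp (- d r) <= 1] trades the factor [r] for
   one of the two exponentials. *)
- pose d := a - c; have d0 : 0 < d by rewrite subr_gt0.
  apply: (@L1_le _ _ R _ _ (fun xi => 2 / d * expR (- d * enorm xi))).
  + exact: measurable_funX.
  + move=> xi; rewrite ger0_norm ?sqr_ge0// /G exprMn sqr_sqrtr// -expRM_natl.
    have -> : expR (2%:R * ((c - a) * enorm xi)) = expR (- d * enorm xi) * expR (- d * enorm xi).
      by rewrite -expRD; congr expR; rewrite /d; ring.
    have h : enorm xi * d * expR (- d * enorm xi) <= 1.
      rewrite mulNr expRN ler_pdivrMr ?expR_gt0// mul1r mulrC.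
      by apply: le_trans (expR_ge1Dx _); rewrite lerDr.
    have E0 := expR_ge0 (- d * enorm xi); move: (expR _) E0 h => X X0 h.
    rewrite -subr_ge0 (_ : _ - _ = 2 / d * X * (1 - enorm xi * d * X)); last by field; rewrite gt_eqF.
    by rewrite mulr_ge0 ?subr_ge0// mulr_ge0// divr_ge0// ltW.
  + by apply: L1Z; exact: L1_expR_enorm.
Qed.

End exponential_weights.

Section half_line.
Context {R : realType}.
Local Notation leb := (@lebesgue_measure R).

Definition hline (s : bool) (a : R) : set R := [set t : R | - a < sgn R s * t].

Lemma hline_itv s a : hline s a = if s then `]- a, +oo[%classic else `]-oo, a[%classic.
Proof.
apply/seteqP; rewrite /hline /sgn; case: s; split=> t /=; rewrite in_itv/= ?mul1r ?andbT//;
  by rewrite mulN1r ltrN2.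
Qed.

Lemma measurable_hline s a : measurable (hline s a).
Proof. by rewrite hline_itv; case: s; exact: measurable_itv. Qed.

(** Origin of the weight in the theorem: a mode of frequency norm [r] decays like [exp (- s t r)],
    and this is the integral of its square over the half line. *)
Lemma integral_expR_hline s (a r : R) : 0 < r ->
  (\int[leb]_(t in hline s a) (expR (- 2 * (sgn R s * t) * r))%:E = (expR (2 * a * r) / (2 * r))%:E)%E.
Proof.
move=> r0; have r20 : 0 < 2 * r by rewrite mulr_gt0.
have cE c : continuous (fun t : R => expR (- 2 * (c * t) * r)).
  move=> t; apply: continuous_comp; last exact: continuous_expR.
  apply: cvgM; last exact: cvg_cst.
  by apply: cvgM; [exact: cvg_cst|apply: cvgM; [exact: cvg_cst|exact: cvg_id]].
have mE c (D : set R) : measurable_fun D (fun t : R => (expR (- 2 * (c * t) * r))%:E).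
  by apply: measurable_funTS; apply/measurable_EFinP; apply: continuous_measurable_fun; exact: cE.
have key : (\int[leb]_(t in `[(- a)%R, +oo[) (expR (- (2 * r) * t))%:E = (expR (2 * a * r) / (2 * r))%:E)%E.
  pose F (t : R) := - (expR (- (2 * r) * t) / (2 * r)).
  have dF t : is_derive t (1 : R) F (expR (- (2 * r) * t)).
    apply: is_derive_eq; rewrite /GRing.scale/=; field; rewrite gt_eqF//.
  have cF : continuous F.
    by move=> y; apply: differentiable_continuous; apply/derivable1_diffP; exact: ex_derive.
  rewrite (@ge0_continuous_FTC2y _ _ F _ 0).
  - rewrite sub0e -EFinN /F opprK; congr (expR _ / _)%:E; ring.
  - by move=> t _; exact: expR_ge0.
  - apply: continuous_subspaceT => t; apply: continuous_comp; last exact: continuous_expR.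
    by apply: cvgM; [exact: cvg_cst|exact: cvg_id].
  - rewrite /F -[X in _ --> X]oppr0; apply: cvgN; rewrite -[X in _ --> X](mul0r (2 * r)^-1).
    apply: cvgMl; under eq_fun do rewrite mulNr.
    have hy : (2 * r * t) @[t --> +oo] --> +oo by apply: gt0_cvgMry => //; exact: cvg_id.
    have h := @cvg_comp _ _ _ (fun t : R => 2 * r * t) (fun u : R => expR (- u)) _ _ _ hy (@cvgr_expR R).
    exact: h.
  - by move=> t _; exact: ex_derive.
  - by apply: cvg_at_right_filter; exact: cF.
  - by move=> t _; rewrite derive1E derive_val.
rewrite hline_itv; case: s; rewrite /sgn.
  rewrite integral_itv_obnd_cbnd; last exact: mE.
  by rewrite -key; apply: eq_integral => t _; congr (expR _)%:E; ring.
rewrite integral_itv_bndo_bndc; last exact: mE.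
rewrite -[in LHS](opprK a) ge0_integration_by_substitutionNy.
- by rewrite -key; apply: eq_integral => t _; congr (expR _)%:E; ring.
- by apply: continuous_subspaceT; exact: cE.
- by move=> t _; exact: expR_ge0.
Qed.

End half_line.

Section differentiable_near.
Context {R : realType} (V : normedModType R).

(** The given function is known to agree with its synthesis only on the half space, so
    differentiability has to be transferred locally. *)
Lemma near_eq_differentiable (f g : V -> R) (x : V) :
  (\forall y \near x, f y = g y) -> differentiable g x -> differentiable f x.
Proof.
move=> fg dg; have [cd E] := (diff_locallyP x g).1 dg.
have fgx : f x = g x by exact: nbhs_singleton fg.
have Ef : f \o shift x = cst (f x) + 'd g x +o_ (0 : V) id.
  move/eqaddoP : E => E; apply/eqaddoP => e e0.
  have n0 : \forall h \near (0 : V), f (h + x) = g (h + x).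
    by move: fg; rewrite (near_shift 0 x) subr0.
  apply: (filterS2 _ _ n0 (E e e0)) => h h1.
  suff -> : (f \o shift x - (cst (f x) + 'd g x)) h = (g \o shift x - (cst (g x) + 'd g x)) h by [].
  by rewrite -[LHS]/(f (h + x) - (f x + 'd g x h)) h1 fgx.
have U := diff_unique cd Ef.
by apply/diff_locallyP; rewrite U.
Qed.

End differentiable_near.

(** * Synthesis from families of coefficients *)

Section synthesis_family.
Context {R : realType} (m : nat) (s : bool) (a : R).
Local Notation mu := (@mun R m).
Local Notation leb := (@lebesgue_measure R).
Local Notation sg := (sgn R s).
Implicit Types (al : 'rV[R]_m -> {set 'I_m} -> bool -> R) (T : {set 'I_m}) (x : 'rV[R]_(1 + m)).

Definition cst2pi : R := ((2 * pi) ^+ m)^-1.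

(** A coefficient of [(2 pi)^-m] times the integral of [exp (i <x, xi>) exp (- s x0 |xi|) al xi];
    the phase [- (pi / 2)] turns the cosine into the sine that accompanies [i al]. *)
Definition synF al x T im : R :=
  cst2pi * (syn sg 0 (fun xi => al xi T im) x + syn sg (- (pi / 2)) (fun xi => iF (al xi) T im) x).

(** The value at the origin is fixed because the weight, being 0 there by [0^-1 = 0], does not
    control it. *)
Definition wfam al := [/\ forall T im, measurable_fun setT (fun xi => al xi T im),
  forall T im, al 0 T im = 0 &
  forall T im, L1 mu (fun xi => expR (2 * a * enorm xi) * al xi T im ^+ 2 / (2 * enorm xi))].

Lemma wfam_iF al : wfam al -> wfam (fun xi => iF (al xi)).
Proof.
move=> [mal a0 lal]; split=> [T [] //=|T [] //=|T [] //=]; rewrite /iF.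
- exact: measurableT_comp.
- by rewrite a0 oppr0.
- by under eq_fun do rewrite sqrrN.
Qed.

Lemma wfam_expL1 al T im : wfam al -> expL1 a (fun xi => al xi T im).
Proof. by move=> [mal a0 lal]; apply: wexpL1. Qed.

Lemma halfspaceE x : halfspace s a x = (- a < sg * x0_of x). Proof. by []. Qed.

Lemma synF_differentiable al x T im : wfam al -> halfspace s a x ->
  differentiable (fun x => synF al x T im) x /\
  forall k, 'D_(@dir R m k) (fun x => synF al x T im) x =
    cst2pi * (synD sg 0 (fun xi => al xi T im) x k + synD sg (- (pi / 2)) (fun xi => iF (al xi) T im) x k).
Proof.
move=> wal xa.
have [d1 e1] := syn_differentiable 0 (normr_sgn s) (wfam_expL1 T im wal) xa.
have [d2 e2] := syn_differentiable (- (pi / 2)) (normr_sgn s) (wfam_expL1 T im (wfam_iF wal)) xa.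
have dD : differentiable (syn sg 0 (fun xi => al xi T im) + syn sg (- (pi / 2)) (fun xi => iF (al xi) T im)) x.
  exact: differentiableD.
split; first exact: (@differentiableZ _ _ _ _ cst2pi _ dD).
move=> k; rewrite -e1 -e2 -[RHS]/(cst2pi *: _).
have dv1 : derivable (syn sg 0 (fun xi => al xi T im)) x (@dir R m k) by exact: diff_derivable.
have dv2 : derivable (syn sg (- (pi / 2)) (fun xi => iF (al xi) T im)) x (@dir R m k) by exact: diff_derivable.
by rewrite -(deriveD dv1 dv2) -(deriveZ cst2pi (derivableD dv1 dv2)).
Qed.

Lemma open_halfspace : open (@halfspace R m s a).
Proof.
have c : continuous (fun x : 'rV[R]_(1 + m) => sg * x0_of x).
  have -> : (fun x : 'rV[R]_(1 + m) => sg * x0_of x) = (fun x => sg * x 0 ord0).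
    by apply/funext => y; rewrite (@x0_ofE R m).
  have c0 : continuous (fun x : 'rV[R]_(1 + m) => x 0 ord0) by exact: coord_continuous.
  by move=> x; exact: (continuousM (@cst_continuous _ _ sg x) (c0 x)).
by have := @open_comp _ _ _ _ (fun y _ => c y) (@open_gt R (- a)).
Qed.

Lemma syn_sum (t : R) (I : finType) (c : I -> R) (A : I -> 'rV[R]_m -> R) x : halfspace s a x ->
  (forall i, expL1 a (A i)) ->
  syn sg t (fun xi => \sum_i c i * A i xi) x = \sum_i c i * syn sg t (A i) x.
Proof.
move=> xa eA; rewrite /syn.
have lA i : L1 mu (fun xi => c i * (kern sg t x xi * A i xi)).
  by apply: L1Z; exact: L1_kern (eA i) xa.
rewrite (_ : (fun xi => kern sg t x xi * \sum_i c i * A i xi) =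
   fun xi => \sum_i c i * (kern sg t x xi * A i xi)); last first.
  by apply/funext => xi; rewrite mulr_sumr; apply: eq_bigr => i _; rewrite mulrCA.
rewrite Rint_sum//; apply: eq_bigr => i _; rewrite RintZ//; exact: L1_kern (eA i) xa.
Qed.

Lemma syn_phase (t : R) (A : 'rV[R]_m -> R) x : expL1 a A -> halfspace s a x ->
  syn sg (t + pi) A x = - syn sg t A x.
Proof.
move=> eA xa; rewrite /syn -RintN; last exact: L1_kern eA xa.
by congr Rintegral; apply/funext => xi; rewrite /kern addrA cosDpi; ring.
Qed.

(** Under the integral [x0] differentiation multiplies by [- s |xi|] and [x_j] differentiation by
    [i xi_j], so the Dirac equation reduces to the eigenvector equation [i xi al = s |xi| al]. *)
Lemma synF_eq al x T : wfam al -> (forall xi T im, NF xi (al xi) T im = sg * enorm xi * al xi T im) ->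
  halfspace s a x -> forall im,
  'D_(@dir R m ord0) (fun x => synF al x T im) x +
  \sum_(j < m) esgn j T * 'D_(@dir R m (lift ord0 j)) (fun x => synF al x (flip j T) im) x = 0.
Proof.
move=> wal Nal xa im.
have eA T' b := wfam_expL1 T' b wal.
have eI T' b := wfam_expL1 T' b (wfam_iF wal).
have eC (j : 'I_m) A : expL1 a A -> expL1 a (fun xi => xi 0 j * A xi).
  by move=> ?; apply: expL1M => //; [exact: measurable_coord|move=> xi; exact: coord_le_enorm].
rewrite (synF_differentiable T im wal xa).2.
under eq_bigr => j _ do rewrite (synF_differentiable (flip j T) im wal xa).2 mulrCA.
rewrite -mulr_sumr -mulrDr; apply/eqP; rewrite mulf_eq0; apply/orP; right; apply/eqP.
rewrite /synD unlift_none.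
under eq_bigr => j _ do rewrite liftK mulrDr.
rewrite big_split/= addNr add0r.
have h1 : \sum_(j < m) esgn j T * syn sg 0 (fun xi => xi 0 j * iF (al xi) (flip j T) im) x =
   - syn sg 0 (fun xi => - sg * enorm xi * al xi T im) x.
  rewrite -syn_sum//; last by move=> j; exact/eC/eI.
  rewrite /syn -RintN.
    congr Rintegral; apply/funext => xi.
    have -> : \sum_(i < m) esgn i T * (xi 0 i * iF (al xi) (flip i T) im) = NF xi (al xi) T im.
      by apply: eq_bigr => j _; ring.
    by rewrite Nal; ring.
  apply: L1_kern xa; apply: expL1M => //; first by apply: measurable_funM => //; exact: measurable_fun_enorm.
  by move=> xi; rewrite normrM normrN normr_sgn mul1r ger0_norm ?enorm_ge0.
have h2 : \sum_(j < m) esgn j T * syn sg (pi / 2) (fun xi => xi 0 j * al xi (flip j T) im) x =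
   - syn sg (- (pi / 2)) (fun xi => - sg * enorm xi * iF (al xi) T im) x.
  have E : expL1 a (fun xi => - sg * enorm xi * iF (al xi) T im).
    apply: expL1M => //; first by apply: measurable_funM => //; exact: measurable_fun_enorm.
    by move=> xi; rewrite normrM normrN normr_sgn mul1r ger0_norm ?enorm_ge0.
  rewrite -syn_sum//; last by move=> j; exact/eC/eA.
  rewrite -syn_phase// (_ : - (pi / 2) + pi = pi / 2); last by field.
  congr syn; apply/funext => xi.
  have iFZ c u T' b : iF (fun T im => c * u T im) T' b = c * iF u T' b :> R by case: b => //=; rewrite /iF mulrN.
  have -> : - sg * enorm xi * iF (al xi) T im = - iF (NF xi (al xi)) T im.
    rewrite mulNr mulNr; congr (- _); rewrite -iFZ.
    by rewrite /iF; case: (im); rewrite Nal.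
  rewrite -NF_iF /NF -sumrN; apply: eq_bigr => j _; rewrite iFK; ring.
rewrite h1 h2; ring.
Qed.

Lemma dens_L1 al (t : R) T im : wfam al -> - a < sg * t ->
  L1 mu (fun xi => expR (- sg * t * enorm xi) * al xi T im).
Proof. by move=> wal ta; apply: (wfam_expL1 T im wal).2; lra. Qed.

(** An inverse transform is the conjugate of the forward transform of the conjugate density; in this
    form [plancherel_le] applies to the slices. *)
Lemma synF_slice al (t : R) T y : wfam al -> - a < sg * t ->
  synF al (pt t y) T false = cst2pi * ftc (fun xi => expR (- sg * t * enorm xi) * al xi T false)
     (fun xi => - (expR (- sg * t * enorm xi) * al xi T true)) y /\
  synF al (pt t y) T true = - (cst2pi * ftc (fun xi => - (expR (- sg * t * enorm xi) * al xi T true))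
     (fun xi => - (expR (- sg * t * enorm xi) * al xi T false)) y).
Proof.
move=> wal ta; have xa : halfspace s a (pt t y) by rewrite halfspaceE x0_of_pt.
have l T' b (th : R) := L1_kern th (wfam_expL1 T' b wal) xa.
have li T' b (th : R) := L1_kern th (wfam_expL1 T' b (wfam_iF wal)) xa.
rewrite /synF /syn -!RintD//; split.
  congr (_ * _); congr Rintegral; apply/funext => xi.
  by rewrite /kern x0_of_pt xv_of_pt addr0 cosBpihalf /iF dotpC; ring.
rewrite /ftc -(mulrN cst2pi) -RintN; last first.
  by apply: L1_ftc; apply: L1N; exact: dens_L1.
congr (_ * _); congr Rintegral; apply/funext => xi.
by rewrite /kern x0_of_pt xv_of_pt addr0 cosBpihalf /iF dotpC; ring.
Qed.

Lemma slice_plancherel al (t : R) T : wfam al -> - a < sg * t ->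
  (\int[mu]_y (synF al (pt t y) T false ^+ 2 + synF al (pt t y) T true ^+ 2)%:E <=
   cst2pi%:E * \int[mu]_xi ((al xi T false ^+ 2 + al xi T true ^+ 2) *
      expR (- 2 * (sg * t) * enorm xi))%:E)%E.
Proof.
move=> wal ta.
have l b := dens_L1 T b wal ta.
have := plancherel_le (l false) (L1N (l true)).
set F := (X in (\int[mu]_xi X xi <= _)%E -> _).
set G := (X in (_ <= _ * \int[mu]_x X x)%E -> _) => h.
have c0 : 0 < (2 * pi) ^+ m :> R by rewrite exprn_gt0// mulr_gt0// pi_gt0.
have mF : measurable_fun setT F.
  apply/measurable_EFinP; apply: measurable_funD; apply: measurable_funX.
    by apply: measurable_ftc; [exact: L1_measurable (l _)|exact: L1_measurable (L1N (l _))].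
  by apply: measurable_ftc; exact: L1_measurable (L1N (l _)).
have -> : (fun y => (synF al (pt t y) T false ^+ 2 + synF al (pt t y) T true ^+ 2)%:E) =
    (fun y => (cst2pi ^+ 2)%:E * F y)%E.
  apply/funext => y; rewrite /F -EFinM; congr EFin.
  have [-> ->] := synF_slice T y wal ta; ring.
rewrite ge0_integralZl//; last 2 first.
- by move=> y _; rewrite lee_fin addr_ge0 ?sqr_ge0.
- by rewrite lee_fin sqr_ge0.
have -> : (\int[mu]_xi ((al xi T false ^+ 2 + al xi T true ^+ 2) *
      expR (- 2 * (sg * t) * enorm xi))%:E = \int[mu]_xi G xi)%E.
  apply: eq_integral => xi _; congr EFin.
  have -> : expR (-2 * (sg * t) * enorm xi) = expR (- sg * t * enorm xi) ^+ 2.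
    by rewrite -expRM_natl; congr expR; ring.
  by rewrite /G; ring.
apply: le_trans (lee_wpmul2l _ h) _; first by rewrite lee_fin sqr_ge0.
rewrite muleA -EFinM; apply: lee_wpmul2r.
  by apply: integral_ge0 => xi _; rewrite lee_fin addr_ge0 ?sqr_ge0.
by rewrite lee_fin /cst2pi expr2 -mulrA mulVf ?mulr1// gt_eqF.
Qed.

(** At the origin the integral over the half line would be infinite while the weight is 0 by
    convention; [S 0 = 0] reconciles the two sides. *)
Lemma tonelli_weight (S : 'rV[R]_m -> R) : measurable_fun setT S -> (forall xi, 0 <= S xi) -> S 0 = 0 ->
  (\int[leb]_(t in hline s a) \int[mu]_xi (S xi * expR (- 2 * (sg * t) * enorm xi))%:E =
   \int[mu]_xi (expR (2 * a * enorm xi) * S xi / (2 * enorm xi))%:E)%E.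
Proof.
move=> mS S0 S00.
pose F (p : measurableTypeR R * 'rV[R]_m) : \bar R :=
  (\1_(hline s a) p.1 * (S p.2 * expR (- 2 * (sg * p.1) * enorm p.2)))%:E.
have F0 p : (0 <= F p)%E by rewrite lee_fin mulr_ge0// mulr_ge0// expR_ge0.
have mF : measurable_fun setT F.
  apply/measurable_EFinP; apply: measurable_funM.
    by apply: (measurableT_comp _ measurable_fst); apply: measurable_indic; exact: measurable_hline.
  apply: measurable_funM; first exact: (measurableT_comp mS measurable_snd).
  apply: measurableT_comp; first exact: measurable_expR.
  apply: measurable_funM; last exact: (measurable_fun_enorm measurable_snd).
  by apply: measurable_funM => //; apply: measurable_funM => //.
have := @fubini_tonelli _ _ _ _ R leb mu F mF F0.
have -> : (\int[leb]_x \int[mu]_y F (x, y) = \int[leb]_(t in hline s a)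
    \int[mu]_xi (S xi * expR (- 2 * (sg * t) * enorm xi))%:E)%E.
  rewrite [RHS]integral_mkcond; apply: eq_integral => t _; rewrite patchE /F/=.
  rewrite indicE; case: ifP => ht; first by under eq_integral do rewrite mul1r.
  by under eq_integral do rewrite mul0r; rewrite integral0.
move=> ->; apply: eq_integral => xi _.
have -> : (\int[leb]_x F (x, xi) = \int[leb]_(t in hline s a) ((S xi)%:E * (expR (- 2 * (sg * t) * enorm xi))%:E))%E.
  rewrite [RHS]integral_mkcond; apply: eq_integral => t _; rewrite patchE /F/=.
  by rewrite indicE; case: ifP => ht; rewrite ?mul1r ?mul0r.
have [->|x0] := eqVneq xi 0.
  by rewrite S00 mulr0 mul0r; under eq_integral do rewrite mul0e; rewrite integral0.
have r0 : 0 < enorm xi by rewrite lt_def enorm_ge0 enorm_eq0 x0.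
have -> : (\int[leb]_(t in hline s a) ((S xi)%:E * (expR (- 2 * (sg * t) * enorm xi))%:E) =
   (S xi)%:E * \int[leb]_(t in hline s a) (expR (- 2 * (sg * t) * enorm xi))%:E)%E.
  apply: ge0_integralZl => //.
  - exact: measurable_hline.
  - apply: measurable_funTS; apply/measurable_EFinP.
    apply: measurableT_comp; first exact: measurable_expR.
    by apply: measurable_funM => //; apply: measurable_funM => //; apply: measurable_funM.
  - by rewrite lee_fin.
by rewrite integral_expR_hline// -EFinM; congr EFin; ring.
Qed.

Lemma synF_continuous al x T im : wfam al -> halfspace s a x ->
  {for x, continuous (fun x => synF al x T im)}.
Proof. by move=> wal xa; apply: differentiable_continuous; exact: (synF_differentiable T im wal xa).1. Qed.

Lemma synD_continuous (t : R) (A : 'rV[R]_m -> R) x k : expL1 a A -> halfspace s a x ->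
  {for x, continuous (fun y => synD sg t A y k)}.
Proof.
move=> eA xa; rewrite /synD; case: unliftP => [j _|_]; apply: differentiable_continuous.
  have e : expL1 a (fun xi => xi 0 j * A xi).
    by apply: expL1M => //; [exact: measurable_coord|move=> xi; exact: coord_le_enorm].
  exact: (syn_differentiable (t + pi / 2) (normr_sgn s) e xa).1.
have e : expL1 a (fun xi => - sg * enorm xi * A xi).
  apply: expL1M => //; first by apply: measurable_funM => //; exact: measurable_fun_enorm.
  by move=> xi; rewrite normrM normrN normr_sgn mul1r ger0_norm ?enorm_ge0.
exact: (syn_differentiable t (normr_sgn s) e xa).1.
Qed.

Lemma synF_monogenic al (f : 'rV[R]_(1 + m) -> Cl R m) : wfam al ->
  (forall xi T im, NF xi (al xi) T im = sg * enorm xi * al xi T im) ->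
  (forall x T im, halfspace s a x -> cpt (f x) T im = synF al x T im) ->
  left_monogenic (@halfspace R m s a) f.
Proof.
move=> wal Nal fE.
have nE T im x : halfspace s a x -> \forall y \near x, Defs.comp f T im y = synF al y T im.
  move=> xa; have : nbhs x (@halfspace R m s a) by apply: open_nbhs_nbhs; split => //; exact: open_halfspace.
  by apply: filterS => y ya; rewrite cptE fE.
have DE T im k x : halfspace s a x ->
    'D_(@dir R m k) (Defs.comp f T im) x = 'D_(@dir R m k) (fun x => synF al x T im) x.
  by move=> xa; apply: near_eq_derive; exact: nE.
split; first exact: open_halfspace.
split=> [T im x xa|].
  by apply: near_eq_differentiable (nE T im x xa) _; exact: (synF_differentiable T im wal xa).1.
split=> [T im k x xa|x xa]; last first.
  apply/monogenicP => T im; rewrite DE//.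
  by under eq_bigr => j _ do rewrite DE//; exact: synF_eq.
pose H y := cst2pi * (synD sg 0 (fun xi => al xi T im) y k + synD sg (- (pi / 2)) (fun xi => iF (al xi) T im) y k).
have HE y : halfspace s a y -> 'D_(@dir R m k) (Defs.comp f T im) y = H y.
  by move=> ya; rewrite DE// (synF_differentiable T im wal ya).2.
have cH : {for x, continuous H}.
  have c1 := @synD_continuous 0 _ x k (wfam_expL1 T im wal) xa.
  have c2 := @synD_continuous (- (pi / 2)) _ x k (wfam_expL1 T im (wfam_iF wal)) xa.
  exact: (continuousM (@cst_continuous _ _ cst2pi x) (continuousD c1 c2)).
have nb : \forall y \near x, H y = 'D_(@dir R m k) (Defs.comp f T im) y.
  have : nbhs x (@halfspace R m s a) by apply: open_nbhs_nbhs; split => //; exact: open_halfspace.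
  by apply: filterS => y ya; rewrite HE.
by rewrite HE//; exact: (cvg_trans (near_eq_cvg nb) cH).
Qed.

Lemma measurable_synF al T im : wfam al ->
  measurable_fun setT (fun p : measurableTypeR R * 'rV[R]_m => \1_(hline s a) p.1 * synF al (pt p.1 p.2) T im).
Proof.
move=> wal; apply: measurable_funM.
  by apply: (measurableT_comp _ measurable_fst); apply: measurable_indic; exact: measurable_hline.
have mk (t : R) (A : 'rV[R]_m -> R) : measurable_fun setT A ->
    measurable_fun setT (fun p : measurableTypeR R * 'rV[R]_m => syn sg t A (pt p.1 p.2)).
  move=> mA; apply: (@measurable_Rintegral_param R _ _ _ _ mu
    (fun q : (measurableTypeR R * 'rV[R]_m) * 'rV[R]_m => kern sg t (pt q.1.1 q.1.2) q.2 * A q.2)).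
  have m1 : measurable_fun setT (fun q : (measurableTypeR R * 'rV[R]_m) * 'rV[R]_m => q.1.1).
    exact: (measurableT_comp measurable_fst measurable_fst).
  have m2 : measurable_fun setT (fun q : (measurableTypeR R * 'rV[R]_m) * 'rV[R]_m => q.1.2).
    exact: (measurableT_comp measurable_snd measurable_fst).
  have m3 : measurable_fun setT (fun q : (measurableTypeR R * 'rV[R]_m) * 'rV[R]_m => q.2).
    exact: measurable_snd.
  apply: measurable_funM; last exact: (measurableT_comp mA m3).
  rewrite /kern; under eq_fun do rewrite x0_of_pt xv_of_pt.
  apply: measurable_funM.
    apply: measurableT_comp; first exact: measurable_expR.
    by apply: measurable_funM; [exact: measurable_funM|exact: measurable_fun_enorm].
  apply: measurableT_comp; first exact: measurable_cos.
  by apply: measurable_funD => //; exact: measurable_fun_dotp.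
have [mal _ _] := wal; have [mial _ _] := wfam_iF wal.
by apply: measurable_funM => //; apply: measurable_funD; apply: mk.
Qed.

(** [slice_plancherel] bounds each slice by its exponentially damped density, and [tonelli_weight]
    adds these bounds up to the weighted integral, coefficient by coefficient. *)
Lemma A2_synF al (f : 'rV[R]_(1 + m) -> Cl R m) : wfam al ->
  (forall xi T im, NF xi (al xi) T im = sg * enorm xi * al xi T im) ->
  (forall x T im, halfspace s a x -> cpt (f x) T im = synF al x T im) ->
  A2 s a f.
Proof.
move=> wal Nal fE; split; first exact: synF_monogenic wal Nal fE.
have [mal al0 lal] := wal.
pose H (T : {set 'I_m}) (p : measurableTypeR R * 'rV[R]_m) : R :=
  (\1_(hline s a) p.1 * synF al (pt p.1 p.2) T false) ^+ 2 +
  (\1_(hline s a) p.1 * synF al (pt p.1 p.2) T true) ^+ 2.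
have mH T : measurable_fun setT (H T).
  by apply: measurable_funD; apply: measurable_funX; exact: measurable_synF.
have H0 T p : 0 <= H T p by rewrite addr_ge0 ?sqr_ge0.
have HE t y T : hline s a t -> H T (t, y) = cpt (f (pt t y)) T false ^+ 2 + cpt (f (pt t y)) T true ^+ 2.
  move=> ta; have xa : halfspace s a (pt t y) by rewrite halfspaceE x0_of_pt.
  by rewrite !fE// /H/= indicE mem_set// !mul1r.
have step t : hline s a t -> iint (fun xv => (clnorm (f (pt t xv)) ^+ 2)%:E) =
    (\int[mu]_y (\sum_T (H T (t, y))%:E))%E.
  move=> ta.
  have -> : (fun xv => (clnorm (f (pt t xv)) ^+ 2)%:E) = (fun y => (\sum_T H T (t, y))%:E).
    by apply/funext => y; rewrite clnormE; congr EFin; apply: eq_bigr => T _; rewrite HE.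
  rewrite iintE.
  - by apply: eq_integral => y _; rewrite sumEFin.
  - apply/measurable_EFinP; apply: measurable_sum => T.
    exact: (measurableT_comp (mH T) (pair1_measurable t)).
  - by move=> y; rewrite lee_fin sumr_ge0.
have -> : [set t : R | (- a < sgn R s * t)%R] = hline s a by [].
rewrite (eq_integral (fun t => \sum_T \int[mu]_y (H T (t, y))%:E)%E); last first.
  move=> t; rewrite inE => ta; rewrite step// ge0_integral_sum//.
  - by move=> T; apply/measurable_EFinP; exact: (measurableT_comp (mH T) (pair1_measurable t)).
  - by move=> T y _; rewrite lee_fin.
have mHt T : measurable_fun setT (fun t : measurableTypeR R => \int[mu]_y (H T (t, y))%:E)%E.
  apply: (@measurable_integral_param R _ _ _ _ mu (fun q => (H T q)%:E)).
  by apply/measurable_EFinP; exact: mH.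
rewrite ge0_integral_sum//; last 3 first.
- exact: measurable_hline.
- by move=> T; apply: measurable_funTS; exact: mHt.
- by move=> T t _; apply: integral_ge0 => y _; rewrite lee_fin.
apply: lte_sum_pinfty => T _.
pose S xi := al xi T false ^+ 2 + al xi T true ^+ 2.
have mS : measurable_fun setT S by apply: measurable_funD; apply: measurable_funX.
have S0 xi : 0 <= S xi by rewrite addr_ge0 ?sqr_ge0.
have mSt : measurable_fun setT (fun t : measurableTypeR R =>
    \int[mu]_xi (S xi * expR (- 2 * (sg * t) * enorm xi))%:E)%E.
  apply: (@measurable_integral_param R _ _ _ _ mu
    (fun q : measurableTypeR R * 'rV[R]_m => (S q.2 * expR (- 2 * (sg * q.1) * enorm q.2))%:E)).
  apply/measurable_EFinP; apply: measurable_funM; first exact: (measurableT_comp mS measurable_snd).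
  apply: measurableT_comp; first exact: measurable_expR.
  apply: measurable_funM; last exact: (measurable_fun_enorm measurable_snd).
  by apply: measurable_funM => //; apply: measurable_funM => //.
apply: (@le_lt_trans _ _ (\int[leb]_(t in hline s a) (cst2pi%:E *
    \int[mu]_xi (S xi * expR (- 2 * (sg * t) * enorm xi))%:E))%E).
  apply: ge0_le_integral => //.
  - exact: measurable_hline.
  - by move=> t _; apply: integral_ge0 => y _; rewrite lee_fin.
  - by apply: measurable_funTS; exact: mHt.
  - by apply: measurable_funTS; apply: measurable_funeM; exact: mSt.
  - move=> t ta; apply: le_trans (slice_plancherel T wal ta).
    rewrite le_eqVlt; apply/orP; left; apply/eqP; apply: eq_integral => y _.
    by rewrite /H/= indicE mem_set// !mul1r.
rewrite ge0_integralZl//; last 3 first.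
- by apply: measurable_funTS; exact: mSt.
- by move=> t _; apply: integral_ge0 => xi _; rewrite lee_fin mulr_ge0// expR_ge0.
- by rewrite lee_fin invr_ge0 exprn_ge0// mulr_ge0// pi_ge0.
rewrite tonelli_weight//; last by rewrite /S !al0 expr0n addr0.
have lS : L1 mu (fun xi => expR (2 * a * enorm xi) * S xi / (2 * enorm xi)).
  under eq_fun do rewrite /S mulrDr mulrDl.
  by apply: L1D; exact: lal.
  by rewrite -EFin_Rintegral// -EFinM ltry.
exact: measurable_hline.
Qed.

End synthesis_family.

Section lines.
Context {R : realType} (V : normedModType R).

Lemma derive_line (F : V -> R) (x v : V) (phi : R -> R) (t : R) :
  (forall h : R, F (h *: v + x) = phi (h + t)) ->
  (fun h : R => h^-1 *: ((F \o shift x) (h *: v) - F x)) =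
  (fun h : R => h^-1 *: ((phi \o shift t) (h *: 1) - phi t)).
Proof.
move=> E; apply/funext => h; rewrite /= /shift/= E.
by have := E 0; rewrite scale0r !add0r => ->; rewrite /GRing.scale/= mulr1.
Qed.

(** Both difference quotients are the same function of [h], so directional derivatives can be
    computed by one variable calculus along a line. *)
Lemma is_derive_line (F : V -> R) (x v : V) (phi : R -> R) (t d : R) :
  (forall h : R, F (h *: v + x) = phi (h + t)) ->
  is_derive t (1 : R) phi d <-> is_derive x v F d.
Proof.
move=> /derive_line E; split=> -[dp vp]; split.
- by rewrite /derivable E.
- by rewrite -vp /derive E.
- by rewrite /derivable -E.
- by rewrite -vp /derive -E.
Qed.

End lines.

(** * Cutoffs and the differential equation of the slices *)

Section bump.
Context {R : realType}.

Lemma derive_quad (f : R -> R) (x d C : R) :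
  (forall h, `|f (h + x) - f x - d * h| <= C * h ^+ 2) -> is_derive x (1 : R) f d.
Proof.
move=> H.
have c : (fun h : R => h^-1 *: ((f \o shift x) (h *: 1) - f x)) @ 0^' --> d.
  apply/cvgrPdist_le => e e0; near=> h.
  have h0 : h != 0 by near: h; exact: nbhs_dnbhs_neq.
  have hC : `|h| <= e / (`|C| + 1).
    near: h; apply: nbhs_dnbhs; apply: (@nbhs0_le _ R^o).
    by rewrite divr_gt0// ltr_wpDl.
  rewrite /= /shift/= /GRing.scale/= mulr1.
  have -> : d - h^-1 * (f (h + x) - f x) = - (h^-1 * (f (h + x) - f x - d * h)) by field.
  rewrite normrN normrM normfV ler_pdivrMl ?normr_gt0//.
  apply: le_trans (H h) _; rewrite -(real_normK (num_real h)) mulrC expr2 -mulrA ler_wpM2l//.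
  apply: (@le_trans _ _ (`|h| * (`|C| + 1))).
    by rewrite ler_wpM2l// (le_trans (ler_norm _))// lerDl.
  by rewrite -ler_pdivlMr// ltr_wpDl.
split; first by apply/cvg_ex; exists d.
exact: cvg_lim c.
Unshelve. all: by end_near. Qed.

Lemma is_derive_sqmax (u : R) : is_derive u (1 : R) (fun u => Num.max 0 u ^+ 2) (2 * Num.max 0 u).
Proof.
apply: (@derive_quad _ _ _ 1) => h; rewrite mul1r.
case: (leP 0 (h + u)) => h1; case: (leP 0 u) => h2; rewrite ler_norml; apply/andP; split; nra.
Qed.

(** The square of the positive part of [1 - (t / N)^2] is continuously differentiable and vanishes
    beyond [N], enough for one integration by parts; its derivative is of order [1 / N]. *)
Definition bump (N t : R) : R := Num.max 0 (1 - (t / N) ^+ 2) ^+ 2.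
Definition bumpD (N t : R) : R := 2 * Num.max 0 (1 - (t / N) ^+ 2) * (- 2 * t / N ^+ 2).

Lemma is_derive_bump N t : N != 0 -> is_derive t (1 : R) (bump N) (bumpD N t).
Proof.
move=> N0.
have d1 : is_derive t (1 : R) (fun t => 1 - (t / N) ^+ 2) (- 2 * t / N ^+ 2).
  by apply: is_derive_eq; rewrite /GRing.scale/=; field.
exact: (is_derive1_comp (is_derive_sqmax _) d1).
Qed.

Lemma bump_ge0 N t : 0 <= bump N t. Proof. exact: sqr_ge0. Qed.

Lemma bump_le1 N t : bump N t <= 1.
Proof.
rewrite /bump expr_le1// ?le_max ?lexx// ge_max ler01/= gerBl; exact: sqr_ge0.
Qed.

Lemma bump_out N t : 0 < N -> N <= `|t| -> bump N t = 0 /\ bumpD N t = 0.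
Proof.
move=> N0 Nt; have h : Num.max 0 (1 - (t / N) ^+ 2) = 0.
  apply/max_idPl; rewrite subr_le0 -(real_normK (num_real _)) normrM normfV (gtr0_norm N0).
  by rewrite exprn_ege1// ler_pdivlMr// mul1r.
by rewrite /bump /bumpD h expr0n mulr0 mul0r.
Qed.

Lemma bumpD_le N t : 0 < N -> `|bumpD N t| <= 4 / N.
Proof.
move=> N0; have [Nt|Nt] := leP N `|t|.
  by rewrite (bump_out N0 Nt).2 normr0 divr_ge0// ltW.
rewrite /bumpD normrM normrM (ger0_norm (_ : 0 <= 2))// (ger0_norm (_ : 0 <= Num.max 0 _)); last first.
  by rewrite le_max lexx.
have m1 : Num.max 0 (1 - (t / N) ^+ 2) <= 1 by rewrite ge_max ler01/= gerBl; exact: sqr_ge0.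
have -> : 4 / N = 2 * 1 * (2 / N) by ring.
apply: ler_pM => //.
- by rewrite mulr_ge0// le_max lexx.
- by rewrite ler_wpM2l.
rewrite !normrM normrN (ger0_norm (_ : 0 <= 2))// normfV (ger0_norm (_ : 0 <= N ^+ 2)); last first.
  by rewrite exprn_ge0// ltW.
rewrite -mulrA ler_wpM2l// ler_pdivrMr ?exprn_gt0// expr2 mulrA mulVf ?gt_eqF// mul1r.
exact: ltW.
Qed.

Lemma continuous_bump N : N != 0 -> continuous (bump N).
Proof.
move=> N0 t; apply: differentiable_continuous; apply/derivable1_diffP.
exact: (@ex_derive _ _ _ _ _ _ _ (is_derive_bump t N0)).
Qed.

Lemma continuous_bumpD N : N != 0 -> continuous (bumpD N).
Proof.
move=> N0 t; have c1 : {for t, continuous (fun t : R => 1 - (t / N) ^+ 2)}.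
  have d1 : is_derive t (1 : R) (fun t => 1 - (t / N) ^+ 2) (- 2 * t / N ^+ 2).
    by apply: is_derive_eq; rewrite /GRing.scale/=; field.
  by apply: differentiable_continuous; apply/derivable1_diffP; exact: ex_derive.
have cm : {for t, continuous (fun t : R => Num.max 0 (1 - (t / N) ^+ 2))}.
  exact: (continuous_max (@cst_continuous _ _ (0 : R) t) c1).
apply: cvgM.
  apply: cvgM; first exact: cvg_cst.
  exact: cm.
by apply: cvgM; [apply: cvgM; [exact: cvg_cst|exact: cvg_id]|exact: cvg_cst].
Qed.

End bump.

Section etaN.
Context {R : realType} (n : nat).
Implicit Types (x : 'rV[R]_n) (k : 'I_n).

Definition etaN (N : R) x : R := \prod_(j < n) bump N (x 0 j).
Definition etaD (N : R) k x : R := bumpD N (x 0 k) * \prod_(j < n | j != k) bump N (x 0 j).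

Lemma is_derive_eta N k x : N != 0 -> is_derive x (delta_mx 0 k : 'rV[R]_n) (etaN N) (etaD N k x).
Proof.
move=> N0; pose C := \prod_(j < n | j != k) bump N (x 0 j).
apply: (is_derive_line (phi := fun t => bump N t * C) (t := x 0 k) _ _).1.
  move=> h; rewrite /etaN (bigD1 k)//= !mxE !eqxx mulr1; congr (_ * _).
  by apply: eq_bigr => j jk; rewrite !mxE eqxx (negbTE jk) mulr0 add0r.
have := is_deriveM (is_derive_bump (x 0 k) N0) (is_derive_cst C (x 0 k) (1 : R)).
congr (is_derive _ _ _ _); rewrite /GRing.scale/= mulr0 add0r mulrC.
by [].
Qed.

Lemma continuous_prod_rV (I : Type) (r : seq I) (P : pred I) (F : I -> 'rV[R]_n -> R) :
  (forall i, continuous (F i)) -> continuous (fun x => \prod_(i <- r | P i) F i x).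
Proof.
move=> cF; elim: r => [|i r ih] x.
  rewrite (_ : (fun x => _) = cst 1); first exact: cst_continuous.
  by apply/funext => h; rewrite big_nil.
case Pi: (P i).
  rewrite (_ : (fun x => _) = (F i) \* (fun x => \prod_(i <- r | P i) F i x)); last first.
    by apply/funext => h; rewrite big_cons Pi.
  exact: (continuousM (cF i x) (ih x)).
rewrite (_ : (fun x => _) = (fun x => \prod_(i <- r | P i) F i x)); last first.
  by apply/funext => h; rewrite big_cons Pi.
exact: ih.
Qed.

Lemma continuous_coord (f : R -> R) j : continuous f -> continuous (fun x : 'rV[R]_n => f (x 0 j)).
Proof.
move=> cf x; apply: continuous_comp; last exact: cf.
exact: coord_continuous.
Qed.

Lemma continuous_eta N : N != 0 -> continuous (etaN N).
Proof.
move=> N0; apply: continuous_prod_rV => j; apply: continuous_coord; exact: continuous_bump.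
Qed.

Lemma continuous_etaD N k : N != 0 -> continuous (etaD N k).
Proof.
move=> N0 x.
have c1 : continuous (fun x : 'rV[R]_n => bumpD N (x 0 k)).
  by apply: continuous_coord; exact: continuous_bumpD.
have c2 : continuous (fun x : 'rV[R]_n => \prod_(j < n | j != k) bump N (x 0 j)).
  by apply: continuous_prod_rV => j; apply: continuous_coord; exact: continuous_bump.
exact: (continuousM (c1 x) (c2 x)).
Qed.

Lemma prod_bump_le1 (P : pred 'I_n) N x : 0 <= \prod_(j < n | P j) bump N (x 0 j) <= 1.
Proof.
apply/andP; split; first by apply: prodr_ge0 => j _; exact: bump_ge0.
by apply: prodr_ile1 => j _; rewrite bump_ge0 bump_le1.
Qed.

Lemma eta_le1 N x : 0 <= etaN N x <= 1. Proof. exact: (prod_bump_le1 xpredT). Qed.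

Lemma etaD_le N k x : 0 < N -> `|etaD N k x| <= 4 / N.
Proof.
move=> N0; rewrite /etaD normrM.
have /andP[h0 h1] := prod_bump_le1 [pred j | j != k] N x.
by rewrite -[leRHS]mulr1 ler_pM// ?bumpD_le// ger0_norm.
Qed.

Lemma eta_out N x : 0 < N -> (exists j, N < `|x 0 j|) -> etaN N x = 0.
Proof.
move=> N0 [j Nj]; rewrite /etaN (bigD1 j)//= (bump_out N0 (ltW Nj)).1 mul0r//.
Qed.

Lemma etaD_out N k x : 0 < N -> (exists j, N < `|x 0 j|) -> etaD N k x = 0.
Proof.
move=> N0 [j Nj]; rewrite /etaD; have [->|jk] := eqVneq k j.
  by rewrite (bump_out N0 (ltW Nj)).2 mul0r.
by rewrite (bigD1 j) 1?eq_sym//= (bump_out N0 (ltW Nj)).1 mul0r mulr0.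
Qed.

Lemma cvg_eta x : (fun k : nat => etaN k.+1%:R x) @ \oo --> (1 : R).
Proof.
rewrite -[X in _ --> X](_ : \prod_(j < n) (1 : R) = 1); last by rewrite big1.
apply: cvg_prod_seq => j.
have h : (fun k : nat => Num.max 0 (1 - (x 0 j * k.+1%:R^-1) ^+ 2) ^+ 2) @ \oo --> (Num.max 0 (1 - (x 0 j * 0) ^+ 2) ^+ 2 : R).
  have c : {for (0 : R), continuous (fun u : R => Num.max 0 (1 - (x 0 j * u) ^+ 2) ^+ 2)}.
    have d1 : is_derive (0 : R) (1 : R) (fun u => 1 - (x 0 j * u) ^+ 2) 0.
      by apply: is_derive_eq; rewrite /GRing.scale/=; ring.
    have d2 := is_derive1_comp (is_derive_sqmax _) d1.
    by apply: differentiable_continuous; apply/derivable1_diffP; exact: (@ex_derive _ _ _ _ _ _ _ d2).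
  exact: (cvg_comp _ _ (@cvg_harmonic R) c).
rewrite mulr0 expr0n subr0 (_ : Num.max 0 1 = 1) ?expr1n in h; last by apply/max_idPr; exact: ler01.
exact: h.
Qed.

Lemma cutoff_eta : cutoff (fun k : nat => etaN k.+1%:R).
Proof.
have N0 k : (0 : R) < k.+1%:R by rewrite ltr0n.
split; [split|].
- by move=> k; apply: continuous_measurable_rV; apply: continuous_eta; rewrite gt_eqF.
- by move=> k x; have /andP[h0 h1] := eta_le1 k.+1%:R x; rewrite ger0_norm.
- exact: cvg_eta.
- by move=> k; exists k.+1%:R => x; exact: eta_out.
Qed.

End etaN.

Section compact_bound.
Context {R : realType} (n : nat).

Lemma compact_bounded_at (K : set 'rV[R]_n) (g : 'rV[R]_n -> R) : compact K ->
  (forall x, K x -> {for x, continuous g}) -> exists M, forall x, K x -> `|g x| <= M.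
Proof.
move=> cK cg.
have cgK : {within K, continuous g}.
  by apply: continuous_in_subspaceT => x /set_mem Kx; exact: cg.
have cpt : compact (g @` K) by exact: continuous_compact.
have [M [_ hM]] := compact_bounded (V := R^o) cpt.
exists (M + 1) => x Kx; apply: hM; first by rewrite ltrDl.
by exists x.
Qed.

Definition icube (r : R) : set 'rV[R]_n := [set x | forall j, `|x 0 j| <= r].

Lemma compact_icube r : compact (icube r).
Proof.
have := @rV_compact R n (fun=> `[- r, r]%classic) (fun _ => @segment_compact R _ _).
congr compact; apply/seteqP; split=> x /= h j; have := h j; by rewrite /= in_itv/= ler_norml.
Qed.

Lemma L1_continuous_cube (g : 'rV[R]_n -> R) r : continuous g ->
  (forall x : 'rV[R]_n, (exists j, r < `|x 0 j|) -> g x = 0) -> L1 (mun n) g.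
Proof.
move=> cg g0; have [M hM] := compact_bounded_at (@compact_icube r) (fun x _ => cg x).
by apply: (@L1_cube_le _ _ _ r M) => //; exact: continuous_measurable_rV.
Qed.

End compact_bound.

Section divergence.
Context {R : realType}.
Local Notation leb := (@lebesgue_measure R).

Lemma scale_addE n (h : R) (v w : 'rV[R]_n) j : (h *: v + w) 0 j = h * v 0 j + w 0 j.
Proof. by rewrite !mxE. Qed.

Lemma pt_add0 n (h t : R) (y : 'rV[R]_n) :
  h *: (delta_mx 0 ord0 : 'rV[R]_n.+1) + pt t y = pt (h + t) y.
Proof.
apply/rowP => j; rewrite scale_addE [delta_mx _ _ _ _]mxE eqxx/=; case: (unliftP ord0 j) => [i ->|->].
  by rewrite !(@ptS R n) /= mulr0 add0r.
by rewrite !(@pt00 R n) mulr1.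
Qed.

Lemma pt_addS n (h t : R) (y : 'rV[R]_n) k :
  h *: (delta_mx 0 (lift ord0 k) : 'rV[R]_n.+1) + pt t y = pt t (h *: delta_mx 0 k + y).
Proof.
apply/rowP => j; rewrite scale_addE [delta_mx _ _ _ _]mxE eqxx/=; case: (unliftP ord0 j) => [i ->|->].
  by rewrite !(@ptS R n) scale_addE [delta_mx _ _ _ _]mxE eqxx/= (inj_eq lift_inj).
by rewrite !(@pt00 R n) (negbTE (neq_lift _ _)) mulr0 add0r.
Qed.

Lemma continuous_slice n (g : 'rV[R]_n.+1 -> R) (t : R) y : {for pt t y, continuous g} ->
  {for y, continuous (fun y : 'rV[R]_n => g (pt t y))}.
Proof.
move=> cg; suff H : g (pt t z) @[z --> y] --> g (pt t y) by exact: H.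
apply/(@cvgrPdist_le _ _ _ _ (nbhs_filter (y : 'rV[R]_n))) => e e0.
move: cg => /cvgrPdist_le /(_ _ e0) /nbhs_ballP[r r0 h].
apply/nbhs_ballP; exists r => // z [_ yz]; apply: h; split => // i j.
case: (unliftP ord0 j) => [k ->|->]; rewrite (ord1 i) ?(@ptS R n) ?(@pt00 R n); first exact: yz.
exact: ballxx.
Qed.

Lemma continuous_slice0 n (g : 'rV[R]_n.+1 -> R) (t : R) (y : 'rV[R]_n) : {for pt t y, continuous g} ->
  {for t, continuous (fun t : R => g (pt t y))}.
Proof.
move=> cg; suff H : g (pt z y) @[z --> t] --> g (pt t y) by exact: H.
apply/cvgrPdist_le => e e0; move: cg => /cvgrPdist_le /(_ _ e0) /nbhs_ballP[r r0 h].
apply/nbhs_ballP; exists r => // z yz; apply: h; split => // i j.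
case: (unliftP ord0 j) => [k ->|->]; rewrite (ord1 i) ?(@ptS R n) ?(@pt00 R n); last exact: yz.
exact: ballxx.
Qed.

(** Induction on the dimension. A derivative in a later coordinate is handled on each slice by the
    induction hypothesis; a derivative in the first coordinate is integrated first, after Fubini,
    and its primitive vanishes at both ends. *)
Lemma int_partial0 n (k : 'I_n) (G g : 'rV[R]_n -> R) (r : R) : 0 <= r ->
  (forall x, is_derive x (delta_mx 0 k : 'rV[R]_n) G (g x)) -> continuous g ->
  (forall x : 'rV[R]_n, (exists j, r < `|x 0 j|) -> G x = 0) ->
  (forall x : 'rV[R]_n, (exists j, r < `|x 0 j|) -> g x = 0) ->
  \int[mun n]_x g x = 0.
Proof.
move=> r0; elim: n k G g => [[]//|n ih] k G g dG cg G0 g0.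
have lg := L1_continuous_cube cg g0.
have csl t : continuous (fun y : 'rV[R]_n => g (pt t y)) by move=> y; exact/continuous_slice/cg.
have g0s t (y : 'rV[R]_n) : (exists j, r < `|y 0 j|) -> g (pt t y) = 0.
  by move=> [j hj]; apply: g0; exists (lift ord0 j); rewrite (@ptS R n).
have lsl t : L1 (mun n) (fun y => g (pt t y)) by apply: (L1_continuous_cube (csl t)) => y; exact: g0s.
rewrite Rint_munS//.
case: (unliftP ord0 k) dG => [j ->|->] dG.
  rewrite (_ : (fun t => _) = fun=> 0); first by rewrite Rintegral_cst// ?mul0r.
  apply/funext => t; apply: (ih j (fun y => G (pt t y))) => //.
  - move=> y; apply: (is_derive_line (phi := fun h => G (h *: delta_mx 0 (lift ord0 j) + pt t y)) (t := 0) _ _).1.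
      by move=> h; rewrite addr0 pt_addS.
    apply: (is_derive_line (F := G) (x := pt t y) _ _).2 (dG (pt t y)).
    by move=> h; rewrite addr0.
  - by move=> y [i hi]; apply: G0; exists (lift ord0 i); rewrite (@ptS R n).
  - by move=> y; exact: g0s.
(* The maximum of [g] on the box, times the product of the indicators of the box, is the integrable
   majorant for Fubini. *)
have [M hM] := compact_bounded_at (@compact_icube R n.+1 r) (fun x _ => cg x).
have M0 : 0 <= M by apply: le_trans (hM 0 _) => // j; rewrite mxE normr0.
have mg := continuous_measurable_rV cg.
have lI : L1 leb (fun t : R => M * \1_(`[- r, r]%classic : set R) t).
  by apply: L1Z; exact: integrable_indic_itv.
have fub : \int[leb]_t \int[mun n]_y g (pt t y) = \int[mun n]_y \int[leb]_t g (pt t y).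
  apply: (@Rint_fubini _ _ _ _ R leb (mun n) (fun p : measurableTypeR R * 'rV[R]_n => g (pt p.1 p.2)) _ _ _ lI (@L1_cube R n r)).
    exact: (measurableT_comp mg (@measurable_consr R n)).
  move=> t y; have [/forallP hc|/forallPn[j]] := boolP [forall j, `|pt t y 0 j| <= r].
    rewrite indicE mem_set; last by rewrite /= in_itv/= -ler_norml; have := hc ord0; rewrite (@pt00 R n).
    rewrite cubeE; first by rewrite !mulr1; exact: hM.
    by move=> j; have := hc (lift ord0 j); rewrite (@ptS R n).
  rewrite -ltNge => hj; rewrite g0 ?normr0; last by exists j.
  by rewrite mulr_ge0 ?cube_ge0// mulr_ge0.
rewrite fub (_ : (fun y => _) = fun=> 0); first by rewrite Rintegral_cst// ?mul0r.
apply/funext => y.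
have dt t : is_derive t (1 : R) (fun t => G (pt t y)) (g (pt t y)).
  apply: (is_derive_line (F := G) (x := pt t y) _ _).2 (dG (pt t y)).
  by move=> h; rewrite pt_add0.
have ct : continuous (fun t => g (pt t y)) by move=> t; exact/continuous_slice0/cg.
have lt : L1 leb (fun t => g (pt t y)).
  apply: L1_le lI; first exact: continuous_measurable_fun.
  move=> t; have [/forallP hc|/forallPn[j]] := boolP [forall j, `|pt t y 0 j| <= r].
    rewrite indicE mem_set; last by rewrite /= in_itv/= -ler_norml; have := hc ord0; rewrite (@pt00 R n).
    by rewrite mulr1; exact: hM.
  by rewrite -ltNge => hj; rewrite g0 ?normr0 ?mulr_ge0//; exists j.
apply: (@Rint_derive0 R (fun t => G (pt t y))) => //.
- apply: cvg_near_cst; near=> k'; apply: G0; exists ord0; rewrite (@pt00 R n) ger0_norm//.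
  by near: k'; exact: nbhs_infty_gtr.
- apply: cvg_near_cst; near=> k'; apply: G0; exists ord0; rewrite (@pt00 R n) normrN ger0_norm//.
  by near: k'; exact: nbhs_infty_gtr.
Unshelve. all: by end_near. Qed.

End divergence.

(** * The differential equation of the cut off slices *)

Section slices.
Context {R : realType} (m : nat) (s : bool) (a : R) (f : 'rV[R]_(1 + m) -> Cl R m).
Hypothesis mono : left_monogenic (@halfspace R m s a) f.
Local Notation mu := (@mun R m).
Local Notation leb := (@lebesgue_measure R).
Local Notation sg := (sgn R s).
Implicit Types (T : {set 'I_m}) (w : 'rV[R]_m -> R).

Definition supp (r : R) w := forall x : 'rV[R]_m, (exists j, r < `|x 0 j|) -> w x = 0.

Definition uD (k : 'I_(1 + m)) T im (x : 'rV[R]_(1 + m)) : R := 'D_(@dir R m k) (Defs.comp f T im) x.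

Lemma halfspace_pt t (x : 'rV[R]_m) : hline s a t -> halfspace s a (pt t x).
Proof. by rewrite halfspaceE x0_of_pt. Qed.

Lemma is_derive_comp T im k x : halfspace s a x ->
  is_derive x (@dir R m k) (Defs.comp f T im) (uD k T im x).
Proof.
move=> xa; have [_ [d _]] := mono.
by apply: DeriveDef => //; apply: diff_derivable; exact: d.
Qed.

Lemma comp_continuous T im x : halfspace s a x -> {for x, continuous (Defs.comp f T im)}.
Proof. by move=> xa; have [_ [d _]] := mono; apply: differentiable_continuous; exact: d. Qed.

Lemma uD_continuous k T im x : halfspace s a x -> {for x, continuous (uD k T im)}.
Proof. by move=> xa; have [_ [_ [c _]]] := mono; exact: c. Qed.

Lemma slice_continuous T im t : hline s a t -> continuous (fun x : 'rV[R]_m => cpt (f (pt t x)) T im).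
Proof. by move=> ta x; exact: (@continuous_slice R m (Defs.comp f T im) t x (@comp_continuous T im _ (halfspace_pt x ta))). Qed.

Lemma uD_slice_continuous k T im t : hline s a t -> continuous (fun x : 'rV[R]_m => uD k T im (pt t x)).
Proof. by move=> ta x; exact: (@continuous_slice R m (uD k T im) t x (@uD_continuous k T im _ (halfspace_pt x ta))). Qed.

Lemma L1_slice w r (v : 'rV[R]_m -> R) : continuous w -> supp r w -> continuous v ->
  L1 mu (fun x => w x * v x).
Proof.
move=> cw w0 cv; apply: (@L1_continuous_cube R m _ r).
  by move=> x; exact: (continuousM (cw x) (cv x)).
by move=> x xr; rewrite w0// mul0r.
Qed.

Lemma hline_near t : hline s a t -> exists2 d : R, 0 < d & forall t', `|t' - t| <= d -> hline s a t'.
Proof.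
rewrite /hline/= => ta; exists ((sg * t + a) / 2); first by rewrite divr_gt0//; lra.
move=> t' h; have : `|sg * (t' - t)| <= (sg * t + a) / 2 by rewrite normrM normr_sgn mul1r.
by rewrite ler_norml mulrBr => /andP[h1 _]; lra.
Qed.

Lemma slice_int_derive w r T im t : continuous w -> supp r w -> hline s a t ->
  is_derive t (1 : R) (fun t => \int[mu]_x (w x * cpt (f (pt t x)) T im))
    (\int[mu]_x (w x * uD ord0 T im (pt t x))).
Proof.
move=> cw w0 ta; have [d d0 hd] := hline_near ta.
pose F (t : R) (x : 'rV[R]_m) := w x * cpt (f (pt t x)) T im.
have inI t' : `]t - d, t + d[%classic t' -> hline s a t'.
  move=> /=; rewrite in_itv/= => /andP[h1 h2]; apply: hd.
  by rewrite ler_norml; apply/andP; split; lra.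
have dF t' x : hline s a t' -> is_derive t' (1 : R) (F ^~ x) (w x * uD ord0 T im (pt t' x)).
  move=> ta'; have h : is_derive t' (1 : R) (fun t => Defs.comp f T im (pt t x)) (uD ord0 T im (pt t' x)).
    apply: (is_derive_line (F := Defs.comp f T im) (x := pt t' x) _ _).2 (is_derive_comp T im ord0 (halfspace_pt x ta')).
    by move=> h; rewrite (@pt_add0 R m).
  exact: (is_deriveZ (w x) h).
(* The box with sides [[t - d, t + d]] and [[- r, r]] is compact and lies in the half space, so
   continuity bounds the [x0] derivative there uniformly in time. *)
pose A (i : 'I_(1 + m)) : set R := if i == ord0 then `[t - d, t + d]%classic else `[- r, r]%classic.
pose K : set 'rV[R]_(1 + m) := [set v | forall i, A i (v 0 i)].
have cK : compact K.
  have cA i : compact (A i) by rewrite /A; case: ifP => _; exact: segment_compact.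
  exact: (rV_compact cA).
have K0 v : K v -> halfspace s a v.
  move=> /(_ ord0); rewrite /A eqxx /= in_itv/= => /andP[h1 h2].
  rewrite halfspaceE (@x0_ofE R m); apply: hd.
  by rewrite ler_norml; apply/andP; split; lra.
have [M hM] := compact_bounded_at cK (fun v Kv => @uD_continuous ord0 T im _ (K0 v Kv)).
have [M' hM'] := compact_bounded_at (@compact_icube R m r) (fun x _ => cw x).
pose G (x : 'rV[R]_m) := `|M'| * `|M| * cube r x.
have h1 : t \in `]t - d, t + d[ by rewrite in_itv/=; apply/andP; split; lra.
have h2 t' : `]t - d, t + d[%classic t' -> mu.-integrable setT (EFin \o F t').
  by move=> /inI ta'; apply: (L1_slice cw w0); exact: slice_continuous.
have h3 t' x : `]t - d, t + d[%classic t' -> setT x -> derivable (F ^~ x) t' 1.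
  by move=> /inI ta' _; exact: (@ex_derive _ _ _ _ _ _ _ (dF t' x ta')).
have h4 x : 0 <= G x by rewrite !mulr_ge0 ?cube_ge0.
have h5 : mu.-integrable setT (EFin \o G) by apply: L1Z; exact: L1_cube.
have pE t' x : hline s a t' -> partial1of2 F t' x = w x * uD ord0 T im (pt t' x).
  by move=> ta'; rewrite partial1of2E (@derive_val _ _ _ _ _ _ _ (dF t' x ta')).
have h6 t' x : `]t - d, t + d[%classic t' -> setT x -> `|partial1of2 F t' x| <= G x.
  move=> It' _; rewrite pE; last exact: inI.
  have [/forallP hc|/forallPn[j]] := boolP [forall j, `|x 0 j| <= r]; last first.
    by rewrite -ltNge => hj; rewrite w0 ?mul0r ?normr0//; exists j.
  rewrite /G cubeE// mulr1 normrM; apply: ler_pM => //.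
    by apply: le_trans (ler_norm _); exact: hM'.
  apply: le_trans (ler_norm _); apply: hM => i; rewrite /A; case: (unliftP ord0 i) => [j ->|->].
    by rewrite eq_sym (negbTE (neq_lift _ _)) (@ptS R m) /= in_itv/= -ler_norml; exact: hc.
  rewrite eqxx (@pt00 R m) /= in_itv/=.
  by move: It' => /=; rewrite in_itv/= => /andP[h1' h2']; rewrite !ltW.
have D1 := derivable_under_integral measurableT h1 h2 h3 h4 h5 h6.
have D2 := differentiation_under_integral measurableT h1 h2 h3 h4 h5 h6.
apply: DeriveDef; first exact: D1.
rewrite -derive1E D2; congr Rintegral; apply/funext => x; exact: pE.
Qed.

Definition cosw w (th : R) (xi x : 'rV[R]_m) : R := w x * cos (dotp x xi + th).

Lemma continuous_dotp (xi : 'rV[R]_m) : continuous (fun x : 'rV[R]_m => dotp x xi).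
Proof.
have -> : (fun x : 'rV[R]_m => dotp x xi) = linf (fun k => xi 0 k).
  by apply/funext => x; rewrite /dotp /linf; apply: eq_bigr => k _; rewrite mulrC.
exact: linf_continuous.
Qed.

Lemma continuous_cosd (th : R) (xi : 'rV[R]_m) : continuous (fun x : 'rV[R]_m => cos (dotp x xi + th)).
Proof.
move=> x.
apply: (@continuous_comp _ _ _ (fun x : 'rV[R]_m => dotp x xi) (fun q : R => cos (q + th)) x).
  exact: continuous_dotp.
apply: continuous_comp; last exact: continuous_cos.
by apply: cvgD; [exact: cvg_id|exact: cvg_cst].
Qed.

Lemma continuous_cosw w th xi : continuous w -> continuous (cosw w th xi).
Proof. by move=> cw x; exact: (continuousM (cw x) (@continuous_cosd th xi x)). Qed.

Lemma supp_cosw r w th xi : supp r w -> supp r (cosw w th xi).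
Proof. by move=> w0 x xr; rewrite /cosw w0// mul0r. Qed.

(* [sY w xi t] is the Fourier transform at [xi] of the slice [w * f (t, .)]:
   since [- sin z = cos (z + pi / 2)], both parts come from one cosine integral. *)
Definition sE w (th : R) xi (t : R) T im : R := \int[mu]_x (cosw w th xi x * cpt (f (pt t x)) T im).
Definition sY w xi t T im : R := sE w 0 xi t T im + iF (sE w (pi / 2) xi t) T im.

Lemma L1_sE w r th xi t T im : continuous w -> supp r w -> hline s a t ->
  L1 mu (fun x => cosw w th xi x * cpt (f (pt t x)) T im).
Proof.
move=> cw w0 ta; apply: (L1_slice (@continuous_cosw _ th xi cw) (supp_cosw th xi w0)).
exact: slice_continuous.
Qed.

Section fixed_cutoff.
Variables (N : R).
Hypothesis N0 : 0 < N.

Lemma supp_eta : supp N (@etaN R m N). Proof. by move=> x; exact: eta_out. Qed.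
Lemma supp_etaD k : supp N (@etaD R m N k). Proof. by move=> x; exact: etaD_out. Qed.
Let cN : continuous (@etaN R m N). Proof. by apply: continuous_eta; rewrite gt_eqF. Qed.
Let cND k : continuous (@etaD R m N k). Proof. by apply: continuous_etaD; rewrite gt_eqF. Qed.

(** Integration by parts moves the derivative to the cutoff, which gives the error term, and to the
    cosine, which gives the factor [xi_k] and the phase shift [pi / 2]. *)
Lemma slice_ibp (k : 'I_m) th xi t T im : hline s a t ->
  \int[mu]_x (cosw (etaN N) th xi x * uD (lift ord0 k) T im (pt t x)) =
  - sE (etaD N k) th xi t T im - xi 0 k * sE (etaN N) (th + pi / 2) xi t T im.
Proof.
move=> ta.
pose u (x : 'rV[R]_m) := cpt (f (pt t x)) T im.
pose c (th : R) (x : 'rV[R]_m) := cos (dotp x xi + th).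
pose g x := etaN N x * (c th x * uD (lift ord0 k) T im (pt t x) + u x * (xi 0 k * c (th + pi / 2) x))
  + c th x * u x * etaD N k x.
have du x : is_derive x (delta_mx 0 k : 'rV[R]_m) u (uD (lift ord0 k) T im (pt t x)).
  apply: (is_derive_line (phi := fun h => Defs.comp f T im (h *: delta_mx 0 (lift ord0 k) + pt t x)) (t := 0) _ _).1.
    by move=> h; rewrite addr0 (@pt_addS R m).
  apply: (is_derive_line (F := Defs.comp f T im) (x := pt t x) _ _).2 (is_derive_comp T im (lift ord0 k) (halfspace_pt x ta)).
  by move=> h; rewrite addr0.
have dc x : is_derive x (delta_mx 0 k : 'rV[R]_m) (c th) (xi 0 k * c (th + pi / 2) x).
  apply: (is_derive_line (phi := fun h => cos (h * xi 0 k + (dotp x xi + th))) (t := 0) _ _).1.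
    move=> h; rewrite addr0 /c dotpDl addrA; congr (cos (_ + _ + _)).
    rewrite /dotp (bigD1 k)//= big1 ?addr0 ?mxE ?eqxx ?mulr1//.
    by move=> j jk; rewrite !mxE (negbTE jk) andbF mulr0 mul0r.
  have -> : c (th + pi / 2) x = - sin (dotp x xi + th) by rewrite /c addrA cosDpihalf.
  apply: is_derive_eq; rewrite /GRing.scale/= mul0r add0r.
  by rewrite !(mulr0, addr0, add0r, mulr1, mul1r); ring.
have dG x : is_derive x (delta_mx 0 k : 'rV[R]_m) (fun x => etaN N x * (c th x * u x)) (g x).
  have := is_deriveM (is_derive_eta k x (lt0r_neq0 N0)) (is_deriveM (dc x) (du x)).
  by congr (is_derive _ _ _ _); rewrite /g /GRing.scale/=; ring.
have cg : continuous g.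
  move=> x; have cc th' : {for x, continuous (c th')} by exact: continuous_cosd.
  have cu : {for x, continuous u} by exact: slice_continuous.
  have cuD : {for x, continuous (fun x => uD (lift ord0 k) T im (pt t x))} by exact: uD_slice_continuous.
  have c1 := continuousM (cu) (continuousM (@cst_continuous _ _ (xi 0 k) x) (cc (th + pi / 2))).
  have cNx : {for x, continuous (etaN N)} by exact: cN.
  have cNDx : {for x, continuous (etaD N k)} by exact: cND.
  have c2 := continuousM cNx (continuousD (continuousM (cc th) cuD) c1).
  exact: (continuousD c2 (continuousM (continuousM (cc th) cu) cNDx)).
have I0 : \int[mu]_x g x = 0.
  apply: (int_partial0 (ltW N0) dG cg) => x xN; first by rewrite eta_out// mul0r.
  by rewrite /g eta_out// etaD_out// mul0r mulr0 addr0.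
have l1 : L1 mu (fun x => cosw (etaN N) th xi x * uD (lift ord0 k) T im (pt t x)).
  apply: (L1_slice (@continuous_cosw _ th xi cN) (supp_cosw th xi supp_eta)).
  exact: uD_slice_continuous.
have l2 := L1_sE (th + pi / 2) xi T im cN supp_eta ta.
have l3 := L1_sE th xi T im (@cND k) (supp_etaD k) ta.
have E : \int[mu]_x g x = \int[mu]_x (cosw (etaN N) th xi x * uD (lift ord0 k) T im (pt t x)) +
   (xi 0 k * sE (etaN N) (th + pi / 2) xi t T im + sE (etaD N k) th xi t T im).
  rewrite /sE -RintZ// -RintD//; last exact: L1Z.
  rewrite -RintD//; last by apply: L1D => //; exact: L1Z.
  by congr Rintegral; apply/funext => x; rewrite /g /cosw /c /u; ring.
by move: E; rewrite I0 => /esym/eqP; rewrite addr_eq0 => /eqP ->; ring.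
Qed.

Lemma sE_pi w th xi t T im : continuous w -> (exists r, supp r w) -> hline s a t ->
  sE w (th + pi) xi t T im = - sE w th xi t T im.
Proof.
move=> cw [r w0] ta; rewrite /sE -RintN; last exact: (L1_sE _ _ _ _ cw w0 ta).
by congr Rintegral; apply/funext => x; rewrite /cosw addrA cosDpi; ring.
Qed.

(** The Dirac equation replaces the [x0] derivative by derivatives along the slice, and these are
    integrated by parts. *)
Lemma sE_derive th xi t T im : hline s a t ->
  is_derive t (1 : R) (fun t => sE (etaN N) th xi t T im)
   (\sum_(k < m) esgn k T * (sE (etaD N k) th xi t (flip k T) im
      + xi 0 k * sE (etaN N) (th + pi / 2) xi t (flip k T) im)).
Proof.
move=> ta; have := slice_int_derive T im (@continuous_cosw _ th xi cN) (supp_cosw th xi supp_eta) ta.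
congr (is_derive _ _ _ _).
have [_ [_ [_ eq0]]] := mono.
have lk k T' : L1 mu (fun x => cosw (etaN N) th xi x * uD (lift ord0 k) T' im (pt t x)).
  apply: (L1_slice (@continuous_cosw _ th xi cN) (supp_cosw th xi supp_eta)).
  exact: uD_slice_continuous.
have E x : cosw (etaN N) th xi x * uD ord0 T im (pt t x) =
   \sum_(k < m) - esgn k T * (cosw (etaN N) th xi x * uD (lift ord0 k) (flip k T) im (pt t x)).
  have := (monogenicP f (pt t x)).1 (eq0 _ (halfspace_pt x ta)) T im.
  move=> /eqP; rewrite addr_eq0 => /eqP h; rewrite {1}/uD h mulrN mulr_sumr -sumrN.
  by apply: eq_bigr => k _; rewrite /uD; ring.
under eq_Rintegral do rewrite E.
rewrite Rint_sum; last by move=> k _; apply: L1Z; exact: lk.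
by apply: eq_bigr => k _; rewrite RintZ// slice_ibp//; ring.
Qed.

(* The error which the cutoff introduces in the ODE. *)
Definition sr xi t T im : R := \sum_(k < m) esgn k T * sY (etaD N k) xi t (flip k T) im.

Lemma is_derive_iF (u : R -> {set 'I_m} -> bool -> R) (du : {set 'I_m} -> bool -> R) t :
  (forall T im, is_derive t (1 : R) (fun t => u t T im) (du T im)) ->
  forall T im, is_derive t (1 : R) (fun t => iF (u t) T im) (iF du T im).
Proof. by move=> d T [|]; rewrite /iF//=; exact: is_deriveN (d T true). Qed.

(** The equation [d/dt F_t = - i xi F_t] for the cut off slice: the terms that differentiate the
    cutoff form [sr], and the phase shifts [pi / 2] assemble into multiplication by [i]. *)
Lemma sY_derive xi t T im : hline s a t ->
  is_derive t (1 : R) (fun t => sY (etaN N) xi t T im) (sr xi t T im - NF xi (sY (etaN N) xi t) T im).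
Proof.
move=> ta.
have d0 T' b := sE_derive 0 xi T' b ta.
have d1 := is_derive_iF (fun T' b => sE_derive (pi / 2) xi T' b ta).
have := is_deriveD (d0 T im) (d1 T im).
congr (is_derive _ _ _ _).
rewrite /sr /NF -sumrB.
have -> : iF (fun T im => \sum_(k < m) esgn k T * (sE (etaD N k) (pi / 2) xi t (flip k T) im
      + xi 0 k * sE (etaN N) (pi / 2 + pi / 2) xi t (flip k T) im)) T im =
   \sum_(k < m) esgn k T * (iF (sE (etaD N k) (pi / 2) xi t) (flip k T) im
      - xi 0 k * iF (sE (etaN N) 0 xi t) (flip k T) im).
  have p : pi / 2 + pi / 2 = 0 + pi :> R by field.
  have sp T' b : sE (etaN N) (pi / 2 + pi / 2) xi t T' b = - sE (etaN N) 0 xi t T' b.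
    by rewrite p sE_pi//; exists N; exact: supp_eta.
  rewrite /iF; case: im d0 d1 => _ _; rewrite -?sumrN; apply: eq_bigr => k _; rewrite sp; ring.
rewrite -big_split/=; apply: eq_bigr => k _; rewrite add0r.
have -> : iF (sY (etaN N) xi t) (flip k T) im =
   iF (sE (etaN N) 0 xi t) (flip k T) im - sE (etaN N) (pi / 2) xi t (flip k T) im.
  by rewrite /sY; case: im {d0 d1}; rewrite /iF/= ?opprD; ring.
by rewrite {1}/sY; ring.
Qed.

End fixed_cutoff.

End slices.

(** * Integration of the equation in time *)

Section cauchy_schwarz.
Context d (X : measurableType d) (R : realType) (mu : {measure set X -> \bar R}).

Lemma Rint_sqr_le (p q : X -> R) : measurable_fun setT p -> measurable_fun setT q ->
  L1 mu (fun x => p x ^+ 2) -> L1 mu (fun x => q x ^+ 2) -> 0 < \int[mu]_x (p x ^+ 2) ->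
  (\int[mu]_x (p x * q x)) ^+ 2 <= \int[mu]_x (p x ^+ 2) * \int[mu]_x (q x ^+ 2).
Proof.
move=> mp mq lp lq A0; have lpq := L1_sqM mp mq lp lq.
set A := \int[mu]_x (p x ^+ 2) in A0 *; set B := \int[mu]_x (p x * q x); set C := \int[mu]_x (q x ^+ 2).
(* The minimiser of [C - 2 l B + l^2 A], the integral of [(q - l p)^2]. *)
pose l := B / A.
have E : \int[mu]_x ((q x - l * p x) ^+ 2) = C + (- 2 * l * B + l ^+ 2 * A).
  rewrite /A /B /C -(RintZ _ lpq) -(RintZ _ lp) -RintD; [|exact: L1Z|exact: L1Z].
  rewrite -RintD//; last by apply: L1D; exact: L1Z.
  by congr Rintegral; apply/funext => x; ring.
have : 0 <= C + (- 2 * l * B + l ^+ 2 * A).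
  by rewrite -E; apply: Rintegral_ge0 => x _; exact: sqr_ge0.
have -> : C + (- 2 * l * B + l ^+ 2 * A) = C - B ^+ 2 / A by rewrite /l; field; rewrite gt_eqF.
by rewrite subr_ge0 ler_pdivrMr// mulrC.
Qed.

End cauchy_schwarz.

Section interval_cs.
Context {R : realType}.
Local Notation leb := (@lebesgue_measure R).

Lemma itv_sqr_le (h : R -> R) (t0 t1 : R) : t0 < t1 -> {within `[t0, t1], continuous h} ->
  (((\int[leb]_(t in `[t0, t1]) h t) ^+ 2)%:E <= (t1 - t0)%:E * \int[leb]_(t in `[t0, t1]) (h t ^+ 2)%:E)%E.
Proof.
move=> t01 ch.
pose D := `[t0, t1]%classic : set R.
have mD : measurable D by exact: measurable_itv.
have mh : measurable_fun D h by exact: subspace_continuous_measurable_fun.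
pose q (t : R) := (h \_ D) t.
have mq : measurable_fun setT q by apply/(measurable_restrictT h mD).
have ch2 : {within `[t0, t1], continuous (fun t => h t ^+ 2)}.
  by move=> x; exact: (cvgM (ch x) (ch x)).
have i1 := continuous_compact_integrable (@segment_compact R t0 t1) ch.
have i2 := continuous_compact_integrable (@segment_compact R t0 t1) ch2.
have qE t : q t = \1_D t * q t.
  by rewrite /q patchE indicE; case: ifP => _; rewrite ?mul1r ?mul0r.
have q2E : (fun t => (q t ^+ 2)%:E) = ((fun t => (h t ^+ 2)%:E) \_ D).
  by apply/funext => t; rewrite /q !patchE; case: ifP => _ //; rewrite expr0n.
have l2 : L1 leb (fun t => q t ^+ 2).
  by rewrite q2E -integrable_mkcond.
have lp : L1 leb (fun t => \1_D t ^+ 2).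
  have -> : (fun t => (\1_D t ^+ 2 : R)%:E) = (fun t => (\1_D t)%:E).
    by apply/funext => t; rewrite indicE; case: (_ \in _); rewrite ?expr1n ?expr0n.
  exact: integrable_indic_itv.
have pE : \int[leb]_t (\1_D t ^+ 2) = t1 - t0.
  have -> : (fun t => (\1_D t ^+ 2 : R)) = \1_D.
    by apply/funext => t; rewrite indicE; case: (_ \in _); rewrite ?expr1n ?expr0n.
  have e : leb D = (t1 - t0)%:E by rewrite /D lebesgue_measure_itv/= lte_fin t01 -EFinB.
  by rewrite /Rintegral integral_indic// setIT; transitivity (fine (leb D)); rewrite // e.
have m1 : measurable_fun setT (\1_D : R -> R) by exact: measurable_indic.
have := @Rint_sqr_le _ _ R leb _ _ m1 mq lp l2; rewrite pE subr_gt0 => /(_ t01).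
have -> : \int[leb]_x (\1_D x * q x) = \int[leb]_(t in `[t0, t1]) h t.
  rewrite [RHS]Rintegral_mkcond; congr Rintegral; apply/funext => t; by rewrite -qE.
move=> le; apply: (@le_trans _ _ ((t1 - t0) * \int[leb]_x (q x ^+ 2))%:E); first by rewrite lee_fin.
by rewrite EFinM (EFin_Rintegral l2) q2E -integral_mkcond.
Qed.

End interval_cs.

Section ode_consequence.
Context {R : realType} (m : nat) (s : bool) (a : R) (f : 'rV[R]_(1 + m) -> Cl R m).
Hypothesis mono : left_monogenic (@halfspace R m s a) f.
Local Notation mu := (@mun R m).
Local Notation leb := (@lebesgue_measure R).
Implicit Types (T : {set 'I_m}) (xi : 'rV[R]_m).

Lemma chiF_derive (c : R) xi (u : R -> {set 'I_m} -> bool -> R) (du : {set 'I_m} -> bool -> R) t :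
  (forall T im, is_derive t (1 : R) (fun t => u t T im) (du T im)) ->
  forall T im, is_derive t (1 : R) (fun t => chiF c xi (u t) T im) (chiF c xi du T im).
Proof.
move=> d T im; have di := is_derive_iF d.
have dN : is_derive t (1 : R) (fun t => NF xi (u t) T im) (NF xi du T im).
  have := @is_derive_sum _ _ _ m (fun k t => xi 0 k * esgn k T * iF (u t) (flip k T) im) t (1 : R)
    (fun k => xi 0 k * esgn k T * iF du (flip k T) im)
    (fun k => is_deriveZ (xi 0 k * esgn k T) (di (flip k T) im)).
  by congr (is_derive _ _ _ _); apply/funext => t'; rewrite /NF fct_sumE.
exact: (is_deriveD (is_deriveZ (2^-1) (d T im)) (is_deriveZ (c / (2 * enorm xi)) dN)).
Qed.

Lemma NF0 (u : {set 'I_m} -> bool -> R) T im : NF 0 u T im = 0.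
Proof. by rewrite /NF big1// => k _; rewrite mxE !mul0r. Qed.

Lemma NF_chiF_all (c : R) xi u T im : c ^+ 2 = 1 ->
  NF xi (chiF c xi u) T im = c * enorm xi * chiF c xi u T im.
Proof.
move=> c1; have [->|x0] := eqVneq xi 0; last exact: NF_chiF.
have -> : enorm (0 : 'rV[R]_m) = 0 by apply/eqP; rewrite enorm_eq0.
by rewrite NF0 mulr0 mul0r.
Qed.

Lemma chiF_NF (c : R) xi u T im : chiF c xi (NF xi u) T im = NF xi (chiF c xi u) T im.
Proof. by rewrite /chiF NF_lin. Qed.

Section fixed.
Variables (N c : R) (xi : 'rV[R]_m).
Hypotheses (N0 : 0 < N) (c1 : c ^+ 2 = 1).

(** The exponential is an integrating factor: [chiF c] maps into the eigenspace where [i xi] acts as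
    [c |xi|], so the main term of the equation cancels and the derivative of [sZ] is the cutoff
    error [sq] alone. *)
Definition sZ t T im : R := expR (c * t * enorm xi) * chiF c xi (sY f (etaN N) xi t) T im.
Definition sq t T im : R := expR (c * t * enorm xi) * chiF c xi (sr f N xi t) T im.

Lemma is_derive_expc (t : R) : is_derive t (1 : R) (fun t => expR (c * t * enorm xi)) (c * enorm xi * expR (c * t * enorm xi)).
Proof. by apply: is_derive_eq; rewrite /GRing.scale/=; ring. Qed.

Lemma sZ_derive t T im : hline s a t -> is_derive t (1 : R) (fun t => sZ t T im) (sq t T im).
Proof.
move=> ta.
have d1 := chiF_derive c xi (fun T im => sY_derive mono N0 xi T im ta) T im.
have := is_deriveM (is_derive_expc t) d1.
congr (is_derive _ _ _ _).
have E : chiF c xi (fun T im => sr f N xi t T im - NF xi (sY f (etaN N) xi t) T im) T im =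
   chiF c xi (sr f N xi t) T im - c * enorm xi * chiF c xi (sY f (etaN N) xi t) T im.
  rewrite -NF_chiF_all// -chiF_NF.
  have := chiF_lin c xi 1 (-1) (sr f N xi t) (NF xi (sY f (etaN N) xi t)) T im.
  rewrite !mul1r !mulN1r => <-; congr chiF; apply/funext => T'; apply/funext => b.
  by rewrite mul1r mulN1r.
by rewrite E /sq /GRing.scale/=; ring.
Qed.

Lemma sY_derivable w r t : continuous w -> supp r w -> hline s a t ->
  exists du, forall T im, is_derive t (1 : R) (fun t => sY f w xi t T im) (du T im).
Proof.
move=> cw w0 ta.
have d th T im := slice_int_derive mono T im (@continuous_cosw R m w th xi cw) (supp_cosw th xi w0) ta.
eexists => T im.
exact: (is_deriveD (d 0 T im) (is_derive_iF (d (pi / 2)) T im)).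
Qed.

Lemma sq_continuous t T im : hline s a t -> {for t, continuous (fun t => sq t T im)}.
Proof.
move=> ta.
have cD k : continuous (@etaD R m N k) by apply: continuous_etaD; rewrite gt_eqF.
have dk k : exists du, forall T im, is_derive t (1 : R) (fun t => sY f (etaD N k) xi t T im) (du T im).
  exact: (sY_derivable (@cD k) (supp_etaD N0 k) ta).
have [dY hY] := choice dk.
have dr T' b : is_derive t (1 : R) (fun t => sr f N xi t T' b)
   (\sum_(k < m) esgn k T' * dY k (flip k T') b).
  have := @is_derive_sum _ _ _ m (fun k t => esgn k T' * sY f (etaD N k) xi t (flip k T') b) t (1 : R)
    (fun k => esgn k T' * dY k (flip k T') b)
    (fun k => is_deriveZ (esgn k T') (hY k (flip k T') b)).
  by congr (is_derive _ _ _ _); apply/funext => t'; rewrite /sr fct_sumE.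
have d1 := is_deriveM (is_derive_expc t) (chiF_derive c xi dr T im).
by apply: differentiable_continuous; apply/derivable1_diffP; exact: (@ex_derive _ _ _ _ _ _ _ d1).
Qed.

Lemma hline_between t0 t1 t : hline s a t0 -> hline s a t1 -> t0 <= t <= t1 -> hline s a t.
Proof.
rewrite /hline/= /sgn => h0 h1 /andP[a0 a1]; case: s h0 h1 => h0 h1; lra.
Qed.

Lemma sZ_diff_le t0 t1 T im : t0 < t1 -> hline s a t0 -> hline s a t1 ->
  (((sZ t1 T im - sZ t0 T im) ^+ 2)%:E <=
   (t1 - t0)%:E * \int[leb]_(t in `[t0, t1]) (sq t T im ^+ 2)%:E)%E.
Proof.
move=> t01 h0 h1.
have hb t : t0 <= t <= t1 -> hline s a t by exact: hline_between.
have cq : {within `[t0, t1], continuous (fun t => sq t T im)}.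
  apply: continuous_in_subspaceT => t /set_mem /=; rewrite in_itv/= => ht.
  by apply: sq_continuous; exact: hb.
have <- : \int[leb]_(t in `[t0, t1]) sq t T im = sZ t1 T im - sZ t0 T im.
  apply: (Rint_FTC (G := fun t => sZ t T im) (ltW t01) _ cq).
  by move=> t ht; apply: sZ_derive; exact: hb.
exact: itv_sqr_le.
Qed.

End fixed.

End ode_consequence.

(** * Bounds and joint measurability *)

Section family_bounds.
Context {R : realType} (m : nat).
Implicit Types (T : {set 'I_m}) (xi : 'rV[R]_m) (u : {set 'I_m} -> bool -> R).

Definition nF u : R := \sum_T (u T false ^+ 2 + u T true ^+ 2).

Lemma nF_ge0 u : 0 <= nF u.
Proof. by apply: sumr_ge0 => T _; rewrite addr_ge0 ?sqr_ge0. Qed.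

Lemma le_nF u T im : u T im ^+ 2 <= nF u.
Proof.
rewrite /nF (bigD1 T)//=; apply: ler_wpDr.
  by apply: sumr_ge0 => S _; rewrite addr_ge0 ?sqr_ge0.
by case: im; rewrite ?lerDl ?lerDr sqr_ge0.
Qed.

Lemma norm_le_nF u T im : `|u T im| <= Num.sqrt (nF u).
Proof. by rewrite -sqrtr_sqr ler_sqrt ?nF_ge0// le_nF. Qed.

Lemma chiF_bound (c B : R) xi u T im : `|c| <= 1 -> (forall T im, `|u T im| <= B) ->
  chiF c xi u T im ^+ 2 <= ((1 + m%:R) * B) ^+ 2.
Proof.
move=> c1 uB.
have B0 : 0 <= B by apply: le_trans (uB T im).
rewrite -(real_normK (num_real (chiF _ _ _ _ _))) lerXn2r// ?nnegrE ?mulr_ge0 ?addr_ge0//.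
apply: le_trans (chiF_le xi u T im c1) _; rewrite mulrDl mul1r; apply: lerD => //.
apply: (@le_trans _ _ (\sum_(k < m) B)).
  by apply: ler_sum => k _; rewrite /iF; case: im; rewrite ?normrN.
by rewrite sumr_const card_ord mulr_natl.
Qed.

Lemma chiF_nF (c : R) xi u T im : `|c| <= 1 -> chiF c xi u T im ^+ 2 <= (1 + m%:R) ^+ 2 * nF u.
Proof.
move=> c1; have := chiF_bound xi T im c1 (norm_le_nF u).
by rewrite exprMn sqr_sqrtr ?nF_ge0.
Qed.

Lemma measurable_chiF (c : R) (u : 'rV[R]_m -> {set 'I_m} -> bool -> R) T im :
  (forall T im, measurable_fun setT (fun xi => u xi T im)) ->
  measurable_fun setT (fun xi => chiF c xi (u xi) T im).
Proof.
move=> mu_.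
have mi T' b : measurable_fun setT (fun xi => iF (u xi) T' b).
  by rewrite /iF; case: b => //; exact: measurableT_comp.
apply: measurable_funD; first exact: measurable_funM.
apply: measurable_funM.
  apply: measurable_funM => //; apply: measurableT_comp; first exact: measurable_invr.
  by apply: measurable_funM => //; exact: measurable_fun_enorm.
apply: measurable_sum => k; apply: measurable_funM => //; apply: measurable_funM => //.
exact: measurable_coord.
Qed.

End family_bounds.

Section slice_measurability.
Context {R : realType} (m : nat) (s : bool) (a : R) (f : 'rV[R]_(1 + m) -> Cl R m).
Hypothesis mono : left_monogenic (@halfspace R m s a) f.
Local Notation mu := (@mun R m).
Local Notation leb := (@lebesgue_measure R).
Implicit Types (T : {set 'I_m}) (xi : 'rV[R]_m) (w : 'rV[R]_m -> R).
Local Notation RxV := (measurableTypeR R * 'rV[R]_m)%type.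

(** Nothing is known of [f] off the half space, hence the indicator, here and in the later joint
    measurability statements. Inside, [f] is continuous and the half space is open. *)
Lemma measurable_patch_slice T im :
  measurable_fun setT (fun p : RxV => \1_(hline s a) p.1 * cpt (f (pt p.1 p.2)) T im).
Proof.
pose h (x : 'rV[R]_(1 + m)) := if asbool (halfspace s a x) then cpt (f x) T im else 0.
have oO := @open_halfspace R m s a.
have mh : measurable_fun setT h.
  apply: measurable_fun_openP => V oV.
  have E : h @^-1` V = (@halfspace R m s a `&` (Defs.comp f T im @^-1` V)) `|`
      (~` (@halfspace R m s a) `&` [set _ | V 0]).
    apply/seteqP; split => x; rewrite /h /=.
      by case: ifPn => [/asboolP xa Vx|/asboolP xa Vx]; [left|right].
    by case=> -[xa Vx]; [rewrite ifT//; exact/asboolP|rewrite ifF//; exact/asboolPn].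
  rewrite E; apply: measurableU.
    apply: open_measurable_rV; rewrite openE => x [xa Vx].
    have c := @comp_continuous R m s a f mono T im x xa.
    have n1 : nbhs x (@halfspace R m s a) by exact: open_nbhs_nbhs.
    have n2 : nbhs x (Defs.comp f T im @^-1` V) by apply: c; exact: open_nbhs_nbhs.
    exact: filterI.
  apply: measurableI; first by apply: measurableC; exact: open_measurable_rV.
  have [V0|V0] := pselect (V 0).
    by rewrite (_ : [set _ | _] = setT)//; apply/seteqP; split.
  by rewrite (_ : [set _ | _] = set0)//; apply/seteqP; split.
have := measurableT_comp mh (@measurable_consr R m).
congr measurable_fun; apply/funext => -[t x]; rewrite /h /= /consr/= indicE.
case: ifPn => [/asboolP|/asboolP] xa.
  by rewrite mem_set ?mul1r//; move: xa; rewrite halfspaceE x0_of_pt.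
by rewrite memNset ?mul0r//; move: xa; rewrite halfspaceE x0_of_pt.
Qed.

Lemma measurable_sE w th T im : measurable_fun setT w ->
  measurable_fun setT (fun p : RxV => \1_(hline s a) p.1 * sE f w th p.2 p.1 T im).
Proof.
move=> mw.
have -> : (fun p : RxV => \1_(hline s a) p.1 * sE f w th p.2 p.1 T im) =
   (fun p : RxV => \int[mu]_x (cosw w th p.2 x * (\1_(hline s a) p.1 * cpt (f (pt p.1 x)) T im))).
  apply/funext => -[t xi]/=; rewrite indicE /sE; case: (_ \in _).
    by rewrite mul1r; under [RHS]eq_Rintegral do rewrite mul1r.
  by rewrite mul0r; under [RHS]eq_Rintegral do rewrite mul0r mulr0; rewrite Rintegral_cst// mul0r.
apply: (@measurable_Rintegral_param R _ _ _ _ mu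
  (fun q : RxV * 'rV[R]_m => cosw w th q.1.2 q.2 * (\1_(hline s a) q.1.1 * cpt (f (pt q.1.1 q.2)) T im))).
have m1 : measurable_fun setT (fun q : RxV * 'rV[R]_m => q.1.1) by exact: (measurableT_comp measurable_fst measurable_fst).
have m2 : measurable_fun setT (fun q : RxV * 'rV[R]_m => q.1.2) by exact: (measurableT_comp measurable_snd measurable_fst).
have m3 : measurable_fun setT (fun q : RxV * 'rV[R]_m => q.2) by exact: measurable_snd.
apply: measurable_funM.
  apply: measurable_funM; first exact: (measurableT_comp mw m3).
  apply: measurableT_comp; first exact: measurable_cos.
  by apply: measurable_funD => //; exact: measurable_fun_dotp.
have mp : measurable_fun setT (fun q : RxV * 'rV[R]_m => (q.1.1, q.2) : RxV).
  exact/measurable_fun_pairP.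
exact: (measurableT_comp (measurable_patch_slice T im) mp).
Qed.

Lemma measurable_sY w T im : measurable_fun setT w ->
  measurable_fun setT (fun p : RxV => \1_(hline s a) p.1 * sY f w p.2 p.1 T im).
Proof.
move=> mw; rewrite /sY; under eq_fun do rewrite mulrDr.
apply: measurable_funD; first exact: measurable_sE.
rewrite /iF; case: im; first exact: measurable_sE.
by under eq_fun do rewrite mulrN; apply: measurableT_comp => //; exact: measurable_sE.
Qed.

Lemma sY_ftc w r xi t T : continuous w -> supp r w -> hline s a t ->
  sY f w xi t T false = ftc (fun x => w x * cpt (f (pt t x)) T false) (fun x => w x * cpt (f (pt t x)) T true) xi /\
  sY f w xi t T true = ftc (fun x => w x * cpt (f (pt t x)) T true) (fun x => - (w x * cpt (f (pt t x)) T false)) xi.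
Proof.
move=> cw w0 ta; have l th b := L1_sE mono th xi T b cw w0 ta.
rewrite /sY /sE /iF; split.
  rewrite -RintB//; congr Rintegral; apply/funext => x.
  by rewrite /cosw addr0 cosDpihalf; ring.
rewrite -RintD//; congr Rintegral; apply/funext => x.
by rewrite /cosw addr0 cosDpihalf; ring.
Qed.

Lemma measurable_slice t T im : hline s a t -> measurable_fun setT (fun x => cpt (f (pt t x)) T im).
Proof. by move=> ta; apply: continuous_measurable_rV; exact: slice_continuous mono T im t ta. Qed.

Lemma sY_plancherel w r (B : R) t : continuous w -> supp r w -> hline s a t -> (forall x, `|w x| <= B) ->
  (\int[mu]_xi (nF (sY f w xi t))%:E <=
   ((2 * pi) ^+ m * B ^+ 2)%:E * \int[mu]_x (clnorm (f (pt t x)) ^+ 2)%:E)%E.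
Proof.
move=> cw w0 ta wB.
have l T b : L1 mu (fun x => w x * cpt (f (pt t x)) T b).
  by apply: (L1_slice cw w0); exact: slice_continuous mono T b t ta.
have msl T b := measurable_slice T b ta.
have mw := continuous_measurable_rV cw.
have c0 : 0 <= (2 * pi) ^+ m :> R by rewrite exprn_ge0// mulr_ge0// pi_ge0.
have mY T b : measurable_fun setT (fun xi => sY f w xi t T b).
  case: b.
    under eq_fun => xi do rewrite (sY_ftc xi T cw w0 ta).2.
    by apply: measurable_ftc_N; exact: L1_measurable (l T _).
  under eq_fun => xi do rewrite (sY_ftc xi T cw w0 ta).1.
  by apply: measurable_ftc; exact: L1_measurable (l T _).
have -> : (\int[mu]_xi (nF (sY f w xi t))%:E =
    \sum_T \int[mu]_xi (sY f w xi t T false ^+ 2 + sY f w xi t T true ^+ 2)%:E)%E.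
  rewrite -ge0_integral_sum//.
  - by apply: eq_integral => xi _; rewrite sumEFin.
  - by move=> T; apply/measurable_EFinP; apply: measurable_funD; exact: measurable_funX.
  - by move=> T xi _; rewrite lee_fin addr_ge0 ?sqr_ge0.
have mF T : measurable_fun setT (fun x => (cpt (f (pt t x)) T false ^+ 2 + cpt (f (pt t x)) T true ^+ 2)%:E).
  by apply/measurable_EFinP; apply: measurable_funD; exact: measurable_funX.
have -> : (\int[mu]_x (clnorm (f (pt t x)) ^+ 2)%:E =
    \sum_T \int[mu]_x (cpt (f (pt t x)) T false ^+ 2 + cpt (f (pt t x)) T true ^+ 2)%:E)%E.
  rewrite -ge0_integral_sum//.
  - by apply: eq_integral => x _; rewrite clnormE sumEFin.
  - by move=> T x _; rewrite lee_fin addr_ge0 ?sqr_ge0.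
rewrite ge0_sume_distrr; last first.
  by move=> T _; apply: integral_ge0 => x _; rewrite lee_fin addr_ge0 ?sqr_ge0.
apply: lee_sum => T _.
have -> : (fun xi => (sY f w xi t T false ^+ 2 + sY f w xi t T true ^+ 2)%:E) = (fun xi => 
   (ftc (fun x => w x * cpt (f (pt t x)) T false) (fun x => w x * cpt (f (pt t x)) T true) xi ^+ 2 +
    ftc (fun x => w x * cpt (f (pt t x)) T true) (fun x => - (w x * cpt (f (pt t x)) T false)) xi ^+ 2)%:E).
  by apply/funext => xi; have [-> ->] := sY_ftc xi T cw w0 ta.
apply: le_trans (plancherel_le (l T false) (l T true)) _.
rewrite EFinM -muleA; apply: lee_wpmul2l; first by rewrite lee_fin.
rewrite -ge0_integralZl//; last 2 first.
- by move=> x _; rewrite lee_fin addr_ge0 ?sqr_ge0.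
- by rewrite lee_fin sqr_ge0.
apply: ge0_le_integral => //.
- by move=> x _; rewrite lee_fin addr_ge0 ?sqr_ge0.
- by apply/measurable_EFinP; apply: measurable_funD; apply: measurable_funX; exact: measurable_funM.
- exact: measurable_funeM.
- move=> x _; rewrite -EFinM lee_fin mulrDr !exprMn.
  have w2 : w x ^+ 2 <= B ^+ 2.
    rewrite -(real_normK (num_real (w x))) lerXn2r// nnegrE//.
    exact: le_trans (wB x).
  by apply: lerD; apply: ler_wpM2r => //; exact: sqr_ge0.
Qed.

End slice_measurability.

(** * Energy estimate for the cutoff error *)

Section energy.
Context {R : realType} (m : nat) (s : bool) (a : R) (f : 'rV[R]_(1 + m) -> Cl R m).
Hypothesis mono : left_monogenic (@halfspace R m s a) f.
Local Notation mu := (@mun R m).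
Local Notation leb := (@lebesgue_measure R).
Implicit Types (T : {set 'I_m}) (xi : 'rV[R]_m) (w : 'rV[R]_m -> R).
Local Notation RxV := (measurableTypeR R * 'rV[R]_m)%type.

Definition sQ (N : R) t xi : R := \sum_(k < m) nF (sY f (etaD N k) xi t).

Lemma sQ_ge0 N t xi : 0 <= sQ N t xi. Proof. by apply: sumr_ge0 => k _; exact: nF_ge0. Qed.

Lemma sr_le N t xi T im : `|sr f N xi t T im| <= m%:R * Num.sqrt (sQ N t xi).
Proof.
apply: le_trans (ler_norm_sum _ _ _) _.
apply: (@le_trans _ _ (\sum_(k < m) Num.sqrt (sQ N t xi))); last by rewrite sumr_const card_ord mulr_natl.
apply: ler_sum => k _; rewrite normrM normr_esgn mul1r; apply: le_trans (norm_le_nF _ _ _) _.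
rewrite ler_sqrt ?sQ_ge0// /sQ (bigD1 k)//= lerDl.
by apply: sumr_ge0 => j _; exact: nF_ge0.
Qed.

Lemma measurable_sQ N : 0 < N ->
  measurable_fun setT (fun p : RxV => \1_(hline s a) p.1 * sQ N p.1 p.2).
Proof.
move=> N0.
have -> : (fun p : RxV => \1_(hline s a) p.1 * sQ N p.1 p.2) = (fun p : RxV =>
  \sum_(k < m) \sum_T ((\1_(hline s a) p.1 * sY f (etaD N k) p.2 p.1 T false) ^+ 2 +
                       (\1_(hline s a) p.1 * sY f (etaD N k) p.2 p.1 T true) ^+ 2)).
  apply/funext => p; rewrite /sQ /nF mulr_sumr; apply: eq_bigr => k _; rewrite mulr_sumr.
  apply: eq_bigr => T _; rewrite indicE; case: (_ \in _); rewrite ?mul1r//.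
  by rewrite !mul0r expr0n addr0.
apply: measurable_sum => k; apply: measurable_sum => T.
have mw : measurable_fun setT (@etaD R m N k).
  by apply: continuous_measurable_rV; apply: continuous_etaD; rewrite gt_eqF.
by apply: measurable_funD; apply: measurable_funX; exact: (measurable_sY mono).
Qed.

(** Each of the [m] error terms is the transform of the slice multiplied by a partial derivative of
    the cutoff, at most [4 / N]; Plancherel turns this into a factor [(4 / N)^2] on the energy of
    the slice. *)
Lemma int_sQ_le N t : 0 < N -> hline s a t ->
  (\int[mu]_xi (sQ N t xi)%:E <=
   (m%:R * ((2 * pi) ^+ m * (4 / N) ^+ 2))%:E * \int[mu]_x (clnorm (f (pt t x)) ^+ 2)%:E)%E.
Proof.
move=> N0 ta.
have cw k : continuous (@etaD R m N k) by apply: continuous_etaD; rewrite gt_eqF.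
have mY k T b : measurable_fun setT (fun xi => sY f (etaD N k) xi t T b).
  have mw : measurable_fun setT (@etaD R m N k) by exact: continuous_measurable_rV.
  have := measurableT_comp (measurable_sY mono T b mw) (pair1_measurable t).
  by congr measurable_fun; apply/funext => xi; rewrite /= indicE mem_set// mul1r.
rewrite /sQ; under eq_integral do rewrite -sumEFin.
rewrite ge0_integral_sum//; last 2 first.
- move=> k; apply/measurable_EFinP; apply: measurable_sum => T.
  by apply: measurable_funD; exact: measurable_funX.
- by move=> k xi _; rewrite lee_fin nF_ge0.
apply: (@le_trans _ _ (\sum_(k < m) (((2 * pi) ^+ m * (4 / N) ^+ 2)%:E * \int[mu]_x (clnorm (f (pt t x)) ^+ 2)%:E))%E).
  apply: lee_sum => k _; apply: (sY_plancherel mono (@cw k) (supp_etaD N0 k) ta) => x.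
  exact: etaD_le.
rewrite -ge0_sume_distrl; last first.
  by move=> k _; rewrite lee_fin mulr_ge0 ?sqr_ge0// exprn_ge0// mulr_ge0// pi_ge0.
by move: (_ * _ ^+ 2) => c; rewrite sumEFin sumr_const card_ord mulr_natl.
Qed.

(** The integrating factor is bounded only on balls of frequencies, hence [trunc K]; there, between
    the two times, its square is at most [exp (2 (|t0| + |t1|) K)]. Cauchy-Schwarz in time and
    Tonelli leave [int_sQ_le] integrated over time, which the total energy bounds. *)
Lemma sZ_diff_int (N c K t0 t1 : R) T im : 0 < N -> c ^+ 2 = 1 -> 0 <= K -> t0 < t1 ->
  hline s a t0 -> hline s a t1 ->
  (\int[mu]_xi (trunc K (fun xi => sZ f N c xi t1 T im - sZ f N c xi t0 T im) xi ^+ 2)%:E <=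
   ((t1 - t0) * (expR (2 * (`|t0| + `|t1|) * K) * ((1 + m%:R) * m%:R) ^+ 2) *
     (m%:R * ((2 * pi) ^+ m * (4 / N) ^+ 2)))%:E *
   \int[leb]_(t in hline s a) \int[mu]_x (clnorm (f (pt t x)) ^+ 2)%:E)%E.
Proof.
move=> N0 c1 K0 t01 h0 h1.
have nc : `|c| = 1.
  by apply/eqP; rewrite -(@pexpr_eq1 _ _ 2)// real_normK ?num_real// c1.
pose D := `[t0, t1]%classic : set R.
have mD : measurable D by exact: measurable_itv.
have hb t : D t -> hline s a t by rewrite /D/= in_itv/=; exact: hline_between.
pose C1 := expR (2 * (`|t0| + `|t1|) * K) * ((1 + m%:R) * m%:R) ^+ 2.
have C10 : 0 <= C1 by rewrite mulr_ge0 ?expR_ge0 ?sqr_ge0.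
pose QP (p : RxV) := \1_(hline s a) p.1 * sQ N p.1 p.2.
have mQP : measurable_fun setT QP by exact: measurable_sQ.
have QP0 p : 0 <= QP p by rewrite mulr_ge0 ?sQ_ge0.
have QPE t xi : D t -> QP (t, xi) = sQ N t xi.
  by move=> /hb ta; rewrite /QP/= indicE mem_set// mul1r.
have mw : measurable_fun setT (@etaN R m N).
  by apply: continuous_measurable_rV; apply: continuous_eta; rewrite gt_eqF.
have mZ t : hline s a t -> measurable_fun setT (fun xi => sZ f N c xi t T im).
  move=> ta; apply: measurable_funM; first exact: measurable_expR_enorm.
  apply: measurable_chiF => T' b.
  have := measurableT_comp (measurable_sY mono T' b mw) (pair1_measurable t).
  by congr measurable_fun; apply/funext => xi; rewrite /= indicE mem_set// mul1r.
have pw xi : ((trunc K (fun xi => sZ f N c xi t1 T im - sZ f N c xi t0 T im) xi ^+ 2)%:E <=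
    ((t1 - t0) * C1)%:E * \int[leb]_(t in D) (QP (t, xi))%:E)%E.
  have I0 : (0 <= \int[leb]_(t in D) (QP (t, xi))%:E)%E by apply: integral_ge0 => t _; rewrite lee_fin.
  have C20 : (0 <= ((t1 - t0) * C1)%:E)%E by rewrite lee_fin mulr_ge0// subr_ge0 ltW.
  rewrite /trunc; case: ifP => xK; last by rewrite expr0n; exact: mule_ge0.
  apply: le_trans (sZ_diff_le mono xi N0 c1 T im t01 h0 h1) _.
  rewrite EFinM -muleA; apply: lee_wpmul2l; first by rewrite lee_fin subr_ge0 ltW.
  have mQx : measurable_fun D (fun t => (QP (t, xi))%:E).
    apply: measurable_funTS; apply/measurable_EFinP.
    exact: (measurableT_comp mQP (pair2_measurable xi)).
  rewrite -ge0_integralZl//; last by move=> t _; rewrite lee_fin.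
  apply: ge0_le_integral => //.
  - by move=> t _; rewrite lee_fin sqr_ge0.
  - apply/measurable_EFinP; apply: measurable_funX; apply: subspace_continuous_measurable_fun => //.
    apply: continuous_in_subspaceT => t /set_mem Dt.
    exact: (@sq_continuous R m s a f mono N c xi N0 t T im (hb t Dt)).
  - exact: measurable_funeM.
  - move=> t Dt; rewrite -EFinM lee_fin (QPE _ _ Dt).
    have e1 : expR (c * t * enorm xi) ^+ 2 <= expR (2 * (`|t0| + `|t1|) * K).
      rewrite -expRM_natl ler_expR -(mulrA 2 (`|t0| + `|t1|)) ler_wpM2l//.
      have r0 := enorm_ge0 xi.
      apply: (@le_trans _ _ (`|t| * enorm xi)).
        by apply: le_trans (ler_norm _) _; rewrite !normrM nc mul1r (ger0_norm r0).
      apply: ler_pM => //.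
      move: Dt; rewrite /D/= in_itv/= => /andP[a0 a1].
      rewrite ler_norml; apply/andP; split.
        by have := ler_norm (- t0); have := normr_ge0 t1; rewrite normrN; lra.
      by have := ler_norm t1; have := normr_ge0 t0; lra.
    have e2 : chiF c xi (sr f N xi t) T im ^+ 2 <= ((1 + m%:R) * m%:R) ^+ 2 * sQ N t xi.
      have nc1 : `|c| <= 1 by rewrite nc.
      have := chiF_bound xi T im nc1 (sr_le N t xi).
      by rewrite (mulrA (1 + m%:R)) exprMn sqr_sqrtr ?sQ_ge0.
    rewrite /sq exprMn; apply: le_trans (ler_pM (sqr_ge0 _) (sqr_ge0 _) e1 e2) _.
    by rewrite mulrA.
pose F (p : RxV) : \bar R := (\1_D p.1 * QP p)%:E.
have mF : measurable_fun setT F.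
  apply/measurable_EFinP; apply: measurable_funM => //.
  by apply: (measurableT_comp _ measurable_fst); exact: measurable_indic.
have F0 p : (0 <= F p)%E by rewrite lee_fin mulr_ge0.
have FD xi : (\int[leb]_(t in D) (QP (t, xi))%:E = \int[leb]_t F (t, xi))%E.
  rewrite integral_mkcond; apply: eq_integral => t _; rewrite patchE /F/= indicE.
  by case: ifP => _; rewrite ?mul1r ?mul0r.
have mG : measurable_fun setT (fun xi => \int[leb]_t F (t, xi))%E.
  exact: (@measurable_fun_fubini_tonelli_G _ _ _ _ R leb F mF F0).
have C20 : 0 <= (t1 - t0) * C1 by rewrite mulr_ge0// subr_ge0 ltW.
apply: (@le_trans _ _ (\int[mu]_xi (((t1 - t0) * C1)%:E * \int[leb]_t F (t, xi)))%E).
  apply: ge0_le_integral => //.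
  - by move=> xi _; rewrite lee_fin sqr_ge0.
  - apply/measurable_EFinP; apply: measurable_funX; apply: measurable_trunc.
    by apply: measurable_funB; exact: mZ.
  - exact: measurable_funeM.
  - by move=> xi _; rewrite -FD.
rewrite ge0_integralZl//; last by move=> xi _; exact: integral_ge0.
rewrite [X in (_ <= X%:E * _)%E](_ : _ = ((t1 - t0) * C1) * (m%:R * ((2 * pi) ^+ m * (4 / N) ^+ 2))); last first.
  by rewrite /C1; ring.
rewrite [X in (_ <= X * _)%E]EFinM -muleA; apply: lee_wpmul2l => //.
have <- := @fubini_tonelli _ _ _ _ R leb mu F mF F0.
have msl : measurable_fun setT (fun t : measurableTypeR R =>
    \int[mu]_x ((\1_(hline s a) t * clnorm (f (pt t x)) ^+ 2))%:E)%E.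
  apply: (@measurable_integral_param R _ _ _ _ mu
    (fun p : RxV => (\1_(hline s a) p.1 * clnorm (f (pt p.1 p.2)) ^+ 2)%:E)).
  apply/measurable_EFinP.
  have -> : (fun p : RxV => \1_(hline s a) p.1 * clnorm (f (pt p.1 p.2)) ^+ 2) = (fun p : RxV =>
     \sum_T ((\1_(hline s a) p.1 * cpt (f (pt p.1 p.2)) T false) ^+ 2 + (\1_(hline s a) p.1 * cpt (f (pt p.1 p.2)) T true) ^+ 2)).
    apply/funext => p; rewrite clnormE mulr_sumr; apply: eq_bigr => T' _; rewrite indicE.
    by case: (_ \in _); rewrite ?mul1r// !mul0r expr0n addr0.
  apply: measurable_sum => T'.
  by apply: measurable_funD; apply: measurable_funX; exact: (measurable_patch_slice mono).
pose C3 := m%:R * ((2 * pi) ^+ m * (4 / N) ^+ 2) : R.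
have C30 : 0 <= C3 by rewrite mulr_ge0// mulr_ge0 ?sqr_ge0// exprn_ge0// mulr_ge0// pi_ge0.
have mslE t : hline s a t -> (\int[mu]_x ((\1_(hline s a) t * clnorm (f (pt t x)) ^+ 2))%:E =
   \int[mu]_x (clnorm (f (pt t x)) ^+ 2)%:E)%E.
  by move=> ta; apply: eq_integral => x _; rewrite indicE mem_set// mul1r.
have pos t : (0 <= \int[mu]_x ((\1_(hline s a) t * clnorm (f (pt t x)) ^+ 2))%:E)%E.
  by apply: integral_ge0 => x _; rewrite lee_fin mulr_ge0 ?sqr_ge0.
apply: (@le_trans _ _ (\int[leb]_(t in hline s a) (C3%:E * \int[mu]_x ((\1_(hline s a) t * clnorm (f (pt t x)) ^+ 2))%:E))%E).
  rewrite [leRHS]integral_mkcond; apply: ge0_le_integral => //.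
  - by move=> t _; apply: integral_ge0.
  - exact: (@measurable_fun_fubini_tonelli_F _ _ _ _ R mu F mF F0).
  - apply/(measurable_restrictT _ (measurable_hline s a)).
    by apply: measurable_funTS; exact: measurable_funeM.
  - move=> t _; rewrite patchE; case: ifPn => [/set_mem ta|/negP ta]; last first.
      rewrite (_ : (fun y => F (t, y)) = fun=> 0%E) ?integral0//.
      have i0 : \1_(hline s a) t = 0 :> R by rewrite indicE memNset// => h; apply: ta; exact: mem_set.
      by apply/funext => y; rewrite /F /QP/= i0 mul0r mulr0.
    rewrite mslE//; apply: le_trans (int_sQ_le N0 ta).
    apply: ge0_le_integral => //.
    + exact: (measurableT_comp mF (pair1_measurable t)).
    + apply/measurable_EFinP; have := measurableT_comp mQP (pair1_measurable t).
      by congr measurable_fun; apply/funext => xi; rewrite /QP /= indicE mem_set// mul1r.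
    + have i1 : \1_(hline s a) t = 1 :> R by rewrite indicE mem_set.
      move=> xi _; rewrite /F /QP lee_fin/= i1 mul1r.
      by rewrite ler_piMl ?sQ_ge0// indicE; case: (_ \in _).
rewrite ge0_integralZl//.
- by apply: lee_wpmul2l => //; rewrite le_eqVlt; apply/orP; left; apply/eqP; apply: eq_integral => t /set_mem ta; exact: mslE.
- exact: measurable_hline.
- exact: measurable_funTS.
Qed.

End energy.

(** * Removal of the cutoff *)

Section limit.
Context {R : realType} (m : nat) (s : bool) (a : R) (f : 'rV[R]_(1 + m) -> Cl R m).
Hypothesis mono : left_monogenic (@halfspace R m s a) f.
Local Notation mu := (@mun R m).
Local Notation leb := (@lebesgue_measure R).
Implicit Types (T : {set 'I_m}) (xi : 'rV[R]_m) (ph : 'rV[R]_m -> {set 'I_m} -> bool -> R).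
Hypothesis energy : (\int[leb]_(t in hline s a) \int[mu]_x (clnorm (f (pt t x)) ^+ 2)%:E < +oo)%E.

Definition slice_ft t ph := forall T,
  is_ft (fun x => cpt (f (pt t x)) T false) (fun x => cpt (f (pt t x)) T true)
        (fun xi => ph xi T false) (fun xi => ph xi T true).

Lemma slice_ft_measurable t ph T im : slice_ft t ph -> measurable_fun setT (fun xi => ph xi T im).
Proof. by move=> h; have [_ [h1 h2] _ _ _] := h T; case: im. Qed.

Lemma measurable_sY_xi (N t : R) T im : 0 < N -> hline s a t ->
  measurable_fun setT (fun xi => sY f (etaN N) xi t T im).
Proof.
move=> N0 ta.
have mw : measurable_fun setT (@etaN R m N).
  by apply: continuous_measurable_rV; apply: continuous_eta; rewrite gt_eqF.
have := measurableT_comp (measurable_sY mono T im mw) (pair1_measurable t).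
by congr measurable_fun; apply/funext => xi; rewrite /= indicE mem_set// mul1r.
Qed.

Lemma slice_ft_cvg t ph : hline s a t -> slice_ft t ph ->
  (fun k : nat => \int[mu]_xi (nF (fun T im => ph xi T im - sY f (etaN k.+1%:R) xi t T im))%:E)%E @ \oo
    --> (0 : \bar R).
Proof.
move=> ta hph.
have N0 k : (0 : R) < k.+1%:R by rewrite ltr0n.
have cN k : continuous (@etaN R m k.+1%:R) by apply: continuous_eta; rewrite gt_eqF.
pose S T (k : nat) := (\int[mu]_xi ((ph xi T false - sY f (etaN k.+1%:R) xi t T false) ^+ 2 +
   (ph xi T true - sY f (etaN k.+1%:R) xi t T true) ^+ 2)%:E)%E.
have E k : (\int[mu]_xi (nF (fun T im => ph xi T im - sY f (etaN k.+1%:R) xi t T im))%:E = \sum_T S T k)%E.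
  rewrite /S -ge0_integral_sum//.
  - by apply: eq_integral => xi _; rewrite sumEFin.
  - move=> T; apply/measurable_EFinP; apply: measurable_funD; apply: measurable_funX;
      by apply: measurable_funB; [exact: slice_ft_measurable hph|exact: measurable_sY_xi].
  - by move=> T xi _; rewrite lee_fin addr_ge0 ?sqr_ge0.
rewrite (funext E).
have cS T : S T @ \oo --> (0 : \bar R).
  apply: cvg_trans (ft_cutoff (hph T) (@cutoff_eta R m)); apply: near_eq_cvg; apply: nearW => k.
  apply: eq_integral => xi _; rewrite /sq2.
  by have [-> ->] := sY_ftc mono xi T (@cN k) (supp_eta (N0 k)) ta.
elim: (index_enum _) => [|T r ih].
  by under eq_fun do rewrite big_nil; exact: cvg_cst.
have h0 : (fun k => S T k + \sum_(j <- r) S j k)%E @ \oo --> (0 + 0 : \bar R)%E.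
  by apply: cvgeD => //; exact: cS.
rewrite adde0 in h0; apply: cvg_trans h0; apply: near_eq_cvg; apply: nearW => k /=.
by rewrite big_cons.
Qed.

(** Counterpart of [sZ] for a transform of the whole slice: the quantity that turns out to be
    independent of time. *)
Definition gZ (c t : R) ph T im xi : R := expR (c * t * enorm xi) * chiF c xi (ph xi) T im.

Lemma gZ_diff_sq (c K N t0 t1 : R) ph0 ph1 T im xi : c ^+ 2 = 1 -> 0 <= K ->
  trunc K (fun xi => gZ c t1 ph1 T im xi - gZ c t0 ph0 T im xi) xi ^+ 2 <=
  2 * trunc K (fun xi => sZ f N c xi t1 T im - sZ f N c xi t0 T im) xi ^+ 2 +
  4 * (expR (2 * (`|t0| + `|t1|) * K) * (1 + m%:R) ^+ 2) *
   (nF (fun T im => ph1 xi T im - sY f (etaN N) xi t1 T im) +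
    nF (fun T im => ph0 xi T im - sY f (etaN N) xi t0 T im)).
Proof.
move=> c1 K0; rewrite /trunc; case: ifP => xK; last first.
  by rewrite expr0n mulr0 add0r mulr_ge0// ?addr_ge0 ?nF_ge0//.
have nc : `|c| <= 1.
  rewrite le_eqVlt; apply/orP; left; apply/eqP.
  by apply/eqP; rewrite -(@pexpr_eq1 _ _ 2)// real_normK ?num_real// c1.
have r0 := enorm_ge0 xi.
have key t ph : `|t| <= `|t0| + `|t1| -> (gZ c t ph T im xi - sZ f N c xi t T im) ^+ 2 <=
   expR (2 * (`|t0| + `|t1|) * K) * (1 + m%:R) ^+ 2 * nF (fun T im => ph xi T im - sY f (etaN N) xi t T im).
  move=> tb.
  have -> : gZ c t ph T im xi - sZ f N c xi t T im = expR (c * t * enorm xi) *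
      chiF c xi (fun T im => ph xi T im - sY f (etaN N) xi t T im) T im.
    rewrite /gZ /sZ -mulrBr; congr (_ * _).
    have := chiF_lin c xi 1 (-1) (ph xi) (sY f (etaN N) xi t) T im.
    rewrite !mul1r !mulN1r => <-; congr chiF; apply/funext => T'; apply/funext => b.
    by rewrite mul1r mulN1r.
  have e1 : expR (c * t * enorm xi) ^+ 2 <= expR (2 * (`|t0| + `|t1|) * K).
    rewrite -expRM_natl ler_expR -(mulrA 2 (`|t0| + `|t1|)) ler_wpM2l//.
    apply: (@le_trans _ _ (`|t| * enorm xi)); last exact: ler_pM.
    by apply: le_trans (ler_norm _) _; rewrite !normrM (ger0_norm r0) ler_wpM2r// ler_piMl.
  have e2 := chiF_nF xi (fun T im => ph xi T im - sY f (etaN N) xi t T im) T im nc.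
  rewrite exprMn; apply: le_trans (ler_pM (sqr_ge0 _) (sqr_ge0 _) e1 e2) _.
  by rewrite mulrA.
have b1 : `|t1| <= `|t0| + `|t1| by rewrite lerDr.
have b0 : `|t0| <= `|t0| + `|t1| by rewrite lerDl.
have k1 := key t1 ph1 b1; have k0 := key t0 ph0 b0.
move: k1 k0; move: (gZ c t1 _ _ _ _) (gZ c t0 _ _ _ _) (sZ _ _ _ _ t1 _ _) (sZ _ _ _ _ t0 _ _) (expR _ * _) (nF _) (nF _).
move=> g1 g0 z1 z0 C n1 n0 k1 k0.
(* Based on [g1 - g0 = (z1 - z0) + ((g1 - z1) - (g0 - z0))]: the drift of the cut off solution, and
   the distance from the cut off to the full transforms. *)
have h1 : (g1 - g0) ^+ 2 <= 2 * (z1 - z0) ^+ 2 + 2 * ((g1 - z1) - (g0 - z0)) ^+ 2.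
  by have := sqr_ge0 ((z1 - z0) - ((g1 - z1) - (g0 - z0))); nra.
have h2 : ((g1 - z1) - (g0 - z0)) ^+ 2 <= 2 * (g1 - z1) ^+ 2 + 2 * (g0 - z0) ^+ 2.
  by have := sqr_ge0 ((g1 - z1) + (g0 - z0)); nra.
by rewrite mulrDr; lra.
Qed.

(** On the ball of radius [K] the squared L2 distance is independent of the cutoff and bounded by
    quantities that tend to 0, so it vanishes. A countable intersection over integer radii then
    covers all frequencies. *)
Lemma ode_limit (c t0 t1 : R) ph0 ph1 T im : c ^+ 2 = 1 -> t0 < t1 -> hline s a t0 -> hline s a t1 ->
  slice_ft t0 ph0 -> slice_ft t1 ph1 ->
  {ae mu, forall xi, gZ c t1 ph1 T im xi = gZ c t0 ph0 T im xi}.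
Proof.
move=> c1 t01 h0 h1 f0 f1.
have N0 k : (0 : R) < k.+1%:R by rewrite ltr0n.
have mg t ph : slice_ft t ph -> measurable_fun setT (gZ c t ph T im).
  move=> h; apply: measurable_funM; first exact: measurable_expR_enorm.
  by apply: measurable_chiF => T' b; exact: slice_ft_measurable h.
pose DK (K : nat) := trunc K%:R (fun xi => gZ c t1 ph1 T im xi - gZ c t0 ph0 T im xi).
have mDK K : measurable_fun setT (DK K).
  by apply: measurable_trunc; apply: measurable_funB; [exact: mg f1|exact: mg f0].
pose A := (\int[leb]_(t in hline s a) \int[mu]_x (clnorm (f (pt t x)) ^+ 2)%:E)%E.
have A0 : (0 <= A)%E.
  by apply: integral_ge0 => t _; apply: integral_ge0 => x _; rewrite lee_fin sqr_ge0.
have Af : A \is a fin_num by rewrite ge0_fin_numE.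
have I0 K : (\int[mu]_xi (DK K xi ^+ 2)%:E = 0)%E.
  pose C := 4 * (expR (2 * (`|t0| + `|t1|) * K%:R) * (1 + m%:R) ^+ 2).
  have C0 : 0 <= C by rewrite mulr_ge0// mulr_ge0 ?expR_ge0 ?sqr_ge0.
  pose e t ph (k : nat) := (\int[mu]_xi (nF (fun T im => ph xi T im - sY f (etaN k.+1%:R) xi t T im))%:E)%E.
  (* The 16 is the square of the 4 in [4 / N]; the remaining [1 / N^2] is the product of two
     harmonic terms in [b]. *)
  pose C2 := (t1 - t0) * (expR (2 * (`|t0| + `|t1|) * K%:R) * ((1 + m%:R) * m%:R) ^+ 2) *
     (m%:R * ((2 * pi) ^+ m * 16)).
  pose b k := (2%:E * ((C2 * fine A) * (k.+1%:R^-1 * k.+1%:R^-1))%:E + C%:E * (e t1 ph1 k + e t0 ph0 k))%E.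
  have cb : b @ \oo --> (0 : \bar R).
    have ch : (fun k : nat => (2 * ((C2 * fine A) * (k.+1%:R^-1 * k.+1%:R^-1)))%:E) @ \oo --> (0 : \bar R).
      apply: cvg_EFin; first by near=> k.
      have : (fun k : nat => 2 * ((C2 * fine A) * (k.+1%:R^-1 * k.+1%:R^-1))) @ \oo --> (2 * ((C2 * fine A) * (0 * 0)) : R).
        by apply: cvgMr; apply: cvgMr; apply: cvgM; exact: cvg_harmonic.
      by rewrite !mulr0.
    have ce : (fun k => C%:E * (e t1 ph1 k + e t0 ph0 k))%E @ \oo --> (C%:E * (0 + 0) : \bar R)%E.
      apply: cvgeMl => //; apply: cvgeD => //; [exact: slice_ft_cvg h1 f1|exact: slice_ft_cvg h0 f0].
    rewrite adde0 mule0 in ce.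
    have := cvgeD _ ch ce; rewrite adde0; apply.
    by [].
  have Ib k : (0 <= \int[mu]_xi (DK K xi ^+ 2)%:E <= b k)%E.
    apply/andP; split; first by apply: integral_ge0 => xi _; rewrite lee_fin sqr_ge0.
    have mZ : measurable_fun setT (fun xi => trunc K%:R (fun xi => sZ f k.+1%:R c xi t1 T im - sZ f k.+1%:R c xi t0 T im) xi ^+ 2).
      apply: measurable_funX; apply: measurable_trunc.
      by apply: measurable_funB; apply: measurable_funM; try exact: measurable_expR_enorm;
        apply: measurable_chiF => T' b'; exact: measurable_sY_xi.
    have mn t ph : hline s a t -> slice_ft t ph -> measurable_fun setT (fun xi => (nF (fun T im => ph xi T im - sY f (etaN k.+1%:R) xi t T im))%:E).
      move=> ta h; apply/measurable_EFinP; apply: measurable_sum => T'.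
      by apply: measurable_funD; apply: measurable_funX; apply: measurable_funB;
        [exact: slice_ft_measurable h|exact: measurable_sY_xi|exact: slice_ft_measurable h|exact: measurable_sY_xi].
    pose G xi := (2%:E * (trunc K%:R (fun xi => sZ f k.+1%:R c xi t1 T im - sZ f k.+1%:R c xi t0 T im) xi ^+ 2)%:E +
       C%:E * ((nF (fun T im => ph1 xi T im - sY f (etaN k.+1%:R) xi t1 T im))%:E +
               (nF (fun T im => ph0 xi T im - sY f (etaN k.+1%:R) xi t0 T im))%:E))%E.
    have mn1 := mn t1 ph1 h1 f1; have mn0 := mn t0 ph0 h0 f0.
    have mZe : measurable_fun setT (fun xi => (trunc K%:R (fun xi => sZ f k.+1%:R c xi t1 T im - sZ f k.+1%:R c xi t0 T im) xi ^+ 2)%:E).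
      exact/measurable_EFinP.
    apply: (@le_trans _ _ (\int[mu]_xi G xi)%E).
      apply: ge0_le_integral => //.
      - by move=> xi _; rewrite lee_fin sqr_ge0.
      - by apply/measurable_EFinP; exact: measurable_funX.
      - by apply: emeasurable_funD; apply: measurable_funeM => //; exact: emeasurable_funD.
      - move=> xi _; have h := gZ_diff_sq k.+1%:R t0 t1 ph0 ph1 T im xi c1 (ler0n _ K).
        by rewrite -lee_fin in h; exact: h.
    rewrite /G ge0_integralD//; last 4 first.
    - by move=> xi _; rewrite -EFinM lee_fin mulr_ge0 ?sqr_ge0.
    - exact: measurable_funeM.
    - by move=> xi _; rewrite -EFinD -EFinM lee_fin mulr_ge0// addr_ge0 ?nF_ge0.
    - by apply: measurable_funeM; exact: emeasurable_funD.
    rewrite ge0_integralZl//; last by move=> xi _; rewrite lee_fin sqr_ge0.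
    rewrite ge0_integralZl//; last 2 first.
    - exact: emeasurable_funD.
    - by move=> xi _; rewrite -EFinD lee_fin addr_ge0 ?nF_ge0.
    rewrite ge0_integralD//; last 2 first.
    - by move=> xi _; rewrite lee_fin nF_ge0.
    - by move=> xi _; rewrite lee_fin nF_ge0.
    apply: leeD => //; apply: lee_wpmul2l => //.
    apply: le_trans (sZ_diff_int mono T im (N0 k) c1 (ler0n _ K) t01 h0 h1) _.
    rewrite -/A -(fineK Af) -EFinM lee_fin le_eqVlt; apply/orP; left; apply/eqP.
    by rewrite /C2; field; rewrite nat1r pnatr_eq0.
  have := squeeze_e0 Ib cb => hc.
  apply/esym; exact: (cvg_unique _ hc (cvg_cst _)).
have ae0 K : {ae mu, forall xi, DK K xi = 0}.
  have mE : measurable_fun setT (fun xi => (DK K xi ^+ 2)%:E) by apply/measurable_EFinP; exact: measurable_funX.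
  have := (ae_eq_integral_abs mu measurableT mE).1.
  under eq_integral do rewrite gee0_abs ?lee_fin ?sqr_ge0//.
  move=> /(_ (I0 K)); apply: filterS => xi /(_ I) /= [] /eqP; rewrite sqrf_eq0 => /eqP.
  exact.
have aeK : {ae mu, forall xi, forall K, DK K xi = 0} by apply/ae_foralln.
apply: filterS aeK => xi h.
have [K hK] : exists K : nat, enorm xi <= K%:R.
  exists (Num.truncn (enorm xi)).+1; exact/ltW/truncnS_gt.
by have := h K; rewrite /DK /trunc hK => /eqP; rewrite subr_eq0 => /eqP.
Unshelve. all: by end_near. Qed.

End limit.

(** * The origin is negligible in positive dimension *)

Section null_origin.
Context {R : realType}.

Lemma ae_neq0 (m : nat) : {ae @mun R m.+1, forall xi : 'rV[R]_m.+1, xi != 0}.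
Proof.
have m0 : measurable [set (0 : 'rV[R]_m.+1)].
  rewrite (_ : [set 0] = @enorm R m.+1 @^-1` [set (0 : R)]); last first.
    by apply/seteqP; split => x /= => [->|/eqP]; [apply/eqP; rewrite enorm_eq0|rewrite enorm_eq0 => /eqP].
  have me : measurable_fun setT (@enorm R m.+1) by exact: measurable_fun_enorm.
  by have := me measurableT _ (measurable_set1 (0 : R)); rewrite setTI.
exists [set 0]; split => //; last by move=> x /= /negP; rewrite negbK => /eqP.
have -> : mun m.+1 [set 0] = (\int[mun m.+1]_x (\1_[set (0 : 'rV[R]_m.+1)] x)%:E)%E.
  by rewrite integral_indic// setIT.
have mi : measurable_fun setT (fun x : 'rV[R]_m.+1 => (\1_[set (0 : 'rV[R]_m.+1)] x : R)%:E).
  by apply/measurable_EFinP; exact: measurable_indic.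
rewrite ge0_integral_munS//.
have mt : measurable_fun setT (fun t : measurableTypeR R =>
    \int[mun m]_y (\1_[set (0 : 'rV[R]_m.+1)] (pt t y))%:E)%E.
  apply: (@measurable_integral_param R _ _ _ _ (mun m)
    (fun p : measurableTypeR R * 'rV[R]_m => (\1_[set (0 : 'rV[R]_m.+1)] (pt p.1 p.2))%:E)).
  exact: (measurableT_comp mi (@measurable_consr R m)).
rewrite -[RHS](integral0 (@lebesgue_measure R) setT); apply: ge0_ae_eq_integral => //.
- by move=> t _; apply: integral_ge0 => y _; rewrite lee_fin.
exists [set (0 : R)]; split; [exact: measurable_set1|exact: lebesgue_measure_set1|].
move=> t /= h; apply/eqP; apply/negP => t0; apply: h => _.
rewrite (_ : (fun y => _) = fun=> 0%E) ?integral0//.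
apply/funext => y; rewrite indicE memNset// => e0; apply: t0; apply/eqP.
by have := @pt00 R m t y; rewrite e0 mxE.
Qed.

End null_origin.

Section ft_plancherel.
Context {R : realType} (m : nat).
Local Notation mu := (@mun R m).

(** The factor 2 comes from [int_sq2_tri], when the transform is compared with that of a truncation.
    It is harmless, because only finiteness and vanishing are deduced. *)
Lemma ft_plancherel (u1 u2 p1 p2 : 'rV[R]_m -> R) : is_ft u1 u2 p1 p2 ->
  (\int[mu]_xi (p1 xi ^+ 2 + p2 xi ^+ 2)%:E <=
   (2 * (2 * pi) ^+ m)%:E * \int[mu]_x (u1 x ^+ 2 + u2 x ^+ 2)%:E)%E.
Proof.
move=> [[m1 m2] [mp1 mp2] [l1 l2] [k1 k2] cp].
have mt1 k := measurable_trunc k%:R m1; have mt2 k := measurable_trunc k%:R m2.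
have lt1 k := L1_trunc k%:R m1 l1; have lt2 k := L1_trunc k%:R m2 l2.
have c0 : 0 <= (2 * pi) ^+ m :> R by rewrite exprn_ge0// mulr_ge0// pi_ge0.
pose v1 (k : nat) := ftc (trunc k%:R u1) (trunc k%:R u2).
pose v2 (k : nat) := ftc (trunc k%:R u2) (fun x => - trunc k%:R u1 x).
have mv1 k : measurable_fun setT (v1 k) by exact: measurable_ftc.
have mv2 k : measurable_fun setT (v2 k) by exact: measurable_ftc_N.
pose b k := (\int[mu]_xi (sq2 (fun xi => p1 xi - v1 k xi)%R (fun xi => p2 xi - v2 k xi)%R xi)%:E)%E.
have b0 k : (0 <= b k)%E by apply: integral_ge0 => xi _; rewrite lee_fin sq2_ge0.
apply/lee_addgt0Pr => e e0; have e20 : 0 < e / 2 by rewrite divr_gt0.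
have [k bk] : exists k, (b k <= (e / 2)%:E)%E.
  have [k _ hk] := (ecvg0P b0).1 cp _ e20.
  by exists k; apply: hk => /=.
have mz : measurable_fun setT (fun _ : 'rV[R]_m => 0 : R) by exact: measurable_cst.
have := int_sq2_tri mp1 mp2 (mv1 k) (mv2 k) mz mz.
have -> : (\int[mu]_x (sq2 (fun x => p1 x - 0)%R (fun x => p2 x - 0)%R x)%:E =
   \int[mu]_xi (p1 xi ^+ 2 + p2 xi ^+ 2)%:E)%E.
  by apply: eq_integral => x _; rewrite /sq2 !subr0.
move=> h; apply: le_trans h _; rewrite addeC; apply: leeD; last first.
  apply: (@le_trans _ _ (2%:E * (e / 2)%:E)%E); first by apply: lee_wpmul2l.
  by rewrite -EFinM lee_fin mulrC divfK.
rewrite EFinM -muleA; apply: lee_wpmul2l => //.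
have -> : (\int[mu]_x (sq2 (fun x => v1 k x - 0)%R (fun x => v2 k x - 0)%R x)%:E =
   \int[mu]_xi (v1 k xi ^+ 2 + v2 k xi ^+ 2)%:E)%E.
  by apply: eq_integral => x _; rewrite /sq2 !subr0.
apply: le_trans (plancherel_le (lt1 k) (lt2 k)) _; apply: lee_wpmul2l; first by rewrite lee_fin.
apply: ge0_le_integral => //.
- by move=> x _; rewrite lee_fin addr_ge0 ?sqr_ge0.
- by apply/measurable_EFinP; apply: measurable_funD; exact: measurable_funX.
- by apply/measurable_EFinP; apply: measurable_funD; exact: measurable_funX.
- move=> x _; rewrite lee_fin -(real_normK (num_real (trunc _ u1 x))) -(real_normK (num_real (trunc _ u2 x))).
  rewrite -(real_normK (num_real (u1 x))) -(real_normK (num_real (u2 x))).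
  by apply: lerD; rewrite lerXn2r ?nnegrE// trunc_le.
Qed.

End ft_plancherel.

(** * The integral formula and the weighted integral in terms of densities *)

Section formula.
Context {R : realType} (m : nat) (s : bool) (a : R).
Local Notation mu := (@mun R m).
Local Notation sg := (sgn R s).
Implicit Types (g : 'rV[R]_m -> Cl R m) (al : 'rV[R]_m -> {set 'I_m} -> bool -> R).

(** Equality of the densities off a null set is all that can be expected, since [al] vanishes at the
    origin while [chi g] need not. Integrability passes from [al] to the integrand, and then [RintE]
    evaluates the iterated integral. *)
Lemma formula_synF g al x T im : wfam a al -> mcpt g ->
  {ae mu, forall xi, forall T im, chiF sg xi (cpt (g xi)) T im = al xi T im} ->
  halfspace s a x ->
  cpt (clscale (((2 * pi) ^+ m)^-1) (clint (fun xi => clmul (eps s x xi) (g xi)))) T im = synF s al x T im.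
Proof.
move=> wal mg hae xa.
have l1 := L1_kern 0 (wfam_expL1 T im wal) xa.
have l2 := L1_kern (- (pi / 2)) (wfam_expL1 T im (wfam_iF wal)) xa.
have E xi : cpt (clmul (eps s x xi) (g xi)) T im =
    kern sg 0 x xi * chiF sg xi (cpt (g xi)) T im + kern sg (- (pi / 2)) x xi * iF (chiF sg xi (cpt (g xi))) T im.
  rewrite /eps clmul_cscale cpt_clcscale chi_mul /kern addr0 cosBpihalf/=; congr (_ + _ * _).
  by rewrite /iF; case: (im); rewrite chi_mul.
have mchi T' b : measurable_fun setT (fun xi => chiF sg xi (cpt (g xi)) T' b) by exact: measurable_chiF.
have mE : measurable_fun setT (fun xi => cpt (clmul (eps s x xi) (g xi)) T im).
  under eq_fun do rewrite E.
  apply: measurable_funD; apply: measurable_funM; try exact: measurable_kern; first exact: mchi.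
  by rewrite /iF; case: (im); [exact: mchi|apply: measurableT_comp => //; exact: mchi].
have aeE : {ae mu, forall xi, kern sg 0 x xi * al xi T im + kern sg (- (pi / 2)) x xi * iF (al xi) T im =
   cpt (clmul (eps s x xi) (g xi)) T im}.
  apply: filterS hae => xi h; rewrite E h; congr (_ + _ * _).
  by rewrite /iF; case: (im); rewrite h.
have lS := L1D l1 l2.
have lE := ae_L1 mE aeE lS.
rewrite cpt_clscale cpt_clint RintE// /synF /syn -RintD//; congr (_ * _).
by apply/esym; apply: ae_Rint => //; exact: L1_measurable lS.
Qed.

Lemma weight_lty g al : (forall T im, measurable_fun setT (fun xi => al xi T im)) -> mcpt g ->
  {ae mu, forall xi, forall T im, chiF sg xi (cpt (g xi)) T im = al xi T im} ->
  iint (fun xi => (expR (2 * a * enorm xi) * clnorm (clmul (chi s xi) (g xi)) ^+ 2 / (2 * enorm xi))%:E) =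
  (\int[mu]_xi (expR (2 * a * enorm xi) * nF (al xi) / (2 * enorm xi))%:E)%E.
Proof.
move=> mal mg hae.
have men : measurable_fun setT (@enorm R m) by exact: measurable_fun_enorm.
have minv : measurable_fun setT (fun xi : 'rV[R]_m => (2 * enorm xi)^-1).
  by apply: measurableT_comp; [exact: measurable_invr|exact: measurable_funM].
have cE xi : clnorm (clmul (chi s xi) (g xi)) ^+ 2 = nF (chiF sg xi (cpt (g xi))).
  by rewrite clnormE /nF; apply: eq_bigr => T _; rewrite !chi_mul.
have mchi T' b : measurable_fun setT (fun xi => chiF sg xi (cpt (g xi)) T' b) by exact: measurable_chiF.
have mnF (u : 'rV[R]_m -> {set 'I_m} -> bool -> R) : (forall T im, measurable_fun setT (fun xi => u xi T im)) ->
   measurable_fun setT (fun xi => (expR (2 * a * enorm xi) * nF (u xi) / (2 * enorm xi))%:E).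
  move=> mu_; apply/measurable_EFinP; apply: measurable_funM => //; apply: measurable_funM.
    exact: measurable_expR_enorm.
  by apply: measurable_sum => T; apply: measurable_funD; exact: measurable_funX.
have pos (u : 'rV[R]_m -> {set 'I_m} -> bool -> R) xi :
   (0 <= (expR (2 * a * enorm xi) * nF (u xi) / (2 * enorm xi))%:E)%E.
  by rewrite lee_fin divr_ge0 ?mulr_ge0 ?expR_ge0 ?nF_ge0 ?enorm_ge0.
under [X in iint X]eq_fun do rewrite cE.
rewrite iintE; [|exact: (mnF (fun xi => chiF sg xi (cpt (g xi))))|exact: (pos (fun xi => chiF sg xi (cpt (g xi))))].
apply: ge0_ae_eq_integral => //.
- exact: (mnF (fun xi => chiF sg xi (cpt (g xi)))).
- exact: mnF.
- by move=> xi _; exact: (pos (fun xi => chiF sg xi (cpt (g xi)))).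
apply: filterS hae => xi h _; congr (_ * _ / _)%:E.
by congr nF; apply/funext => T; apply/funext => b.
Qed.

End formula.

Section ae_tools.
Context d (X : measurableType d) (R : realType) (mu : {measure set X -> \bar R}).

Lemma ae_forall_fin (I : finType) (P : I -> X -> Prop) :
  (forall i, {ae mu, forall x, P i x}) -> {ae mu, forall x, forall i, P i x}.
Proof.
move=> h.
have hn : {ae mu, forall x, forall n : nat, forall i : I, nat_of_ord (enum_rank i) = n -> P i x}.
  apply/ae_foralln => n; have [nI|nI] := ltnP n #|I|.
    apply: filterS (h (enum_val (Ordinal nI))) => x hx i rin.
    suff -> : i = enum_val (Ordinal nI) by [].
    by rewrite -(enum_rankK i); congr enum_val; exact: val_inj.
  by apply: nearW => x i rin; have := ltn_ord (enum_rank i); rewrite rin ltnNge nI.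
by apply: filterS hn => x hx i; exact: (hx _ i erefl).
Qed.

Lemma int_sq0_ae (h : X -> R) : measurable_fun setT h -> (\int[mu]_x (h x ^+ 2)%:E = 0)%E ->
  {ae mu, forall x, h x = 0}.
Proof.
move=> mh h0.
have mE : measurable_fun setT (fun x => (h x ^+ 2)%:E) by apply/measurable_EFinP; exact: measurable_funX.
have := (ae_eq_integral_abs mu measurableT mE).1.
under eq_integral do rewrite gee0_abs ?lee_fin ?sqr_ge0//.
move=> /(_ h0); apply: filterS => x /(_ I) /= [] /eqP; rewrite sqrf_eq0 => /eqP.
exact.
Qed.

End ae_tools.

(** * Spectral densities of monogenic functions *)

Section forward.
Context {R : realType} (m : nat) (s : bool) (a : R) (f : 'rV[R]_(1 + m) -> Cl R m).
Local Notation mu := (@mun R m).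
Local Notation leb := (@lebesgue_measure R).
Local Notation sg := (sgn R s).
Implicit Types (T : {set 'I_m}) (xi : 'rV[R]_m) (ph : 'rV[R]_m -> {set 'I_m} -> bool -> R).
Hypothesis mono : left_monogenic (@halfspace R m s a) f.
Hypothesis energy : (\int[leb]_(t in hline s a) \int[mu]_x (clnorm (f (pt t x)) ^+ 2)%:E < +oo)%E.
Hypothesis ae0 : {ae mu, forall xi, xi != 0}.

Definition Et (t : R) : \bar R := (\int[mu]_x (clnorm (f (pt t x)) ^+ 2)%:E)%E.
(** Finite total energy makes almost every slice square integrable; at this stage only such slices
    have an L2 transform. *)
Definition good t := hline s a t /\ (Et t < +oo)%E.

Lemma Et_ge0 t : (0 <= Et t)%E.
Proof. by apply: integral_ge0 => x _; rewrite lee_fin sqr_ge0. Qed.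

Lemma measurable_Et : measurable_fun (hline s a) (Et : measurableTypeR R -> \bar R).
Proof.
have msl : measurable_fun setT (fun t : measurableTypeR R =>
    \int[mu]_x ((\1_(hline s a) t * clnorm (f (pt t x)) ^+ 2))%:E)%E.
  apply: (@measurable_integral_param R _ _ _ _ mu
    (fun p : measurableTypeR R * 'rV[R]_m => (\1_(hline s a) p.1 * clnorm (f (pt p.1 p.2)) ^+ 2)%:E)).
  apply/measurable_EFinP.
  have -> : (fun p : measurableTypeR R * 'rV[R]_m => \1_(hline s a) p.1 * clnorm (f (pt p.1 p.2)) ^+ 2) =
     (fun p => \sum_T ((\1_(hline s a) p.1 * cpt (f (pt p.1 p.2)) T false) ^+ 2 + (\1_(hline s a) p.1 * cpt (f (pt p.1 p.2)) T true) ^+ 2)).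
    apply/funext => p; rewrite clnormE mulr_sumr; apply: eq_bigr => T' _; rewrite indicE.
    by case: (_ \in _); rewrite ?mul1r// !mul0r expr0n addr0.
  apply: measurable_sum => T'.
  by apply: measurable_funD; apply: measurable_funX; exact: (measurable_patch_slice mono).
have := @measurable_funTS _ _ _ _ (hline s a) _ msl.
apply: eq_measurable_fun => t /set_mem ta.
by apply: eq_integral => x _; rewrite indicE mem_set// mul1r.
Qed.

(** The slices of infinite energy form a null set, and a null set contains no interval. *)
Lemma good_dense t (d : R) : hline s a t -> 0 < d -> exists2 t', good t' & `|t' - t| < d.
Proof.
move=> ta d0; have [d1 d10 hd] := hline_near ta.
pose r := Num.min d d1; have r0 : 0 < r by rewrite lt_min d0.
apply: contrapT => h.
have intE : leb.-integrable (hline s a) Et.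
  apply/integrableP; split; first exact: measurable_Et.
  by under eq_integral do rewrite gee0_abs ?Et_ge0//.
have mh : measurable (hline s a : set (measurableTypeR R)) by exact: measurable_hline.
have [N [mN N0 sN]] := @integrable_ae _ _ R leb (hline s a) mh _ intE.
have sub : `]t - r, t + r[%classic `<=` N.
  move=> t' /=; rewrite in_itv/= => /andP[a1 a2]; apply: sN => /= hh; apply: h.
  have tr : `|t' - t| < r by rewrite ltr_norml; apply/andP; split; lra.
  have ta' : hline s a t'.
    by apply: hd; apply: le_trans (ltW tr) _; rewrite /r ge_min lexx orbT.
  exists t'; last by apply: lt_le_trans tr _; rewrite /r ge_min lexx.
  by split=> //; rewrite -ge0_fin_numE ?Et_ge0//; exact: hh.
have le0 : (leb (`]t - r, t + r[%classic)%R <= leb N)%E.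
  by apply: le_measure => //; rewrite inE//; exact: measurable_itv.
move: le0; rewrite lebesgue_measure_itv/= lte_fin ltrBlDr -addrA ltrDl addr_gt0//.
have -> : leb N = 0%E by exact: N0.
by rewrite -EFinB lee_fin; lra.
Qed.

Lemma good_L1 t T im : good t -> L1 mu (fun x => cpt (f (pt t x)) T im ^+ 2).
Proof.
move=> [ta fin]; have ms T' b := measurable_slice mono T' b ta.
have lc : L1 mu (fun x => clnorm (f (pt t x)) ^+ 2).
  apply: L1P; last by under eq_integral do rewrite ger0_norm ?sqr_ge0//.
  by apply: measurable_clnorm.
apply: L1_le lc; first exact: measurable_funX.
by move=> x; rewrite ger0_norm ?sqr_ge0// cpt_le_clnorm.
Qed.

Lemma good_ft t : good t -> exists ph, slice_ft f t ph.
Proof.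
move=> gt; have [ta _] := gt.
have ex T : exists p : ('rV[R]_m -> R) * ('rV[R]_m -> R),
   is_ft (fun x => cpt (f (pt t x)) T false) (fun x => cpt (f (pt t x)) T true) p.1 p.2.
  have [p1 [p2 h]] := ft_exists (measurable_slice mono T false ta) (measurable_slice mono T true ta)
    (good_L1 T false gt) (good_L1 T true gt).
  by exists (p1, p2).
have [p hp] := choice ex.
by exists (fun xi T im => if im then (p T).2 xi else (p T).1 xi) => T; exact: hp.
Qed.

Definition C2pi : R := 2 * (2 * pi) ^+ m.

Lemma C2pi_gt0 : 0 < C2pi.
Proof. by rewrite mulr_gt0// exprn_gt0// mulr_gt0// pi_gt0. Qed.

Lemma int_nF_le t ph : hline s a t -> slice_ft f t ph -> (\int[mu]_xi (nF (ph xi))%:E <= C2pi%:E * Et t)%E.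
Proof.
move=> ta hp; have ms T' b := measurable_slice mono T' b ta.
have mp T im := slice_ft_measurable T im hp.
have -> : (\int[mu]_xi (nF (ph xi))%:E = \sum_T \int[mu]_xi (ph xi T false ^+ 2 + ph xi T true ^+ 2)%:E)%E.
  rewrite -ge0_integral_sum//.
  - by apply: eq_integral => xi _; rewrite sumEFin.
  - by move=> T; apply/measurable_EFinP; apply: measurable_funD; exact: measurable_funX.
  - by move=> T xi _; rewrite lee_fin addr_ge0 ?sqr_ge0.
have -> : (Et t = \sum_T \int[mu]_x (cpt (f (pt t x)) T false ^+ 2 + cpt (f (pt t x)) T true ^+ 2)%:E)%E.
  rewrite -ge0_integral_sum//.
  - by apply: eq_integral => x _; rewrite clnormE sumEFin.
  - by move=> T; apply/measurable_EFinP; apply: measurable_funD; exact: measurable_funX.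
  - by move=> T x _; rewrite lee_fin addr_ge0 ?sqr_ge0.
rewrite ge0_sume_distrr; last first.
  by move=> T _; apply: integral_ge0 => x _; rewrite lee_fin addr_ge0 ?sqr_ge0.
by apply: lee_sum => T _; exact: ft_plancherel (hp T).
Qed.

(* The half line has infinite length but carries finite energy. *)
Lemma bounded_by_energy0 (t0 : R) (b : \bar R) (C : R) : hline s a t0 -> 0 < C -> (0 <= b)%E ->
  (forall t, good t -> sg * t0 <= sg * t -> (b <= C%:E * Et t)%E) -> b = 0%E.
Proof.
move=> ta0 C0 b0 h.
(* On slices of infinite energy the bound is trivial, so it can be integrated over whole
   intervals. *)
have hb t : hline s a t -> sg * t0 <= sg * t -> (b <= C%:E * Et t)%E.
  move=> ta st; have [fin|inf] := boolP (Et t < +oo)%E; first exact: h.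
  suff -> : Et t = +oo%E by rewrite gt0_muley ?lte_fin// leey.
  by apply/eqP; move: inf; rewrite -leNgt leye_eq.
have key (n : nat) : (b * n%:R%:E <= C%:E * \int[leb]_(t in hline s a) Et t)%E.
  pose I := if s then `[t0, t0 + n%:R]%classic else `[t0 - n%:R, t0]%classic : set R.
  have mI : measurable I by rewrite /I; case: (s); exact: measurable_itv.
  have leI : leb I = n%:R%:E.
    have [np|n0] := ltP 0 (n%:R : R).
      by rewrite /I; case: (s); rewrite lebesgue_measure_itv/= lte_fin ?ltrBlDr ltrDl np -EFinB; congr EFin; ring.
    have -> : n%:R = 0 :> R by apply/eqP; rewrite eq_le n0 ler0n.
    have e0 : n%:R = 0 :> R by apply/eqP; rewrite eq_le n0 ler0n.
    by rewrite /I e0; case: (s); rewrite ?addr0 ?subr0 lebesgue_measure_itv/= ltxx.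
  have It t : I t -> sg * t0 <= sg * t.
    by rewrite /I /sgn; case: (s) => /=; rewrite in_itv/= => /andP[h1 h2]; lra.
  have Ih t : I t -> hline s a t.
    by move=> /It; move: ta0; rewrite /hline/=; lra.
  rewrite -leI -(integral_cst leb mI).
  have mC : measurable_fun (hline s a) (fun t : measurableTypeR R => C%:E * Et t)%E.
    by apply: measurable_funeM; exact: measurable_Et.
  have pC t : hline s a t -> (0 <= C%:E * Et t)%E.
    by move=> _; rewrite mule_ge0 ?Et_ge0// lee_fin ltW.
  rewrite -ge0_integralZl//; last 4 first.
  - exact: measurable_hline.
  - exact: measurable_Et.
  - by move=> t _; exact: Et_ge0.
  - by rewrite lee_fin ltW.
  apply: (@le_trans _ _ (\int[leb]_(t in I) (C%:E * Et t))%E).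
    apply: ge0_le_integral => //.
    - by apply: (measurable_funS _ Ih mC); exact: measurable_hline.
    - by move=> t It'; apply: hb; [exact: Ih|exact: It].
  apply: ge0_subset_integral => //; exact: measurable_hline.
pose B := (C%:E * \int[leb]_(t in hline s a) Et t)%E.
have Bf : B \is a fin_num.
  rewrite fin_numM// ge0_fin_numE//.
  by apply: integral_ge0 => t _; exact: Et_ge0.
have : (b < +oo)%E.
  apply: le_lt_trans (_ : (B < +oo)%E); last by rewrite ltey_eq Bf.
  by have := key 1%N; rewrite mule1.
rewrite -ge0_fin_numE// => bf; rewrite -(fineK bf); congr EFin; apply/eqP; rewrite eq_le fine_ge0// andbT.
rewrite leNgt; apply/negP => bp.
have keyR (n : nat) : fine b * n%:R <= fine B.
  by rewrite -lee_fin EFinM !fineK//; exact: key.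
have [n hn] : exists n : nat, fine B / fine b < n%:R.
  by exists (Num.truncn (fine B / fine b)).+1; exact: truncnS_gt.
by have := keyR n; rewrite ltr_pdivrMr// mulrC in hn; rewrite leNgt hn.
Qed.

Lemma gZ_ae (c t t' : R) ph ph' T im : c ^+ 2 = 1 -> good t -> good t' -> t != t' ->
  slice_ft f t ph -> slice_ft f t' ph' ->
  {ae mu, forall xi, gZ c t ph T im xi = gZ c t' ph' T im xi}.
Proof.
move=> c1 [ta _] [ta' _] tt hp hp'; have [lt|lt|e] := ltgtP t t'; last by rewrite e eqxx in tt.
  by apply: filterS (ode_limit mono energy T im c1 lt ta ta' hp hp') => xi ->.
exact: (ode_limit mono energy T im c1 lt ta' ta hp' hp).
Qed.

(** When the times coincide but the transforms may differ, both are compared at a third good time,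
    because [ode_limit] requires distinct times. *)
Lemma gZ_ae_all (c t t' : R) ph ph' T im : c ^+ 2 = 1 -> good t -> good t' ->
  slice_ft f t ph -> slice_ft f t' ph' ->
  {ae mu, forall xi, gZ c t ph T im xi = gZ c t' ph' T im xi}.
Proof.
move=> c1 gt gt' hp hp'; have [e|ne] := eqVneq t t'; last exact: gZ_ae hp hp'.
have ta1 : hline s a (t + sg).
  by have [] := gt; rewrite /hline/= mulrDr -expr2 sgn_sqr; lra.
have h20 : 0 < 2^-1 :> R by rewrite invr_gt0.
have [t1 g1 d1] := good_dense ta1 h20.
have ne1 : t1 != t.
  apply/eqP => t1t; move: d1; rewrite t1t opprD addrA subrr add0r normrN normr_sgn; lra.
have [ph1 hp1] := good_ft g1.
have n1 : t != t1 by rewrite eq_sym.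
have n2 : t1 != t' by rewrite -e.
have h1 := gZ_ae T im c1 gt g1 n1 hp hp1.
have h2 := gZ_ae T im c1 g1 gt' n2 hp1 hp'.
by apply: (filterS2 _ _ h1 h2) => xi -> ->.
Qed.

Lemma NF_scale (k : R) xi u T im : NF xi (fun T im => k * u T im) T im = k * NF xi u T im.
Proof. by rewrite /NF mulr_sumr; apply: eq_bigr => j _; case: im; rewrite /iF; ring. Qed.

Lemma sgnN_sqr : (- sg) ^+ 2 = 1. Proof. by rewrite sqrrN sgn_sqr. Qed.

Lemma norm_sgnN : `|- sg| <= 1. Proof. by rewrite normrN normr_sgn. Qed.

Lemma chi_minus0 t0 ph0 T im : good t0 -> slice_ft f t0 ph0 ->
  {ae mu, forall xi, chiF (- sg) xi (ph0 xi) T im = 0}.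
Proof.
move=> g0 h0; have [ta0 _] := g0.
have mp0 T' b := slice_ft_measurable T' b h0.
have mc0 : measurable_fun setT (fun xi => chiF (- sg) xi (ph0 xi) T im) by exact: measurable_chiF.
apply: int_sq0_ae => //.
pose C := (1 + m%:R) ^+ 2 * C2pi.
have C0 : 0 < C by rewrite mulr_gt0 ?C2pi_gt0// exprn_gt0// ltr_pwDl.
(* At later times the invariant with sign [- s] expresses the component at [t0] as that at [t] times
   [exp (- s (t - t0) |xi|) <= 1]; its fixed norm is thus bounded by the energy of every later
   slice. *)
apply: (@bounded_by_energy0 t0 _ C) => //.
  by apply: integral_ge0 => xi _; rewrite lee_fin sqr_ge0.
move=> t gt st; have [ta _] := gt; have [ph hp] := good_ft gt.
have mp T' b := slice_ft_measurable T' b hp.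
have mc : measurable_fun setT (fun xi => chiF (- sg) xi (ph xi) T im) by exact: measurable_chiF.
have mnF : measurable_fun setT (fun xi => (nF (ph xi))%:E).
  by apply/measurable_EFinP; apply: measurable_sum => T'; apply: measurable_funD; exact: measurable_funX.
have E : (\int[mu]_xi (chiF (- sg) xi (ph0 xi) T im ^+ 2)%:E =
   \int[mu]_xi ((expR (- (sg * (t - t0)) * enorm xi) * chiF (- sg) xi (ph xi) T im) ^+ 2)%:E)%E.
  apply: ge0_ae_eq_integral => //.
  - by apply/measurable_EFinP; exact: measurable_funX.
  - apply/measurable_EFinP; apply: measurable_funX; apply: measurable_funM => //.
    exact: measurable_expR_enorm.
  - by move=> xi _; rewrite lee_fin sqr_ge0.
  - by move=> xi _; rewrite lee_fin sqr_ge0.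
  apply: filterS (gZ_ae_all T im sgnN_sqr gt g0 hp h0) => xi; rewrite /gZ => e _; congr (_ ^+ 2)%:E.
  have -> : chiF (- sg) xi (ph0 xi) T im = expR (sg * t0 * enorm xi) * (expR (- sg * t0 * enorm xi) * chiF (- sg) xi (ph0 xi) T im).
    by rewrite mulrA -expRD -mulrDl mulNr subrr mul0r expR0 mul1r.
  by rewrite -e mulrA -expRD; congr (expR _ * _); ring.
rewrite E; apply: (@le_trans _ _ (((1 + m%:R) ^+ 2)%:E * \int[mu]_xi (nF (ph xi))%:E)%E).
  rewrite -ge0_integralZl//; last by move=> xi _; rewrite lee_fin nF_ge0.
  apply: ge0_le_integral => //.
  - by move=> xi _; rewrite lee_fin sqr_ge0.
  - apply/measurable_EFinP; apply: measurable_funX; apply: measurable_funM => //.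
    exact: measurable_expR_enorm.
  - exact: measurable_funeM.
  - move=> xi _; rewrite -EFinM lee_fin exprMn.
    apply: le_trans (chiF_nF xi (ph xi) T im norm_sgnN); apply: ler_piMl; first exact: sqr_ge0.
    rewrite expr_le1 ?expR_ge0// -expR0 ler_expR mulNr oppr_le0 mulr_ge0 ?enorm_ge0//.
    by rewrite mulrBr subr_ge0.
have -> : C%:E = (((1 + m%:R) ^+ 2)%:E * C2pi%:E)%E by rewrite -EFinM.
rewrite -muleA; apply: lee_wpmul2l; first by rewrite lee_fin sqr_ge0.
exact: int_nF_le.
Qed.

Section density.
Variables (t0 : R) (ph0 : 'rV[R]_m -> {set 'I_m} -> bool -> R).
Hypotheses (g0 : good t0) (h0 : slice_ft f t0 ph0).

(** The exponential undoes the evolution from [x0 = 0] to [t0], so up to null sets the density does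
    not depend on the chosen slice. The value at the origin is the one that [wfam] demands. *)
Definition dens xi T im : R := if xi == 0 then 0 else gZ sg t0 ph0 T im xi.

Lemma measurable_dens T im : measurable_fun setT (fun xi => dens xi T im).
Proof.
have mg : measurable_fun setT (gZ sg t0 ph0 T im).
  apply: measurable_funM; first exact: measurable_expR_enorm.
  by apply: measurable_chiF => T' b; exact: slice_ft_measurable h0.
have mE : measurable [set xi : 'rV[R]_m | enorm xi = 0].
  have me : measurable_fun setT (@enorm R m) by exact: measurable_fun_enorm.
  by have := me measurableT _ (measurable_set1 (0 : R)); rewrite setTI.
have -> : (fun xi => dens xi T im) = (fun xi => \1_(~` [set xi : 'rV[R]_m | enorm xi = 0]) xi * gZ sg t0 ph0 T im xi).
  apply/funext => xi; rewrite /dens indicE; have [->|x0] := eqVneq xi 0.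
    by rewrite memNset ?mul0r//= => h; apply: h; apply/eqP; rewrite enorm_eq0.
  by rewrite mem_set ?mul1r//= => /eqP; rewrite enorm_eq0 (negbTE x0).
by apply: measurable_funM => //; apply: measurable_indic; exact: measurableC.
Qed.

Lemma NF_dens xi T im : NF xi (dens xi) T im = sg * enorm xi * dens xi T im.
Proof.
rewrite /dens; have [->|x0] := eqVneq xi 0; first by rewrite NF0 mulr0.
by rewrite (NF_scale (expR (sg * t0 * enorm xi))) NF_chiF ?sgn_sqr// /gZ; ring.
Qed.

(** The transform is the sum of its two spectral components: the one with sign [- s] vanishes by
    [chi_minus0], the other is determined by the time invariant. *)
Lemma dens_ae t ph : good t -> slice_ft f t ph ->
  {ae mu, forall xi, forall p : {set 'I_m} * bool, ph xi p.1 p.2 = expR (- sg * t * enorm xi) * dens xi p.1 p.2}.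
Proof.
move=> gt hp; apply: ae_forall_fin => -[T im] /=.
have e1 := gZ_ae_all T im (@sgn_sqr R s) gt g0 hp h0.
have e2 := chi_minus0 T im gt hp.
apply: (filterS3 _ _ e1 e2 ae0) => xi h1 h2 x0.
rewrite /dens (negbTE x0) -h1 /gZ mulrA -expRD -mulrDl mulNr addNr mul0r expR0 mul1r.
by rewrite -[LHS](chiF_split sg xi) h2 addr0.
Qed.

(** [tonelli_weight] is read backwards: the weighted integral is the integral over time of the
    squared norms of a coefficient of the transforms, which Plancherel bounds by the energy. Slices
    of infinite energy satisfy the bound trivially. *)
Lemma wfam_dens : wfam a dens.
Proof.
split; [exact: measurable_dens|by move=> T im; rewrite /dens eqxx|].
move=> T im; have mT := measurable_dens T im.
pose S xi := dens xi T im ^+ 2.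
have mS : measurable_fun setT S by exact: measurable_funX.
have S0 xi : 0 <= S xi by exact: sqr_ge0.
have men : measurable_fun setT (@enorm R m) by exact: measurable_fun_enorm.
apply: L1P.
  apply: measurable_funM; first by apply: measurable_funM => //; exact: measurable_expR_enorm.
  by apply: measurableT_comp; [exact: measurable_invr|exact: measurable_funM].
have -> : (\int[mu]_x `|expR (2 * a * enorm x) * dens x T im ^+ 2 / (2 * enorm x)|%:E =
   \int[mu]_x (expR (2 * a * enorm x) * S x / (2 * enorm x))%:E)%E.
  apply: eq_integral => xi _; rewrite ger0_norm//.
  apply: divr_ge0; last by rewrite mulr_ge0// enorm_ge0.
  by apply: mulr_ge0; [exact: expR_ge0|exact: sqr_ge0].
have S00 : S 0 = 0 by rewrite /S /dens eqxx expr0n.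
rewrite -(tonelli_weight s a mS S0 S00).
have mSt : measurable_fun setT (fun t : measurableTypeR R =>
    \int[mu]_xi (S xi * expR (- 2 * (sg * t) * enorm xi))%:E)%E.
  apply: (@measurable_integral_param R _ _ _ _ mu
    (fun q : measurableTypeR R * 'rV[R]_m => (S q.2 * expR (- 2 * (sg * q.1) * enorm q.2))%:E)).
  apply/measurable_EFinP; apply: measurable_funM; first exact: (measurableT_comp mS measurable_snd).
  apply: measurableT_comp; first exact: measurable_expR.
  apply: measurable_funM; last exact: (measurable_fun_enorm measurable_snd).
  by apply: measurable_funM => //; apply: measurable_funM => //.
apply: (@le_lt_trans _ _ (\int[leb]_(t in hline s a) (C2pi%:E * Et t))%E); last first.
  have -> : (\int[leb]_(t in hline s a) (C2pi%:E * Et t) = C2pi%:E * \int[leb]_(t in hline s a) Et t)%E.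
    apply: ge0_integralZl => //; [exact: measurable_hline|exact: measurable_Et|by move=> t _; exact: Et_ge0|].
    by rewrite lee_fin ltW// C2pi_gt0.
  have If : (\int[leb]_(t in hline s a) Et t)%E \is a fin_num.
    by rewrite ge0_fin_numE//; apply: integral_ge0 => t _; exact: Et_ge0.
  by rewrite -(fineK If) -EFinM ltry.
apply: ge0_le_integral => //.
- exact: measurable_hline.
- by move=> t _; apply: integral_ge0 => xi _; rewrite lee_fin mulr_ge0// expR_ge0.
- exact: measurable_funTS.
- by apply: measurable_funeM; exact: measurable_Et.
move=> t ta; have [fin|inf] := boolP (Et t < +oo)%E; last first.
  suff -> : Et t = +oo%E by rewrite gt0_muley ?lte_fin ?C2pi_gt0// leey.
  by apply/eqP; move: inf; rewrite -leNgt leye_eq.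
have gt : good t by split.
have [ph hp] := good_ft gt.
have mp T' b := slice_ft_measurable T' b hp.
apply: le_trans (int_nF_le ta hp).
have -> : (\int[mu]_xi (S xi * expR (- 2 * (sg * t) * enorm xi))%:E = \int[mu]_xi (ph xi T im ^+ 2)%:E)%E.
  apply: ge0_ae_eq_integral => //.
  - apply/measurable_EFinP; apply: measurable_funM => //; exact: measurable_expR_enorm.
  - by apply/measurable_EFinP; exact: measurable_funX.
  - by move=> xi _; rewrite lee_fin mulr_ge0// expR_ge0.
  - by move=> xi _; rewrite lee_fin sqr_ge0.
  apply: filterS (dens_ae gt hp) => xi h _; congr EFin; rewrite (h (T, im)) exprMn mulrC /S/=.
  by congr (_ * _); rewrite -expRM_natl; congr expR; ring.
apply: ge0_le_integral => //.
- by move=> xi _; rewrite lee_fin sqr_ge0.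
- by apply/measurable_EFinP; exact: measurable_funX.
- by apply/measurable_EFinP; apply: measurable_sum => T'; apply: measurable_funD; exact: measurable_funX.
- by move=> xi _; rewrite lee_fin le_nF.
Qed.

(** Inversion requires an integrable transform; almost everywhere it equals [exp (- s t |xi|)] times
    the density, integrable by [dens_L1] because [t] lies strictly inside the half line. *)
Lemma good_formula t y T im : good t -> cpt (f (pt t y)) T im = synF s dens (pt t y) T im.
Proof.
move=> gt; have [ta _] := gt; have [ph hp] := good_ft gt.
have lD b := dens_L1 T b wfam_dens ta.
have mp b := slice_ft_measurable T b hp.
have ae b : {ae mu, forall xi, expR (- sg * t * enorm xi) * dens xi T b = ph xi T b}.
  by apply: filterS (dens_ae gt hp) => xi h; rewrite (h (T, b)).
have lp b := ae_L1 (mp b) (ae b) (lD b).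
have cs b : {for y, continuous (fun x => cpt (f (pt t x)) T b)} by exact: (@slice_continuous R m s a f mono T b t ta y).
have mcos : measurable_fun setT (fun xi => cos (dotp y xi)).
  by apply: measurableT_comp; [exact: measurable_cos|exact: measurable_fun_dotp].
have msin : measurable_fun setT (fun xi => sin (dotp y xi)).
  by apply: measurableT_comp; [exact: measurable_sin|exact: measurable_fun_dotp].
have mD b := L1_measurable (lD b).
have [s1 s2] := synF_slice T y wfam_dens ta.
case: im.
  rewrite s2 (ft_inversion (is_ft_rot (hp T)) (lp true) (L1N (lp false)) (cs true)).
  rewrite -mulrN; congr (_ * _); rewrite /ftc -RintN; last by apply: L1_ftc; exact: L1N.
  apply: ae_Rint.
  - by apply: measurable_funB; apply: measurable_funM => //; exact: measurableT_comp.
  - under eq_fun => xi do rewrite dotpC.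
    apply: measurableT_comp => //; apply: measurable_funD; apply: measurable_funM => //;
      exact: measurableT_comp.
  - apply: (filterS2 _ _ (ae true) (ae false)) => xi <- <-; rewrite dotpC; ring.
rewrite s1 (ft_inversion (hp T) (lp false) (lp true) (cs false)); congr (_ * _); rewrite /ftc.
apply: ae_Rint.
- by apply: measurable_funB; exact: measurable_funM.
- under eq_fun => xi do rewrite dotpC.
  by apply: measurable_funD; apply: measurable_funM => //; exact: measurableT_comp.
- apply: (filterS2 _ _ (ae true) (ae false)) => xi <- <-; rewrite dotpC; ring.
Qed.

Lemma all_formula x T im : halfspace s a x -> cpt (f x) T im = synF s dens x T im.
Proof.
rewrite -(@pt_of R m x); move: (x0_of x) (xv_of x) => t y xa.
have ta : hline s a t by move: xa; rewrite halfspaceE x0_of_pt.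
have c1 := @continuous_slice0 R m _ _ _ (@comp_continuous R m s a f mono T im _ xa).
have c2 := @continuous_slice0 R m _ _ _ (@synF_continuous R m s a dens _ T im wfam_dens xa).
have cF := continuousB c1 c2.
apply/eqP; rewrite -subr_eq0; apply/negPn/negP => ne.
have pos : 0 < `|cpt (f (pt t y)) T im - synF s dens (pt t y) T im| by rewrite normr_gt0.
move: cF => /cvgrPdist_lt /(_ _ pos) /nbhs_ballP[r r0 h].
have [t' gt' d'] := good_dense ta r0.
have := h t'; rewrite /ball/= distrC => /(_ d').
by rewrite -[X in `|X| < _]/((cpt (f (pt t y)) T im - synF s dens (pt t y) T im) - (cpt (f (pt t' y)) T im - synF s dens (pt t' y) T im)) (good_formula _ _ _ gt') subrr subr0 ltxx.
Qed.

(** The energy says nothing about this particular slice. Once the formula is known on all slices,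
    [2 a |xi| <= exp (2 a |xi|)] bounds the unweighted norm of the density by [1 / a] times the
    weighted one, and Plancherel returns to the slice. *)
Lemma good_zero : 0 < a -> good 0.
Proof.
move=> a0; have ta : hline s a 0 by rewrite /hline/= mulr0 oppr_lt0.
split=> //; have [mal _ lal] := wfam_dens.
have ms T' b := measurable_slice mono T' b ta.
have -> : (Et 0 = \sum_T \int[mu]_x (cpt (f (pt 0 x)) T false ^+ 2 + cpt (f (pt 0 x)) T true ^+ 2)%:E)%E.
  rewrite -ge0_integral_sum//.
  - by apply: eq_integral => x _; rewrite clnormE sumEFin.
  - by move=> T; apply/measurable_EFinP; apply: measurable_funD; exact: measurable_funX.
  - by move=> T x _; rewrite lee_fin addr_ge0 ?sqr_ge0.
apply: lte_sum_pinfty => T _.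
have l2 b : L1 mu (fun xi => dens xi T b ^+ 2).
  apply: (@L1_le _ _ R mu _ (fun xi => a^-1 * (expR (2 * a * enorm xi) * dens xi T b ^+ 2 / (2 * enorm xi)))).
  - exact: measurable_funX.
  - move=> xi; rewrite ger0_norm ?sqr_ge0//.
    have [->|x0] := eqVneq xi 0; first by rewrite /dens eqxx expr0n mulr0 mul0r mulr0.
    have r0 : 0 < enorm xi by rewrite lt_def enorm_ge0 enorm_eq0 x0.
    have h : 2 * a * enorm xi <= expR (2 * a * enorm xi) by apply: le_trans (expR_ge1Dx _); rewrite lerDr.
    have d2 := sqr_ge0 (dens xi T b).
    move: (expR _) (dens xi T b ^+ 2) h d2 => X D h D0.
    have -> : a^-1 * (X * D / (2 * enorm xi)) = D * (X / (2 * a * enorm xi)) by field; rewrite !gt_eqF.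
    by rewrite ler_peMr// ler_pdivlMr ?mul1r// !mulr_gt0.
  - by apply: L1Z; exact: lal.
have -> : (\int[mu]_x (cpt (f (pt 0 x)) T false ^+ 2 + cpt (f (pt 0 x)) T true ^+ 2)%:E =
   \int[mu]_y (synF s dens (pt 0 y) T false ^+ 2 + synF s dens (pt 0 y) T true ^+ 2)%:E)%E.
  apply: eq_integral => y _; have xa := halfspace_pt y ta.
  by rewrite !(all_formula _ _ xa).
apply: le_lt_trans (slice_plancherel T wfam_dens ta) _.
have -> : (\int[mu]_xi ((dens xi T false ^+ 2 + dens xi T true ^+ 2) * expR (- 2 * (sg * 0) * enorm xi))%:E =
  \int[mu]_xi (dens xi T false ^+ 2 + dens xi T true ^+ 2)%:E)%E.
  by apply: eq_integral => xi _; rewrite !mulr0 mul0r expR0 mulr1.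
by rewrite -(EFin_Rintegral (L1D (l2 false) (l2 true))) -EFinM ltry.
Qed.

End density.

Lemma forward_main : 0 < a -> exists al, [/\ wfam a al,
  forall xi T im, NF xi (al xi) T im = sg * enorm xi * al xi T im,
  forall x T im, halfspace s a x -> cpt (f x) T im = synF s al x T im &
  exists2 ph, slice_ft f 0 ph & {ae mu, forall xi, forall p : {set 'I_m} * bool, ph xi p.1 p.2 = al xi p.1 p.2}].
Proof.
move=> a0; have ta : hline s a 0 by rewrite /hline/= mulr0 oppr_lt0.
have [t0 g0 _] := good_dense ta ltr01.
have [ph0 h0] := good_ft g0.
exists (dens t0 ph0); split.
- exact: wfam_dens.
- by move=> xi T im; exact: NF_dens.
- by move=> x T im; exact: all_formula.
have gz := good_zero g0 h0 a0; have [ph hp] := good_ft gz.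
exists ph => //; apply: filterS (dens_ae g0 h0 gz hp) => xi h p.
by rewrite h mulr0 mul0r expR0 mul1r.
Qed.

End forward.

(** * The two implications *)

Section characterisation.
Context {R : realType} (m : nat) (s : bool) (a : R) (f : 'rV[R]_(1 + m) -> Cl R m).
Local Notation mu := (@mun R m).
Local Notation leb := (@lebesgue_measure R).
Local Notation sg := (sgn R s).
Implicit Types (g : 'rV[R]_m -> Cl R m) (al : 'rV[R]_m -> {set 'I_m} -> bool -> R).

Definition representable := exists g : 'rV[R]_m -> Cl R m,
  is_L2_fourier (fun xv => f (pt 0 xv)) g /\
  ((((2 * pi) ^+ m)^-1)%:E *
     iint (fun xi => (expR (2 * a * enorm xi)
                      * (clnorm (clmul (chi s xi) (g xi))) ^+ 2
                      / (2 * enorm xi))%:E) < +oo)%E /\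
  (forall x, @halfspace R m s a x ->
     f x = clscale (((2 * pi) ^+ m)^-1) (clint (fun xi => clmul (eps s x xi) (g xi)))).

Lemma A2_representable : 0 < a -> {ae mu, forall xi, xi != 0} -> A2 s a f -> representable.
Proof.
move=> a0 ae0 [mono en].
have en' : (\int[leb]_(t in hline s a) \int[mu]_x (clnorm (f (pt t x)) ^+ 2)%:E < +oo)%E.
  apply: le_lt_trans en; rewrite le_eqVlt; apply/orP; left; apply/eqP.
  apply: eq_integral => t /set_mem ta; apply/esym; rewrite iintE//; last by move=> x; rewrite lee_fin sqr_ge0.
  apply/measurable_EFinP; apply: (@measurable_clnorm R m (fun x => f (pt t x))) => T im; exact: (measurable_slice mono T im (ta : hline s a t)).
have [al [wal Nal fE [ph hp hae]]] := forward_main mono en' ae0 a0.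
pose g : 'rV[R]_m -> Cl R m := fun xi T => (ph xi T false, ph xi T true).
have gE xi T im : cpt (g xi) T im = ph xi T im by case: im.
have ftg : is_L2_fourier (fun xv => f (pt 0 xv)) g by apply: is_L2_fourier_cpt => T; exact: hp.
have mg : mcpt g by case: ftg => _ [/L2_mcpt].
have aeg : {ae mu, forall xi, forall T im, chiF sg xi (cpt (g xi)) T im = al xi T im}.
  apply: (filterS2 _ _ ae0 hae) => xi x0 h T im.
  have -> : cpt (g xi) = al xi.
    by apply/funext => T'; apply/funext => b; rewrite gE; exact: (h (T', b)).
  by apply: chiF_id => //; exact: sgn_sqr.
have [mal _ lal] := wal.
exists g; split=> //; split=> [|x xa]; last first.
  by apply: cpt_inj => T im; rewrite (formula_synF _ _ wal mg aeg xa) fE.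
rewrite (weight_lty a mal mg aeg).
have l : L1 mu (fun xi => expR (2 * a * enorm xi) * nF (al xi) / (2 * enorm xi)).
  have E xi : expR (2 * a * enorm xi) * nF (al xi) / (2 * enorm xi) = \sum_T
      (expR (2 * a * enorm xi) * al xi T false ^+ 2 / (2 * enorm xi) +
       expR (2 * a * enorm xi) * al xi T true ^+ 2 / (2 * enorm xi)).
    rewrite /nF mulr_sumr mulr_suml; apply: eq_bigr => T _.
    by rewrite mulrDr mulrDl.
  under eq_fun => xi do rewrite E.
  by apply: L1_sum => T _; exact: L1D.
by rewrite -(EFin_Rintegral l) -EFinM ltry.
Qed.

Lemma representable_A2 : {ae mu, forall xi, xi != 0} -> representable -> A2 s a f.
Proof.
move=> ae0 [g [[_ [/L2_mcpt mg _]] [wg fE]]].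
(* Only the projected part of [g] enters the formula; it is modified at the negligible origin to
   meet the normalisation in [wfam]. *)
pose al xi T im := if xi == 0 then 0 else chiF sg xi (cpt (g xi)) T im.
have mal T im : measurable_fun setT (fun xi => al xi T im).
  have mE : measurable [set xi : 'rV[R]_m | enorm xi = 0].
    have me : measurable_fun setT (@enorm R m) by exact: measurable_fun_enorm.
    by have := me measurableT _ (measurable_set1 (0 : R)); rewrite setTI.
  have -> : (fun xi => al xi T im) =
      (fun xi => \1_(~` [set xi : 'rV[R]_m | enorm xi = 0]) xi * chiF sg xi (cpt (g xi)) T im).
    apply/funext => xi; rewrite /al indicE; have [->|x0] := eqVneq xi 0.
      by rewrite memNset ?mul0r//= => h; apply: h; apply/eqP; rewrite enorm_eq0.
    by rewrite mem_set ?mul1r//= => /eqP; rewrite enorm_eq0 (negbTE x0).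
  apply: measurable_funM; first by apply: measurable_indic; exact: measurableC.
  by apply: measurable_chiF => T' b; exact: mg.
have aeg : {ae mu, forall xi, forall T im, chiF sg xi (cpt (g xi)) T im = al xi T im}.
  by apply: filterS ae0 => xi x0 T im; rewrite /al (negbTE x0).
have men : measurable_fun setT (@enorm R m) by exact: measurable_fun_enorm.
have mw (S : 'rV[R]_m -> R) : measurable_fun setT S ->
    measurable_fun setT (fun xi => expR (2 * a * enorm xi) * S xi / (2 * enorm xi)).
  move=> mS; apply: measurable_funM; first by apply: measurable_funM => //; exact: measurable_expR_enorm.
  by apply: measurableT_comp; [exact: measurable_invr|exact: measurable_funM].
have w0 xi (z : R) : 0 <= z -> 0 <= expR (2 * a * enorm xi) * z / (2 * enorm xi).
  by move=> z0; rewrite mulr_ge0 ?invr_ge0 ?mulr_ge0 ?expR_ge0 ?enorm_ge0.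
have ln : L1 mu (fun xi => expR (2 * a * enorm xi) * nF (al xi) / (2 * enorm xi)).
  apply: L1P.
    apply: mw; apply: measurable_sum => T; apply: measurable_funD; exact: measurable_funX.
  under eq_integral do rewrite ger0_norm ?w0 ?nF_ge0//.
  rewrite -(weight_lty a mal mg aeg).
  have c0 : 0 < ((2 * pi) ^+ m)^-1 :> R by rewrite invr_gt0 exprn_gt0// mulr_gt0 ?pi_gt0.
  rewrite ltey; apply/eqP => E; move: wg; rewrite E gt0_muley ?lte_fin//.
have wal : wfam a al.
  split=> //; first by move=> T im; rewrite /al eqxx.
  move=> T im; apply: (L1_le _ _ ln); first by apply: mw; exact: measurable_funX.
  move=> xi; rewrite ger0_norm ?w0 ?sqr_ge0//.
  rewrite ler_wpM2r ?invr_ge0 ?mulr_ge0 ?enorm_ge0// ler_wpM2l ?expR_ge0//; exact: le_nF.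
apply: (A2_synF wal).
  move=> xi T im; rewrite /al; have [->|x0] := eqVneq xi 0; first by rewrite NF0 mulr0.
  by apply: NF_chiF => //; exact: sgn_sqr.
by move=> x T im xa; rewrite (fE _ xa); exact: (formula_synF _ _ wal mg aeg xa).
Qed.

End characterisation.

(** * Dimension 0 *)

Section dimension0.
Context {R : realType} (s : bool) (a : R) (f : 'rV[R]_(1 + 0) -> Cl R 0).
Local Notation leb := (@lebesgue_measure R).
Local Notation sg := (sgn R s).

(** Without further variables the Dirac operator is [d/dx0], and the mean value theorem applies on
    the half line. *)
Lemma mono0_const t t' : left_monogenic (@halfspace R 0 s a) f ->
  hline s a t -> hline s a t' -> f (pt t 0) = f (pt t' 0).
Proof.
move=> mono.
wlog tt : t t' / t <= t' => [h ta ta'|ta ta'].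
  by case: (leP t t') => [tt|/ltW tt]; [exact: h|symmetry; exact: h].
apply: cpt_inj => T im.
move: tt; rewrite le_eqVlt => /orP[/eqP->//|tt].
have hb u : u \in `[t, t'] -> is_derive u (1 : R) (fun u => cpt (f (pt u 0)) T im) 0.
  rewrite in_itv/= => hu; have ua := hline_between ta ta' hu.
  have [_ [_ [_ /(_ _ (halfspace_pt 0 ua)) /monogenicP /(_ T im)]]] := mono.
  rewrite big_ord0 addr0 => D0.
  have := is_derive_comp mono T im ord0 (halfspace_pt 0 ua).
  rewrite /uD D0 => d; apply: (is_derive_line (F := Defs.comp f T im) (x := pt u 0) _ _).2 d.
  by move=> h; rewrite (@pt_add0 R 0).
pose F (u : R) : R := cpt (f (pt u 0)) T im.
have dF (u : R) : u \in `]t, t'[ -> is_derive u (1 : R) F ((fun=> 0) u).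
  by move=> ut; apply: hb; exact: subset_itv_oo_cc.
have cF : {within `[t, t'], continuous F}.
  by apply: derivable_within_continuous => u ut; have [] := hb u ut.
have [c _ E] := MVT tt dF cF.
by apply/esym/eqP; rewrite -subr_eq0 -/(F t) -/(F t') E mul0r.
Qed.

Lemma A2_eq0 x : A2 s a f -> halfspace s a x -> f x = clzero R (m:=0).
Proof.
move=> [mono en]; rewrite -(@pt_of R 0 x) (thinmx0 (xv_of x)) halfspaceE x0_of_pt => ta.
move: (x0_of x) ta => t ta.
pose c := clnorm (f (pt t 0)) ^+ 2.
have E : (\int[leb]_(u in hline s a) iint (fun xv => (clnorm (f (pt u xv)) ^+ 2)%:E) = c%:E * leb (hline s a))%E.
  rewrite -integral_cst; last exact: measurable_hline.
  apply: eq_integral => u /set_mem ua /=.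
  by rewrite (mono0_const mono ua ta).
have Loo : leb (hline s a) = +oo%E.
  have -> : hline s a = if s then `]-a, +oo[%classic else `]-oo, a[%classic.
    by apply/seteqP; split => u; rewrite /hline/= /sgn; case: (s); rewrite /= in_itv/= ?andbT; lra.
  by case: (s); rewrite lebesgue_measure_itv/= ?ltNyr ?ltry.
have c0 : c = 0.
  apply/eqP; rewrite eq_le sqr_ge0 andbT leNgt; apply/negP => c0.
  by move: en; rewrite E Loo gt0_muley ?lte_fin.
apply: cpt_inj => T im; apply/eqP; rewrite -[cpt (@clzero _ _) _ _]/(if im then 0 else 0) if_same.
by rewrite -sqrf_eq0 eq_le sqr_ge0 andbT -c0; exact: cpt_le_clnorm.
Qed.

(** The only frequency is 0, where the exponentials are 1 and [chi] is one half. *)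
Lemma cpt_clmul_eps0 (x : 'rV[R]_(1 + 0)) (xi : 'rV[R]_0) u T im :
  cpt (clmul (eps s x xi) u) T im = 2^-1 * cpt u T im.
Proof.
rewrite /eps clmul_cscale cpt_clcscale/= /enorm /dotp !big_ord0 sqrtr0 mulr0 expR0 cos0 sin0.
by rewrite !(mul1r, mulr0) mul0r addr0 chi_mul /chiF /NF big_ord0 mulr0 addr0.
Qed.

Lemma cpt_formula0 (g : 'rV[R]_0 -> Cl R 0) x T im :
  cpt (clscale (((2 * pi) ^+ 0)^-1) (clint (fun xi => clmul (eps s x xi) (g xi)))) T im = 2^-1 * cpt (g 0) T im.
Proof. by rewrite cpt_clscale expr0 invr1 mul1r cpt_clint/= cpt_clmul_eps0. Qed.

Lemma fourier_trunc0 (k : nat) (h : 'rV[R]_0 -> Cl R 0) xi : fourier_trunc k%:R h xi = h 0.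
Proof.
apply: cpt_inj => T im; rewrite cpt_clint/= /enorm /dotp !big_ord0 sqrtr0 ler0n cpt_clcscale/=.
by rewrite cos0 sin0 oppr0 mul1r mul0r addr0.
Qed.

(** On a one point space with unit mass every truncated transform is the value of the function, so
    the transform is the identity. *)
Lemma is_L2_fourier0 (h g : 'rV[R]_0 -> Cl R 0) : is_L2_fourier h g <-> h 0 = g 0.
Proof.
have L2h (h' : 'rV[R]_0 -> Cl R 0) : L2 h'.
  split; last exact: ltry.
  have E : h' = fun=> h' 0 by apply/funext => x; rewrite (thinmx0 x).
  by move=> T; rewrite !borel_funP E; split; exact: measurable_cst.
pose c := clnorm (cladd (g 0) (clscale (-1) (h 0))) ^+ 2.
have E : (fun n : nat => l2sq (fun xi => cladd (g xi) (clscale (-1) (fourier_trunc n%:R h xi)))) = (fun=> c%:E).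
  by apply/funext => n; rewrite /l2sq/= fourier_trunc0.
rewrite /is_L2_fourier E; split=> [[_ [_ cv]]|hg].
  have [c0] : c%:E = 0%E by apply: (cvg_unique _ _ cv) => //; exact: cvg_cst.
  apply: cpt_inj => T im; apply/esym/eqP; rewrite -subr_eq0.
  have -> : cpt (g 0) T im - cpt (h 0) T im = cpt (cladd (g 0) (clscale (-1) (h 0))) T im.
    by rewrite cpt_cladd cpt_clscale mulN1r.
  by rewrite -sqrf_eq0 eq_le sqr_ge0 andbT -c0; exact: cpt_le_clnorm.
split=> //; split=> //.
have -> : c = 0.
  rewrite /c hg clnormE big1// => T _.
  by rewrite !cpt_cladd !cpt_clscale !mulN1r !subrr expr0n addr0.
exact: cvg_cst.
Qed.

Lemma cpt_clzero m T im : cpt (@clzero R m) T im = 0.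
Proof. by case: im. Qed.

Lemma A2_representable0 : 0 < a -> A2 s a f <-> representable s a f.
Proof.
move=> a0; have h0 (y : 'rV[R]_0) : halfspace s a (pt 0 y).
  by rewrite halfspaceE x0_of_pt /= mulr0 oppr_lt0.
split=> [Af|[g [/is_L2_fourier0 fg [_ fE]]]].
  exists (fun=> @clzero R 0); split; first by apply/is_L2_fourier0; rewrite A2_eq0.
  split=> [|x xa]; first by rewrite /= -EFinM ltry.
  by apply: cpt_inj => T im; rewrite A2_eq0// cpt_formula0 cpt_clzero mulr0.
(* At [x0 = 0] the formula reads [f = f / 2], which forces [g] to vanish. *)
have g0 T im : cpt (g 0) T im = 0.
  by have := cpt_formula0 g (pt 0 0) T im; rewrite -(fE _ (h0 0)) fg => /eqP; rewrite eq_sym => h; lra.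
apply: (@A2_synF R 0 s a (fun _ _ _ => 0)).
- split=> // T im; under eq_fun do rewrite expr0n mulr0 mul0r.
  exact: L1_cst0.
- by move=> xi T im; rewrite /NF big_ord0 mulr0.
- move=> x T im xa; rewrite (fE _ xa) cpt_formula0 g0 mulr0 /synF.
  have Z t : syn sg t (fun=> 0) x = 0.
    rewrite /syn (_ : (fun xi => _) = fun=> 0 * 0); last by apply/funext => xi; rewrite !mulr0.
    by rewrite RintZ ?mul0r//; exact: L1_cst0.
  have -> : (fun xi : 'rV[R]_0 => iF (fun _ _ => 0 : R) T im) = fun=> 0.
    by apply/funext => xi; rewrite /iF oppr0; case: (im).
  by rewrite !Z addr0 mulr0.
Qed.

End dimension0.

Theorem theorem3p7 (R : realType) (m : nat) (a : R) (s : bool)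
    (f : 'rV[R]_(1 + m) -> Cl R m) :
  0 < a ->
  (A2 s a f <->
   exists g : 'rV[R]_m -> Cl R m,
     is_L2_fourier (fun xv => f (pt 0 xv)) g /\
     ((((2 * pi) ^+ m)^-1)%:E *
        iint (fun xi => (expR (2 * a * enorm xi)
                         * (clnorm (clmul (chi s xi) (g xi))) ^+ 2
                         / (2 * enorm xi))%:E) < +oo)%E /\
     (forall x, @halfspace R m s a x ->
        f x = clscale (((2 * pi) ^+ m)^-1) (clint (fun xi => clmul (eps s x xi) (g xi))))).
Proof.
case: m f => [|n] f a0; first exact: A2_representable0.
have ae0 := @ae_neq0 R n.
by split=> [/A2_representable|]; [apply|exact: representable_A2].
Qed.
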